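(* Let $(\tau,s)\in C_s$, let $\hat g_0=1$, and consider the minimal immersion $\Psi=\Psi_{L(\tau,s),1}:\mathbb{C}\setminus L(\tau,s)\to\mathbb{R}^3$ with associated functions $\alpha(u),\beta(u)$. If $\sum_{i<j}r_ir_j<0$, then there exists $u^*\in(0,\frac{\omega_3}{2})$ such that $$\beta(u^* )=0,\qquad \beta(\omega_3-u^* )=0 .$$
   Context: Parameters. $\wp,\zeta$ are the Weierstrass functions of a lattice ($\zeta'=-\wp$). For $\tau>0$ let $\tilde L(\tau)$ be the lattice generated by $2(1-i\tau)$ and $2(1+i\tau)$. Let $\tau_0>0$ be the unique zero on $(0,\infty)$ of $F(\tau)=\zeta(2|\tilde L(\tau))+2\wp(2|\tilde L(\tau))$. For $0<\tau<\tau_0$ let $s(\tau)$ be the unique zero in $(0,2)$ of $2\zeta(s|\tilde L(\tau))-\zeta(2|\tilde L(\tau))s$, and $C_s=\{(\tau,s(\tau)):0<\tau<\tau_0\}$. For $\tau>0$, $s\in(0,2)$ put $\lambda=\sqrt[3]{-4\wp'(s|\tilde L(\tau))}>0$, $\omega_1=\lambda(1-i\tau)$, $\omega_2=\lambda(1+i\tau)$, $\omega_3=\omega_1+\omega_2=2\lambda$, $L=L(\tau,s)$ the lattice generated by $2\omega_1,2\omega_2$, $\mu=\lambda s$, $b=4\wp(\mu|L)$; then $\wp'(\mu|L)=-\frac14$. Let $e_j=\wp(\omega_j|L)$ and $r_j=b-4e_j$, $j=1,2,3$. Immersion. For $\hat g_0>0$ put $\phi(z)=b-4\wp(z|L)$,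 $g(z)=\hat g_0\exp\left(\int_0^zd\nu/\phi(\nu)\right)$ and $\Psi_{L(\tau,s),\hat g_0}(z)=\mathrm{Re}\int_{\omega_3/2}^z\left(\tfrac12(\tfrac1g-g),\tfrac i2(\tfrac1g+g),1\right)\phi\,dz$. Its induced metric is $e^{2\omega}(du^2+dv^2)$, $z=u+iv$, with $e^\omega=\frac{|\phi|}{2}(|g|+|g|^{-1})$. Functions $\alpha,\beta$. By Wente, there are real functions $\alpha,\beta$ of $u$ alone (smooth away from isolated singularities) with $2\omega_u(u,v)=\alpha(u)e^{\omega(u,v)}+\beta(u)e^{-\omega(u,v)}$. Each curve $v\mapsto\Psi(u,v)$ lies in a sphere which the surface meets at angle $\theta(u)$ with $\tan\theta(u)=2/\beta(u)$, so $\beta(u)=0$ means orthogonal intersection. *)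

(* Defs.v *)
From Stdlib Require Import Reals ZArith List.
From Coquelicot Require Import Coquelicot.
Import ListNotations.
Open Scope R_scope.

Definition Cexp (z : C) : C := (exp (Re z) * cos (Im z), exp (Re z) * sin (Im z)).

Definition CLim_seq (u : nat -> C) : C :=
  (real (Lim_seq (fun N => Re (u N))), real (Lim_seq (fun N => Im (u N)))).

(** * Weierstrass functions *)

(* The generators are full periods (not half-periods). *)
Record lattice := Lattice { gen1 : C; gen2 : C }.

Definition lattice_pt (L : lattice) (m n : Z) : C :=
  (RtoC (IZR m) * gen1 L + RtoC (IZR n) * gen2 L)%C.

Definition in_lattice (L : lattice) (z : C) : Prop :=
  exists m n : Z, z = lattice_pt L m n.

(* Sum of [f w] over the nonzero [w] in [L], as the limit of the partial sums
   over |m|, |n| <= N.  It is only used for absolutely convergent sums, so the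
   choice of exhaustion is immaterial. *)
Definition lattice_sum (L : lattice) (f : C -> C) : C :=
  CLim_seq (fun N : nat =>
    sum_n (fun i : nat =>
      sum_n (fun j : nat =>
        let m := (Z.of_nat i - Z.of_nat N)%Z in
        let n := (Z.of_nat j - Z.of_nat N)%Z in
        if andb (Z.eqb m 0) (Z.eqb n 0) then RtoC 0 else f (lattice_pt L m n))
      (2 * N)) (2 * N)).

Definition wp (L : lattice) (z : C) : C :=
  (/ (z * z) + lattice_sum L (fun w => / ((z - w) * (z - w)) - / (w * w)))%C.

Definition wp' (L : lattice) : C -> C := C_derive (wp L).

Definition wzeta (L : lattice) (z : C) : C :=
  (/ z + lattice_sum L (fun w => / (z - w) + / w + z / (w * w)))%C.

(** * Parameters *)

Definition Ltilde (tau : R) : lattice :=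
  Lattice (2 * (1 - Ci * tau))%C (2 * (1 + Ci * tau))%C.

Definition Ffun (tau : R) : C :=
  (wzeta (Ltilde tau) 2 + 2 * wp (Ltilde tau) 2)%C.

Definition is_tau0 (tau0 : R) : Prop :=
  unique (fun tau : R => 0 < tau /\ Ffun tau = RtoC 0) tau0.

Definition is_s_of_tau (tau s : R) : Prop :=
  unique (fun s : R => 0 < s < 2 /\
    (2 * wzeta (Ltilde tau) s - wzeta (Ltilde tau) 2 * s)%C = RtoC 0) s.

Definition Cs (tau s : R) : Prop :=
  exists tau0 : R, is_tau0 tau0 /\ 0 < tau < tau0 /\ is_s_of_tau tau s.

(* Real cube root; the argument is a positive real number for 0 < tau, 0 < s < 2. *)
Definition lambda (tau s : R) : R :=
  Rpower (- 4 * Re (wp' (Ltilde tau) s)) (1 / 3).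

Definition omega1 (tau s : R) : C := (lambda tau s * (1 - Ci * tau))%C.
Definition omega2 (tau s : R) : C := (lambda tau s * (1 + Ci * tau))%C.
(* omega1 + omega2 = 2 lambda is real. *)
Definition omega3 (tau s : R) : R := 2 * lambda tau s.

Definition Lat (tau s : R) : lattice :=
  Lattice (2 * omega1 tau s)%C (2 * omega2 tau s)%C.

Definition mu (tau s : R) : R := lambda tau s * s.
Definition bpar (tau s : R) : C := (4 * wp (Lat tau s) (mu tau s))%C.

Definition r1 (tau s : R) : C := (bpar tau s - 4 * wp (Lat tau s) (omega1 tau s))%C.
Definition r2 (tau s : R) : C := (bpar tau s - 4 * wp (Lat tau s) (omega2 tau s))%C.
Definition r3 (tau s : R) : C := (bpar tau s - 4 * wp (Lat tau s) (omega3 tau s))%C.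

(* The sum of the r_i r_j is real: r3 is real and r1, r2 are conjugate, since
   the lattice is invariant under conjugation, which exchanges omega1, omega2. *)
Definition sum_rr (tau s : R) : R :=
  Re (r1 tau s * r2 tau s + r1 tau s * r3 tau s + r2 tau s * r3 tau s)%C.

Definition phi (tau s : R) (z : C) : C := (bpar tau s - 4 * wp (Lat tau s) z)%C.

(** * Path integrals *)

(* Integral of [f] along the polygonal path from [z0] through the vertices [l]. *)
Definition segment_int (f : C -> C) (a b : C) : C :=
  ((b - a) * RInt (V := C_R_CompleteNormedModule)
               (fun t : R => f (a + t * (b - a))%C) 0 1)%C.

Fixpoint path_int (f : C -> C) (z0 : C) (l : list C) : C :=
  match l with
  | [] => RtoC 0
  | z1 :: l' => (segment_int f z0 z1 + path_int f z1 l')%C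
  end.

Fixpoint on_path (z0 : C) (l : list C) (p : C) : Prop :=
  match l with
  | [] => p = z0
  | z1 :: l' =>
      (exists t : R, 0 <= t <= 1 /\ p = (z0 + t * (z1 - z0))%C) \/ on_path z1 l' p
  end.

(* The endpoints are exempt from the condition because the integrands below
   have removable singularities there, e.g. 1/phi at the lattice point 0. *)
Definition path_avoiding (bad : C -> Prop) (z0 z : C) (l : list C) : Prop :=
  last l z0 = z /\
  (forall p : C, on_path z0 l p -> p = z0 \/ p = z \/ ~ bad p).

(** * The immersion *)

Definition pole_phi (tau s : R) (z : C) : Prop := in_lattice (Lat tau s) z.
Definition zero_phi (tau s : R) (z : C) : Prop :=
  ~ in_lattice (Lat tau s) z /\ phi tau s z = RtoC 0.
Definition special (tau s : R) (z : C) : Prop := pole_phi tau s z \/ zero_phi tau s z.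

(* g(z) = g0 exp (int_0^z dnu / phi(nu)).  The residues of 1/phi are +1 and -1,
   so the exponential does not depend on the path.  [g] is left unspecified at
   the zeros of phi, where the meromorphic function g has a zero or a pole. *)
Definition is_gauss_map (tau s g0 : R) (g : C -> C) : Prop :=
  forall (z : C) (l : list C), ~ zero_phi tau s z ->
    path_avoiding (special tau s) 0 z l ->
    g z = (g0 * Cexp (path_int (fun nu => / phi tau s nu) 0 l))%C.

Definition R3 : Type := (R * R * R)%type.
Definition dot (x y : R3) : R :=
  fst (fst x) * fst (fst y) + snd (fst x) * snd (fst y) + snd x * snd y.

(* Psi is defined on all of C minus the lattice, zeros of phi included: the
   integrands extend holomorphically across these. *)
Definition is_immersion (tau s : R) (g : C -> C) (Psi : C -> R3) : Prop :=
  forall (z : C) (l : list C), ~ in_lattice (Lat tau s) z ->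
    path_avoiding (special tau s) (omega3 tau s / 2) z l ->
    let I f := Re (path_int f (omega3 tau s / 2) l) in
    Psi z =
      (I (fun z => / 2 * (/ g z - g z) * phi tau s z)%C,
       I (fun z => Ci / 2 * (/ g z + g z) * phi tau s z)%C,
       I (fun z => phi tau s z)).

Definition d_u (Psi : C -> R3) (u v : R) : R3 :=
  (Derive (fun x : R => fst (fst (Psi (x, v)))) u,
   Derive (fun x : R => snd (fst (Psi (x, v)))) u,
   Derive (fun x : R => snd (Psi (x, v))) u).

Definition d_v (Psi : C -> R3) (u v : R) : R3 :=
  (Derive (fun y : R => fst (fst (Psi (u, y)))) v,
   Derive (fun y : R => snd (fst (Psi (u, y)))) v,
   Derive (fun y : R => snd (Psi (u, y))) v).

(* The metric determines omega on all of C minus the lattice; the formula for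
   exp omega needs phi <> 0, where [g] takes a finite nonzero value. *)
Definition is_conformal_factor (tau s : R) (g : C -> C) (Psi : C -> R3)
    (omega : R -> R -> R) : Prop :=
  forall u v : R, ~ in_lattice (Lat tau s) (u, v) ->
    dot (d_u Psi u v) (d_u Psi u v) = exp (2 * omega u v) /\
    dot (d_v Psi u v) (d_v Psi u v) = exp (2 * omega u v) /\
    dot (d_u Psi u v) (d_v Psi u v) = 0 /\
    (phi tau s (u, v) <> RtoC 0 ->
       exp (omega u v) =
         Cmod (phi tau s (u, v)) / 2 * (Cmod (g (u, v)) + / Cmod (g (u, v)))).

(** * The functions alpha and beta *)

Definition smooth_at (f : R -> R) (u : R) : Prop :=
  locally u (fun x : R => forall n : nat, ex_derive_n f n x).

(* [sing] is the set of singularities of (alpha, beta).  Its points are isolated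
   and non-removable; without the latter, [sing] could be enlarged at will.  The
   values of [alpha] and [beta] on [sing] are meaningless.  Singularities do occur:
   for (tau, s) in C_s and g0 = 1 there is one at u = omega3 / 2. *)
Definition associated (tau s : R) (omega : R -> R -> R)
    (sing : R -> Prop) (alpha beta : R -> R) : Prop :=
  (forall u : R, locally' u (fun x : R => ~ sing x)) /\
  (forall u : R, ~ sing u -> smooth_at alpha u /\ smooth_at beta u) /\
  (forall u v : R, ~ sing u -> ~ in_lattice (Lat tau s) (u, v) ->
     2 * Derive (fun x : R => omega x v) u =
       alpha u * exp (omega u v) + beta u * exp (- omega u v)) /\
  (forall u : R, sing u ->
     ~ exists a b : R -> R, smooth_at a u /\ smooth_at b u /\
         locally' u (fun x : R => a x = alpha x /\ b x = beta x)).

(* Main.v *)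
Require Import Defs.
From Stdlib Require Import Reals Ranalysis5 ZArith List Lra Lia.
From Stdlib Require Import ClassicalEpsilon FunctionalExtensionality.
From Coquelicot Require Import Coquelicot.
Import ListNotations.
Open Scope R_scope.

(** The function [/ phi] equals [zeta (z - mu) - zeta (z + mu) + 2 zeta mu], and the
    equation defining [C_s] makes [log |g|], a combination of [log |sigma|] and of a
    linear function, vanish at [omega3] and change sign under [z |-> 2 omega2 - z].
    Hence the metric factor [H(u) = |phi| cosh (log |g|)] of the real axis reappears on
    the horizontal line of height [Im (2 omega2)] as [H(omega3 - u)].  Eliminating
    [alpha] between Wente's two equations over the same [u] shows that [beta] vanishes
    at [u] and at [omega3 - u] for every critical point [u] of
    [D(u) = / H(u) - / H(omega3 - u)] with [D(u) <> 0].  Now [D(0) = - / r3 < 0],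
    [D(omega3 / 2) = 0], [D'(0) = 0], and [D''(0)] has the sign of the sum of the
    [r_i r_j]: if that sum is negative, [D] attains its minimum over
    [[0, omega3 / 2]] in the interior, and is negative there. *)

(** * Complex differentiation *)

(** Multiplied by [e^omega], Wente's equation reads [2 H'(u) = alpha H(u)^2 + beta] on the real axis
    and [- 2 H'(omega3 - u) = alpha H(omega3 - u)^2 + beta] on the upper line, so [beta] is a
    nonvanishing multiple of [D'] wherever [D <> 0]. Two obstacles shape the proof. The formula for
    [e^omega] fails where [phi] vanishes, so [H] is continued across [mu] through [|phi| / |g|],
    whose logarithmic derivative is smooth there. And [u] might lie in [sing]; but the solved system
    is smooth near [u], and a singularity there would be removable. The sign of [D''(0)] comes from
    comparing [1 / H(u) <= u^2 / 4 + O(u^4)], due to the double pole of [phi], with the coefficient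
    [1 / 4 - (sum of the r_i r_j) / (4 r3^2)] of [u^2] in [1 / H(omega3 - u)]; the latter uses
    [phi'^2 = - (phi - r1) (phi - r2) (phi - r3)] with [r1 r2 r3 = 1], a form of the normalization
    [wp'(mu) = - 1 / 4]. Facts usually drawn from counting zeros of elliptic functions are drawn
    from uniqueness for [wp'' = 6 wp^2 + g]. *)

Definition ccont (f : C -> C) (z : C) : Prop :=
  forall e, 0 < e -> exists d, 0 < d /\ forall h, Cmod h < d -> Cmod (f (z + h)%C - f z)%C < e.

(** A bound on the defect instead of a quotient: [h = 0] needs no exclusion, and the rules of
    calculus reduce to triangle inequalities. *)
Definition cderiv (f : C -> C) (z l : C) : Prop :=
  forall e, 0 < e -> exists d, 0 < d /\
    forall h, Cmod h < d -> Cmod (f (z + h)%C - f z - h * l)%C <= e * Cmod h.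

Definition vderiv (c : R -> C) (t : R) (l : C) : Prop :=
  forall e, 0 < e -> exists d, 0 < d /\
    forall h : R, Rabs h < d -> Cmod (c (t + h)%R - c t - h * l)%C <= e * Rabs h.

Definition near (p : C) (P : C -> Prop) : Prop :=
  exists d, 0 < d /\ forall h, Cmod h < d -> P (p + h)%C.

(** The punctured neighbourhood: identities between meromorphic functions are established off their
    poles and then extended by continuity. *)
Definition near' (p : C) (P : C -> Prop) : Prop :=
  exists d, 0 < d /\ forall h, Cmod h < d -> h <> RtoC 0 -> P (p + h)%C.

Lemma Cmod_le_tri (a b c : C) : Cmod (a - c)%C <= Cmod (a - b)%C + Cmod (b - c)%C.
Proof. replace (a - c)%C with ((a - b) + (b - c))%C by ring. apply Cmod_triangle. Qed.

Lemma Cmod_sub_ge (a b : C) : Cmod a - Cmod b <= Cmod (a + b)%C.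
Proof.
  replace a with ((a + b) + - b)%C at 1 by ring.
  generalize (Cmod_triangle (a + b)%C (- b)%C). rewrite Cmod_opp. lra.
Qed.

Lemma Cmod_minus_sym (a b : C) : Cmod (a - b)%C = Cmod (b - a)%C.
Proof. replace (a - b)%C with (- (b - a))%C by ring. apply Cmod_opp. Qed.

Lemma im_le_Cmod (c : C) : Rabs (Im c) <= Cmod c.
Proof. eapply Rle_trans; [|apply Rmax_Cmod]. apply Rmax_r. Qed.

Lemma Cmod_le_ReIm (c : C) : Cmod c <= Rabs (Re c) + Rabs (Im c).
Proof.
  destruct c as [x y]; simpl.
  replace (x, y) with (RtoC x + Ci * RtoC y)%C.
  2:{ unfold RtoC, Ci, Cplus, Cmult; simpl; f_equal; ring. }
  eapply Rle_trans; [apply Cmod_triangle|].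
  rewrite Cmod_mult, Cmod_Ci, !Cmod_R. lra.
Qed.

Lemma near_and (p : C) (P Q : C -> Prop) :
  near p P -> near p Q -> near p (fun z => P z /\ Q z).
Proof.
  intros [d [Hd HP]] [d' [Hd' HQ]]. exists (Rmin d d'). split; [now apply Rmin_pos|].
  intros h Hh. split; [apply HP|apply HQ]; eapply Rlt_le_trans; eauto; [apply Rmin_l|apply Rmin_r].
Qed.

Lemma near_impl (p : C) (P Q : C -> Prop) :
  (forall z, P z -> Q z) -> near p P -> near p Q.
Proof. intros H [d [Hd HP]]. exists d; split; auto. Qed.

Lemma near'_impl (p : C) (P Q : C -> Prop) :
  (forall z, P z -> Q z) -> near' p P -> near' p Q.
Proof. intros H [d [Hd HP]]. exists d; split; auto. Qed.

Lemma near'_and (p : C) (P Q : C -> Prop) :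
  near' p P -> near' p Q -> near' p (fun z => P z /\ Q z).
Proof.
  intros [d [Hd HP]] [d' [Hd' HQ]]. exists (Rmin d d'). split; [now apply Rmin_pos|].
  intros h Hh H0. split; [apply HP|apply HQ]; auto; eapply Rlt_le_trans; eauto; [apply Rmin_l|apply Rmin_r].
Qed.

Lemma near_near' (p : C) (P : C -> Prop) : near p P -> near' p P.
Proof. intros [d [Hd HP]]. exists d; split; auto. Qed.

Lemma near_self (p : C) (P : C -> Prop) : near p P -> P p.
Proof.
  intros [d [Hd HP]]. replace p with (p + 0)%C by ring. apply HP. rewrite Cmod_0; auto.
Qed.

Lemma near_near (p : C) (P : C -> Prop) : near p P -> near p (fun q => near q P).
Proof.
  intros [d [Hd HP]]. exists (d / 2). split; [lra|]. intros h Hh.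
  exists (d / 2). split; [lra|]. intros k Hk.
  replace (p + h + k)%C with (p + (h + k))%C by ring. apply HP.
  generalize (Cmod_triangle h k). lra.
Qed.

Lemma near'_near (p : C) (P : C -> Prop) : near' p P -> near' p (fun q => near q P).
Proof.
  intros [d [Hd HP]]. exists (d / 2). split; [lra|]. intros h Hh H0.
  apply Cmod_gt_0 in H0.
  exists (Rmin (d / 2) (Cmod h)). split; [apply Rmin_pos; lra|]. intros k Hk.
  replace (p + h + k)%C with (p + (h + k))%C by ring. apply HP.
  - generalize (Cmod_triangle h k) (Rmin_l (d/2) (Cmod h)). lra.
  - apply Cmod_gt_0. generalize (Cmod_sub_ge h k) (Rmin_r (d/2) (Cmod h)). lra.
Qed.

Lemma cderiv_ccont f z l : cderiv f z l -> ccont f z.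
Proof.
  intros H e He. destruct (H 1 Rlt_0_1) as [d [Hd H']].
  assert (Hl := Cmod_ge_0 l).
  exists (Rmin d (e / (2 + Cmod l))). split.
  - apply Rmin_pos; auto. apply Rdiv_lt_0_compat; lra.
  - intros h Hh.
    assert (H1 := H' h (Rlt_le_trans _ _ _ Hh (Rmin_l _ _))).
    assert (H2 := Rlt_le_trans _ _ _ Hh (Rmin_r _ _)).
    replace (f (z + h)%C - f z)%C with ((f (z + h)%C - f z - h * l) + h * l)%C by ring.
    eapply Rle_lt_trans; [apply Cmod_triangle|]. rewrite Cmod_mult.
    apply Rlt_le_trans with (e / (2 + Cmod l) * (2 + Cmod l)).
    2: right; field; lra.
    assert (0 <= Cmod h) by apply Cmod_ge_0.
    nra.
Qed.

(** Termwise differentiation of the lattice series yields a remainder of this quadratic form, with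
    one constant for the whole sum. *)
Lemma cderiv_quad f z l M d :
  0 < d -> (forall h, Cmod h < d -> Cmod (f (z + h)%C - f z - h * l)%C <= M * (Cmod h * Cmod h)) ->
  cderiv f z l.
Proof.
  intros Hd H e He. assert (Hm := Rabs_pos M).
  exists (Rmin d (e / (1 + Rabs M))). split.
  - apply Rmin_pos; auto. apply Rdiv_lt_0_compat; lra.
  - intros h Hh.
    assert (H1 := H h (Rlt_le_trans _ _ _ Hh (Rmin_l _ _))).
    assert (H2 := Rlt_le_trans _ _ _ Hh (Rmin_r _ _)).
    eapply Rle_trans; [apply H1|].
    assert (0 <= Cmod h) by apply Cmod_ge_0.
    rewrite <- Rmult_assoc. apply Rmult_le_compat_r; auto.
    apply Rle_trans with ((1 + Rabs M) * (e / (1 + Rabs M))).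
    2: right; field; lra.
    generalize (Rle_abs M). intro. nra.
Qed.

Lemma cderiv_const c z : cderiv (fun _ => c) z 0.
Proof.
  intros e He. exists 1; split; [lra|]. intros h _.
  replace (c - c - h * 0)%C with (RtoC 0) by ring. rewrite Cmod_0.
  generalize (Cmod_ge_0 h). nra.
Qed.

Lemma cderiv_id z : cderiv (fun z => z) z 1.
Proof.
  intros e He. exists 1; split; [lra|]. intros h _.
  replace (z + h - z - h * 1)%C with (RtoC 0) by ring. rewrite Cmod_0.
  generalize (Cmod_ge_0 h). nra.
Qed.

Lemma cderiv_plus f g z a b :
  cderiv f z a -> cderiv g z b -> cderiv (fun z => f z + g z)%C z (a + b).
Proof.
  intros Hf Hg e He. destruct (Hf (e / 2)) as [d [Hd H1]]; [lra|].
  destruct (Hg (e / 2)) as [d' [Hd' H2]]; [lra|].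
  exists (Rmin d d'). split; [now apply Rmin_pos|]. intros h Hh.
  assert (A := H1 h (Rlt_le_trans _ _ _ Hh (Rmin_l _ _))).
  assert (B := H2 h (Rlt_le_trans _ _ _ Hh (Rmin_r _ _))).
  replace (f (z + h)%C + g (z + h)%C - (f z + g z) - h * (a + b))%C
    with ((f (z + h)%C - f z - h * a) + (g (z + h)%C - g z - h * b))%C by ring.
  eapply Rle_trans; [apply Cmod_triangle|]. lra.
Qed.

Lemma cderiv_mult f g z a b :
  cderiv f z a -> cderiv g z b -> cderiv (fun z => f z * g z)%C z (a * g z + f z * b).
Proof.
  intros Hf Hg e He.
  assert (Hc := cderiv_ccont _ _ _ Hf).
  set (e' := e / (1 + Cmod (g z) + Cmod (f z) + Cmod b)).
  assert (P1 := Cmod_ge_0 (g z)). assert (P2 := Cmod_ge_0 (f z)). assert (P3 := Cmod_ge_0 b).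
  assert (He' : 0 < e') by (apply Rdiv_lt_0_compat; lra).
  destruct (Hf e' He') as [d1 [Hd1 H1]].
  destruct (Hg (Rmin e' 1)) as [d2 [Hd2 H2]]; [apply Rmin_pos; lra|].
  destruct (Hc (Rmin e' 1)) as [d3 [Hd3 H3]]; [apply Rmin_pos; lra|].
  exists (Rmin d1 (Rmin d2 d3)). split; [repeat apply Rmin_pos; auto|]. intros h Hh.
  assert (A := H1 h (Rlt_le_trans _ _ _ Hh (Rmin_l _ _))).
  assert (Hh' := Rlt_le_trans _ _ _ Hh (Rmin_r _ _)).
  assert (B := H2 h (Rlt_le_trans _ _ _ Hh' (Rmin_l _ _))).
  assert (D := H3 h (Rlt_le_trans _ _ _ Hh' (Rmin_r _ _))).
  set (F := f (z + h)%C) in *. set (G := g (z + h)%C) in *.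
  replace (F * G - f z * g z - h * (a * g z + f z * b))%C
    with ((F - f z - h * a) * g z + (f z * (G - g z - h * b) +
           ((F - f z) * (G - g z - h * b) + (F - f z) * (h * b))))%C by ring.
  assert (P4 := Cmod_ge_0 h).
  assert (P5 := Cmod_ge_0 (F - f z - h * a)%C).
  assert (P6 := Cmod_ge_0 (G - g z - h * b)%C).
  assert (P7 := Cmod_ge_0 (F - f z)%C).
  eapply Rle_trans; [apply Cmod_triangle|]. rewrite Cmod_mult.
  eapply Rle_trans; [apply Rplus_le_compat_l, Cmod_triangle|]. rewrite Cmod_mult.
  eapply Rle_trans; [apply Rplus_le_compat_l, Rplus_le_compat_l, Cmod_triangle|].
  rewrite !Cmod_mult.
  assert (M1 := Rmin_l e' 1). assert (M2 := Rmin_r e' 1).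
  assert (Ee : e = e' * (1 + Cmod (g z) + Cmod (f z) + Cmod b)) by (unfold e'; field; lra).
  rewrite Ee.
  assert (Q1 : Cmod (F - f z - h * a)%C * Cmod (g z) <= e' * Cmod h * Cmod (g z))
    by (apply Rmult_le_compat_r; lra).
  assert (Q2 : Cmod (f z) * Cmod (G - g z - h * b)%C <= Cmod (f z) * (e' * Cmod h)).
  { apply Rmult_le_compat_l; auto. eapply Rle_trans; [apply B|]. apply Rmult_le_compat_r; lra. }
  assert (Q3 : Cmod (F - f z)%C * Cmod (G - g z - h * b)%C <= e' * (1 * Cmod h)).
  { apply Rmult_le_compat; auto; [lra|]. eapply Rle_trans; [apply B|]. apply Rmult_le_compat_r; lra. }
  assert (Q4 : Cmod (F - f z)%C * (Cmod h * Cmod b) <= e' * (Cmod h * Cmod b)).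
  { apply Rmult_le_compat_r; [|lra]. now apply Rmult_le_pos. }
  nra.
Qed.

Lemma cderiv_comp_affine f z u w l :
  cderiv f (u * z + w)%C l -> cderiv (fun z => f (u * z + w)%C) z (u * l).
Proof.
  intros Hf e He. assert (P := Cmod_ge_0 u).
  destruct (Hf (e / (1 + Cmod u))) as [d [Hd H]]; [apply Rdiv_lt_0_compat; lra|].
  exists (d / (1 + Cmod u)). split; [apply Rdiv_lt_0_compat; lra|]. intros h Hh.
  assert (P2 := Cmod_ge_0 h).
  replace (u * (z + h) + w)%C with (u * z + w + u * h)%C by ring.
  replace (h * (u * l))%C with ((u * h) * l)%C by ring.
  eapply Rle_trans; [apply H|].
  - rewrite Cmod_mult. apply (Rmult_lt_compat_r (1 + Cmod u)) in Hh; [|lra].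
    replace (d / (1 + Cmod u) * (1 + Cmod u)) with d in Hh by (field; lra). nra.
  - rewrite Cmod_mult. rewrite <- Rmult_assoc. apply Rmult_le_compat_r; auto.
    apply Rle_trans with (e / (1 + Cmod u) * (1 + Cmod u)); [|right; field; lra].
    apply Rmult_le_compat_l; [|lra]. left; apply Rdiv_lt_0_compat; lra.
Qed.

Lemma cderiv_shift f z w l : cderiv f (z + w)%C l -> cderiv (fun z => f (z + w)%C) z l.
Proof.
  intros H e He. destruct (H e He) as [d [Hd H']]. exists d; split; auto. intros h Hh.
  replace (z + h + w)%C with (z + w + h)%C by ring. auto.
Qed.

Lemma cderiv_reflect f z w l : cderiv f (w - z)%C l -> cderiv (fun z => f (w - z)%C) z (- l).
Proof.
  intros H. generalize (cderiv_comp_affine f z (-(1))%C w l).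
  replace (-(1) * z + w)%C with (w - z)%C by ring. intros K.
  intros e He. destruct (K H e He) as [d [Hd H']]. exists d; split; auto. intros h Hh.
  generalize (H' h Hh). cbv beta.
  replace (-(1) * (z + h) + w)%C with (w - (z + h))%C by ring.
  replace (-(1) * z + w)%C with (w - z)%C by ring.
  now replace (-(1) * l)%C with (- l)%C by ring.
Qed.

Lemma cderiv_near f g z l : near z (fun y => f y = g y) -> cderiv f z l -> cderiv g z l.
Proof.
  intros N H e He. destruct (H e He) as [d [Hd H']].
  assert (E := near_self _ _ N). destruct N as [d' [Hd' N]].
  exists (Rmin d d'). split; [now apply Rmin_pos|]. intros h Hh.
  rewrite <- E, <- N by (eapply Rlt_le_trans; [apply Hh|apply Rmin_r]).
  apply H'. eapply Rlt_le_trans; [apply Hh|apply Rmin_l].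
Qed.

Lemma cderiv_ext f g z l : (forall y, f y = g y) -> cderiv f z l -> cderiv g z l.
Proof. intros H. apply cderiv_near. exists 1. split; [lra|auto]. Qed.

Lemma cderiv_eq f z l l' : l = l' -> cderiv f z l -> cderiv f z l'.
Proof. now intros ->. Qed.

Lemma cderiv_opp f z a : cderiv f z a -> cderiv (fun z => - f z)%C z (- a).
Proof.
  intros H. apply (cderiv_ext (fun y => -(1) * f y)%C); [intros; ring|].
  apply (cderiv_eq _ _ (0 * f z + -(1) * a)%C); [ring|].
  apply (cderiv_mult (fun _ => -(1))%C f); [apply cderiv_const|apply H].
Qed.

Lemma cderiv_minus f g z a b :
  cderiv f z a -> cderiv g z b -> cderiv (fun z => f z - g z)%C z (a - b).
Proof. intros. apply cderiv_plus; auto. now apply cderiv_opp. Qed.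

Lemma cderiv_Cinv z : z <> RtoC 0 -> cderiv Cinv z (- / (z * z)).
Proof.
  intros Hz. assert (P : 0 < Cmod z) by now apply Cmod_gt_0.
  apply (cderiv_quad _ _ _ (2 / (Cmod z * Cmod z * Cmod z)) (Cmod z / 2)); [lra|].
  intros h Hh. assert (P2 := Cmod_ge_0 h).
  assert (G := Cmod_sub_ge z h). assert (P3 : 0 < Cmod (z + h)%C) by lra.
  assert (Hzh : (z + h)%C <> RtoC 0) by now apply Cmod_gt_0.
  replace (/ (z + h) - / z - h * - / (z * z))%C with ((h * h) / (z * z * (z + h)))%C
    by (field; auto).
  rewrite Cmod_div by (repeat apply Cmult_neq_0; auto). rewrite !Cmod_mult.
  unfold Rdiv. rewrite (Rmult_comm (2 * _)). apply Rmult_le_compat_l; [nra|].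
  replace (2 * / (Cmod z * Cmod z * Cmod z)) with (/ (Cmod z * Cmod z * (Cmod z / 2))) by (field; lra).
  apply Rinv_le_contravar.
  - apply Rmult_lt_0_compat; [apply Rmult_lt_0_compat|]; lra.
  - apply Rmult_le_compat_l; [|lra]. left; apply Rmult_lt_0_compat; lra.
Qed.

Lemma cderiv_comp f g z a b :
  cderiv f z a -> cderiv g (f z) b -> cderiv (fun z => g (f z)) z (a * b).
Proof.
  intros Hf Hg e He. assert (Hc := cderiv_ccont _ _ _ Hf).
  assert (Pa := Cmod_ge_0 a). assert (Pb := Cmod_ge_0 b).
  set (e1 := e / (2 * (1 + Cmod a))). assert (0 < e1) by (apply Rdiv_lt_0_compat; lra).
  set (e2 := Rmin 1 (e / (2 * (1 + Cmod b)))).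
  assert (0 < e2) by (apply Rmin_pos; [lra|]; apply Rdiv_lt_0_compat; lra).
  destruct (Hg e1) as [d1 [Hd1 H1]]; auto.
  destruct (Hf e2) as [d2 [Hd2 H2]]; auto.
  destruct (Hc d1 Hd1) as [d3 [Hd3 H3]].
  exists (Rmin d2 d3). split; [now apply Rmin_pos|]. intros h Hh.
  assert (A := H2 h (Rlt_le_trans _ _ _ Hh (Rmin_l _ _))).
  assert (B := H3 h (Rlt_le_trans _ _ _ Hh (Rmin_r _ _))).
  set (k := (f (z + h)%C - f z)%C) in *.
  assert (D := H1 k B). replace (f z + k)%C with (f (z + h)%C) in D by (unfold k; ring).
  replace (g (f (z + h)%C) - g (f z) - h * (a * b))%C
    with ((g (f (z + h)%C) - g (f z) - k * b) + (k - h * a) * b)%C by ring.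
  eapply Rle_trans; [apply Cmod_triangle|]. rewrite Cmod_mult.
  assert (Ph := Cmod_ge_0 h).
  assert (Hk : Cmod k <= (1 + Cmod a) * Cmod h).
  { replace k with ((k - h * a) + h * a)%C by ring.
    eapply Rle_trans; [apply Cmod_triangle|]. rewrite Cmod_mult.
    assert (e2 <= 1) by apply Rmin_l. nra. }
  apply Rle_trans with (e1 * ((1 + Cmod a) * Cmod h) + e / (2 * (1 + Cmod b)) * Cmod h * (1 + Cmod b)).
  - apply Rplus_le_compat.
    + eapply Rle_trans; [apply D|]. apply Rmult_le_compat_l; lra.
    + apply Rmult_le_compat; try lra; [apply Cmod_ge_0|].
      eapply Rle_trans; [apply A|]. apply Rmult_le_compat_r; auto. apply Rmin_r.
  - unfold e1. right. field; lra.
Qed.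

Lemma cderiv_inv f z a :
  f z <> RtoC 0 -> cderiv f z a -> cderiv (fun z => / f z)%C z (- a / (f z * f z)).
Proof.
  intros H0 H. eapply cderiv_eq; [|apply (cderiv_comp f Cinv); [apply H|now apply cderiv_Cinv]].
  field; auto.
Qed.

Lemma ccont_ext_near f g z : near z (fun y => f y = g y) -> ccont f z -> ccont g z.
Proof.
  intros N H e He. destruct (H e He) as [d [Hd H']].
  assert (E := near_self _ _ N). destruct N as [d' [Hd' N]].
  exists (Rmin d d'). split; [now apply Rmin_pos|]. intros h Hh.
  rewrite <- E, <- N by (eapply Rlt_le_trans; [apply Hh|apply Rmin_r]).
  apply H'. eapply Rlt_le_trans; [apply Hh|apply Rmin_l].
Qed.

Lemma ccont_const c z : ccont (fun _ => c) z.
Proof. eapply cderiv_ccont, cderiv_const. Qed.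

Lemma ccont_plus f g z : ccont f z -> ccont g z -> ccont (fun z => f z + g z)%C z.
Proof.
  intros Hf Hg e He. destruct (Hf (e / 2)) as [d [Hd H1]]; [lra|].
  destruct (Hg (e / 2)) as [d' [Hd' H2]]; [lra|].
  exists (Rmin d d'). split; [now apply Rmin_pos|]. intros h Hh.
  assert (A := H1 h (Rlt_le_trans _ _ _ Hh (Rmin_l _ _))).
  assert (B := H2 h (Rlt_le_trans _ _ _ Hh (Rmin_r _ _))).
  replace (f (z + h)%C + g (z + h)%C - (f z + g z))%C
    with ((f (z + h)%C - f z) + (g (z + h)%C - g z))%C by ring.
  eapply Rle_lt_trans; [apply Cmod_triangle|]. lra.
Qed.

Lemma ccont_mult f g z : ccont f z -> ccont g z -> ccont (fun z => f z * g z)%C z.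
Proof.
  intros Hf Hg e He.
  assert (P1 := Cmod_ge_0 (g z)). assert (P2 := Cmod_ge_0 (f z)).
  set (e' := Rmin 1 (e / (2 + Cmod (g z) + Cmod (f z)))).
  assert (He' : 0 < e') by (apply Rmin_pos; [lra|]; apply Rdiv_lt_0_compat; lra).
  destruct (Hf e' He') as [d [Hd H1]]. destruct (Hg e' He') as [d' [Hd' H2]].
  exists (Rmin d d'). split; [now apply Rmin_pos|]. intros h Hh.
  assert (A := H1 h (Rlt_le_trans _ _ _ Hh (Rmin_l _ _))).
  assert (B := H2 h (Rlt_le_trans _ _ _ Hh (Rmin_r _ _))).
  set (F := f (z + h)%C) in *. set (G := g (z + h)%C) in *.
  replace (F * G - f z * g z)%C
    with ((F - f z) * g z + (f z * (G - g z) + (F - f z) * (G - g z)))%C by ring.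
  eapply Rle_lt_trans; [apply Cmod_triangle|]. rewrite Cmod_mult.
  eapply Rle_lt_trans; [apply Rplus_le_compat_l, Cmod_triangle|]. rewrite !Cmod_mult.
  assert (M1 : e' <= 1) by apply Rmin_l.
  assert (M2 : e' <= e / (2 + Cmod (g z) + Cmod (f z))) by apply Rmin_r.
  assert (P5 := Cmod_ge_0 (F - f z)%C). assert (P6 := Cmod_ge_0 (G - g z)%C).
  apply Rlt_le_trans with (e / (2 + Cmod (g z) + Cmod (f z)) * (2 + Cmod (g z) + Cmod (f z))).
  2: right; field; lra.
  set (q := e / (2 + Cmod (g z) + Cmod (f z))) in *.
  assert (Cmod (F - f z)%C * Cmod (g z) <= q * Cmod (g z)) by (apply Rmult_le_compat_r; lra).
  assert (Cmod (f z) * Cmod (G - g z)%C <= Cmod (f z) * q) by (apply Rmult_le_compat_l; lra).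
  assert (Cmod (F - f z)%C * Cmod (G - g z)%C <= q * 1) by (apply Rmult_le_compat; lra).
  nra.
Qed.

Lemma ccont_shift f z w : ccont f (z + w)%C -> ccont (fun z => f (z + w)%C) z.
Proof.
  intros H e He. destruct (H e He) as [d [Hd H']]. exists d; split; auto. intros h Hh.
  replace (z + h + w)%C with (z + w + h)%C by ring. auto.
Qed.

Lemma ccont_reflect f z w : ccont f (w - z)%C -> ccont (fun z => f (w - z)%C) z.
Proof.
  intros H e He. destruct (H e He) as [d [Hd H']]. exists d; split; auto. intros h Hh.
  replace (w - (z + h))%C with (w - z + - h)%C by ring. apply H'. now rewrite Cmod_opp.
Qed.

(** The continuity principle by which identities proved away from isolated points reach those
    points. *)
Lemma ccont_eq_near' f g p : ccont f p -> ccont g p -> near' p (fun z => f z = g z) -> f p = g p.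
Proof.
  intros Hf Hg [d [Hd H]].
  destruct (Ceq_dec (f p) (g p)) as [E|E]; auto. exfalso.
  assert (P : 0 < Cmod (f p - g p)%C).
  { apply Cmod_gt_0. intro Z. apply E. replace (f p) with ((f p - g p) + g p)%C by ring. rewrite Z. ring. }
  destruct (Hf (Cmod (f p - g p)%C / 2)) as [d1 [Hd1 H1]]; [lra|].
  destruct (Hg (Cmod (f p - g p)%C / 2)) as [d2 [Hd2 H2]]; [lra|].
  set (h := RtoC (Rmin d (Rmin d1 d2) / 2)).
  assert (Pm : 0 < Rmin d (Rmin d1 d2)) by (repeat apply Rmin_pos; auto).
  assert (Hh : Cmod h < Rmin d (Rmin d1 d2)) by (unfold h; rewrite Cmod_R, Rabs_pos_eq; lra).
  assert (Hh0 : h <> RtoC 0) by (intro K; apply RtoC_inj in K; lra).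
  assert (Hh' := Rlt_le_trans _ _ _ Hh (Rmin_r _ _)).
  assert (A := H1 h (Rlt_le_trans _ _ _ Hh' (Rmin_l _ _))).
  assert (B := H2 h (Rlt_le_trans _ _ _ Hh' (Rmin_r _ _))).
  rewrite <- (H h (Rlt_le_trans _ _ _ Hh (Rmin_l _ _)) Hh0) in B.
  rewrite Cmod_minus_sym in A.
  assert (T := Cmod_le_tri (f p) (f (p + h)%C) (g p)). lra.
Qed.

Lemma cderiv_unique f z l l' : cderiv f z l -> cderiv f z l' -> l = l'.
Proof.
  intros H H'. destruct (Ceq_dec l l') as [E|E]; auto. exfalso.
  assert (P : 0 < Cmod (l - l')%C).
  { apply Cmod_gt_0. intro Z. apply E. replace l with ((l - l') + l')%C by ring. rewrite Z. ring. }
  destruct (H (Cmod (l - l')%C / 4)) as [d [Hd H1]]; [lra|].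
  destruct (H' (Cmod (l - l')%C / 4)) as [d' [Hd' H2]]; [lra|].
  assert (Pm : 0 < Rmin d d') by (apply Rmin_pos; auto).
  set (h := RtoC (Rmin d d' / 2)).
  assert (Eh : Cmod h = Rmin d d' / 2) by (unfold h; rewrite Cmod_R, Rabs_pos_eq; lra).
  assert (M1 := Rmin_l d d'). assert (M2 := Rmin_r d d').
  assert (A := H1 h ltac:(lra)). assert (B := H2 h ltac:(lra)).
  assert (T : Cmod (h * (l - l'))%C <= Cmod (l - l')%C / 2 * Cmod h).
  { replace (h * (l - l'))%C with
      ((f (z + h)%C - f z - h * l') + - (f (z + h)%C - f z - h * l))%C by ring.
    eapply Rle_trans; [apply Cmod_triangle|]. rewrite Cmod_opp. lra. }
  rewrite Cmod_mult in T. nra.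
Qed.

Lemma is_derive_eps (f : R -> R) t l :
  is_derive f t l <->
  (forall e, 0 < e -> exists d, 0 < d /\
    forall h, Rabs h < d -> Rabs (f (t + h) - f t - h * l) <= e * Rabs h).
Proof.
  rewrite is_derive_Reals. split.
  - intros H e He. destruct (H e He) as [d Hd]. exists d. split; [apply cond_pos|].
    intros h Hh. destruct (Req_dec h 0) as [->|H0].
    + replace (f (t + 0) - f t - 0 * l) with 0 by (rewrite Rplus_0_r; ring).
      rewrite Rabs_R0. lra.
    + specialize (Hd h H0 Hh).
      replace (f (t + h) - f t - h * l) with (((f (t + h) - f t) / h - l) * h) by (field; auto).
      rewrite Rabs_mult. apply Rmult_le_compat_r; [apply Rabs_pos|lra].
  - intros H e He. destruct (H (e / 2)) as [d [Hd H']]; [lra|].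
    exists (mkposreal d Hd). intros h H0 Hh. simpl in Hh. specialize (H' h Hh).
    replace ((f (t + h) - f t) / h - l) with ((f (t + h) - f t - h * l) * / h) by (field; auto).
    rewrite Rabs_mult, Rabs_inv.
    assert (P := Rabs_pos_lt h H0).
    apply Rle_lt_trans with (e / 2 * Rabs h * / Rabs h).
    + apply Rmult_le_compat_r; auto. left. now apply Rinv_0_lt_compat.
    + rewrite Rmult_assoc, Rinv_r; lra.
Qed.

Lemma continuous_eps (f : R -> R) t :
  (forall e, 0 < e -> exists d, 0 < d /\ forall h, Rabs h < d -> Rabs (f (t + h) - f t) < e) ->
  continuous f t.
Proof.
  intros H. apply continuity_pt_filterlim. intros e He.
  destruct (H e He) as [d [Hd H']]. exists d. split; auto.
  intros x [_ Hx]. simpl in *. unfold R_dist in *.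
  replace x with (t + (x - t)) by ring. auto.
Qed.

Lemma vderiv_intro c t (a b : R) :
  is_derive (fun t => Re (c t)) t a -> is_derive (fun t => Im (c t)) t b -> vderiv c t (a, b).
Proof.
  intros Ha Hb e He. rewrite is_derive_eps in Ha, Hb.
  destruct (Ha (e / 2)) as [d [Hd H1]]; [lra|]. destruct (Hb (e / 2)) as [d' [Hd' H2]]; [lra|].
  exists (Rmin d d'). split; [now apply Rmin_pos|]. intros h Hh.
  assert (A := H1 h (Rlt_le_trans _ _ _ Hh (Rmin_l _ _))).
  assert (B := H2 h (Rlt_le_trans _ _ _ Hh (Rmin_r _ _))).
  eapply Rle_trans; [apply Cmod_le_ReIm|].
  replace (Re (c (t + h)%R - c t - h * (a, b))%C) with (Re (c (t + h)%R) - Re (c t) - h * a)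
    by (simpl; unfold Re; ring).
  replace (Im (c (t + h)%R - c t - h * (a, b))%C) with (Im (c (t + h)%R) - Im (c t) - h * b)
    by (simpl; unfold Im; ring).
  lra.
Qed.

Lemma vderiv_Re c t l : vderiv c t l -> is_derive (fun t => Re (c t)) t (Re l).
Proof.
  intros H. apply is_derive_eps. intros e He. destruct (H e He) as [d [Hd H']].
  exists d; split; auto. intros h Hh. eapply Rle_trans; [|apply H'; auto].
  eapply Rle_trans; [|apply re_le_Cmod]. right. f_equal. simpl; unfold Re; ring.
Qed.

Lemma vderiv_Im c t l : vderiv c t l -> is_derive (fun t => Im (c t)) t (Im l).
Proof.
  intros H. apply is_derive_eps. intros e He. destruct (H e He) as [d [Hd H']].
  exists d; split; auto. intros h Hh. eapply Rle_trans; [|apply H'; auto].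
  eapply Rle_trans; [|apply im_le_Cmod]. right. f_equal. simpl; unfold Im; ring.
Qed.

Lemma vderiv_cont c t l : vderiv c t l ->
  forall e, 0 < e -> exists d, 0 < d /\ forall h : R, Rabs h < d -> Cmod (c (t + h)%R - c t)%C < e.
Proof.
  intros H e He. destruct (H 1 Rlt_0_1) as [d [Hd H']].
  assert (Hl := Cmod_ge_0 l).
  exists (Rmin d (e / (2 + Cmod l))). split.
  - apply Rmin_pos; auto. apply Rdiv_lt_0_compat; lra.
  - intros h Hh.
    assert (H1 := H' h (Rlt_le_trans _ _ _ Hh (Rmin_l _ _))).
    assert (H2 := Rlt_le_trans _ _ _ Hh (Rmin_r _ _)).
    replace (c (t + h)%R - c t)%C with ((c (t + h)%R - c t - h * l) + h * l)%C by ring.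
    eapply Rle_lt_trans; [apply Cmod_triangle|]. rewrite Cmod_mult, Cmod_R.
    apply Rlt_le_trans with (e / (2 + Cmod l) * (2 + Cmod l)).
    2: right; field; lra.
    assert (0 <= Rabs h) by apply Rabs_pos.
    nra.
Qed.

Lemma cderiv_vderiv f c t l d : cderiv f (c t) l -> vderiv c t d -> vderiv (fun t => f (c t)) t (d * l).
Proof.
  intros Hf Hc e He. assert (Hk := vderiv_cont _ _ _ Hc).
  assert (Pd := Cmod_ge_0 d). assert (Pl := Cmod_ge_0 l).
  set (e1 := e / (2 * (1 + Cmod d))). assert (0 < e1) by (apply Rdiv_lt_0_compat; lra).
  set (e2 := Rmin 1 (e / (2 * (1 + Cmod l)))).
  assert (0 < e2) by (apply Rmin_pos; [lra|]; apply Rdiv_lt_0_compat; lra).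
  destruct (Hf e1) as [d1 [Hd1 H1]]; auto.
  destruct (Hc e2) as [d2 [Hd2 H2]]; auto.
  destruct (Hk d1 Hd1) as [d3 [Hd3 H3]].
  exists (Rmin d2 d3). split; [now apply Rmin_pos|]. intros h Hh.
  assert (A := H2 h (Rlt_le_trans _ _ _ Hh (Rmin_l _ _))).
  assert (B := H3 h (Rlt_le_trans _ _ _ Hh (Rmin_r _ _))).
  set (k := (c (t + h)%R - c t)%C) in *.
  assert (D := H1 k B). replace (c t + k)%C with (c (t + h)%R) in D by (unfold k; ring).
  replace (f (c (t + h)%R) - f (c t) - h * (d * l))%C
    with ((f (c (t + h)%R) - f (c t) - k * l) + (k - h * d) * l)%C by ring.
  eapply Rle_trans; [apply Cmod_triangle|]. rewrite Cmod_mult.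
  assert (Ph := Rabs_pos h).
  assert (Hkk : Cmod k <= (1 + Cmod d) * Rabs h).
  { replace k with ((k - h * d) + h * d)%C by ring.
    eapply Rle_trans; [apply Cmod_triangle|]. rewrite Cmod_mult, Cmod_R.
    assert (e2 <= 1) by apply Rmin_l. nra. }
  apply Rle_trans with (e1 * ((1 + Cmod d) * Rabs h) + e / (2 * (1 + Cmod l)) * Rabs h * (1 + Cmod l)).
  - apply Rplus_le_compat.
    + eapply Rle_trans; [apply D|]. apply Rmult_le_compat_l; lra.
    + apply Rmult_le_compat; try lra; [apply Cmod_ge_0|].
      eapply Rle_trans; [apply A|]. apply Rmult_le_compat_r; auto. apply Rmin_r.
  - unfold e1. right. field; lra.
Qed.

Lemma ccont_curve f c t l : ccont f (c t) -> vderiv c t l ->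
  forall e, 0 < e -> exists d, 0 < d /\ forall h : R, Rabs h < d -> Cmod (f (c (t + h)%R) - f (c t))%C < e.
Proof.
  intros Hf Hc e He. destruct (Hf e He) as [d [Hd H]].
  destruct (vderiv_cont _ _ _ Hc d Hd) as [d' [Hd' H']]. exists d'; split; auto. intros h Hh.
  replace (c (t + h)%R) with (c t + (c (t + h)%R - c t))%C by ring. auto.
Qed.

Lemma continuous_Re_curve f c t l : ccont f (c t) -> vderiv c t l -> continuous (fun t => Re (f (c t))) t.
Proof.
  intros Hf Hc. apply continuous_eps. intros e He.
  destruct (ccont_curve _ _ _ _ Hf Hc e He) as [d [Hd H]]. exists d; split; auto. intros h Hh.
  eapply Rle_lt_trans; [|apply H, Hh]. eapply Rle_trans; [|apply re_le_Cmod]. right; reflexivity.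
Qed.

Lemma continuous_Im_curve f c t l : ccont f (c t) -> vderiv c t l -> continuous (fun t => Im (f (c t))) t.
Proof.
  intros Hf Hc. apply continuous_eps. intros e He.
  destruct (ccont_curve _ _ _ _ Hf Hc e He) as [d [Hd H]]. exists d; split; auto. intros h Hh.
  eapply Rle_lt_trans; [|apply H, Hh]. eapply Rle_trans; [|apply im_le_Cmod]. right; reflexivity.
Qed.

(** * Liouville's theorem *)

Definition ei (t : R) : C := (cos t, sin t).

Lemma vderiv_radius (z : C) (t r : R) : vderiv (fun r : R => z + r * ei t)%C r (ei t).
Proof.
  apply vderiv_intro; simpl.
  - eapply is_derive_ext; [intros; reflexivity|]. unfold Re; simpl. auto_derive; auto. ring.
  - unfold Im; simpl. auto_derive; auto. ring.
Qed.

Lemma vderiv_angle (z : C) (r t : R) : vderiv (fun t : R => z + r * ei t)%C t (r * (Ci * ei t)).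
Proof.
  replace (r * (Ci * ei t))%C with (- (r * sin t), r * cos t)%R.
  2:{ unfold ei, Ci, RtoC, Cmult; simpl; f_equal; ring. }
  apply vderiv_intro; unfold Re, Im; simpl; auto_derive; auto; ring.
Qed.

(** Joint continuity in radius and angle is what differentiation under the integral sign
    requires. *)
Lemma vderiv_circle_cont_2d (f : C -> C) (z : C) (r t : R) :
  ccont f (z + r * ei t)%C ->
  continuity_2d_pt (fun u v => Re (f (z + u * ei v)%C)) r t.
Proof.
  intros Hf e. destruct (Hf e (cond_pos e)) as [d [Hd H]].
  assert (K1 : continuity_2d_pt (fun u v => u * cos v) r t).
  { apply continuity_2d_pt_mult; [apply continuity_2d_pt_id1|].
    apply (continuity_1d_2d_pt_comp cos (fun _ v => v)).
    - apply continuity_cos.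
    - apply continuity_2d_pt_id2. }
  assert (K2 : continuity_2d_pt (fun u v => u * sin v) r t).
  { apply continuity_2d_pt_mult; [apply continuity_2d_pt_id1|].
    apply (continuity_1d_2d_pt_comp sin (fun _ v => v)).
    - apply continuity_sin.
    - apply continuity_2d_pt_id2. }
  assert (Hd2 : 0 < d / 2) by lra.
  destruct (K1 (mkposreal _ Hd2)) as [d1 H1]. destruct (K2 (mkposreal _ Hd2)) as [d2 H2].
  exists (mkposreal _ (Rmin_pos _ _ (cond_pos d1) (cond_pos d2))). simpl. intros u v Hu Hv.
  specialize (H1 u v (Rlt_le_trans _ _ _ Hu (Rmin_l _ _)) (Rlt_le_trans _ _ _ Hv (Rmin_l _ _))).
  specialize (H2 u v (Rlt_le_trans _ _ _ Hu (Rmin_r _ _)) (Rlt_le_trans _ _ _ Hv (Rmin_r _ _))).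
  simpl in H1, H2.
  replace (z + u * ei v)%C with (z + r * ei t + (u * ei v - r * ei t))%C by ring.
  eapply Rle_lt_trans; [|apply (H (u * ei v - r * ei t)%C)].
  - eapply Rle_trans; [|apply re_le_Cmod]. right; reflexivity.
  - eapply Rle_lt_trans; [apply Cmod_le_ReIm|]. unfold ei, Re, Im; simpl.
    replace (u * cos v - 0 * sin v + - (r * cos t - 0 * sin t)) with (u * cos v - r * cos t) by ring.
    replace (u * sin v + 0 * cos v + - (r * sin t + 0 * cos t)) with (u * sin v - r * sin t) by ring.
    lra.
Qed.

Section CircleAverages.
Variables (f df : C -> C) (M : R).
Hypothesis Hd : forall z, cderiv f z (df z).
Hypothesis Hc : forall z, ccont df z.
Hypothesis Hb : forall z, Cmod (f z) <= M.
Variable z : C.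

(** [A] and [B] are the real and imaginary parts of [e^(-it) f(z + r e^(it))]. The radial derivative
    of this function is [f'(z + r e^(it))], with real part [a]; its angular derivative is
    [i (r f' - e^(-it) f)], whence [dB/dt = r a - A]. These two relations replace Cauchy's integral
    formula. *)
Let A (r t : R) : R := Re (f (z + r * ei t)%C) * cos t + Im (f (z + r * ei t)%C) * sin t.
Let B (r t : R) : R := Im (f (z + r * ei t)%C) * cos t - Re (f (z + r * ei t)%C) * sin t.
Let a (r t : R) : R := Re (df (z + r * ei t)%C).

Lemma circle_dr r t : is_derive (fun r => A r t) r (a r t).
Proof.
  assert (V := cderiv_vderiv f _ r _ _ (Hd _) (vderiv_radius z t r)).
  assert (V1 := vderiv_Re _ _ _ V). assert (V2 := vderiv_Im _ _ _ V).
  unfold A. evar_last.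
  - apply (is_derive_plus (K := R_AbsRing) (V := R_NormedModule)).
    + apply (is_derive_scal_l (fun r : R => Re (f (z + r * ei t)%C)) r _ (cos t) V1).
    + apply (is_derive_scal_l (fun r : R => Im (f (z + r * ei t)%C)) r _ (sin t) V2).
  - unfold a. set (w := df _). destruct w as [x y]. unfold plus, scal; simpl; unfold mult; simpl.
    generalize (sin2_cos2 t). unfold Rsqr. intros E.
    transitivity (x * (sin t * sin t + cos t * cos t)); [ring|rewrite E; ring].
Qed.

Lemma circle_dt r t : is_derive (fun t => B r t) t (r * a r t - A r t).
Proof.
  assert (V := cderiv_vderiv f _ t _ _ (Hd _) (vderiv_angle z r t)).
  assert (V1 := vderiv_Re _ _ _ V). assert (V2 := vderiv_Im _ _ _ V).
  unfold B. evar_last.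
  - apply (is_derive_minus (K := R_AbsRing) (V := R_NormedModule)).
    + apply (is_derive_mult (fun t : R => Im (f (z + r * ei t)%C)) cos t _ _ V2 (is_derive_cos t)).
      intros; apply Rmult_comm.
    + apply (is_derive_mult (fun t : R => Re (f (z + r * ei t)%C)) sin t _ _ V1 (is_derive_sin t)).
      intros; apply Rmult_comm.
  - unfold a, A. set (w := df _). destruct w as [x y].
    unfold minus, plus, opp, scal; simpl; unfold mult, Re, Im; simpl.
    generalize (sin2_cos2 t). unfold Rsqr. intros E.
    set (p := fst (f _)). set (q := snd (f _)).
    transitivity (r * x * (sin t * sin t + cos t * cos t) - (p * cos t + q * sin t)); [ring|rewrite E; ring].
Qed.

Lemma circle_cont_a r t : continuous (a r) t.
Proof. unfold a. eapply continuous_Re_curve; [apply Hc|apply vderiv_angle]. Qed.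

Lemma circle_cont_A r t : continuous (A r) t.
Proof.
  unfold A. apply (continuous_plus (V := R_NormedModule)); apply (continuous_mult (K := R_AbsRing)).
  - eapply continuous_Re_curve; [eapply cderiv_ccont, Hd|apply vderiv_angle].
  - apply continuity_pt_filterlim, continuity_cos.
  - eapply continuous_Im_curve; [eapply cderiv_ccont, Hd|apply vderiv_angle].
  - apply continuity_pt_filterlim, continuity_sin.
Qed.

Let N (r : R) : R := RInt (A r) 0 (2 * PI).

Lemma circle_ex_a r : ex_RInt (a r) 0 (2 * PI).
Proof. apply (ex_RInt_continuous (V := R_CompleteNormedModule)). intros; apply circle_cont_a. Qed.

Lemma circle_ex_A r : ex_RInt (A r) 0 (2 * PI).
Proof. apply (ex_RInt_continuous (V := R_CompleteNormedModule)). intros; apply circle_cont_A. Qed.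

Lemma circle_average_dr r : is_derive N r (RInt (a r) 0 (2 * PI)).
Proof.
  unfold N. evar_last.
  - apply (is_derive_RInt_param A 0 (2 * PI) r).
    + apply filter_forall. intros x t _. eexists. apply circle_dr.
    + intros t _. apply (continuity_2d_pt_ext a).
      * intros x y. symmetry. apply is_derive_unique, circle_dr.
      * apply (vderiv_circle_cont_2d df). apply Hc.
    + apply filter_forall. intros; apply circle_ex_A.
  - apply RInt_ext. intros t _. apply is_derive_unique, circle_dr.
Qed.

(** Integration of [dB/dt = r a - A] over a full turn; the boundary terms agree by periodicity. *)
Lemma circle_average_parts r : r * RInt (a r) 0 (2 * PI) = N r.
Proof.
  assert (E : is_RInt (fun t => r * a r t - A r t) 0 (2 * PI) (B r (2 * PI) - B r 0)).
  { apply (is_RInt_derive (B r)).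
    - intros; apply circle_dt.
    - intros t _. apply (continuous_minus (V := R_NormedModule)).
      + apply (continuous_scal_r r (a r)), circle_cont_a.
      + apply circle_cont_A. }
  assert (F : is_RInt (fun t => r * a r t - A r t) 0 (2 * PI) (r * RInt (a r) 0 (2 * PI) - N r)).
  { apply (is_RInt_minus (V := R_NormedModule) (fun t => r * a r t) (A r)).
    - apply (is_RInt_scal (V := R_NormedModule) (a r)).
      apply (RInt_correct (V := R_CompleteNormedModule)), circle_ex_a.
    - apply (RInt_correct (V := R_CompleteNormedModule)), circle_ex_A. }
  apply (is_RInt_unique (V := R_CompleteNormedModule)) in E, F. rewrite E in F.
  replace (B r (2 * PI) - B r 0) with 0 in F; [lra|].
  unfold B, ei. rewrite cos_2PI, sin_2PI, cos_0, sin_0. ring.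
Qed.

(** Since [N' = N / r], the quotient [N(r) / r] is constant, while [N] is bounded along with [f]; so
    the quotient is 0. *)
Lemma circle_average_zero r : 0 < r -> RInt (a r) 0 (2 * PI) = 0.
Proof.
  intros Hr.
  assert (HPI := PI_RGT_0).
  assert (K : forall x y, 0 < x -> x < y -> N x / x = N y / y).
  { intros x y Hx Hxy. apply (eq_is_derive (fun r => N r / r)); auto.
    intros t [Ht _]. evar_last.
    - apply (is_derive_div N (fun t => t) t _ 1 (circle_average_dr t)); [|lra].
      apply (is_derive_id (K := R_AbsRing)).
    - rewrite <- (circle_average_parts t).
      set (q := RInt (a t) 0 (2 * PI)). change (zero : R) with 0. field. lra. }
  assert (Bd : forall x, Rabs (N x) <= 2 * PI * (2 * M)).
  { intros x. unfold N. replace (2 * PI) with (2 * PI - 0) at 2 by ring.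
    apply abs_RInt_le_const; [lra|apply circle_ex_A|]. intros t _.
    unfold A. eapply Rle_trans; [apply Rabs_triang|]. rewrite !Rabs_mult.
    set (w := f _). assert (Hw := Hb (z + x * ei t)%C). fold w in Hw.
    assert (H1 := re_le_Cmod w). assert (H2 := im_le_Cmod w).
    assert (H3 : Rabs (cos t) <= 1) by (apply Rabs_le, COS_bound).
    assert (H4 : Rabs (sin t) <= 1) by (apply Rabs_le, SIN_bound).
    assert (P1 := Rabs_pos (Re w)). assert (P2 := Rabs_pos (Im w)).
    assert (P3 := Rabs_pos (cos t)). assert (P4 := Rabs_pos (sin t)).
    nra. }
  assert (Z : N r / r = 0).
  { destruct (Req_dec (N r / r) 0) as [E|E]; auto. exfalso.
    assert (P := Rabs_pos_lt _ E).
    assert (HM : 0 <= M) by (eapply Rle_trans; [apply Cmod_ge_0|apply (Hb z)]).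
    (* At this radius a nonzero constant quotient would force [Rabs (N y)] above its bound
       [2 * PI * (2 * M)]. *)
    set (y := r + (2 * PI * (2 * M) + 1) / Rabs (N r / r)).
    assert (Hy : r < y).
    { unfold y. assert (0 < (2 * PI * (2 * M) + 1) / Rabs (N r / r)); [|lra].
      apply Rdiv_lt_0_compat; auto. nra. }
    assert (E1 := K r y Hr Hy).
    assert (E2 : Rabs (N y) = Rabs (N r / r) * y).
    { rewrite E1. unfold Rdiv. rewrite Rabs_mult, Rabs_inv, (Rabs_pos_eq y) by lra. field. lra. }
    assert (E3 := Bd y). rewrite E2 in E3. unfold y in E3.
    rewrite Rmult_plus_distr_l in E3.
    replace (Rabs (N r / r) * ((2 * PI * (2 * M) + 1) / Rabs (N r / r)))
      with (2 * PI * (2 * M) + 1) in E3 by (field; lra).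
    nra. }
  apply (Rmult_eq_reg_l r); [|lra]. rewrite circle_average_parts, Rmult_0_r.
  replace (N r) with (N r / r * r) by (field; lra). rewrite Z. ring.
Qed.

(** The mean of [Re df] over every circle is 0, whereas on small circles [Re df] stays within
    [Rabs (Re (df z)) / 2] of [Re (df z)]. *)
Lemma liouville_Re : Re (df z) = 0.
Proof.
  destruct (Req_dec (Re (df z)) 0) as [E|E]; auto. exfalso.
  assert (P := Rabs_pos_lt _ E). assert (HPI := PI_RGT_0).
  destruct (Hc z (Rabs (Re (df z)) / 2)) as [d [Hd0 H]]; [lra|].
  set (r := d / 2). assert (Hr : 0 < r) by (unfold r; lra).
  assert (I : is_RInt (fun t => a r t - Re (df z)) 0 (2 * PI) (0 - (2 * PI - 0) * Re (df z))).
  { apply (is_RInt_minus (V := R_NormedModule) (a r)).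
    - generalize (RInt_correct (V := R_CompleteNormedModule) _ _ _ (circle_ex_a r)).
      now rewrite (circle_average_zero r Hr).
    - apply (is_RInt_const (V := R_NormedModule)). }
  assert (J : Rabs (RInt (fun t => a r t - Re (df z)) 0 (2 * PI))
              <= (2 * PI - 0) * (Rabs (Re (df z)) / 2)).
  { apply abs_RInt_le_const; [lra|eexists; apply I|].
    intros t _. left. eapply Rle_lt_trans; [|apply (H (r * ei t)%C)].
    - unfold a. eapply Rle_trans; [|apply re_le_Cmod]. right; reflexivity.
    - rewrite Cmod_mult, Cmod_R, Rabs_pos_eq by lra.
      replace (Cmod (ei t)) with 1; [unfold r; lra|].
      unfold Cmod, ei; simpl. rewrite <- sqrt_1 at 1. f_equal.
      generalize (sin2_cos2 t); unfold Rsqr; lra. }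
  apply (is_RInt_unique (V := R_CompleteNormedModule)) in I. rewrite I in J.
  rewrite Rminus_0_l, Rabs_Ropp, Rabs_mult, (Rabs_pos_eq (2 * PI - 0)) in J by lra.
  nra.
Qed.
End CircleAverages.

Lemma liouville_deriv (f df : C -> C) M :
  (forall z, cderiv f z (df z)) -> (forall z, ccont df z) -> (forall z, Cmod (f z) <= M) ->
  forall z, df z = RtoC 0.
Proof.
  intros Hd Hc Hb z.
  assert (H1 := liouville_Re f df M Hd Hc Hb z).
  (* The imaginary part of [df] is read off from the function [i f], which has the same bound. *)
  assert (H2 : Re (Ci * df z)%C = 0).
  { apply (liouville_Re (fun z => Ci * f z)%C (fun z => Ci * df z)%C M).
    - intros y. apply (cderiv_eq _ _ (0 * f y + Ci * df y)%C); [ring|].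
      apply (cderiv_mult (fun _ => Ci) f); [apply cderiv_const|apply Hd].
    - intros y. apply (ccont_mult (fun _ => Ci) df); [apply ccont_const|apply Hc].
    - intros y. rewrite Cmod_mult, Cmod_Ci, Rmult_1_l. apply Hb. }
  destruct (df z) as [x y]. unfold Re in *; simpl in *. unfold RtoC. f_equal; lra.
Qed.

(** * Holomorphic germs and functions with two periods *)

Lemma vderiv_segment a b t : vderiv (fun t : R => a + t * (b - a))%C t (b - a).
Proof.
  intros e He. exists 1. split; [lra|]. intros h _.
  replace (a + (t + h)%R * (b - a) - (a + t * (b - a)) - h * (b - a))%C with (RtoC 0).
  - rewrite Cmod_0. generalize (Rabs_pos h); nra.
  - rewrite RtoC_plus. ring.
Qed.

Lemma cderiv_zero_segment f a b :
  (forall t, 0 <= t <= 1 -> cderiv f (a + t * (b - a))%C 0) -> f a = f b.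
Proof.
  intros H.
  assert (V : forall t, 0 <= t <= 1 -> vderiv (fun t : R => f (a + t * (b - a))%C) t 0).
  { intros t Ht. replace (RtoC 0) with ((b - a) * 0)%C by ring.
    apply cderiv_vderiv; [now apply H|apply vderiv_segment]. }
  assert (E1 := eq_is_derive (fun t : R => Re (f (a + t * (b - a))%C)) 0 1
    (fun t Ht => vderiv_Re _ _ _ (V t Ht)) Rlt_0_1).
  assert (E2 := eq_is_derive (fun t : R => Im (f (a + t * (b - a))%C)) 0 1
    (fun t Ht => vderiv_Im _ _ _ (V t Ht)) Rlt_0_1).
  simpl in E1, E2.
  replace (a + 0 * (b - a))%C with a in E1, E2 by ring.
  replace (a + 1 * (b - a))%C with b in E1, E2 by ring.
  destruct (f a), (f b). unfold Re, Im in *; simpl in *. congruence.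
Qed.

(** Continuity of the derivative is part of the notion because the circle averages assume it; for
    the lattice series it follows from a second termwise differentiation. *)
Definition cC1 (f : C -> C) (p : C) : Prop :=
  exists df, near p (fun z => cderiv f z (df z) /\ ccont df z).

Lemma cC1_ccont f p : cC1 f p -> ccont f p.
Proof. intros [df H]. apply near_self in H. eapply cderiv_ccont. apply H. Qed.

Lemma cC1_near f g p : near p (fun z => f z = g z) -> cC1 f p -> cC1 g p.
Proof.
  intros N [df H]. exists df. apply near_near in N.
  eapply near_impl; [|apply (near_and _ _ _ N H)].
  intros z [Hz [H1 H2]]. split; auto. eapply cderiv_near; eauto.
Qed.

Lemma cC1_const c p : cC1 (fun _ => c) p.
Proof.
  exists (fun _ => RtoC 0). exists 1. split; [lra|]. intros. split; [apply cderiv_const|apply ccont_const].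
Qed.

Lemma cC1_id p : cC1 (fun z => z) p.
Proof.
  exists (fun _ => RtoC 1). exists 1. split; [lra|]. intros. split; [apply cderiv_id|apply ccont_const].
Qed.

Lemma cC1_plus f g p : cC1 f p -> cC1 g p -> cC1 (fun z => f z + g z)%C p.
Proof.
  intros [df H1] [dg H2]. exists (fun z => df z + dg z)%C.
  eapply near_impl; [|apply (near_and _ _ _ H1 H2)]. intros z [[A B] [A' B']]. split.
  - now apply cderiv_plus.
  - now apply ccont_plus.
Qed.

Lemma cC1_mult f g p : cC1 f p -> cC1 g p -> cC1 (fun z => f z * g z)%C p.
Proof.
  intros [df H1] [dg H2]. exists (fun z => df z * g z + f z * dg z)%C.
  eapply near_impl; [|apply (near_and _ _ _ H1 H2)]. intros z [[A B] [A' B']]. split.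
  - now apply cderiv_mult.
  - apply ccont_plus; apply ccont_mult; auto; eapply cderiv_ccont; eauto.
Qed.

Lemma cC1_opp f p : cC1 f p -> cC1 (fun z => - f z)%C p.
Proof.
  intros H. apply (cC1_near (fun z => -(1) * f z)%C).
  - exists 1; split; [lra|]. intros; ring.
  - apply (cC1_mult (fun _ => -(1))%C f); auto. apply cC1_const.
Qed.

Lemma cC1_minus f g p : cC1 f p -> cC1 g p -> cC1 (fun z => f z - g z)%C p.
Proof. intros. apply cC1_plus; auto. now apply cC1_opp. Qed.

Lemma near_shift (P : C -> Prop) z w : near (z + w)%C P -> near z (fun y => P (y + w)%C).
Proof.
  intros [d [Hd H]]. exists d; split; auto. intros h Hh.
  replace (z + h + w)%C with (z + w + h)%C by ring. auto.
Qed.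

Lemma near'_shift (P : C -> Prop) z w : near' (z + w)%C P -> near' z (fun y => P (y + w)%C).
Proof.
  intros [d [Hd H]]. exists d; split; auto. intros h Hh H0.
  replace (z + h + w)%C with (z + w + h)%C by ring. auto.
Qed.

Lemma near_reflect (P : C -> Prop) z w : near (w - z)%C P -> near z (fun y => P (w - y)%C).
Proof.
  intros [d [Hd H]]. exists d; split; auto. intros h Hh.
  replace (w - (z + h))%C with (w - z + - h)%C by ring. apply H. now rewrite Cmod_opp.
Qed.

Lemma cC1_shift f z w : cC1 f (z + w)%C -> cC1 (fun z => f (z + w)%C) z.
Proof.
  intros [df H]. exists (fun z => df (z + w)%C). apply near_shift in H.
  eapply near_impl; [|apply H]. intros y [A B]. split; [now apply cderiv_shift|now apply ccont_shift].
Qed.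

Lemma cC1_reflect f z w : cC1 f (w - z)%C -> cC1 (fun z => f (w - z)%C) z.
Proof.
  intros [df H]. exists (fun z => -(1) * df (w - z))%C. apply near_reflect in H.
  eapply near_impl; [|apply H]. intros y [A B]. split.
  - apply (cderiv_eq _ _ (- df (w - y))%C); [ring|]. now apply cderiv_reflect.
  - apply (ccont_mult (fun _ => -(1))%C (fun z => df (w - z)%C)); [apply ccont_const|].
    now apply ccont_reflect.
Qed.

(** Compactness of [[a, b]] as an induction on intervals: the supremum of the points that can be
    reached from [a] is itself reached, and can be passed unless it is [b]. It serves to bound
    functions on compact sets. *)
Lemma interval_induction (Q : R -> R -> Prop) (a b : R) :
  a <= b ->
  (forall t, a <= t <= b -> exists d, 0 < d /\ forall u v, t - d < u -> u <= v -> v < t + d -> Q u v) ->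
  (forall u v w, u <= v -> v <= w -> Q u v -> Q v w -> Q u w) ->
  Q a b.
Proof.
  intros Hab Hl Ht.
  set (E := fun t => a <= t <= b /\ Q a t).
  assert (Ea : E a).
  { split; [lra|]. destruct (Hl a) as [d [Hd H]]; [lra|]. apply H; lra. }
  destruct (completeness E) as [m [Hm1 Hm2]].
  - exists b. intros t [Ht' _]. lra.
  - now exists a.
  - assert (Ham : a <= m) by now apply Hm1.
    assert (Hmb : m <= b) by (apply Hm2; intros t [H _]; lra).
    destruct (Hl m) as [d [Hd H]]; [lra|].
    assert (exists t, E t /\ m - d < t <= m) as [t [[Et1 Et2] Ht3]].
    { destruct (classic (exists t, E t /\ m - d < t <= m)) as [K|K]; auto. exfalso.
      assert (m <= m - d); [|lra]. apply Hm2. intros t Et.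
      destruct (Rle_dec t (m - d)); auto. exfalso. apply K. exists t. split; auto.
      split; [lra|]. now apply Hm1. }
    set (v := Rmin b (m + d / 2)).
    assert (Hv : m <= v) by (apply Rmin_glb; lra).
    assert (Ev : E v).
    { split; [split; [lra|apply Rmin_l]|].
      apply (Ht a t v); auto; try lra. apply H; try lra.
      assert (v <= m + d / 2) by apply Rmin_r. lra. }
    assert (v <= m) by now apply Hm1.
    assert (v = b).
    { unfold v in *. destruct (Rle_dec b (m + d / 2)); [now rewrite Rmin_left|].
      rewrite Rmin_right in *; lra. }
    subst v. rewrite <- H1. apply Ev.
Qed.

Lemma bounded_on_cell (f : C -> C) (g1 g2 : C) :
  (forall z, ccont f z) ->
  exists M, forall x y : R, 0 <= x <= 1 -> 0 <= y <= 1 -> Cmod (f (x * g1 + y * g2)%C) <= M.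
Proof.
  intros Hc.
  assert (G1 := Cmod_ge_0 g1). assert (G2 := Cmod_ge_0 g2).
  assert (Hloc : forall x y : R, exists d K, 0 < d /\ forall x' y' : R,
     Rabs (x' - x) < d -> Rabs (y' - y) < d -> Cmod (f (x' * g1 + y' * g2)%C) <= K).
  { intros x y. destruct (Hc (x * g1 + y * g2)%C 1 Rlt_0_1) as [d [Hd H]].
    exists (d / (1 + Cmod g1 + Cmod g2)), (1 + Cmod (f (x * g1 + y * g2)%C)).
    split; [apply Rdiv_lt_0_compat; lra|]. intros x' y' Hx Hy.
    assert (E : Cmod ((x' - x)%R * g1 + (y' - y)%R * g2)%C < d).
    { eapply Rle_lt_trans; [apply Cmod_triangle|]. rewrite !Cmod_mult, !Cmod_R.
      set (q := d / (1 + Cmod g1 + Cmod g2)) in *.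
      replace d with (q * (1 + Cmod g1 + Cmod g2)) by (unfold q; field; lra).
      assert (0 < q) by (apply Rdiv_lt_0_compat; lra). nra. }
    specialize (H _ E).
    replace (x * g1 + y * g2 + ((x' - x)%R * g1 + (y' - y)%R * g2))%C
      with (x' * g1 + y' * g2)%C in H by (rewrite !RtoC_minus; ring).
    set (w := f (x' * g1 + y' * g2)%C) in *. set (w0 := f (x * g1 + y * g2)%C) in *.
    replace w with ((w - w0) + w0)%C by ring.
    eapply Rle_trans; [apply Cmod_triangle|]. lra. }
  (* Tube argument: the width [d] in [x] is made uniform over a whole row of [y] before the rows are
     joined. *)
  assert (Hrow : forall x, exists d K, 0 < d /\ forall x' y' : R,
     Rabs (x' - x) < d -> 0 <= y' <= 1 -> Cmod (f (x' * g1 + y' * g2)%C) <= K).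
  { intros x. apply (interval_induction (fun u v => exists d K, 0 < d /\ forall x' y' : R,
     Rabs (x' - x) < d -> u <= y' <= v -> Cmod (f (x' * g1 + y' * g2)%C) <= K)); [lra| |].
    - intros y _. destruct (Hloc x y) as [d [K [Hd H]]]. exists d; split; auto.
      intros u v Hu Huv Hv. exists d, K. split; auto. intros x' y' Hx Hy.
      apply H; auto. apply Rabs_def1; lra.
    - intros u v w _ _ [d [K [Hd H]]] [d' [K' [Hd' H']]].
      exists (Rmin d d'), (Rmax K K'). split; [now apply Rmin_pos|]. intros x' y' Hx Hy.
      destruct (Rle_dec y' v).
      + eapply Rle_trans; [apply H|apply Rmax_l]; try lra.
        eapply Rlt_le_trans; [apply Hx|apply Rmin_l].
      + eapply Rle_trans; [apply H'|apply Rmax_r]; try lra.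
        eapply Rlt_le_trans; [apply Hx|apply Rmin_r]. }
  apply (interval_induction (fun u v => exists M, forall x y : R,
    u <= x <= v -> 0 <= y <= 1 -> Cmod (f (x * g1 + y * g2)%C) <= M)); [lra| |].
  - intros x _. destruct (Hrow x) as [d [K [Hd H]]]. exists d; split; auto.
    intros u v Hu Huv Hv. exists K. intros x' y' Hx Hy. apply H; auto. apply Rabs_def1; lra.
  - intros u v w _ _ [K H] [K' H']. exists (Rmax K K'). intros x y Hx Hy.
    destruct (Rle_dec x v).
    + eapply Rle_trans; [apply H|apply Rmax_l]; lra.
    + eapply Rle_trans; [apply H'|apply Rmax_r]; lra.
Qed.

Definition nondegenerate (L : lattice) : Prop :=
  Re (gen1 L) * Im (gen2 L) - Im (gen1 L) * Re (gen2 L) <> 0.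

Lemma lattice_coordinates L z : nondegenerate L ->
  exists x y : R, z = (x * gen1 L + y * gen2 L)%C.
Proof.
  unfold nondegenerate. destruct L as [[a b] [c d]], z as [p q]. unfold Re, Im; simpl. intros H.
  exists ((p * d - q * c) / (a * d - b * c)), ((a * q - b * p) / (a * d - b * c)).
  unfold RtoC, Cplus, Cmult; simpl. f_equal; field; auto.
Qed.

Lemma floor_decomposition (x : R) : exists (m : Z) (t : R), x = IZR m + t /\ 0 <= t <= 1.
Proof.
  exists (up x - 1)%Z, (x - IZR (up x - 1)). rewrite minus_IZR.
  generalize (archimed x). lra.
Qed.

Definition lattice_periodic (L : lattice) (f : C -> C) : Prop :=
  forall z m n, f (z + lattice_pt L m n)%C = f z.

Lemma periodic_bounded L f : nondegenerate L -> (forall z, ccont f z) -> lattice_periodic L f ->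
  exists M, forall z, Cmod (f z) <= M.
Proof.
  intros HL Hc Hp. destruct (bounded_on_cell f (gen1 L) (gen2 L) Hc) as [M HM].
  exists M. intros z. destruct (lattice_coordinates L z HL) as [x [y ->]].
  destruct (floor_decomposition x) as [m [t [-> Ht]]].
  destruct (floor_decomposition y) as [n [u [-> Hu]]].
  replace ((IZR m + t)%R * gen1 L + (IZR n + u)%R * gen2 L)%C
    with ((t * gen1 L + u * gen2 L) + lattice_pt L m n)%C
    by (unfold lattice_pt; rewrite !RtoC_plus; ring).
  rewrite Hp. now apply HM.
Qed.

(* The removable singularities are filled in by choice, so that no order of
   vanishing has to be computed. *)
Lemma elliptic_constant L (f : C -> C) :
  nondegenerate L ->
  (forall p m n, near' p (fun z => f (z + lattice_pt L m n)%C = f z)) ->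
  (forall p, exists F, cC1 F p /\ near' p (fun z => f z = F z)) ->
  exists c, forall p, near' p (fun z => f z = c).
Proof.
  intros HL Hp Hr.
  destruct (choice _ Hr) as [F HF].
  (* Each point takes the value of its own local extension. Comparison with [f] on punctured
     neighbourhoods shows that [h] coincides with [F p] near [p], so [h] is a single holomorphic
     function. *)
  set (h := fun p => F p p).
  assert (HhF : forall p, near p (fun z => h z = F p z)).
  { intros p. destruct (HF p) as [HC HN].
    assert (A : near' p (fun z => h z = F p z)).
    { destruct HC as [dF HC].
      assert (B := near'_and _ _ _ (near'_near _ _ HN) (near_near' _ _ HC)).
      eapply near'_impl; [|apply B]. intros z [Hz1 [Hz2 _]]. unfold h.
      destruct (HF z) as [HCz HNz].
      apply ccont_eq_near'; [now apply cC1_ccont|eapply cderiv_ccont; eauto|].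
      eapply near'_impl; [|apply (near'_and _ _ _ HNz (near_near' _ _ Hz1))].
      intros y [E1 E2]. congruence. }
    destruct A as [d [Hd A]]. exists d; split; auto. intros k Hk.
    destruct (Ceq_dec k 0) as [->|K]; [|now apply A].
    replace (p + 0)%C with p by ring. reflexivity. }
  assert (Hh1 : forall p, cC1 h p).
  { intros p. apply (cC1_near (F p)); [|apply HF].
    eapply near_impl; [|apply HhF]. auto. }
  assert (Hfh : forall p, near' p (fun z => f z = h z)).
  { intros p. eapply near'_impl;
      [|apply (near'_and _ _ _ (proj2 (HF p)) (near_near' _ _ (HhF p)))].
    intros z [A B]. congruence. }
  assert (Hhp : lattice_periodic L h).
  { intros z m n. apply (ccont_eq_near' (fun z => h (z + lattice_pt L m n)%C) h).
    - apply ccont_shift, cC1_ccont, Hh1.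
    - apply cC1_ccont, Hh1.
    - assert (A := near'_shift _ _ _ (Hfh (z + lattice_pt L m n)%C)).
      eapply near'_impl; [|apply (near'_and _ _ _ (Hp z m n) (near'_and _ _ _ A (Hfh z)))].
      intros y [E0 [E1 E2]]. cbv beta in *. congruence. }
  assert (Hder : forall z, exists l, cderiv h z l).
  { intros z. destruct (Hh1 z) as [dh Hd]. apply near_self in Hd. exists (dh z). apply Hd. }
  destruct (choice _ Hder) as [dh Hdh].
  assert (Hdc : forall z, ccont dh z).
  { intros z. destruct (Hh1 z) as [dg Hd]. apply (ccont_ext_near dg).
    - eapply near_impl; [|apply Hd]. intros y [A _]. eapply cderiv_unique; eauto.
    - apply near_self in Hd. apply Hd. }
  destruct (periodic_bounded L h HL) as [M HM]; auto.
  { intros; apply cC1_ccont, Hh1. }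
  assert (Z := liouville_deriv h dh M Hdh Hdc HM).
  (* With zero derivative everywhere, [h] is constant along segments. *)
  exists (h 0). intros p. eapply near'_impl; [|apply Hfh].
  intros z ->. symmetry. apply cderiv_zero_segment. intros t _.
  generalize (Hdh (0 + t * (z - 0))%C). now rewrite Z.
Qed.

(** * Sums over a lattice *)

Definition clim (u : nat -> C) (l : C) : Prop :=
  forall e, 0 < e -> exists N0, forall N, (N0 <= N)%nat -> Cmod (u N - l)%C < e.

Lemma clim_intro u (a b : R) :
  is_lim_seq (fun N => Re (u N)) a -> is_lim_seq (fun N => Im (u N)) b -> clim u (a, b).
Proof.
  intros Ha Hb e He. apply is_lim_seq_spec in Ha, Hb.
  assert (He2 : 0 < e / 2) by lra.
  destruct (Ha (mkposreal _ He2)) as [N1 H1]. destruct (Hb (mkposreal _ He2)) as [N2 H2].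
  exists (max N1 N2). intros N HN. simpl in *.
  eapply Rle_lt_trans; [apply Cmod_le_ReIm|].
  assert (A := H1 N ltac:(lia)). assert (B := H2 N ltac:(lia)).
  replace (Re (u N - (a, b))%C) with (Re (u N) - a) by reflexivity.
  replace (Im (u N - (a, b))%C) with (Im (u N) - b) by reflexivity. lra.
Qed.

Lemma clim_Re u l : clim u l -> is_lim_seq (fun N => Re (u N)) (Re l).
Proof.
  intros H. apply is_lim_seq_spec. intros e. destruct (H e (cond_pos e)) as [N0 H0].
  exists N0. intros N HN. eapply Rle_lt_trans; [|apply H0, HN].
  eapply Rle_trans; [|apply re_le_Cmod]. right; reflexivity.
Qed.

Lemma clim_Im u l : clim u l -> is_lim_seq (fun N => Im (u N)) (Im l).
Proof.
  intros H. apply is_lim_seq_spec. intros e. destruct (H e (cond_pos e)) as [N0 H0].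
  exists N0. intros N HN. eapply Rle_lt_trans; [|apply H0, HN].
  eapply Rle_trans; [|apply im_le_Cmod]. right; reflexivity.
Qed.

Lemma clim_CLim u l : clim u l -> CLim_seq u = l.
Proof.
  intros H. unfold CLim_seq.
  rewrite (is_lim_seq_unique _ _ (clim_Re _ _ H)), (is_lim_seq_unique _ _ (clim_Im _ _ H)).
  now destruct l.
Qed.

Lemma clim_ext u v l : (forall N, u N = v N) -> clim u l -> clim v l.
Proof. intros E H e He. destruct (H e He) as [N0 H0]. exists N0. intros N HN. rewrite <- E. auto. Qed.

Lemma clim_plus u v a b : clim u a -> clim v b -> clim (fun N => u N + v N)%C (a + b).
Proof.
  intros Hu Hv e He. destruct (Hu (e / 2)) as [N1 H1]; [lra|]. destruct (Hv (e / 2)) as [N2 H2]; [lra|].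
  exists (max N1 N2). intros N HN. assert (A := H1 N ltac:(lia)). assert (B := H2 N ltac:(lia)).
  replace (u N + v N - (a + b))%C with ((u N - a) + (v N - b))%C by ring.
  eapply Rle_lt_trans; [apply Cmod_triangle|]. lra.
Qed.

Lemma clim_scal c u a : clim u a -> clim (fun N => c * u N)%C (c * a).
Proof.
  intros Hu e He. assert (P := Cmod_ge_0 c).
  destruct (Hu (e / (1 + Cmod c))) as [N0 H0]; [apply Rdiv_lt_0_compat; lra|].
  exists N0. intros N HN. specialize (H0 N HN).
  replace (c * u N - c * a)%C with (c * (u N - a))%C by ring. rewrite Cmod_mult.
  assert (Q := Cmod_ge_0 (u N - a)%C).
  apply Rle_lt_trans with ((1 + Cmod c) * Cmod (u N - a)%C); [nra|].
  apply (Rmult_lt_compat_l (1 + Cmod c)) in H0; [|lra].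
  replace ((1 + Cmod c) * (e / (1 + Cmod c))) with e in H0 by (field; lra). auto.
Qed.

Lemma clim_bound u l K : clim u l -> (forall N, Cmod (u N) <= K) -> Cmod l <= K.
Proof.
  intros H HK. apply Rnot_lt_le. intros Hlt. destruct (H (Cmod l - K)) as [N0 H0]; [lra|].
  specialize (H0 N0 (Nat.le_refl _)). specialize (HK N0).
  generalize (Cmod_sub_ge (l - u N0)%C (u N0)). rewrite (Cmod_minus_sym l).
  replace (l - u N0 + u N0)%C with l by ring.
  assert (T := Cmod_triangle (l - u N0)%C (u N0)).
  replace (l - u N0 + u N0)%C with l in T by ring. rewrite (Cmod_minus_sym l) in T. lra.
Qed.

(** The sum over [- N <= m <= N], indexed exactly as in [lattice_sum], so that [wp] and [wzeta]
    unfold to such sums by conversion. *)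
Definition sZ {G : AbelianMonoid} (f : Z -> G) (N : nat) : G :=
  sum_n (fun i => f (Z.of_nat i - Z.of_nat N)%Z) (2 * N).

Lemma sZ_O {G : AbelianMonoid} (f : Z -> G) : sZ f 0 = f 0%Z.
Proof. unfold sZ. simpl. now rewrite sum_O. Qed.

(** Peeling off the two outermost terms turns identities between symmetric sums into inductions on
    [N]. *)
Lemma sZ_S {G : AbelianMonoid} (f : Z -> G) N :
  sZ f (S N) = plus (sZ f N) (plus (f (Z.of_nat (S N))) (f (- Z.of_nat (S N))%Z)).
Proof.
  unfold sZ. replace (2 * S N)%nat with (S (S (2 * N)))%nat by lia.
  rewrite sum_Sn. unfold sum_n at 1. rewrite sum_Sn_m by lia. rewrite <- sum_n_m_S.
  rewrite (sum_n_m_ext _ (fun i => f (Z.of_nat i - Z.of_nat N)%Z)).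
  2: intros; f_equal; lia.
  change (sum_n_m (fun i => f (Z.of_nat i - Z.of_nat N)%Z) 0 (2 * N))
    with (sum_n (fun i => f (Z.of_nat i - Z.of_nat N)%Z) (2 * N)).
  replace (Z.of_nat (S (S (2 * N))) - Z.of_nat (S N))%Z with (Z.of_nat (S N)) by lia.
  replace (Z.of_nat 0 - Z.of_nat (S N))%Z with (- Z.of_nat (S N))%Z by lia.
  rewrite (plus_comm (f (- _)%Z)), <- !plus_assoc. f_equal. apply plus_comm.
Qed.

(** The monoid structures hide the carrier of the goal from [ring]; the type is restored to [R] or
    [C] before it is called. *)
Ltac eqring :=
  lazymatch goal with
  | |- @eq _ ?x ?y => first [change (@eq R x y); ring | change (@eq C x y); ring]
  end.

Lemma sZ_C_S (f : Z -> C) N :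
  sZ f (S N) = (sZ f N + (f (Z.of_nat (S N)) + f (- Z.of_nat (S N))%Z))%C.
Proof. apply (sZ_S (G := C_AbelianMonoid)). Qed.

Lemma sZ_R_S (f : Z -> R) N :
  sZ f (S N) = sZ f N + (f (Z.of_nat (S N)) + f (- Z.of_nat (S N))%Z).
Proof. apply (sZ_S (G := R_AbelianMonoid)). Qed.

Lemma sZ_C_plus (f g : Z -> C) N : sZ (fun m => f m + g m)%C N = (sZ f N + sZ g N)%C.
Proof. induction N as [|N IH]; [now rewrite !sZ_O|]. rewrite !sZ_C_S, IH. eqring. Qed.

Lemma sZ_C_scal c (f : Z -> C) N : sZ (fun m => c * f m)%C N = (c * sZ f N)%C.
Proof. induction N as [|N IH]; [now rewrite !sZ_O|]. rewrite !sZ_C_S, IH. eqring. Qed.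

Lemma sZ_ext {G : AbelianMonoid} (f g : Z -> G) N :
  (forall m, (Z.abs m <= Z.of_nat N)%Z -> f m = g m) -> sZ f N = sZ g N.
Proof.
  intros H. unfold sZ. apply sum_n_ext_loc. intros i Hi. apply H. lia.
Qed.

Lemma sZ_C_opp (f : Z -> C) N : sZ (fun m => f (- m)%Z) N = sZ f N.
Proof.
  induction N as [|N IH]; [now rewrite !sZ_O|]. rewrite !sZ_C_S, IH.
  rewrite Z.opp_involutive. eqring.
Qed.

Lemma sZ_C_exchange (a : Z -> Z -> C) N K :
  sZ (fun m => sZ (fun n => a m n) K) N = sZ (fun n => sZ (fun m => a m n) N) K.
Proof.
  induction N as [|N IH].
  - rewrite sZ_O. apply sZ_ext. intros. now rewrite sZ_O.
  - rewrite sZ_C_S, IH, <- !sZ_C_plus. apply sZ_ext. intros. now rewrite sZ_C_S.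
Qed.

Lemma sZ_C_telescope (f : Z -> C) N :
  sZ (fun m => f (m + 1)%Z - f m)%C N = (f (Z.of_nat N + 1)%Z - f (- Z.of_nat N)%Z)%C.
Proof.
  induction N as [|N IH]; [now rewrite sZ_O|]. rewrite sZ_C_S, IH.
  replace (Z.of_nat N + 1)%Z with (Z.of_nat (S N)) by lia.
  replace (- Z.of_nat (S N) + 1)%Z with (- Z.of_nat N)%Z by lia. eqring.
Qed.

Lemma sZ_Cmod (f : Z -> C) N : Cmod (sZ f N) <= sZ (fun m => Cmod (f m)) N.
Proof.
  induction N as [|N IH]; [rewrite !sZ_O; lra|]. rewrite sZ_C_S, sZ_R_S.
  eapply Rle_trans; [apply Cmod_triangle|]. apply Rplus_le_compat; auto. apply Cmod_triangle.
Qed.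

Lemma sZ_R_le (f g : Z -> R) N : (forall m, f m <= g m) -> sZ f N <= sZ g N.
Proof.
  intros H. induction N as [|N IH]; [rewrite !sZ_O; auto|]. rewrite !sZ_R_S.
  apply Rplus_le_compat; auto. now apply Rplus_le_compat.
Qed.

Lemma sZ_R_plus (f g : Z -> R) N : sZ (fun m => f m + g m) N = sZ f N + sZ g N.
Proof. induction N as [|N IH]; [now rewrite !sZ_O|]. rewrite !sZ_R_S, IH. eqring. Qed.

Lemma sZ_R_scal c (f : Z -> R) N : sZ (fun m => c * f m) N = c * sZ f N.
Proof. induction N as [|N IH]; [now rewrite !sZ_O|]. rewrite !sZ_R_S, IH. eqring. Qed.

Lemma sZ_R_scal_r c (f : Z -> R) N : sZ (fun m => f m * c) N = sZ f N * c.
Proof. induction N as [|N IH]; [now rewrite !sZ_O|]. rewrite !sZ_R_S, IH. eqring. Qed.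

Lemma sZ_R_const (c : R) N : sZ (fun _ => c) N = (2 * INR N + 1) * c.
Proof. induction N as [|N IH]; [rewrite sZ_O; change (c = (2 * 0 + 1) * c); ring|].
  rewrite sZ_R_S, S_INR. replace (sZ _ N) with ((2 * INR N + 1) * c) by (symmetry; apply IH). eqring. Qed.

Lemma sZ_R_nonneg (f : Z -> R) N : (forall m, 0 <= f m) -> 0 <= sZ f N.
Proof.
  intros H. induction N as [|N IH]; [rewrite sZ_O; auto|]. rewrite sZ_R_S.
  generalize (H (Z.of_nat (S N))) (H (- Z.of_nat (S N))%Z). lra.
Qed.

Lemma sZ_R_incr (f : Z -> R) N : (forall m, 0 <= f m) -> sZ f N <= sZ f (S N).
Proof.
  intros H. rewrite sZ_R_S. generalize (H (Z.of_nat (S N))) (H (- Z.of_nat (S N))%Z). lra.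
Qed.

Lemma sZ_Re (f : Z -> C) N : Re (sZ f N) = sZ (fun m => Re (f m)) N.
Proof.
  induction N as [|N IH]; [now rewrite !sZ_O|]. rewrite sZ_C_S, sZ_R_S, <- IH. reflexivity.
Qed.

Lemma sZ_Im (f : Z -> C) N : Im (sZ f N) = sZ (fun m => Im (f m)) N.
Proof.
  induction N as [|N IH]; [now rewrite !sZ_O|]. rewrite sZ_C_S, sZ_R_S, <- IH. reflexivity.
Qed.

Definition sq {G : AbelianMonoid} (a : Z -> Z -> G) (N : nat) : G := sZ (fun m => sZ (a m) N) N.

Definition Lsum (a : Z -> Z -> C) : C := CLim_seq (sq a).

(** The summand 1 keeps it positive at the origin, so one majorant covers all indices. *)
Definition size (m n : Z) : R := 1 + Rabs (IZR m) + Rabs (IZR n).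

(** Order 3 is the decay of the regularized terms of both [wp] and [zeta], and it is summable over a
    lattice of rank two. *)
Definition dom (a : Z -> Z -> C) : Prop :=
  exists M, forall m n, Cmod (a m n) <= M / size m n ^ 3.

Lemma size_ge_1 m n : 1 <= size m n.
Proof. unfold size. generalize (Rabs_pos (IZR m)) (Rabs_pos (IZR n)). lra. Qed.

(** The power [(1 + |m|)^(-3/2)]: the product [rho m * rho n] majorizes [1 / size^3] and makes the
    double sum factor. *)
Definition rho (m : Z) : R := / ((1 + Rabs (IZR m)) * sqrt (1 + Rabs (IZR m))).

Lemma rho_pos m : 0 < rho m.
Proof.
  unfold rho. assert (P := Rabs_pos (IZR m)). apply Rinv_0_lt_compat, Rmult_lt_0_compat; [lra|].
  apply sqrt_lt_R0. lra.
Qed.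

Lemma size_rho m n : / size m n ^ 3 <= rho m * rho n.
Proof.
  unfold rho, size. set (x := 1 + Rabs (IZR m)). set (y := 1 + Rabs (IZR n)).
  assert (Hx : 1 <= x) by (unfold x; generalize (Rabs_pos (IZR m)); lra).
  assert (Hy : 1 <= y) by (unfold y; generalize (Rabs_pos (IZR n)); lra).
  replace (x + Rabs (IZR n)) with (x + y - 1) by (unfold y; ring).
  rewrite <- Rinv_mult. apply Rinv_le_contravar.
  - repeat apply Rmult_lt_0_compat; try apply sqrt_lt_R0; lra.
  - replace (x * sqrt x * (y * sqrt y)) with (x * y * sqrt (x * y)) by (rewrite sqrt_mult by lra; ring).
    set (s := x + y - 1).
    assert (Hs : sqrt (x * y) <= s).
    { rewrite <- (sqrt_Rsqr s) by (unfold s; lra). apply sqrt_le_1_alt. unfold Rsqr, s. nra. }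
    assert (x * y <= s * s) by (unfold s; nra).
    assert (0 <= sqrt (x * y)) by apply sqrt_pos.
    replace (s ^ 3) with (s * s * s) by ring. apply Rmult_le_compat; auto. nra.
Qed.

(** Comparison with a telescoping sum: with [k = N + 1], the two new terms add up to
    [2 (k + 1)^(-3/2)], which is at most [4 / sqrt k - 4 / sqrt (k + 1)]. The constant 5 gives
    equality at [N = 0]. *)
Lemma sum_rho N : sZ rho N <= 5 - 4 / sqrt (INR N + 1).
Proof.
  induction N as [|N IH].
  - rewrite sZ_O. unfold rho. rewrite Rabs_R0. simpl. rewrite Rplus_0_r, Rplus_0_l, sqrt_1. lra.
  - rewrite sZ_R_S. unfold rho at 2 3. rewrite opp_IZR, Rabs_Ropp, <- INR_IZR_INZ.
    rewrite (Rabs_pos_eq (INR (S N))) by apply pos_INR. rewrite S_INR.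
    set (k := INR N + 1) in *. assert (Hk : 1 <= k) by (unfold k; generalize (pos_INR N); lra).
    replace (1 + k) with (k + 1) by ring.
    set (p := sqrt k) in *. set (q := sqrt (k + 1)).
    assert (Hp : 0 < p) by (apply sqrt_lt_R0; lra).
    assert (Hq : 0 < q) by (apply sqrt_lt_R0; lra).
    assert (Ep : p * p = k) by (apply sqrt_sqrt; lra).
    assert (Eq : q * q = k + 1) by (apply sqrt_sqrt; lra).
    assert (Hpq : p <= q) by (apply sqrt_le_1_alt; lra).
    cut (/ ((k + 1) * q) + / ((k + 1) * q) <= 4 / p - 4 / q); [lra|].
    rewrite <- Eq. replace (4 / p - 4 / q) with (4 / (p * q * (p + q))).
    2:{ field_simplify_eq; [|repeat split; lra]. replace (q ^ 2) with (p ^ 2 + 1) by (simpl; lra). ring. }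
    replace (/ (q * q * q) + / (q * q * q)) with (4 / (q * q * (q + q))) by (field; lra).
    unfold Rdiv. apply Rmult_le_compat_l; [lra|]. apply Rinv_le_contravar.
    + repeat apply Rmult_lt_0_compat; lra.
    + apply Rmult_le_compat; try lra; [nra|]. apply Rmult_le_compat_r; lra.
Qed.

(** The double sum is at most the square of the one-dimensional sum, and 25 is the square of the
    bound 5. *)
Lemma sq_size_bound N : sq (fun m n => / size m n ^ 3) N <= 25.
Proof.
  unfold sq. apply Rle_trans with (sZ (fun m => rho m * sZ rho N) N).
  - apply sZ_R_le. intros m. rewrite <- sZ_R_scal. apply sZ_R_le. intros n. apply size_rho.
  - rewrite sZ_R_scal_r.
    assert (H := sum_rho N). assert (0 <= sZ rho N) by (apply sZ_R_nonneg; intros; left; apply rho_pos).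
    assert (0 < 4 / sqrt (INR N + 1)).
    { apply Rdiv_lt_0_compat; [lra|]. apply sqrt_lt_R0. generalize (pos_INR N); lra. }
    nra.
Qed.

Lemma sq_R_incr (a : Z -> Z -> R) N : (forall m n, 0 <= a m n) -> sq a N <= sq a (S N).
Proof.
  intros H. unfold sq. eapply Rle_trans; [|apply sZ_R_incr].
  - apply sZ_R_le. intros. apply sZ_R_incr. auto.
  - intros. apply sZ_R_nonneg. auto.
Qed.

Lemma sq_R_scal c (a : Z -> Z -> R) N : sq (fun m n => c * a m n) N = c * sq a N.
Proof.
  unfold sq. rewrite <- sZ_R_scal. apply (sZ_ext (G := R_AbelianMonoid)). intros. apply sZ_R_scal.
Qed.

Lemma sq_R_plus (a b : Z -> Z -> R) N : sq (fun m n => a m n + b m n) N = sq a N + sq b N.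
Proof.
  unfold sq. rewrite <- sZ_R_plus. apply (sZ_ext (G := R_AbelianMonoid)). intros. apply sZ_R_plus.
Qed.

Lemma sq_C_scal c (a : Z -> Z -> C) N : sq (fun m n => c * a m n)%C N = (c * sq a N)%C.
Proof.
  unfold sq. rewrite <- sZ_C_scal. apply (sZ_ext (G := C_AbelianMonoid)). intros. apply sZ_C_scal.
Qed.

Lemma sq_C_plus (a b : Z -> Z -> C) N : sq (fun m n => a m n + b m n)%C N = (sq a N + sq b N)%C.
Proof.
  unfold sq. rewrite <- sZ_C_plus. apply (sZ_ext (G := C_AbelianMonoid)). intros. apply sZ_C_plus.
Qed.

Lemma sq_Re (a : Z -> Z -> C) N : Re (sq a N) = sq (fun m n => Re (a m n)) N.
Proof. unfold sq. rewrite sZ_Re. apply (sZ_ext (G := R_AbelianMonoid)). intros. apply sZ_Re. Qed.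

Lemma sq_Im (a : Z -> Z -> C) N : Im (sq a N) = sq (fun m n => Im (a m n)) N.
Proof. unfold sq. rewrite sZ_Im. apply (sZ_ext (G := R_AbelianMonoid)). intros. apply sZ_Im. Qed.

Lemma sq_Cmod (a : Z -> Z -> C) N M :
  0 <= M -> (forall m n, Cmod (a m n) <= M / size m n ^ 3) -> Cmod (sq a N) <= 25 * M.
Proof.
  intros HM H. unfold sq. eapply Rle_trans; [apply sZ_Cmod|].
  apply Rle_trans with (M * sq (fun m n => / size m n ^ 3) N).
  - rewrite <- sq_R_scal. apply sZ_R_le. intros m. eapply Rle_trans; [apply sZ_Cmod|].
    apply sZ_R_le. apply H.
  - generalize (sq_size_bound N). nra.
Qed.

Lemma sq_R_converges (b : Z -> Z -> R) M :
  (forall m n, Rabs (b m n) <= M / size m n ^ 3) -> exists l : R, is_lim_seq (sq b) l.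
Proof.
  intros H.
  assert (HM : 0 <= M).
  { specialize (H 0%Z 0%Z). unfold size in H. rewrite Rabs_R0 in H.
    replace (M / (1 + 0 + 0) ^ 3) with M in H by (simpl; field).
    eapply Rle_trans; [apply Rabs_pos|apply H]. }
  (* Both [w] and [b + w] have nonnegative terms, so their partial sums increase and are bounded;
     [b] is the difference of the two. *)
  set (w := fun m n => M * / size m n ^ 3).
  assert (Hw : forall m n, 0 <= w m n).
  { intros. unfold w. apply Rmult_le_pos; auto. left. apply Rinv_0_lt_compat, pow_lt.
    generalize (size_ge_1 m n); lra. }
  assert (Hwb : forall N, sq w N <= M * 25).
  { intros N. unfold w. rewrite sq_R_scal. apply Rmult_le_compat_l; auto. apply sq_size_bound. }
  assert (Hbw : forall m n, - w m n <= b m n <= w m n).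
  { intros m n. generalize (H m n). intros K. apply Rabs_le_between in K. apply K. }
  assert (L1 : ex_finite_lim_seq (sq w)).
  { apply (ex_finite_lim_seq_incr _ (M * 25)); auto. intros. now apply sq_R_incr. }
  assert (L2 : ex_finite_lim_seq (sq (fun m n => b m n + w m n))).
  { apply (ex_finite_lim_seq_incr _ (2 * (M * 25))).
    - intros N. apply sq_R_incr. intros m n. generalize (Hbw m n); lra.
    - intros N. apply Rle_trans with (sq (fun m n => 2 * w m n) N).
      + apply sZ_R_le. intros. apply sZ_R_le. intros n. generalize (Hbw m n); lra.
      + rewrite sq_R_scal. generalize (Hwb N); lra. }
  destruct L1 as [l1 L1], L2 as [l2 L2]. exists (l2 - l1).
  apply (is_lim_seq_ext (fun N => sq (fun m n => b m n + w m n) N - sq w N)).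
  - intros N. rewrite sq_R_plus. ring.
  - apply is_lim_seq_minus'; auto.
Qed.

Lemma dom_clim a : dom a -> clim (sq a) (Lsum a).
Proof.
  intros [M H].
  destruct (sq_R_converges (fun m n => Re (a m n)) M) as [x Hx].
  { intros. eapply Rle_trans; [apply re_le_Cmod|apply H]. }
  destruct (sq_R_converges (fun m n => Im (a m n)) M) as [y Hy].
  { intros. eapply Rle_trans; [apply im_le_Cmod|apply H]. }
  assert (K : clim (sq a) (x, y)).
  { apply clim_intro.
    - eapply is_lim_seq_ext; [|apply Hx]. intros; symmetry; apply sq_Re.
    - eapply is_lim_seq_ext; [|apply Hy]. intros; symmetry; apply sq_Im. }
  unfold Lsum. now rewrite (clim_CLim _ _ K).
Qed.

Lemma Lsum_ext a b : (forall m n, a m n = b m n) -> Lsum a = Lsum b.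
Proof.
  intros H. f_equal. apply functional_extensionality. intros m. apply functional_extensionality. auto.
Qed.

Lemma dom_ext a b : (forall m n, a m n = b m n) -> dom a -> dom b.
Proof. intros E [M H]. exists M. intros. rewrite <- E. auto. Qed.

Lemma dom_plus a b : dom a -> dom b -> dom (fun m n => a m n + b m n)%C.
Proof.
  intros [M H] [M' H']. exists (M + M'). intros m n. eapply Rle_trans; [apply Cmod_triangle|].
  rewrite Rdiv_plus_distr. apply Rplus_le_compat; auto.
Qed.

Lemma dom_scal c a : dom a -> dom (fun m n => c * a m n)%C.
Proof.
  intros [M H]. exists (Cmod c * M). intros m n. rewrite Cmod_mult. unfold Rdiv. rewrite Rmult_assoc.
  apply Rmult_le_compat_l; [apply Cmod_ge_0|]. apply H.
Qed.

Lemma Lsum_plus a b : dom a -> dom b -> Lsum (fun m n => a m n + b m n)%C = (Lsum a + Lsum b)%C.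
Proof.
  intros Ha Hb. apply clim_CLim. eapply clim_ext; [|apply clim_plus; apply dom_clim; eauto].
  intros. symmetry. apply sq_C_plus.
Qed.

Lemma Lsum_scal c a : dom a -> Lsum (fun m n => c * a m n)%C = (c * Lsum a)%C.
Proof.
  intros Ha. apply clim_CLim. eapply clim_ext; [|apply clim_scal; apply dom_clim; eauto].
  intros. symmetry. apply sq_C_scal.
Qed.

Lemma Lsum_bound a M : 0 <= M -> (forall m n, Cmod (a m n) <= M / size m n ^ 3) -> Cmod (Lsum a) <= 25 * M.
Proof.
  intros HM H. apply (clim_bound (sq a)); [apply dom_clim; now exists M|].
  intros. now apply sq_Cmod.
Qed.

(** The squares of summation are invariant under negation, so the partial sums themselves agree and
    no convergence is assumed; likewise for the exchange of the indices below. *)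
Lemma Lsum_opp a : Lsum (fun m n => a (- m)%Z (- n)%Z) = Lsum a.
Proof.
  unfold Lsum. f_equal. apply functional_extensionality. intros N. unfold sq.
  rewrite (sZ_C_opp (fun m => sZ (fun n => a m (- n)%Z) N)).
  apply sZ_ext. intros. apply sZ_C_opp.
Qed.

Lemma Lsum_swap a : Lsum (fun m n => a n m) = Lsum a.
Proof.
  unfold Lsum. f_equal. apply functional_extensionality. intros N. unfold sq. apply sZ_C_exchange.
Qed.

Lemma Lsum_conj a : dom a -> Lsum (fun m n => Cconj (a m n)) = Cconj (Lsum a).
Proof.
  intros H. apply clim_CLim. assert (K := dom_clim _ H).
  apply clim_intro.
  - eapply is_lim_seq_ext; [|apply (clim_Re _ _ K)]. intros. now rewrite !sq_Re.
  - eapply is_lim_seq_ext; [|exact (proj1 (is_lim_seq_opp _ _) (clim_Im _ _ K))].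
    intros. rewrite !sq_Im. simpl.
    replace (sq (fun m n => - snd (a m n)) n) with (sq (fun m n => -1 * Im (a m n)) n).
    + rewrite sq_R_scal. ring.
    + f_equal. apply functional_extensionality; intro. apply functional_extensionality; intro.
      unfold Im. ring.
Qed.

Lemma sq_single (c : C) N :
  sq (fun m n => if andb (Z.eqb m 0) (Z.eqb n 0) then c else RtoC 0) N = c.
Proof.
  assert (Z0 : forall f : Z -> C, (forall m, m <> 0%Z -> f m = RtoC 0) -> sZ f N = f 0%Z).
  { intros f Hf. induction N as [|N IH]; [apply sZ_O|]. rewrite sZ_C_S, IH, (Hf (Z.of_nat (S N))), (Hf (- Z.of_nat (S N))%Z) by lia. eqring. }
  unfold sq. rewrite Z0.
  - rewrite Z0; auto. intros m Hm. apply Z.eqb_neq in Hm. now rewrite Hm.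
  - intros m Hm. apply Z.eqb_neq in Hm. rewrite Hm. simpl. rewrite Z0; auto.
Qed.

Definition origin (m n : Z) : bool := andb (Z.eqb m 0) (Z.eqb n 0).

Lemma size_origin m n : origin m n = true -> size m n = 1.
Proof.
  unfold origin. rewrite Bool.andb_true_iff, !Z.eqb_eq. intros [-> ->].
  unfold size. rewrite Rabs_R0. ring.
Qed.

Lemma dom_single c : dom (fun m n => if origin m n then c else RtoC 0).
Proof.
  exists (Cmod c). intros m n. destruct (origin m n) eqn:E.
  - rewrite (size_origin _ _ E). simpl. right. field.
  - rewrite Cmod_0. apply Rmult_le_pos; [apply Cmod_ge_0|]. left. apply Rinv_0_lt_compat, pow_lt.
    generalize (size_ge_1 m n); lra.
Qed.

(** Isolates the term at the origin, which carries the pole at 0 in the applications. *)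
Lemma Lsum_split a c : dom (fun m n => if origin m n then RtoC 0 else a m n) ->
  Lsum (fun m n => if origin m n then c else a m n) =
  (c + Lsum (fun m n => if origin m n then RtoC 0 else a m n))%C.
Proof.
  intros H. assert (E : Lsum (fun m n => if origin m n then c else RtoC 0) = c).
  { apply clim_CLim. intros e He. exists 0%nat. intros. unfold origin. rewrite sq_single.
    replace (c - c)%C with (RtoC 0) by ring. now rewrite Cmod_0. }
  transitivity (Lsum (fun m n => if origin m n then c else RtoC 0) +
    Lsum (fun m n => if origin m n then RtoC 0 else a m n))%C; [|now rewrite E].
  rewrite <- Lsum_plus; [|apply dom_single|auto].
  apply Lsum_ext. intros. destruct (origin m n); ring.
Qed.

(* Only the squares |m|, |n| <= N are summed, so a shift changes the partial
   sums by a boundary term, of size N / N^2. *)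
Lemma Lsum_shift_1 (f : Z -> Z -> C) K :
  (forall m n, Cmod (f m n) <= K / size m n ^ 2) ->
  clim (sq (fun m n => f (m + 1)%Z n - f m n)%C) 0.
Proof.
  intros H e He.
  assert (HK : 0 <= K).
  { specialize (H 0%Z 0%Z). rewrite (size_origin 0 0 eq_refl) in H.
    replace (K / 1 ^ 2) with K in H by (simpl; field). eapply Rle_trans; [apply Cmod_ge_0|apply H]. }
  (* Two boundary lines of [2 N + 1] terms, each term at most [K / (1 + N)^2], contribute at most
     [4 K / (1 + N)]. *)
  destruct (nfloor_ex (4 * K / e)) as [N0 HN0].
  { apply Rmult_le_pos; [lra|]. left. now apply Rinv_0_lt_compat. }
  exists (S N0). intros N HN.
  assert (HN1 : 4 * K / e < INR N) by (apply le_INR in HN; rewrite S_INR in HN; lra).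
  assert (PN : 0 <= INR N) by apply pos_INR.
  unfold sq. rewrite sZ_C_exchange.
  rewrite (sZ_ext _ (fun n => f (Z.of_nat N + 1)%Z n - f (- Z.of_nat N)%Z n)%C).
  2: intros n _; apply (sZ_C_telescope (fun m => f m n)).
  assert (E0 : forall x : C, (x - RtoC 0)%C = x) by (intros; ring). rewrite E0.
  eapply Rle_lt_trans; [apply sZ_Cmod|].
  apply Rle_lt_trans with (sZ (fun _ => 2 * K / (1 + INR N) ^ 2) N).
  - apply sZ_R_le. intros n. eapply Rle_trans; [apply Cmod_triangle|]. rewrite Cmod_opp.
    assert (B : forall m, INR N <= Rabs (IZR m) -> Cmod (f m n) <= K / (1 + INR N) ^ 2).
    { intros m Hm. eapply Rle_trans; [apply H|]. unfold Rdiv. apply Rmult_le_compat_l; auto.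
      apply Rinv_le_contravar; [apply pow_lt; lra|]. apply pow_incr. split; [lra|].
      unfold size. generalize (Rabs_pos (IZR n)). lra. }
    replace (2 * K / (1 + INR N) ^ 2) with (K / (1 + INR N) ^ 2 + K / (1 + INR N) ^ 2) by (field; lra).
    apply Rplus_le_compat; apply B.
    + rewrite plus_IZR, <- INR_IZR_INZ, Rabs_pos_eq; lra.
    + rewrite opp_IZR, Rabs_Ropp, <- INR_IZR_INZ, Rabs_pos_eq; lra.
  - rewrite sZ_R_const.
    apply Rle_lt_trans with (4 * K / (1 + INR N)).
    + replace (4 * K / (1 + INR N)) with (2 * (1 + INR N) * (2 * K / (1 + INR N) ^ 2)) by (field; lra).
      apply Rmult_le_compat_r; [|lra]. apply Rmult_le_pos; [lra|]. left.
      apply Rinv_0_lt_compat, pow_lt. lra.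
    + apply (Rmult_lt_reg_r (1 + INR N)); [lra|].
      replace (4 * K / (1 + INR N) * (1 + INR N)) with (4 * K) by (field; lra).
      apply (Rmult_lt_compat_r e) in HN1; auto.
      replace (4 * K / e * e) with (4 * K) in HN1 by (field; lra). nra.
Qed.

Lemma size_sym m n : size m n = size n m.
Proof. unfold size; ring. Qed.

Lemma Lsum_shift_2 (f : Z -> Z -> C) K :
  (forall m n, Cmod (f m n) <= K / size m n ^ 2) ->
  clim (sq (fun m n => f m (n + 1)%Z - f m n)%C) 0.
Proof.
  intros H. eapply clim_ext; [|apply (Lsum_shift_1 (fun m n => f n m) K)].
  - intros N. unfold sq. rewrite sZ_C_exchange. reflexivity.
  - intros. rewrite size_sym. auto.
Qed.

(** Differentiation under the sum: a remainder dominated termwise by [M |h|^2 / size^3] sums to at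
    most [25 M |h|^2]. *)
Lemma Lsum_cderiv (T : Z -> Z -> C -> C) (T' : Z -> Z -> C) z d M :
  0 < d -> 0 <= M -> dom (fun m n => T m n z) -> dom T' ->
  (forall m n h, Cmod h < d ->
     Cmod (T m n (z + h)%C - T m n z - h * T' m n)%C <= M * (Cmod h * Cmod h) / size m n ^ 3) ->
  cderiv (fun z => Lsum (fun m n => T m n z)) z (Lsum T').
Proof.
  intros Hd HM H0 H1 H. apply (cderiv_quad _ _ _ (25 * M) d Hd). intros h Hh.
  set (Rm := fun m n => (T m n (z + h)%C - T m n z - h * T' m n)%C).
  assert (HR : dom Rm) by (exists (M * (Cmod h * Cmod h)); intros; now apply H).
  assert (E : Lsum (fun m n => T m n (z + h)%C) = (Lsum Rm + (Lsum (fun m n => T m n z) + h * Lsum T'))%C).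
  { rewrite <- Lsum_scal, <- !Lsum_plus; auto.
    - apply Lsum_ext. intros. unfold Rm. ring.
    - apply dom_plus; auto. now apply dom_scal.
    - now apply dom_scal. }
  rewrite E.
  replace (Lsum Rm + (Lsum (fun m n => T m n z) + h * Lsum T') - Lsum (fun m n => T m n z) - h * Lsum T')%C
    with (Lsum Rm) by ring.
  rewrite Rmult_assoc. apply Lsum_bound; [|now intros; apply H].
  apply Rmult_le_pos; auto. generalize (Cmod_ge_0 h); nra.
Qed.

(** * Weierstrass functions *)

(** Cramer's rule: [m D] and [n D], with [D] the determinant of the generators, are bounded by
    multiples of the modulus of the lattice point. *)
Lemma lattice_pt_lower L : nondegenerate L ->
  exists c, 0 < c /\ forall m n, c * (Rabs (IZR m) + Rabs (IZR n)) <= Cmod (lattice_pt L m n).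
Proof.
  intros HL. set (D := Re (gen1 L) * Im (gen2 L) - Im (gen1 L) * Re (gen2 L)).
  assert (HD : 0 < Rabs D) by (apply Rabs_pos_lt, HL).
  set (K := 2 * (1 + Cmod (gen1 L) + Cmod (gen2 L))).
  assert (G1 := Cmod_ge_0 (gen1 L)). assert (G2 := Cmod_ge_0 (gen2 L)).
  assert (HK : 0 < K) by (unfold K; lra).
  exists (Rabs D / K). split; [now apply Rdiv_lt_0_compat|]. intros m n.
  set (w := lattice_pt L m n).
  assert (E1 : IZR m * D = Re w * Im (gen2 L) - Im w * Re (gen2 L)).
  { unfold w, D, lattice_pt, Re, Im; simpl. ring. }
  assert (E2 : IZR n * D = Im w * Re (gen1 L) - Re w * Im (gen1 L)).
  { unfold w, D, lattice_pt, Re, Im; simpl. ring. }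
  assert (W1 := re_le_Cmod w). assert (W2 := im_le_Cmod w).
  assert (B : forall a b, Rabs (Re w * b - Im w * a) <= Cmod w * (Rabs b + Rabs a)).
  { intros a b. eapply Rle_trans; [apply Rabs_triang|]. rewrite Rabs_Ropp, !Rabs_mult.
    generalize (Rabs_pos a) (Rabs_pos b). nra. }
  assert (F1 : Rabs (IZR m) * Rabs D <= Cmod w * (2 * Cmod (gen2 L))).
  { rewrite <- Rabs_mult, E1. eapply Rle_trans; [apply B|]. apply Rmult_le_compat_l; [apply Cmod_ge_0|].
    generalize (re_le_Cmod (gen2 L)) (im_le_Cmod (gen2 L)); lra. }
  assert (F2 : Rabs (IZR n) * Rabs D <= Cmod w * (2 * Cmod (gen1 L))).
  { rewrite <- Rabs_mult, E2, Rabs_minus_sym. eapply Rle_trans; [apply B|].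
    apply Rmult_le_compat_l; [apply Cmod_ge_0|].
    generalize (re_le_Cmod (gen1 L)) (im_le_Cmod (gen1 L)); lra. }
  apply (Rmult_le_reg_r K); auto.
  replace (Rabs D / K * (Rabs (IZR m) + Rabs (IZR n)) * K)
    with (Rabs (IZR m) * Rabs D + Rabs (IZR n) * Rabs D) by (field; lra).
  unfold K. generalize (Cmod_ge_0 w). nra.
Qed.

Lemma lattice_pt_upper L m n : Cmod (lattice_pt L m n) <= (Cmod (gen1 L) + Cmod (gen2 L)) * size m n.
Proof.
  unfold lattice_pt, size. eapply Rle_trans; [apply Cmod_triangle|]. rewrite !Cmod_mult, !Cmod_R.
  assert (A := Cmod_ge_0 (gen1 L)). assert (B := Cmod_ge_0 (gen2 L)).
  assert (P := Rabs_pos (IZR m)). assert (Q := Rabs_pos (IZR n)).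
  assert (0 <= Cmod (gen1 L) * Rabs (IZR n)) by now apply Rmult_le_pos.
  assert (0 <= Cmod (gen2 L) * Rabs (IZR m)) by now apply Rmult_le_pos.
  lra.
Qed.

Lemma finite_range_min (Q : Z -> R -> Prop) (K : nat) :
  (forall m d d', 0 < d' -> d' <= d -> Q m d -> Q m d') ->
  (forall m, exists d, 0 < d /\ Q m d) ->
  exists d, 0 < d /\ forall m, (Z.abs m <= Z.of_nat K)%Z -> Q m d.
Proof.
  intros Hm He. induction K as [|K [d [Hd IH]]].
  - destruct (He 0%Z) as [d [Hd H]]. exists d. split; auto. intros m Hm0.
    replace m with 0%Z by lia. auto.
  - destruct (He (Z.of_nat (S K))) as [d1 [Hd1 H1]].
    destruct (He (- Z.of_nat (S K))%Z) as [d2 [Hd2 H2]].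
    assert (P : 0 < Rmin d (Rmin d1 d2)) by (repeat apply Rmin_pos; auto).
    assert (A1 := Rmin_l d (Rmin d1 d2)). assert (A2 := Rmin_r d (Rmin d1 d2)).
    assert (A3 := Rmin_l d1 d2). assert (A4 := Rmin_r d1 d2).
    exists (Rmin d (Rmin d1 d2)). split; auto. intros m Hm0.
    destruct (Z.eq_dec m (Z.of_nat (S K))) as [->|N1]; [apply (Hm _ d1); auto; lra|].
    destruct (Z.eq_dec m (- Z.of_nat (S K))%Z) as [->|N2]; [apply (Hm _ d2); auto; lra|].
    apply (Hm _ d); auto. apply IH. lia.
Qed.

(** The selector [g] lets the same estimates serve the full lattice ([gall]) and the lattice without
    0 ([gz]), the latter for regular parts at 0. *)
Definition off (L : lattice) (g : Z -> Z -> bool) (z : C) : Prop :=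
  forall m n, g m n = true -> z <> lattice_pt L m n.

Definition separated (L : lattice) (g : Z -> Z -> bool) (z : C) (d : R) : Prop :=
  0 < d /\ forall m n, g m n = true -> d * size m n <= Cmod (z - lattice_pt L m n)%C.

(** Far lattice points are separated from [z] by the linear lower bound on their modulus; the
    finitely many others give a positive minimum. *)
Lemma off_separated L g z : nondegenerate L -> off L g z -> exists d, separated L g z d.
Proof.
  intros HL Hz. destruct (lattice_pt_lower L HL) as [c [Hc Hlow]].
  (* Once [|m|] or [|n|] exceeds [K + 1], one has [c (|m| + |n|) > 2 (|z| + c)], whence
     [|w - z| >= (c / 4) size] for the lattice point [w]. *)
  destruct (nfloor_ex (2 * (Cmod z + c) / c)) as [K HK].
  { apply Rmult_le_pos; [|left; now apply Rinv_0_lt_compat]. generalize (Cmod_ge_0 z); lra. }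
  destruct (finite_range_min (fun m d => forall n, (Z.abs n <= Z.of_nat (S K))%Z ->
     g m n = true -> d * size m n <= Cmod (z - lattice_pt L m n)%C) (S K)) as [d1 [Hd1 H1]].
  { intros m d d' Hd' Hle H n Hn Hg. eapply Rle_trans; [|apply H; auto].
    apply Rmult_le_compat_r; auto. generalize (size_ge_1 m n); lra. }
  { intros m. destruct (finite_range_min (fun n d =>
     g m n = true -> d * size m n <= Cmod (z - lattice_pt L m n)%C) (S K)) as [d [Hd H]].
    - intros n d d' Hd' Hle H Hg. eapply Rle_trans; [|apply H; auto].
      apply Rmult_le_compat_r; auto. generalize (size_ge_1 m n); lra.
    - intros n. assert (S1 := size_ge_1 m n). destruct (g m n) eqn:E.
      + exists (Cmod (z - lattice_pt L m n)%C / size m n).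
        assert (0 < Cmod (z - lattice_pt L m n)%C).
        { apply Cmod_gt_0. intro Z. apply (Hz m n E).
          replace z with ((z - lattice_pt L m n) + lattice_pt L m n)%C by ring. rewrite Z. ring. }
        split; [apply Rdiv_lt_0_compat; lra|]. intros _. right. field. lra.
      + exists 1. split; [lra|discriminate].
    - exists d. split; auto. }
  assert (Hm : 0 < Rmin d1 (c / 4)) by (apply Rmin_pos; lra).
  exists (Rmin d1 (c / 4)). split; auto. intros m n Hg.
  assert (M1 := Rmin_l d1 (c / 4)). assert (M2 := Rmin_r d1 (c / 4)). assert (S1 := size_ge_1 m n).
  destruct (Z_le_gt_dec (Z.abs m) (Z.of_nat (S K))) as [A|A];
    [destruct (Z_le_gt_dec (Z.abs n) (Z.of_nat (S K))) as [B|B]|].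
  - eapply Rle_trans; [|apply H1; auto]. apply Rmult_le_compat_r; lra.
  - assert (INR K + 1 <= Rabs (IZR n)).
    { rewrite <- S_INR, INR_IZR_INZ, <- abs_IZR. apply IZR_le. lia. }
    assert (T := Cmod_sub_ge (lattice_pt L m n) (- z)%C). rewrite Cmod_opp in T.
    rewrite Cmod_minus_sym. eapply Rle_trans; [|apply T]. specialize (Hlow m n).
    assert (P := Rabs_pos (IZR m)).
    apply Rle_trans with (c / 4 * size m n); [apply Rmult_le_compat_r; lra|]. unfold size in *.
    assert (2 * (Cmod z + c) < c * (INR K + 1)).
    { apply (Rmult_lt_reg_r (/ c)); [now apply Rinv_0_lt_compat|].
      replace (c * (INR K + 1) * / c) with (INR K + 1) by (field; lra). apply HK. }
    nra.
  - assert (INR K + 1 <= Rabs (IZR m)).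
    { rewrite <- S_INR, INR_IZR_INZ, <- abs_IZR. apply IZR_le. lia. }
    assert (T := Cmod_sub_ge (lattice_pt L m n) (- z)%C). rewrite Cmod_opp in T.
    rewrite Cmod_minus_sym. eapply Rle_trans; [|apply T]. specialize (Hlow m n).
    assert (P := Rabs_pos (IZR n)).
    apply Rle_trans with (c / 4 * size m n); [apply Rmult_le_compat_r; lra|]. unfold size in *.
    assert (2 * (Cmod z + c) < c * (INR K + 1)).
    { apply (Rmult_lt_reg_r (/ c)); [now apply Rinv_0_lt_compat|].
      replace (c * (INR K + 1) * / c) with (INR K + 1) by (field; lra). apply HK. }
    nra.
Qed.

Lemma separated_shift L g z d h : separated L g z d -> Cmod h < d / 2 -> separated L g (z + h)%C (d / 2).
Proof.
  intros [Hd H] Hh. split; [lra|]. intros m n Hg. specialize (H m n Hg).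
  replace (z + h - lattice_pt L m n)%C with ((z - lattice_pt L m n) + h)%C by ring.
  eapply Rle_trans; [|apply Cmod_sub_ge]. generalize (size_ge_1 m n). nra.
Qed.

Lemma separated_off L g z d : separated L g z d -> off L g z.
Proof.
  intros [Hd H] m n Hg E. specialize (H m n Hg). rewrite E in H.
  replace (lattice_pt L m n - lattice_pt L m n)%C with (RtoC 0) in H by ring. rewrite Cmod_0 in H.
  generalize (size_ge_1 m n). nra.
Qed.

Lemma off_near L g z : nondegenerate L -> off L g z -> near z (off L g).
Proof.
  intros HL H. destruct (off_separated L g z HL H) as [d Hd]. exists (d / 2).
  split; [destruct Hd; lra|]. intros h Hh. eapply separated_off, separated_shift; eauto.
Qed.

Lemma Cmod_Cinv_pow_bound x (d s : R) k : 0 < d -> 0 < s -> d * s <= Cmod x -> Cmod (/ x ^ k)%C <= / d ^ k * / s ^ k.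
Proof.
  intros Hd Hs H. assert (0 < d * s) by nra.
  assert (x <> RtoC 0) by (apply Cmod_gt_0; lra).
  rewrite Cmod_inv by now apply Cpow_nz. rewrite Cmod_pow, <- Rinv_mult, <- Rpow_mult_distr.
  apply Rinv_le_contravar; [now apply pow_lt|]. apply pow_incr. lra.
Qed.

Lemma size_pow_le m n k : (3 <= k)%nat -> / size m n ^ k <= / size m n ^ 3.
Proof.
  intros Hk. assert (S := size_ge_1 m n). apply Rinv_le_contravar; [apply pow_lt; lra|].
  now apply Rle_pow.
Qed.

(** Second-order Taylor remainder of [x^(-k)], uniform in the scale of [x]. The induction multiplies
    by [1 / (x + h)], and the first-order term then leaves one further term in [h^2], weighted by
    [k + 1]. *)
Lemma inv_pow_remainder k : exists K, 0 <= K /\ forall x h, x <> RtoC 0 -> Cmod h <= Cmod x / 2 ->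
  Cmod (/ (x + h) ^ k - / x ^ k + RtoC (INR k) * h * / x ^ S k)%C
    <= K * (Cmod h * Cmod h) * / Cmod x ^ (k + 2).
Proof.
  induction k as [|k [K [HK IH]]].
  - exists 0. split; [lra|]. intros x h Hx Hh. simpl.
    replace (/ 1 - / 1 + 0 * h * / (x * 1))%C with (RtoC 0) by (field; auto).
    rewrite Cmod_0. lra.
  - exists (2 * K + 2 * INR (S k)). assert (HS := pos_INR (S k)). split; [lra|]. intros x h Hx Hh.
    assert (Px : 0 < Cmod x) by now apply Cmod_gt_0.
    assert (G := Cmod_sub_ge x h).
    assert (Hxh : (x + h)%C <> RtoC 0) by (apply Cmod_gt_0; lra).
    assert (Nx : (x ^ k)%C <> RtoC 0) by now apply Cpow_nz.
    assert (Nxh : ((x + h) ^ k)%C <> RtoC 0) by now apply Cpow_nz.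
    specialize (IH x h Hx Hh).
    replace (/ (x + h) ^ S k - / x ^ S k + RtoC (INR (S k)) * h * / x ^ S (S k))%C
      with ((/ (x + h) ^ k - / x ^ k + RtoC (INR k) * h * / x ^ S k) * / (x + h)
        + RtoC (INR (S k)) * (h * h) * / x ^ S (S k) * / (x + h))%C.
    2:{ rewrite S_INR, RtoC_plus. rewrite !Cpow_S. field; auto. }
    assert (I : Cmod (/ (x + h))%C <= 2 * / Cmod x).
    { rewrite Cmod_inv by auto. replace (2 * / Cmod x) with (/ (Cmod x / 2)) by (field; lra).
      apply Rinv_le_contravar; lra. }
    eapply Rle_trans; [apply Cmod_triangle|]. rewrite !Cmod_mult, Cmod_R, Rabs_pos_eq by auto.
    rewrite (Cmod_inv (x ^ S (S k))) by now apply Cpow_nz. rewrite Cmod_pow.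
    assert (P1 := Cmod_ge_0 (/ (x + h))%C). assert (P2 := Cmod_ge_0 h).
    assert (Q : 0 < / Cmod x ^ (k + 2)) by (apply Rinv_0_lt_compat, pow_lt; auto).
    replace (S k + 2)%nat with (S (k + 2)) by lia.
    replace (S (S k)) with (k + 2)%nat by lia.
    simpl (Cmod x ^ S (k + 2)). rewrite Rinv_mult.
    set (q := / Cmod x ^ (k + 2)) in *. set (hh := Cmod h * Cmod h) in *.
    assert (0 <= hh) by (unfold hh; nra).
    apply Rle_trans with (K * hh * q * (2 * / Cmod x) + INR (S k) * hh * q * (2 * / Cmod x)).
    + apply Rplus_le_compat; apply Rmult_le_compat; auto; try lra.
      * apply Cmod_ge_0.
      * repeat apply Rmult_le_pos; lra.
    + right. ring.
Qed.

(** One format for all the absolutely convergent series: [k] is the order of the poles, and weights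
    [c] of decay [j] (see [cdom]) suffice once [j + k >= 3]. It covers [wp'], its derivatives and
    the difference quotients used later. *)
Definition PSum (L : lattice) (c : Z -> Z -> C) (g : Z -> Z -> bool) (k : nat) (z : C) : C :=
  Lsum (fun m n => if g m n then (c m n * / (z - lattice_pt L m n) ^ k)%C else RtoC 0).

Definition cdom (g : Z -> Z -> bool) (c : Z -> Z -> C) (j : nat) : Prop :=
  exists M, 0 <= M /\ forall m n, g m n = true -> Cmod (c m n) <= M * / size m n ^ j.

Lemma PSum_dom L c g j k z : nondegenerate L -> cdom g c j -> (3 <= j + k)%nat -> off L g z ->
  dom (fun m n => if g m n then (c m n * / (z - lattice_pt L m n) ^ k)%C else RtoC 0).
Proof.
  intros HL [M [HM Hc]] Hjk Hz. destruct (off_separated L g z HL Hz) as [d [Hd H]].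
  exists (M * / d ^ k). intros m n. assert (S := size_ge_1 m n).
  assert (Pd : 0 < / d ^ k) by (apply Rinv_0_lt_compat, pow_lt; auto).
  destruct (g m n) eqn:E.
  - rewrite Cmod_mult.
    apply Rle_trans with (M * / size m n ^ j * (/ d ^ k * / size m n ^ k)).
    + apply Rmult_le_compat; auto; try apply Cmod_ge_0. apply Cmod_Cinv_pow_bound; auto. lra.
    + replace (M * / size m n ^ j * (/ d ^ k * / size m n ^ k)) with (M * / d ^ k * / size m n ^ (j + k)).
      2:{ rewrite pow_add, Rinv_mult. ring. }
      apply Rmult_le_compat_l; [nra|]. now apply size_pow_le.
  - rewrite Cmod_0. apply Rmult_le_pos; [nra|]. left. apply Rinv_0_lt_compat, pow_lt. lra.
Qed.

Lemma PSum_cderiv L c g j k z : nondegenerate L -> cdom g c j -> (3 <= j + k)%nat -> off L g z ->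
  cderiv (PSum L c g k) z (- RtoC (INR k) * PSum L c g (S k) z)%C.
Proof.
  intros HL Hc Hjk Hz.
  assert (D1 := PSum_dom L c g j k z HL Hc Hjk Hz).
  assert (D2 := PSum_dom L c g j (S k) z HL Hc ltac:(lia) Hz).
  unfold PSum at 2. rewrite <- Lsum_scal by auto.
  destruct (off_separated L g z HL Hz) as [d [Hd H]].
  destruct Hc as [M [HM Hc]]. destruct (inv_pow_remainder k) as [K [HK HR]].
  assert (Pd : 0 < / d ^ (k + 2)) by (apply Rinv_0_lt_compat, pow_lt; auto).
  apply (Lsum_cderiv (fun m n z => if g m n then (c m n * / (z - lattice_pt L m n) ^ k)%C else RtoC 0)
           _ z (d / 2) (M * K * / d ^ (k + 2))); auto.
  - lra.
  - repeat apply Rmult_le_pos; lra.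
  - now apply dom_scal.
  - intros m n h Hh. assert (S1 := size_ge_1 m n). assert (Ph := Cmod_ge_0 h).
    assert (Q1 : 0 < / size m n ^ j) by (apply Rinv_0_lt_compat, pow_lt; lra).
    destruct (g m n) eqn:E.
    + specialize (H m n E). set (x := (z - lattice_pt L m n)%C) in *.
      assert (Px : 0 < Cmod x) by nra.
      assert (Hx : x <> RtoC 0) by now apply Cmod_gt_0.
      replace (z + h - lattice_pt L m n)%C with (x + h)%C by (unfold x; ring).
      replace (c m n * / (x + h) ^ k - c m n * / x ^ k - h * (- RtoC (INR k) * (c m n * / x ^ S k)))%C
        with (c m n * (/ (x + h) ^ k - / x ^ k + RtoC (INR k) * h * / x ^ S k))%C by ring.
      rewrite Cmod_mult.
      apply Rle_trans with (M * / size m n ^ j * (K * (Cmod h * Cmod h) * (/ d ^ (k + 2) * / size m n ^ (k + 2)))).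
      * apply Rmult_le_compat; auto; try apply Cmod_ge_0.
        eapply Rle_trans; [apply HR; auto; nra|]. apply Rmult_le_compat_l; [nra|].
        rewrite <- Rinv_mult, <- Rpow_mult_distr. apply Rinv_le_contravar; [apply pow_lt; nra|].
        apply pow_incr. nra.
      * replace (M * / size m n ^ j * (K * (Cmod h * Cmod h) * (/ d ^ (k + 2) * / size m n ^ (k + 2))))
          with (M * K * / d ^ (k + 2) * (Cmod h * Cmod h) * / size m n ^ (j + (k + 2))).
        2:{ rewrite (pow_add _ j), Rinv_mult. ring. }
        apply Rmult_le_compat_l; [repeat apply Rmult_le_pos; lra|]. apply size_pow_le. lia.
    + replace (0 - 0 - h * (- RtoC (INR k) * 0))%C with (RtoC 0) by ring. rewrite Cmod_0.
      apply Rmult_le_pos; [repeat apply Rmult_le_pos; lra|]. left. apply Rinv_0_lt_compat, pow_lt. lra.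
Qed.

Lemma PSum_ccont L c g j k z : nondegenerate L -> cdom g c j -> (3 <= j + k)%nat -> off L g z ->
  ccont (PSum L c g k) z.
Proof. intros. eapply cderiv_ccont, PSum_cderiv; eauto. Qed.

Lemma PSum_cC1 L c g j k z : nondegenerate L -> cdom g c j -> (3 <= j + k)%nat -> off L g z ->
  cC1 (PSum L c g k) z.
Proof.
  intros HL Hc Hjk Hz. assert (N := off_near L g z HL Hz).
  exists (fun z => - RtoC (INR k) * PSum L c g (S k) z)%C.
  eapply near_impl; [|apply N]. intros y Hy. split.
  - now apply (PSum_cderiv L c g j).
  - apply (ccont_mult (fun _ => - RtoC (INR k))%C); [apply ccont_const|].
    apply (PSum_ccont L c g j); auto. lia.
Qed.

Definition gall (m n : Z) : bool := true.
Definition gz (m n : Z) : bool := negb (origin m n).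

Lemma lattice_pt_0 L : lattice_pt L 0 0 = RtoC 0.
Proof. unfold lattice_pt. ring. Qed.

Lemma lattice_pt_opp L m n : lattice_pt L (- m) (- n) = (- lattice_pt L m n)%C.
Proof. unfold lattice_pt. rewrite !opp_IZR, !RtoC_opp. ring. Qed.

Lemma lattice_pt_plus L m n m' n' :
  lattice_pt L (m + m') (n + n') = (lattice_pt L m n + lattice_pt L m' n')%C.
Proof. unfold lattice_pt. rewrite !plus_IZR, !RtoC_plus. ring. Qed.

Lemma lattice_pt_nonzero L m n : nondegenerate L -> gz m n = true -> lattice_pt L m n <> RtoC 0.
Proof.
  intros HL Hg E. destruct (lattice_pt_lower L HL) as [c [Hc H]]. specialize (H m n).
  rewrite E, Cmod_0 in H. unfold gz, origin in Hg.
  assert (P1 := Rabs_pos (IZR m)). assert (P2 := Rabs_pos (IZR n)).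
  assert (Em : Rabs (IZR m) = 0) by nra. assert (En : Rabs (IZR n) = 0) by nra.
  rewrite <- abs_IZR in Em, En. apply eq_IZR in Em, En.
  replace m with 0%Z in Hg by lia. replace n with 0%Z in Hg by lia. discriminate.
Qed.

Lemma off_gz_0 L : nondegenerate L -> off L gz 0.
Proof. intros HL m n Hg E. now apply (lattice_pt_nonzero L m n HL Hg). Qed.

Lemma off_gall L z : off L gall z <-> ~ in_lattice L z.
Proof.
  split.
  - intros H [m [n E]]. now apply (H m n).
  - intros H m n _ E. apply H. now exists m, n.
Qed.

Lemma off_gall_gz L z : off L gall z -> off L gz z.
Proof. intros H m n _. now apply H. Qed.

Lemma off_gz_gall L z : off L gz z -> z <> RtoC 0 -> off L gall z.
Proof.
  intros H H0 m n _. destruct (origin m n) eqn:E.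
  - unfold origin in E. rewrite Bool.andb_true_iff, !Z.eqb_eq in E. destruct E as [-> ->].
    now rewrite lattice_pt_0.
  - apply H. unfold gz. now rewrite E.
Qed.

Lemma off_gall_ne0 L z : off L gall z -> z <> RtoC 0.
Proof. intros H. rewrite <- (lattice_pt_0 L). now apply H. Qed.

Lemma off_gall_shift L z m n : off L gall z -> off L gall (z + lattice_pt L m n)%C.
Proof.
  intros H m' n' _ E. apply (H (m' + - m)%Z (n' + - n)%Z eq_refl).
  rewrite lattice_pt_plus, lattice_pt_opp, <- E. ring.
Qed.

Lemma off_gall_opp L z : off L gall z -> off L gall (- z)%C.
Proof.
  intros H m n _ E. apply (H (- m)%Z (- n)%Z eq_refl). rewrite lattice_pt_opp, <- E. ring.
Qed.

Lemma not_off_gall L z : ~ off L gall z -> exists m n, z = lattice_pt L m n.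
Proof.
  intros H. destruct (classic (in_lattice L z)) as [K|K]; auto. exfalso. apply H. now apply off_gall.
Qed.

(** With the origin omitted, these are the terms of the regular parts [wp z - 1 / z^2] and, below,
    [zeta z - 1 / z], which are holomorphic at 0. *)
Definition wpR_term (L : lattice) (m n : Z) (z : C) : C :=
  if origin m n then RtoC 0
  else (/ ((z - lattice_pt L m n) * (z - lattice_pt L m n))
        - / (lattice_pt L m n * lattice_pt L m n))%C.

Definition zetaR_term (L : lattice) (m n : Z) (z : C) : C :=
  if origin m n then RtoC 0
  else (/ (z - lattice_pt L m n) + / lattice_pt L m n
        + z / (lattice_pt L m n * lattice_pt L m n))%C.

Definition wpR (L : lattice) (z : C) : C := Lsum (fun m n => wpR_term L m n z).
Definition zetaR (L : lattice) (z : C) : C := Lsum (fun m n => zetaR_term L m n z).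

Lemma wp_wpR L z : wp L z = (/ (z * z) + wpR L z)%C.
Proof. reflexivity. Qed.

Lemma wzeta_zetaR L z : wzeta L z = (/ z + zetaR L z)%C.
Proof. reflexivity. Qed.

(** The sum of [(z - w)^(-k)] over lattice points [w]. Over the whole lattice, the cases
    [k = 3, 4, 5] are [- wp' / 2], [wp'' / 6] and [- wp''' / 24]. *)
Definition Epow (L : lattice) (g : Z -> Z -> bool) (k : nat) : C -> C := PSum L (fun _ _ => RtoC 1) g k.

Lemma cdom_1 g : cdom g (fun _ _ => RtoC 1) 0.
Proof. exists 1. split; [lra|]. intros. rewrite Cmod_1. simpl. lra. Qed.

Lemma Csqr_pow (x : C) : (x * x)%C = (x ^ 2)%C.
Proof. simpl. ring. Qed.

Lemma gz_origin m n : gz m n = negb (origin m n).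
Proof. reflexivity. Qed.

Section Lattice.
Variable L : lattice.
Hypothesis HL : nondegenerate L.

Lemma lattice_separated_0 : exists d, separated L gz 0 d.
Proof. apply off_separated; auto. now apply off_gz_0. Qed.

Lemma wpR_dom z : off L gz z -> dom (fun m n => wpR_term L m n z).
Proof.
  intros Hz. destruct lattice_separated_0 as [e [He H0]].
  destruct (off_separated L gz z HL Hz) as [d [Hd H]].
  assert (G1 := Cmod_ge_0 (gen1 L)). assert (G2 := Cmod_ge_0 (gen2 L)).
  set (G := Cmod (gen1 L) + Cmod (gen2 L)).
  assert (HG : 0 <= G) by (unfold G; lra).
  assert (Pz := Cmod_ge_0 z).
  exists (Cmod z * (2 * G + Cmod z) * (/ e ^ 2 * / d ^ 2)). intros m n. assert (S1 := size_ge_1 m n).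
  assert (Q0 : 0 < / e ^ 2 * / d ^ 2)
    by (apply Rmult_lt_0_compat; apply Rinv_0_lt_compat, pow_lt; auto).
  unfold wpR_term. destruct (origin m n) eqn:E.
  - rewrite Cmod_0. apply Rmult_le_pos; [apply Rmult_le_pos; [nra|lra]|].
    left. apply Rinv_0_lt_compat, pow_lt. lra.
  - assert (Hg : gz m n = true) by (unfold gz; now rewrite E).
    specialize (H m n Hg). specialize (H0 m n Hg).
    assert (U := lattice_pt_upper L m n). fold G in U.
    set (w := lattice_pt L m n) in *. set (x := (z - w)%C) in *.
    replace (0 - w)%C with (- w)%C in H0 by ring. rewrite Cmod_opp in H0.
    assert (Hw : w <> RtoC 0) by (apply Cmod_gt_0; nra).
    assert (Hx : x <> RtoC 0) by (apply Cmod_gt_0; nra).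
    replace (/ (x * x) - / (w * w))%C with (z * (2 * w - z) * (/ w ^ 2 * / x ^ 2))%C
      by (unfold x in *; field; split; auto).
    rewrite !Cmod_mult.
    assert (B1 := Cmod_Cinv_pow_bound w e (size m n) 2 He ltac:(lra) H0).
    assert (B2 := Cmod_Cinv_pow_bound x d (size m n) 2 Hd ltac:(lra) H).
    assert (B3 : Cmod (2 * w - z)%C <= (2 * G + Cmod z) * size m n).
    { eapply Rle_trans; [apply Cmod_triangle|]. rewrite Cmod_opp, Cmod_mult, Cmod_R, Rabs_pos_eq by lra.
      nra. }
    apply Rle_trans with (Cmod z * ((2 * G + Cmod z) * size m n) *
      (/ e ^ 2 * / size m n ^ 2 * (/ d ^ 2 * / size m n ^ 2))).
    + repeat apply Rmult_le_compat; auto; try lra; repeat apply Rmult_le_pos; auto; try apply Cmod_ge_0.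
    + right. field. repeat split; lra.
Qed.

Lemma zetaR_dom z : off L gz z -> dom (fun m n => zetaR_term L m n z).
Proof.
  intros Hz. destruct lattice_separated_0 as [e [He H0]].
  destruct (off_separated L gz z HL Hz) as [d [Hd H]].
  assert (Pz := Cmod_ge_0 z).
  exists (Cmod z * Cmod z * (/ e ^ 2 * / d ^ 1)). intros m n. assert (S1 := size_ge_1 m n).
  assert (Q0 : 0 < / e ^ 2 * / d ^ 1)
    by (apply Rmult_lt_0_compat; apply Rinv_0_lt_compat, pow_lt; auto).
  unfold zetaR_term. destruct (origin m n) eqn:E.
  - rewrite Cmod_0. apply Rmult_le_pos; [apply Rmult_le_pos; [nra|lra]|].
    left. apply Rinv_0_lt_compat, pow_lt. lra.
  - assert (Hg : gz m n = true) by (unfold gz; now rewrite E).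
    specialize (H m n Hg). specialize (H0 m n Hg).
    set (w := lattice_pt L m n) in *. set (x := (z - w)%C) in *.
    replace (0 - w)%C with (- w)%C in H0 by ring. rewrite Cmod_opp in H0.
    assert (Hw : w <> RtoC 0) by (apply Cmod_gt_0; nra).
    assert (Hx : x <> RtoC 0) by (apply Cmod_gt_0; nra).
    replace (/ x + / w + z / (w * w))%C with (z * z * (/ w ^ 2 * / x ^ 1))%C
      by (unfold x in *; field; split; auto).
    rewrite !Cmod_mult.
    assert (B1 := Cmod_Cinv_pow_bound w e (size m n) 2 He ltac:(lra) H0).
    assert (B2 := Cmod_Cinv_pow_bound x d (size m n) 1 Hd ltac:(lra) H).
    apply Rle_trans with (Cmod z * Cmod z *
      (/ e ^ 2 * / size m n ^ 2 * (/ d ^ 1 * / size m n ^ 1))).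
    + repeat apply Rmult_le_compat; auto; try lra; repeat apply Rmult_le_pos; auto; try apply Cmod_ge_0.
    + right. field. repeat split; lra.
Qed.

Lemma remainder_bound_size d k x h (s K : R) : 0 < d -> 1 <= s -> d * s <= Cmod x -> 0 <= K ->
  (1 <= k)%nat ->
  K * (Cmod h * Cmod h) * / Cmod x ^ (k + 2) <= K * / d ^ (k + 2) * (Cmod h * Cmod h) / s ^ 3.
Proof.
  intros Hd Hs Hx HK Hk. assert (Ph := Cmod_ge_0 h).
  apply Rle_trans with (K * (Cmod h * Cmod h) * (/ d ^ (k + 2) * / s ^ 3)); [|right; unfold Rdiv; ring].
  apply Rmult_le_compat_l; [nra|].
  apply Rle_trans with (/ d ^ (k + 2) * / s ^ (k + 2)).
  - rewrite <- Rinv_mult, <- Rpow_mult_distr. apply Rinv_le_contravar; [apply pow_lt; nra|].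
    apply pow_incr. nra.
  - apply Rmult_le_compat_l; [left; apply Rinv_0_lt_compat, pow_lt; auto|].
    apply Rinv_le_contravar; [apply pow_lt; lra|]. apply Rle_pow; [auto|lia].
Qed.

Lemma wpR_cderiv z : off L gz z -> cderiv (wpR L) z (- (2) * Epow L gz 3 z)%C.
Proof.
  intros Hz. assert (D1 := wpR_dom z Hz).
  assert (D2 := PSum_dom L _ gz 0 3 z HL (cdom_1 gz) ltac:(lia) Hz).
  unfold Epow, PSum. rewrite <- Lsum_scal by auto.
  destruct (off_separated L gz z HL Hz) as [d [Hd H]].
  destruct (inv_pow_remainder 2) as [K [HK HR]].
  assert (Pd : 0 < / d ^ (2 + 2)) by (apply Rinv_0_lt_compat, pow_lt; auto).
  apply (Lsum_cderiv (wpR_term L) _ z (d / 2) (K * / d ^ (2 + 2))); auto.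
  - lra.
  - apply Rmult_le_pos; lra.
  - now apply dom_scal.
  - intros m n h Hh. assert (S1 := size_ge_1 m n). assert (Ph := Cmod_ge_0 h).
    unfold wpR_term. rewrite gz_origin. destruct (origin m n) eqn:E; simpl negb; cbv iota.
    + replace (0 - 0 - h * (- (2) * 0))%C with (RtoC 0) by ring. rewrite Cmod_0.
      apply Rmult_le_pos; [repeat apply Rmult_le_pos; lra|]. left. apply Rinv_0_lt_compat, pow_lt. lra.
    + specialize (H m n ltac:(unfold gz; now rewrite E)). set (x := (z - lattice_pt L m n)%C) in *.
      assert (Px : 0 < Cmod x) by nra.
      assert (Hx : x <> RtoC 0) by now apply Cmod_gt_0.
      replace (z + h - lattice_pt L m n)%C with (x + h)%C by (unfold x; ring).
      eapply Rle_trans; [|apply (remainder_bound_size d 2 x h (size m n) K); auto].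
      eapply Rle_trans; [|apply (HR x h Hx); nra]. right. f_equal.
      rewrite (Csqr_pow (x + h)), (Csqr_pow x). change (INR 2) with (1 + 1).
      rewrite RtoC_plus. ring.
Qed.

Lemma zetaR_cderiv z : off L gz z -> cderiv (zetaR L) z (- wpR L z)%C.
Proof.
  intros Hz. assert (D1 := zetaR_dom z Hz). assert (D2 := wpR_dom z Hz).
  replace (- wpR L z)%C with (-(1) * wpR L z)%C by ring.
  unfold wpR. rewrite <- Lsum_scal by auto.
  destruct (off_separated L gz z HL Hz) as [d [Hd H]].
  destruct (inv_pow_remainder 1) as [K [HK HR]].
  assert (Pd : 0 < / d ^ (1 + 2)) by (apply Rinv_0_lt_compat, pow_lt; auto).
  apply (Lsum_cderiv (zetaR_term L) _ z (d / 2) (K * / d ^ (1 + 2))); auto.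
  - lra.
  - apply Rmult_le_pos; lra.
  - now apply dom_scal.
  - intros m n h Hh. assert (S1 := size_ge_1 m n). assert (Ph := Cmod_ge_0 h).
    unfold zetaR_term, wpR_term. destruct (origin m n) eqn:E.
    + replace (0 - 0 - h * (- (1) * 0))%C with (RtoC 0) by ring. rewrite Cmod_0.
      apply Rmult_le_pos; [repeat apply Rmult_le_pos; lra|]. left. apply Rinv_0_lt_compat, pow_lt. lra.
    + assert (Hg : gz m n = true) by (unfold gz; now rewrite E).
      assert (Hw := lattice_pt_nonzero L m n HL Hg).
      specialize (H m n Hg). set (x := (z - lattice_pt L m n)%C) in *.
      assert (Px : 0 < Cmod x) by nra.
      assert (Hx : x <> RtoC 0) by now apply Cmod_gt_0.
      replace (z + h - lattice_pt L m n)%C with (x + h)%C by (unfold x; ring).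
      eapply Rle_trans; [|apply (remainder_bound_size d 1 x h (size m n) K); auto].
      eapply Rle_trans; [|apply (HR x h Hx); nra]. right. f_equal.
      assert (Hxh : (x + h)%C <> RtoC 0).
      { apply Cmod_gt_0. generalize (Cmod_sub_ge x h). nra. }
      set (w := lattice_pt L m n) in *. simpl. field. auto.
Qed.

Lemma wpR_cC1 z : off L gz z -> cC1 (wpR L) z.
Proof.
  intros Hz. assert (N := off_near L gz z HL Hz).
  exists (fun z => - (2) * Epow L gz 3 z)%C. eapply near_impl; [|apply N]. intros y Hy. split.
  - now apply wpR_cderiv.
  - apply (ccont_mult (fun _ => - (2))%C); [apply ccont_const|].
    apply (PSum_ccont L _ gz 0); auto. apply cdom_1.
Qed.

Lemma zetaR_cC1 z : off L gz z -> cC1 (zetaR L) z.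
Proof.
  intros Hz. assert (N := off_near L gz z HL Hz).
  exists (fun z => - wpR L z)%C. eapply near_impl; [|apply N]. intros y Hy. split.
  - now apply zetaR_cderiv.
  - eapply cderiv_ccont, cderiv_opp, wpR_cderiv; auto.
Qed.

Lemma Epow_split k z : (3 <= k)%nat -> off L gall z -> Epow L gall k z = (/ z ^ k + Epow L gz k z)%C.
Proof.
  intros Hk Hz. unfold Epow, PSum.
  rewrite (Lsum_ext _ (fun m n => if origin m n then (/ z ^ k)%C else (1 * / (z - lattice_pt L m n) ^ k)%C)).
  - rewrite Lsum_split.
    + f_equal. apply Lsum_ext. intros. rewrite gz_origin. now destruct (origin m n).
    + eapply dom_ext; [|apply (PSum_dom L (fun _ _ => RtoC 1) gz 0 k z HL (cdom_1 _) ltac:(lia)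
        (off_gall_gz _ _ Hz))].
      intros. cbv beta. rewrite gz_origin. now destruct (origin m n).
  - intros. unfold gall. destruct (origin m n) eqn:E; auto.
    unfold origin in E. rewrite Bool.andb_true_iff, !Z.eqb_eq in E. destruct E as [-> ->].
    rewrite lattice_pt_0. replace (z - 0)%C with z by ring. ring.
Qed.

(** [wp'] is the value of a total derivative operator; this explicit series carries the proofs, and
    [wp'_wpd] connects the two. *)
Definition wpd (z : C) : C := (- (2) * Epow L gall 3 z)%C.

Lemma wp_cderiv z : off L gall z -> cderiv (wp L) z (wpd z).
Proof.
  intros Hz. assert (H0 := off_gall_ne0 _ _ Hz).
  apply (cderiv_eq _ _ (- (1 * z + z * 1) / (z * z * (z * z)) + - (2) * Epow L gz 3 z)%C).
  - unfold wpd. rewrite Epow_split by auto. field. auto.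
  - apply (cderiv_plus (fun z => / (z * z))%C (wpR L)).
    + apply (cderiv_inv (fun z => z * z)%C); [now apply Cmult_neq_0|].
      apply cderiv_mult; apply cderiv_id.
    + apply wpR_cderiv. now apply off_gall_gz.
Qed.

Lemma wzeta_cderiv z : off L gall z -> cderiv (wzeta L) z (- wp L z)%C.
Proof.
  intros Hz. assert (H0 := off_gall_ne0 _ _ Hz).
  apply (cderiv_eq _ _ (- (1) / (z * z) + - wpR L z)%C).
  - rewrite wp_wpR. field. auto.
  - apply (cderiv_plus Cinv (zetaR L)).
    + apply (cderiv_inv (fun z => z)%C); auto. apply cderiv_id.
    + apply zetaR_cderiv. now apply off_gall_gz.
Qed.

Lemma Epow_cderiv k z : (3 <= k)%nat -> off L gall z ->
  cderiv (Epow L gall k) z (- RtoC (INR k) * Epow L gall (S k) z)%C.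
Proof. intros. apply (PSum_cderiv L _ gall 0); auto. apply cdom_1. Qed.

Lemma wp_cC1 z : off L gall z -> cC1 (wp L) z.
Proof.
  intros Hz. assert (N := off_near L gall z HL Hz).
  exists wpd. eapply near_impl; [|apply N]. intros y Hy. split.
  - now apply wp_cderiv.
  - apply (ccont_mult (fun _ => - (2))%C); [apply ccont_const|].
    eapply cderiv_ccont, Epow_cderiv; auto.
Qed.

Lemma wzeta_cC1 z : off L gall z -> cC1 (wzeta L) z.
Proof.
  intros Hz. assert (N := off_near L gall z HL Hz).
  exists (fun z => - wp L z)%C. eapply near_impl; [|apply N]. intros y Hy. split.
  - now apply wzeta_cderiv.
  - eapply cderiv_ccont, cderiv_opp, wp_cderiv; auto.
Qed.

(** The term at the origin is included here, so that translation by a period shifts all indices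
    alike. *)
Definition wp_term (m n : Z) (z : C) : C :=
  if origin m n then (/ (z * z))%C
  else (/ ((z - lattice_pt L m n) * (z - lattice_pt L m n))
        - / (lattice_pt L m n * lattice_pt L m n))%C.

Definition zeta_term (m n : Z) (z : C) : C :=
  if origin m n then (/ z)%C
  else (/ (z - lattice_pt L m n) + / lattice_pt L m n
        + z / (lattice_pt L m n * lattice_pt L m n))%C.

Lemma dom_change_origin a c : dom (fun m n => if origin m n then RtoC 0 else a m n) ->
  dom (fun m n => if origin m n then c else a m n).
Proof.
  intros H. eapply dom_ext; [|apply (dom_plus _ _ (dom_single c) H)].
  intros. cbv beta. destruct (origin m n); ring.
Qed.

Lemma wp_term_dom z : off L gz z -> dom (fun m n => wp_term m n z).
Proof. intros Hz. apply dom_change_origin. now apply wpR_dom. Qed.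

Lemma zeta_term_dom z : off L gz z -> dom (fun m n => zeta_term m n z).
Proof. intros Hz. apply dom_change_origin. now apply zetaR_dom. Qed.

Lemma wp_Lsum z : off L gz z -> wp L z = Lsum (fun m n => wp_term m n z).
Proof. intros Hz. symmetry. apply Lsum_split. now apply wpR_dom. Qed.

Lemma wzeta_Lsum z : off L gz z -> wzeta L z = Lsum (fun m n => zeta_term m n z).
Proof. intros Hz. symmetry. apply Lsum_split. now apply zetaR_dom. Qed.

Lemma origin_opp m n : origin (- m) (- n) = origin m n.
Proof. destruct m, n; reflexivity. Qed.

Lemma wp_even z : wp L (- z) = wp L z.
Proof.
  rewrite !wp_wpR. f_equal; [f_equal; ring|]. unfold wpR.
  rewrite <- (Lsum_opp (fun m n => wpR_term L m n (- z))). apply Lsum_ext. intros m n.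
  unfold wpR_term. rewrite origin_opp, lattice_pt_opp. destruct (origin m n); auto.
  f_equal; f_equal; ring.
Qed.

Lemma Cinv_opp (x : C) : (/ - x)%C = (- / x)%C.
Proof.
  destruct x as [a b]. unfold Cinv, Copp; simpl.
  replace (- a * (- a * 1) + - b * (- b * 1)) with (a * (a * 1) + b * (b * 1)) by ring.
  f_equal; unfold Rdiv; ring.
Qed.

Lemma wzeta_odd z : off L gz z -> wzeta L (- z) = (- wzeta L z)%C.
Proof.
  intros Hz. rewrite !wzeta_zetaR. rewrite Cinv_opp.
  replace (- (/ z + zetaR L z))%C with (- / z + - (1) * zetaR L z)%C by ring. f_equal. unfold zetaR.
  rewrite <- Lsum_scal by now apply zetaR_dom.
  rewrite <- (Lsum_opp (fun m n => zetaR_term L m n (- z))). apply Lsum_ext. intros m n.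
  unfold zetaR_term. rewrite origin_opp, lattice_pt_opp. destruct (origin m n); [ring|].
  replace (- z - - lattice_pt L m n)%C with (- (z - lattice_pt L m n))%C by ring.
  rewrite !Cinv_opp. unfold Cdiv.
  replace (- lattice_pt L m n * - lattice_pt L m n)%C with (lattice_pt L m n * lattice_pt L m n)%C by ring.
  ring.
Qed.

Lemma Lsum_minus a b : dom a -> dom b -> Lsum (fun m n => a m n - b m n)%C = (Lsum a - Lsum b)%C.
Proof.
  intros Ha Hb. rewrite (Lsum_ext _ (fun m n => a m n + - (1) * b m n)%C) by (intros; ring).
  rewrite Lsum_plus, Lsum_scal by (auto; now apply dom_scal). ring.
Qed.

Lemma telescoping_zero_1 T f K :
  (forall m n, Cmod (f m n) <= K / size m n ^ 2) ->
  (forall m n, T m n = (f (m + 1)%Z n - f m n)%C) -> Lsum T = RtoC 0.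
Proof.
  intros HK HT. apply clim_CLim. eapply clim_ext; [|apply (Lsum_shift_1 f K HK)].
  intros N. f_equal. apply functional_extensionality; intro. apply functional_extensionality; intro. auto.
Qed.

Lemma telescoping_zero_2 T f K :
  (forall m n, Cmod (f m n) <= K / size m n ^ 2) ->
  (forall m n, T m n = (f m (n + 1)%Z - f m n)%C) -> Lsum T = RtoC 0.
Proof.
  intros HK HT. apply clim_CLim. eapply clim_ext; [|apply (Lsum_shift_2 f K HK)].
  intros N. f_equal. apply functional_extensionality; intro. apply functional_extensionality; intro. auto.
Qed.

(** The hypotheses use backward shifts because replacing [z] by [z - w1], with [w1] the first
    generator, moves the index [m] to [m + 1] in the lattice sums. *)
Lemma periodic_from_generators (f : C -> C) (P : C -> Prop) :
  (forall z m n, P z -> P (z + lattice_pt L m n)%C) ->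
  (forall z, P z -> f (z - lattice_pt L 1 0)%C = f z) ->
  (forall z, P z -> f (z - lattice_pt L 0 1)%C = f z) ->
  forall m n z, P z -> f (z + lattice_pt L m n)%C = f z.
Proof.
  intros HP H1 H2.
  assert (A : forall k z, P z -> f (z + lattice_pt L (Z.of_nat k) 0)%C = f z).
  { induction k as [|k IH]; intros z Hz.
    - simpl. rewrite lattice_pt_0. f_equal; ring.
    - rewrite <- (H1 (z + lattice_pt L (Z.of_nat (S k)) 0)%C) by auto.
      rewrite <- (IH z Hz). f_equal. replace (Z.of_nat (S k)) with (Z.of_nat k + 1)%Z by lia.
      replace 0%Z with (0 + 0)%Z at 1 by lia. rewrite lattice_pt_plus. ring. }
  assert (B : forall k z, P z -> f (z + lattice_pt L 0 (Z.of_nat k))%C = f z).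
  { induction k as [|k IH]; intros z Hz.
    - simpl. rewrite lattice_pt_0. f_equal; ring.
    - rewrite <- (H2 (z + lattice_pt L 0 (Z.of_nat (S k)))%C) by auto.
      rewrite <- (IH z Hz). f_equal. replace (Z.of_nat (S k)) with (Z.of_nat k + 1)%Z by lia.
      replace 0%Z with (0 + 0)%Z at 1 by lia. rewrite lattice_pt_plus. ring. }
  assert (A' : forall m z, P z -> f (z + lattice_pt L m 0)%C = f z).
  { intros m z Hz. destruct (Z_le_gt_dec 0 m) as [Hm|Hm].
    - rewrite <- (Z2Nat.id m Hm). now apply A.
    - rewrite <- (A (Z.to_nat (- m)) (z + lattice_pt L m 0)%C) by auto.
      rewrite Z2Nat.id by lia. f_equal. rewrite <- Cplus_assoc, <- lattice_pt_plus.
      replace (m + - m)%Z with 0%Z by lia. rewrite lattice_pt_0. ring. }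
  assert (B' : forall n z, P z -> f (z + lattice_pt L 0 n)%C = f z).
  { intros m z Hz. destruct (Z_le_gt_dec 0 m) as [Hm|Hm].
    - rewrite <- (Z2Nat.id m Hm). now apply B.
    - rewrite <- (B (Z.to_nat (- m)) (z + lattice_pt L 0 m)%C) by auto.
      rewrite Z2Nat.id by lia. f_equal. rewrite <- Cplus_assoc, <- lattice_pt_plus.
      replace (m + - m)%Z with 0%Z by lia. rewrite lattice_pt_0. ring. }
  intros m n z Hz. replace (lattice_pt L m n) with (lattice_pt L m 0 + lattice_pt L 0 n)%C.
  - rewrite Cplus_assoc, B' by auto. auto.
  - rewrite <- lattice_pt_plus. f_equal; lia.
Qed.

(** The constants [1 / w^2] cancel in [wp (z - w1) - wp z], which is left as a telescoping sum of
    the terms [1 / (z - w)^2]; their decay of order 2 makes the boundary contribution vanish in the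
    limit. *)
Lemma wp_periodic m n z : off L gall z -> wp L (z + lattice_pt L m n)%C = wp L z.
Proof.
  revert m n z. apply periodic_from_generators.
  - intros; now apply off_gall_shift.
  - intros z Hz.
    assert (Hz' : off L gall (z - lattice_pt L 1 0)%C).
    { generalize (off_gall_shift L z (-1) 0 Hz).
      replace (lattice_pt L (-1) 0) with (- lattice_pt L 1 0)%C by (rewrite <- lattice_pt_opp; reflexivity). auto. }
    assert (E : (wp L (z - lattice_pt L 1 0) - wp L z)%C = RtoC 0).
    { rewrite !wp_Lsum by now apply off_gall_gz.
      rewrite <- Lsum_minus by now apply wp_term_dom, off_gall_gz.
      destruct (off_separated L gall z HL Hz) as [d [Hd H]].
      apply (telescoping_zero_1 _ (fun m n => / (z - lattice_pt L m n) ^ 2)%C (/ d ^ 2)).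
      - intros m n. apply Cmod_Cinv_pow_bound; auto. generalize (size_ge_1 m n); lra.
      - intros m n. unfold wp_term.
        replace (z - lattice_pt L (m + 1) n)%C with (z - lattice_pt L 1 0 - lattice_pt L m n)%C.
        2:{ replace n with (n + 0)%Z at 2 by lia. rewrite lattice_pt_plus. ring. }
        rewrite <- !Csqr_pow. destruct (origin m n) eqn:E.
        + unfold origin in E. rewrite Bool.andb_true_iff, !Z.eqb_eq in E. destruct E as [-> ->].
          rewrite lattice_pt_0. unfold Cminus. rewrite Copp_0, !Cplus_0_r. reflexivity.
        + ring. }
    replace (wp L (z - lattice_pt L 1 0)) with ((wp L (z - lattice_pt L 1 0) - wp L z) + wp L z)%C by ring.
    rewrite E. ring.
  - intros z Hz.
    assert (Hz' : off L gall (z - lattice_pt L 0 1)%C).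
    { generalize (off_gall_shift L z 0 (-1) Hz).
      replace (lattice_pt L 0 (-1)) with (- lattice_pt L 0 1)%C by (rewrite <- lattice_pt_opp; reflexivity). auto. }
    assert (E : (wp L (z - lattice_pt L 0 1) - wp L z)%C = RtoC 0).
    { rewrite !wp_Lsum by now apply off_gall_gz.
      rewrite <- Lsum_minus by now apply wp_term_dom, off_gall_gz.
      destruct (off_separated L gall z HL Hz) as [d [Hd H]].
      apply (telescoping_zero_2 _ (fun m n => / (z - lattice_pt L m n) ^ 2)%C (/ d ^ 2)).
      - intros m n. apply Cmod_Cinv_pow_bound; auto. generalize (size_ge_1 m n); lra.
      - intros m n. unfold wp_term.
        replace (z - lattice_pt L m (n + 1))%C with (z - lattice_pt L 0 1 - lattice_pt L m n)%C.
        2:{ replace m with (m + 0)%Z at 2 by lia. rewrite lattice_pt_plus. ring. }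
        rewrite <- !Csqr_pow. destruct (origin m n) eqn:E.
        + unfold origin in E. rewrite Bool.andb_true_iff, !Z.eqb_eq in E. destruct E as [-> ->].
          rewrite lattice_pt_0. unfold Cminus. rewrite Copp_0, !Cplus_0_r. reflexivity.
        + ring. }
    replace (wp L (z - lattice_pt L 0 1)) with ((wp L (z - lattice_pt L 0 1) - wp L z) + wp L z)%C by ring.
    rewrite E. ring.
Qed.
End Lattice.

Lemma dom_opp a : dom a -> dom (fun m n => a (- m)%Z (- n)%Z).
Proof.
  intros [M H]. exists M. intros m n. specialize (H (- m)%Z (- n)%Z).
  unfold size in *. now rewrite !opp_IZR, !Rabs_Ropp in H.
Qed.

Lemma near'_0_off L : nondegenerate L -> near' 0 (off L gall).
Proof.
  intros HL. destruct (off_near L gz 0 HL (off_gz_0 L HL)) as [d [Hd H]].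
  exists d. split; auto. intros h Hh H0. apply off_gz_gall; auto.
  replace (0 + h)%C with h by ring. auto.
Qed.

(** * The reciprocal of phi as a combination of zeta functions *)

Section Identity.
Variable L : lattice.
Hypothesis HL : nondegenerate L.

(** The addition identity equates this function with [wp'(mu) / (wp z - wp mu)], hence with
    [1 / phi] when [wp'(mu) = - 1 / 4]. *)
Definition wzeta3 (mu z : C) : C := (wzeta L (z - mu) - wzeta L (z + mu) + 2 * wzeta L mu)%C.

(** The sum over [a] in [mu + L] of [1 / (a^j (z - a))], convergent for [j >= 2]. Such sums express
    the expansion of [wzeta3] at 0 with exact remainders. *)
Definition inv_zeta (mu : C) (j : nat) (z : C) : C :=
  PSum L (fun m n => / (mu + lattice_pt L m n) ^ j)%C gall 1 (z - mu)%C.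

Lemma cdom_inv_shift mu j : off L gall mu -> cdom gall (fun m n => / (mu + lattice_pt L m n) ^ j)%C j.
Proof.
  intros H. destruct (off_separated L gall (- mu)%C HL (off_gall_opp _ _ H)) as [d [Hd Hs]].
  exists (/ d ^ j). split; [left; apply Rinv_0_lt_compat, pow_lt; auto|]. intros m n Hg.
  apply Cmod_Cinv_pow_bound; auto; [generalize (size_ge_1 m n); lra|].
  specialize (Hs m n Hg). replace (mu + lattice_pt L m n)%C with (- (- mu - lattice_pt L m n))%C by ring.
  now rewrite Cmod_opp.
Qed.

Lemma off_gall_plus_ne mu m n : off L gall mu -> (mu + lattice_pt L m n)%C <> RtoC 0.
Proof.
  intros H E. apply (H (- m)%Z (- n)%Z eq_refl). rewrite lattice_pt_opp.
  replace mu with ((mu + lattice_pt L m n) + - lattice_pt L m n)%C by ring. rewrite E. ring.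
Qed.

Lemma off_gall_minus_ne z m n : off L gall z -> (z - lattice_pt L m n)%C <> RtoC 0.
Proof.
  intros H E. apply (H m n eq_refl).
  replace z with ((z - lattice_pt L m n) + lattice_pt L m n)%C by ring. rewrite E. ring.
Qed.

Lemma off_gall_reflect z mu : off L gall (z + mu)%C -> off L gall (- z - mu)%C.
Proof. intros H. replace (- z - mu)%C with (- (z + mu))%C by ring. now apply off_gall_opp. Qed.

Lemma inv_zeta_dom mu j z : off L gall mu -> (2 <= j)%nat -> off L gall (z - mu)%C ->
  dom (fun m n => / (mu + lattice_pt L m n) ^ j * / (z - mu - lattice_pt L m n) ^ 1)%C.
Proof.
  intros Hmu Hj Hz.
  apply (PSum_dom L (fun m n => / (mu + lattice_pt L m n) ^ j)%C gall j 1 (z - mu)%C HL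
          (cdom_inv_shift mu j Hmu)); auto. lia.
Qed.

(* B(z) = zeta(z-mu) - zeta(z+mu) + 2 zeta(mu) is the sum over a in mu + L of
   1/(z-a) - 1/(z+a) + 2/a = z^2 (1/(a^2 (z-a)) + 1/(a^2 (-z-a))). *)
Lemma wzeta3_square mu z : off L gall mu -> off L gall (z - mu)%C -> off L gall (z + mu)%C ->
  wzeta3 mu z = (z * z * (inv_zeta mu 2 z + inv_zeta mu 2 (- z)))%C.
Proof.
  intros Hmu H1 H2. assert (H3 := off_gall_reflect z mu H2).
  unfold wzeta3, inv_zeta, PSum.
  rewrite !wzeta_Lsum by (auto; now apply off_gall_gz).
  rewrite <- (Lsum_opp (fun m n => zeta_term L m n (z + mu))), <- (Lsum_opp (fun m n => zeta_term L m n mu)).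
  assert (D1 := zeta_term_dom L HL _ (off_gall_gz _ _ H1)).
  assert (D2 := dom_opp _ (zeta_term_dom L HL _ (off_gall_gz _ _ H2))).
  assert (D3 := dom_opp _ (zeta_term_dom L HL _ (off_gall_gz _ _ Hmu))).
  assert (D4 := inv_zeta_dom mu 2 z Hmu (le_n 2) H1).
  assert (D5 := inv_zeta_dom mu 2 (- z) Hmu (le_n 2) H3).
  cbv beta in D2, D3. unfold gall.
  rewrite <- Lsum_minus by auto.
  rewrite <- (Lsum_scal 2) by auto.
  rewrite <- Lsum_plus; [|apply (dom_ext (fun m n => zeta_term L m n (z - mu) + -(1) * zeta_term L (- m) (- n) (z + mu))%C); [intros; ring|apply dom_plus; auto; now apply dom_scal]|now apply dom_scal].
  rewrite <- Lsum_plus by auto.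
  rewrite <- Lsum_scal by now apply dom_plus.
  apply Lsum_ext. intros m n. unfold zeta_term. rewrite origin_opp, lattice_pt_opp.
  assert (N1 := off_gall_plus_ne mu m n Hmu).
  assert (N2 := off_gall_minus_ne _ m n H1). assert (N3 := off_gall_minus_ne _ m n H3).
  assert (N4 : (z + mu + lattice_pt L m n)%C <> RtoC 0).
  { intro E. apply N3. replace (- z - mu - lattice_pt L m n)%C with (- (z + mu + lattice_pt L m n))%C by ring.
    rewrite E. ring. }
  destruct (origin m n) eqn:E.
  - unfold origin in E. rewrite Bool.andb_true_iff, !Z.eqb_eq in E. destruct E as [-> ->].
    rewrite lattice_pt_0 in *.
    replace (mu + 0)%C with mu in * by ring.
    replace (z - mu - 0)%C with (z - mu)%C in * by ring.
    replace (- z - mu - 0)%C with (- (z + mu))%C in * by ring.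
    replace (z + mu + 0)%C with (z + mu)%C in * by ring.
    simpl. field. auto.
  - assert (Nw : lattice_pt L m n <> RtoC 0) by (apply lattice_pt_nonzero; auto; unfold gz; now rewrite E).
    set (w := lattice_pt L m n) in *.
    replace (- z - mu - w)%C with (- (z + mu + w))%C in * by ring.
    replace (z + mu - - w)%C with (z + mu + w)%C in * by ring.
    replace (mu - - w)%C with (mu + w)%C in * by ring.
    simpl. field. repeat split; auto.
Qed.
Lemma wzeta3_even mu z : off L gall (z - mu)%C -> off L gall (z + mu)%C -> wzeta3 mu (- z) = wzeta3 mu z.
Proof.
  intros H1 H2. unfold wzeta3.
  replace (- z - mu)%C with (- (z + mu))%C by ring. replace (- z + mu)%C with (- (z - mu))%C by ring.
  rewrite !wzeta_odd by (auto; now apply off_gall_gz). ring.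
Qed.

Lemma inv_zeta_ccont mu j z : off L gall mu -> (2 <= j)%nat -> off L gall (z - mu)%C -> ccont (inv_zeta mu j) z.
Proof.
  intros Hmu Hj Hz. unfold inv_zeta.
  apply (ccont_shift (PSum L (fun m n => / (mu + lattice_pt L m n) ^ j)%C gall 1) z (- mu)).
  apply (PSum_ccont L _ gall j); auto; [now apply cdom_inv_shift|lia].
Qed.

Lemma inv_zeta_cC1 mu j z : off L gall mu -> (2 <= j)%nat -> off L gall (z - mu)%C -> cC1 (inv_zeta mu j) z.
Proof.
  intros Hmu Hj Hz. unfold inv_zeta.
  apply (cC1_shift (PSum L (fun m n => / (mu + lattice_pt L m n) ^ j)%C gall 1) z (- mu)).
  apply (PSum_cC1 L _ gall j); auto; [now apply cdom_inv_shift|lia].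
Qed.

(** At [z = 0] each term is [- 1 / a^(j + 1)]; the reflection of the lattice turns [mu + w] into
    [mu - w]. *)
Lemma inv_zeta_0 mu j : off L gall mu -> (2 <= j)%nat ->
  inv_zeta mu j 0 = (- Epow L gall (S j) mu)%C.
Proof.
  intros Hmu Hj. unfold inv_zeta, Epow, PSum, gall.
  rewrite <- (Lsum_opp (fun m n => (1 * / (mu - lattice_pt L m n) ^ S j)%C)).
  replace (- Lsum _)%C with (-(1) * Lsum (fun m n : Z => (1 * / (mu - lattice_pt L (- m) (- n)) ^ S j)))%C by ring.
  rewrite <- Lsum_scal.
  - apply Lsum_ext. intros m n. rewrite lattice_pt_opp.
    assert (N1 := off_gall_plus_ne mu m n Hmu).
    replace (0 - mu - lattice_pt L m n)%C with (- (mu + lattice_pt L m n))%C by ring.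
    replace (mu - - lattice_pt L m n)%C with (mu + lattice_pt L m n)%C by ring.
    set (a := (mu + lattice_pt L m n)%C) in *. rewrite Cpow_1_r, Cpow_S.
    assert (a ^ j <> 0)%C by now apply Cpow_nz.
    field. auto.
  - apply (dom_opp (fun m n => 1 * / (mu - lattice_pt L m n) ^ S j)%C).
    apply (PSum_dom L (fun _ _ => RtoC 1) gall 0 (S j) mu HL (cdom_1 _)); auto. lia.
Qed.

(* The difference quotient of wp at mu, up to sign. *)
Definition wp_quot (mu z : C) : C :=
  (PSum L (fun m n => / (mu - lattice_pt L m n) ^ 2)%C gall 1 z +
   PSum L (fun m n => / (mu - lattice_pt L m n) ^ 1)%C gall 2 z)%C.

Lemma cdom_inv_minus mu j : off L gall mu -> cdom gall (fun m n => / (mu - lattice_pt L m n) ^ j)%C j.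
Proof.
  intros H. destruct (off_separated L gall mu HL H) as [d [Hd Hs]].
  exists (/ d ^ j). split; [left; apply Rinv_0_lt_compat, pow_lt; auto|]. intros m n Hg.
  apply Cmod_Cinv_pow_bound; auto. generalize (size_ge_1 m n); lra.
Qed.

(** Termwise, with [x = z - w] and [y = mu - w], one has [1 / x^2 - 1 / y^2 = (y - x) (1 / (x y^2) +
    1 / (x^2 y))], and [y - x = mu - z]. The zero of [wp z - wp mu] at [mu] is thus divided out
    without a local expansion. *)
Lemma wp_quot_spec mu z : off L gall mu -> off L gall z ->
  (wp L z - wp L mu)%C = (- (z - mu) * wp_quot mu z)%C.
Proof.
  intros Hmu Hz. rewrite !wp_Lsum by (auto; now apply off_gall_gz). unfold wp_quot, PSum, gall.
  assert (D1 := PSum_dom L _ gall 2 1 z HL (cdom_inv_minus mu 2 Hmu) (le_n 3) Hz).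
  assert (D2 := PSum_dom L _ gall 1 2 z HL (cdom_inv_minus mu 1 Hmu) (le_n 3) Hz).
  unfold gall in D1, D2.
  rewrite <- Lsum_minus by (apply wp_term_dom; auto; now apply off_gall_gz).
  rewrite <- Lsum_plus by auto. rewrite <- Lsum_scal by now apply dom_plus.
  apply Lsum_ext. intros m n. unfold wp_term.
  assert (N1 := off_gall_minus_ne mu m n Hmu). assert (N2 := off_gall_minus_ne z m n Hz).
  destruct (origin m n) eqn:E.
  - unfold origin in E. rewrite Bool.andb_true_iff, !Z.eqb_eq in E. destruct E as [-> ->].
    rewrite lattice_pt_0 in *.
    replace (mu - 0)%C with mu in * by ring. replace (z - 0)%C with z in * by ring.
    simpl. field. auto.
  - assert (Nw : lattice_pt L m n <> RtoC 0) by (apply lattice_pt_nonzero; auto; unfold gz; now rewrite E).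
    set (w := lattice_pt L m n) in *. simpl. field. auto.
Qed.

Lemma wp_quot_cC1 mu z : off L gall mu -> off L gall z -> cC1 (wp_quot mu) z.
Proof.
  intros Hmu Hz. unfold wp_quot. apply cC1_plus.
  - apply (PSum_cC1 L _ gall 2); auto. now apply cdom_inv_minus.
  - apply (PSum_cC1 L _ gall 1); auto. now apply cdom_inv_minus.
Qed.

Lemma off_sub_lattice_pt' z m n : off L gall z -> off L gall (z - lattice_pt L m n)%C.
Proof. intros H. unfold Cminus. rewrite <- lattice_pt_opp. now apply off_gall_shift. Qed.

(** Each zeta function is only quasi-periodic, its telescoping terms having decay of order 1. The
    difference [1 / (z - mu - w) - 1 / (z + mu - w)] has order 2, so the boundary terms vanish: the
    quasi-periods cancel. *)
Lemma wzeta3_periodic mu m n z : off L gall (z - mu)%C -> off L gall (z + mu)%C ->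
  wzeta3 mu (z + lattice_pt L m n)%C = wzeta3 mu z.
Proof.
  intros H1 H2. assert (H := conj H1 H2). clear H1 H2. revert m n z H.
  assert (HP : forall z m n, off L gall (z - mu)%C /\ off L gall (z + mu)%C ->
    off L gall (z + lattice_pt L m n - mu)%C /\ off L gall (z + lattice_pt L m n + mu)%C).
  { intros z m n [H1 H2]. split.
    - replace (z + lattice_pt L m n - mu)%C with (z - mu + lattice_pt L m n)%C by ring. now apply off_gall_shift.
    - replace (z + lattice_pt L m n + mu)%C with (z + mu + lattice_pt L m n)%C by ring. now apply off_gall_shift. }
  assert (HF : forall z, off L gall (z - mu)%C -> off L gall (z + mu)%C -> exists K, forall m n,
    Cmod (/ (z - mu - lattice_pt L m n) - / (z + mu - lattice_pt L m n))%C <= K / size m n ^ 2).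
  { intros z H1 H2. destruct (off_separated L gall _ HL H1) as [d [Hd S1]].
    destruct (off_separated L gall _ HL H2) as [e [He S2]].
    exists (2 * Cmod mu * (/ d ^ 1 * / e ^ 1)). intros m n.
    assert (N1 := off_gall_minus_ne _ m n H1). assert (N2 := off_gall_minus_ne _ m n H2).
    specialize (S1 m n eq_refl). specialize (S2 m n eq_refl). assert (S := size_ge_1 m n).
    assert (B1 := Cmod_Cinv_pow_bound _ d (size m n) 1 Hd ltac:(lra) S1).
    assert (B2 := Cmod_Cinv_pow_bound _ e (size m n) 1 He ltac:(lra) S2).
    replace (/ (z - mu - lattice_pt L m n) - / (z + mu - lattice_pt L m n))%C
      with (2 * mu * (/ (z - mu - lattice_pt L m n) ^ 1 * / (z + mu - lattice_pt L m n) ^ 1))%C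
      by (simpl; field; auto).
    rewrite !Cmod_mult, Cmod_R, Rabs_pos_eq by lra.
    assert (P := Cmod_ge_0 mu).
    apply Rle_trans with (2 * Cmod mu * (/ d ^ 1 * / size m n ^ 1 * (/ e ^ 1 * / size m n ^ 1))).
    - apply Rmult_le_compat_l; [lra|]. apply Rmult_le_compat; auto; apply Cmod_ge_0.
    - right. field. repeat split; lra. }
  assert (HT : forall z m' n', off L gall (z - mu)%C /\ off L gall (z + mu)%C ->
    Lsum (fun m n => (/ (z - mu - lattice_pt L (m + m') (n + n')) - / (z + mu - lattice_pt L (m + m') (n + n')) -
      (/ (z - mu - lattice_pt L m n) - / (z + mu - lattice_pt L m n)))%C) = RtoC 0 ->
    wzeta3 mu (z - lattice_pt L m' n')%C = wzeta3 mu z).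
  { intros z m' n' [H1 H2] H0.
    assert (H1' : off L gall (z - lattice_pt L m' n' - mu)%C).
    { replace (z - lattice_pt L m' n' - mu)%C with (z - mu - lattice_pt L m' n')%C by ring.
      now apply off_sub_lattice_pt'. }
    assert (H2' : off L gall (z - lattice_pt L m' n' + mu)%C).
    { replace (z - lattice_pt L m' n' + mu)%C with (z + mu - lattice_pt L m' n')%C by ring.
      now apply off_sub_lattice_pt'. }
    unfold wzeta3. f_equal.
    rewrite !wzeta_Lsum by (auto; now apply off_gall_gz).
    rewrite <- !Lsum_minus by (auto; apply zeta_term_dom; auto; now apply off_gall_gz).
    assert (DD : forall y, off L gall (y - mu)%C -> off L gall (y + mu)%C ->
       dom (fun m n => zeta_term L m n (y - mu) - zeta_term L m n (y + mu))%C).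
    { intros y K1 K2. apply (dom_ext (fun m n => zeta_term L m n (y - mu) + -(1) * zeta_term L m n (y + mu))%C);
        [intros; ring|]. apply dom_plus; [|apply dom_scal]; apply zeta_term_dom; auto; now apply off_gall_gz. }
    match goal with |- ?a = ?b => assert (E : (a - b)%C = RtoC 0) end.
    - rewrite <- Lsum_minus by auto. rewrite <- H0. apply Lsum_ext. intros m n.
      unfold zeta_term. rewrite !lattice_pt_plus.
      destruct (origin m n) eqn:E.
      + unfold origin in E. rewrite Bool.andb_true_iff, !Z.eqb_eq in E. destruct E as [-> ->].
        rewrite lattice_pt_0.
        replace (z - lattice_pt L m' n' - mu)%C with (z - mu - (0 + lattice_pt L m' n'))%C by ring.
        replace (z - lattice_pt L m' n' + mu)%C with (z + mu - (0 + lattice_pt L m' n'))%C by ring.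
        replace (z - mu - 0)%C with (z - mu)%C by ring. replace (z + mu - 0)%C with (z + mu)%C by ring.
        reflexivity.
      + replace (z - lattice_pt L m' n' - mu - lattice_pt L m n)%C
          with (z - mu - (lattice_pt L m n + lattice_pt L m' n'))%C by ring.
        replace (z - lattice_pt L m' n' + mu - lattice_pt L m n)%C
          with (z + mu - (lattice_pt L m n + lattice_pt L m' n'))%C by ring.
        unfold Cdiv. ring.
    - match goal with |- ?a = ?b => replace a with ((a - b) + b)%C by ring end. rewrite E. ring. }
  apply (periodic_from_generators L (wzeta3 mu)); auto.
  - intros z Hz. apply HT; auto. destruct (HF z (proj1 Hz) (proj2 Hz)) as [K HK].
    apply (telescoping_zero_1 _ _ K HK). intros m n.
    replace (n + 0)%Z with n by lia. reflexivity.
  - intros z Hz. apply HT; auto. destruct (HF z (proj1 Hz) (proj2 Hz)) as [K HK].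
    apply (telescoping_zero_2 _ _ K HK). intros m n.
    replace (m + 0)%Z with m by lia. reflexivity.
Qed.
End Identity.

Lemma wpR_0 L : wpR L 0 = RtoC 0.
Proof.
  unfold wpR. transitivity (Lsum (fun _ _ => RtoC 0)).
  - apply Lsum_ext. intros m n. unfold wpR_term. destruct (origin m n); auto.
    replace ((0 - lattice_pt L m n) * (0 - lattice_pt L m n))%C with (lattice_pt L m n * lattice_pt L m n)%C by ring.
    ring.
  - apply clim_CLim. intros e He. exists 0%nat. intros N _. unfold sq.
    assert (Z : forall N, sZ (fun _ => RtoC 0) N = RtoC 0).
    { induction N0 as [|N0 IH]; [apply sZ_O|]. rewrite sZ_C_S, IH. eqring. }
    rewrite (sZ_ext _ (fun _ => RtoC 0)) by (intros; apply Z). rewrite Z.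
    replace (0 - 0)%C with (RtoC 0) by ring. now rewrite Cmod_0.
Qed.

(** * The addition identity and the third derivative of wp *)

Section Elliptic.
Variable L : lattice.
Hypothesis HL : nondegenerate L.

Lemma near'_off_shift p q : (exists m n, (p + q)%C = lattice_pt L m n) ->
  near' p (fun z => off L gall (z + q)%C).
Proof.
  intros [m [n E]]. destruct (near'_0_off L HL) as [d [Hd H]].
  exists d. split; auto. intros h Hh H0.
  replace (p + h + q)%C with ((0 + h) + (p + q))%C by ring. rewrite E. apply off_gall_shift. auto.
Qed.

Lemma near'_off p q : near' p (fun z => off L gall (z + q)%C).
Proof.
  destruct (classic (off L gall (p + q)%C)) as [H|H].
  - apply near_near', near_shift, off_near; auto.
  - apply near'_off_shift. now apply not_off_gall.
Qed.

Lemma near'_off_0 p : near' p (off L gall).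
Proof.
  eapply near'_impl; [|apply (near'_off p 0)]. intros z H. cbv beta in H. now replace (z + 0)%C with z in H by ring.
Qed.

Lemma near'_ne p : near' p (fun z => z <> p).
Proof.
  exists 1. split; [lra|]. intros h _ H0 E. apply H0.
  replace h with ((p + h) - p)%C by ring. rewrite E. ring.
Qed.

(** For admissible [mu] it is elliptic, has only removable singularities and tends to 0 at 0, so
    Liouville's theorem makes it vanish. *)
Definition elliptic_defect (mu z : C) : C :=
  ((wp L z - wp L mu) * wzeta3 L mu z - wpd L mu)%C.

(** The factor [z^2] of [wzeta3] absorbs the double pole of [wp]; what remains at 0 is
    [2 * inv_zeta L mu 2 0 - wpd L mu], which is 0. *)
Lemma elliptic_defect_at_0 mu : off L gall mu ->
  exists F, cC1 F 0 /\ near' 0 (fun z => elliptic_defect mu z = F z) /\ F 0 = RtoC 0.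
Proof.
  intros Hmu.
  exists (fun z => (1 + z * z * (wpR L z - wp L mu)) * (inv_zeta L mu 2 z + inv_zeta L mu 2 (0 - z)) - wpd L mu)%C.
  assert (Hm : off L gall (0 - mu)%C).
  { replace (0 - mu)%C with (- mu)%C by ring. now apply off_gall_opp. }
  assert (Q1 : cC1 (inv_zeta L mu 2) 0) by (apply inv_zeta_cC1; auto).
  split; [|split].
  - apply cC1_minus; [|apply cC1_const]. apply cC1_mult.
    + apply cC1_plus; [apply cC1_const|]. apply cC1_mult; [apply cC1_mult; apply cC1_id|].
      apply cC1_minus; [|apply cC1_const]. apply wpR_cC1; auto. now apply off_gz_0.
    + apply cC1_plus; auto. apply cC1_reflect. now replace (0 - 0)%C with (RtoC 0) by ring.
  - assert (A := near'_off_0 0). assert (B := near'_off 0 mu). assert (D := near'_off 0 (- mu)).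
    eapply near'_impl; [|apply (near'_and _ _ _ A (near'_and _ _ _ B D))].
    intros z [Hz [H2 H1]]. change (off L gall (z - mu)%C) in H1.
    unfold elliptic_defect. rewrite wzeta3_square by auto.
    replace (- z)%C with (0 - z)%C by ring. rewrite wp_wpR.
    assert (z <> RtoC 0) by now apply off_gall_ne0 in Hz. field. auto.
  - replace (0 - 0)%C with (RtoC 0) by ring. rewrite inv_zeta_0 by auto. unfold wpd. ring.
Qed.

(** The simple pole of [zeta (z - mu)] meets the zero of [wp z - wp mu]. The condition on [mu + mu]
    keeps [zeta (z + mu)] regular at [mu]. *)
Lemma elliptic_defect_at_mu mu : off L gall mu -> off L gall (mu + mu)%C ->
  exists F, cC1 F mu /\ near' mu (fun z => elliptic_defect mu z = F z).
Proof.
  intros Hmu H2mu.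
  exists (fun z => - wp_quot L mu z * (1 + (z - mu) * (zetaR L (z - mu) - wzeta L (z + mu) + 2 * wzeta L mu))
    - wpd L mu)%C.
  split.
  - apply cC1_minus; [|apply cC1_const]. apply cC1_mult.
    + apply cC1_opp. now apply wp_quot_cC1.
    + apply cC1_plus; [apply cC1_const|]. apply cC1_mult.
      * apply cC1_minus; [apply cC1_id|apply cC1_const].
      * apply cC1_plus; [|apply cC1_const]. apply cC1_minus.
        -- apply (cC1_shift (zetaR L) mu (- mu)). apply zetaR_cC1; auto.
           replace (mu + - mu)%C with (RtoC 0) by ring. now apply off_gz_0.
        -- apply cC1_shift, wzeta_cC1; auto.
  - assert (A := near'_off_0 mu). assert (B := near'_ne mu).
    eapply near'_impl; [|apply (near'_and _ _ _ A B)].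
    intros z [Hz Hne]. unfold elliptic_defect. rewrite wp_quot_spec by auto.
    unfold wzeta3. rewrite (wzeta_zetaR L (z - mu)).
    assert ((z - mu)%C <> 0).
    { intro E. apply Hne. replace z with ((z - mu) + mu)%C by ring. rewrite E. ring. }
    field. auto.
Qed.

Lemma elliptic_defect_even mu z : off L gall (z - mu)%C -> off L gall (z + mu)%C ->
  elliptic_defect mu (- z) = elliptic_defect mu z.
Proof. intros H1 H2. unfold elliptic_defect. rewrite wp_even, wzeta3_even; auto. Qed.

Lemma elliptic_defect_periodic mu p m n :
  near' p (fun z => elliptic_defect mu (z + lattice_pt L m n)%C = elliptic_defect mu z).
Proof.
  assert (A := near'_off_0 p). assert (B := near'_off p mu). assert (D := near'_off p (- mu)).
  eapply near'_impl; [|apply (near'_and _ _ _ A (near'_and _ _ _ B D))].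
  intros z [Hz [H2 H1]]. change (off L gall (z - mu)%C) in H1.
  unfold elliptic_defect. rewrite wp_periodic, wzeta3_periodic; auto.
Qed.

(** The possible singularities are the classes of 0, [mu] and [- mu]. Periodicity carries each local
    extension over its class, and evenness carries the one at [mu] to [- mu]. *)
Lemma elliptic_defect_zero mu p : off L gall mu -> off L gall (mu + mu)%C ->
  near' p (fun z => elliptic_defect mu z = RtoC 0).
Proof.
  intros Hmu H2mu. destruct (elliptic_defect_at_0 mu Hmu) as [F0 [HF1 [HF2 HF3]]].
  destruct (elliptic_defect_at_mu mu Hmu H2mu) as [F1 [HG1 HG2]].
  assert (HT : forall p m n, (exists F, cC1 F p /\ near' p (fun z => elliptic_defect mu z = F z)) ->
     exists F, cC1 F (p + lattice_pt L m n)%C /\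
       near' (p + lattice_pt L m n)%C (fun z => elliptic_defect mu z = F z)).
  { intros q m n [F [H1 H2]]. exists (fun z => F (z + - lattice_pt L m n)%C). split.
    - apply cC1_shift. now replace (q + lattice_pt L m n + - lattice_pt L m n)%C with q by ring.
    - assert (K := elliptic_defect_periodic mu (q + lattice_pt L m n) (- m) (- n)).
      assert (K2 : near' (q + lattice_pt L m n)%C
        (fun z => elliptic_defect mu (z + - lattice_pt L m n)%C = F (z + - lattice_pt L m n)%C)).
      { apply (near'_shift (fun z => elliptic_defect mu z = F z)).
        now replace (q + lattice_pt L m n + - lattice_pt L m n)%C with q by ring. }
      eapply near'_impl; [|apply (near'_and _ _ _ K K2)].
      intros z [E1 E2]. cbv beta in *. rewrite lattice_pt_opp in E1. congruence. }
  destruct (elliptic_constant L (elliptic_defect mu) HL) as [c Hc].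
  - intros; apply elliptic_defect_periodic.
  - intros q.
    destruct (classic (off L gall q)) as [Hq|Hq].
    2:{ destruct (not_off_gall _ _ Hq) as [m [n ->]].
        replace (lattice_pt L m n) with (0 + lattice_pt L m n)%C by ring. apply HT. now exists F0. }
    destruct (classic (off L gall (q - mu)%C)) as [Hq1|Hq1].
    2:{ destruct (not_off_gall _ _ Hq1) as [m [n E]].
        replace q with (mu + lattice_pt L m n)%C by (rewrite <- E; ring). apply HT. now exists F1. }
    destruct (classic (off L gall (q + mu)%C)) as [Hq2|Hq2].
    2:{ destruct (not_off_gall _ _ Hq2) as [m [n E]].
        replace q with (- mu + lattice_pt L m n)%C by (rewrite <- E; ring). apply HT.
        exists (fun z => F1 (0 - z)%C). split.
        - apply cC1_reflect. now replace (0 - - mu)%C with mu by ring.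
        - assert (K : near' (- mu)%C (fun z => elliptic_defect mu (- z)%C = F1 (0 - z)%C)).
          { destruct HG2 as [d [Hd HG2]]. exists d. split; auto. intros h Hh H0.
            replace (0 - (- mu + h))%C with (mu + - h)%C by ring.
            replace (- (- mu + h))%C with (mu + - h)%C by ring. apply HG2; [now rewrite Cmod_opp|].
            intro E0. apply H0. replace h with (- - h)%C by ring. rewrite E0. ring. }
          assert (B := near'_off (- mu)%C mu). assert (D := near'_off (- mu)%C (- mu)).
          eapply near'_impl; [|apply (near'_and _ _ _ K (near'_and _ _ _ B D))].
          intros z [E1 [E2 E3]]. cbv beta in *. rewrite <- E1. symmetry. now apply elliptic_defect_even. }
    exists (elliptic_defect mu). split.
    + apply cC1_minus; [|apply cC1_const]. apply cC1_mult.
      * apply cC1_minus; [|apply cC1_const]. now apply wp_cC1.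
      * apply cC1_plus; [|apply cC1_const]. apply cC1_minus.
        -- apply (cC1_shift (wzeta L) q (- mu)), wzeta_cC1; auto.
        -- apply cC1_shift, wzeta_cC1; auto.
    + exists 1. split; [lra|]. auto.
  (* The constant is identified as the value at 0 of the extension [F0]. *)
  - replace (RtoC 0) with c; auto. rewrite <- HF3. symmetry.
    apply (ccont_eq_near' F0 (fun _ => c)).
    + now apply cC1_ccont.
    + apply ccont_const.
    + eapply near'_impl; [|apply (near'_and _ _ _ HF2 (Hc 0))]. intros z [A B]. cbv beta in *. congruence.
Qed.

Theorem wp_addition mu z :
  off L gall mu -> off L gall (mu + mu)%C ->
  off L gall z -> off L gall (z - mu)%C -> off L gall (z + mu)%C ->
  ((wp L z - wp L mu) * wzeta3 L mu z)%C = wpd L mu.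
Proof.
  intros Hmu H2mu Hz H1 H2.
  assert (E : elliptic_defect mu z = RtoC 0).
  { apply (ccont_eq_near' (elliptic_defect mu) (fun _ => RtoC 0)).
    - apply cC1_ccont. apply cC1_minus; [|apply cC1_const]. apply cC1_mult.
      + apply cC1_minus; [|apply cC1_const]. now apply wp_cC1.
      + apply cC1_plus; [|apply cC1_const]. apply cC1_minus.
        * apply (cC1_shift (wzeta L) z (- mu)), wzeta_cC1; auto.
        * apply cC1_shift, wzeta_cC1; auto.
    - apply ccont_const.
    - now apply elliptic_defect_zero. }
  unfold elliptic_defect in E.
  replace (wpd L mu) with (((wp L z - wp L mu) * wzeta3 L mu z)
    - ((wp L z - wp L mu) * wzeta3 L mu z - wpd L mu))%C by ring.
  rewrite E. ring.
Qed.

(** The next coefficient at 0: subtracting from the even sum its value at 0 leaves [z^2] times the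
    sum with weights [a^(-4)]. *)
Lemma inv_zeta_difference mu z : off L gall mu -> off L gall (z - mu)%C -> off L gall (z + mu)%C ->
  (inv_zeta L mu 2 z + inv_zeta L mu 2 (- z) - wpd L mu)%C
  = (z * z * (inv_zeta L mu 4 z + inv_zeta L mu 4 (- z)))%C.
Proof.
  intros Hmu H1 H2. assert (H3 := off_gall_reflect L z mu H2).
  assert (E : wpd L mu = (2 * inv_zeta L mu 2 0)%C).
  { rewrite inv_zeta_0 by auto. unfold wpd. ring. }
  assert (H4 : off L gall (0 - mu)%C).
  { replace (0 - mu)%C with (- mu)%C by ring. now apply off_gall_opp. }
  rewrite E. replace (inv_zeta L mu 2 z + inv_zeta L mu 2 (- z) - 2 * inv_zeta L mu 2 0)%C
    with (inv_zeta L mu 2 z + inv_zeta L mu 2 (- z) + - (2) * inv_zeta L mu 2 0)%C by ring.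
  unfold inv_zeta, PSum, gall.
  assert (D1 := inv_zeta_dom L HL mu 2 z Hmu (le_n 2) H1).
  assert (D2 := inv_zeta_dom L HL mu 2 (- z) Hmu (le_n 2) H3).
  assert (D3 := inv_zeta_dom L HL mu 2 0 Hmu (le_n 2) H4).
  assert (D4 := inv_zeta_dom L HL mu 4 z Hmu ltac:(lia) H1).
  assert (D5 := inv_zeta_dom L HL mu 4 (- z) Hmu ltac:(lia) H3).
  rewrite <- (Lsum_scal (- (2))) by auto.
  rewrite <- Lsum_plus by auto. rewrite <- Lsum_plus; [|now apply dom_plus|now apply dom_scal].
  rewrite <- Lsum_plus by auto. rewrite <- Lsum_scal by now apply dom_plus.
  apply Lsum_ext. intros m n.
  assert (N1 := off_gall_plus_ne L mu m n Hmu).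
  assert (N2 := off_gall_minus_ne L _ m n H1). assert (N3 := off_gall_minus_ne L _ m n H3).
  replace (z - mu - lattice_pt L m n)%C with (z - (mu + lattice_pt L m n))%C in * by ring.
  replace (- z - mu - lattice_pt L m n)%C with (- z - (mu + lattice_pt L m n))%C in * by ring.
  replace (0 - mu - lattice_pt L m n)%C with (- (mu + lattice_pt L m n))%C in * by ring.
  set (a := (mu + lattice_pt L m n)%C) in *. simpl. field. repeat split; auto.
Qed.

(** Comparison of the coefficients of [z^2] in the addition identity. With [S] and [V] the even sums
    of weights [a^(-2)] and [a^(-4)], it reads [V = (wp mu - wpR z) S], and [wpR] vanishes at 0.
    This is [wp''' = 12 wp wp'], reached without Eisenstein series. *)
Lemma Epow_5_generic mu : off L gall mu -> off L gall (mu + mu)%C ->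
  Epow L gall 5 mu = (wp L mu * Epow L gall 3 mu)%C.
Proof.
  intros Hmu H2mu.
  assert (Hm : off L gall (0 - mu)%C).
  { replace (0 - mu)%C with (- mu)%C by ring. now apply off_gall_opp. }
  assert (E : (fun z => inv_zeta L mu 4 z + inv_zeta L mu 4 (0 - z))%C 0 =
    (fun z => (wp L mu - wpR L z) * (inv_zeta L mu 2 z + inv_zeta L mu 2 (0 - z)))%C 0).
  { apply (ccont_eq_near' (fun z => inv_zeta L mu 4 z + inv_zeta L mu 4 (0 - z))%C
      (fun z => (wp L mu - wpR L z) * (inv_zeta L mu 2 z + inv_zeta L mu 2 (0 - z)))%C).
    - apply ccont_plus; [now apply inv_zeta_ccont; auto; lia|].
      apply ccont_reflect. replace (0 - 0)%C with (RtoC 0) by ring. apply inv_zeta_ccont; auto; lia.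
    - apply ccont_mult; [apply cC1_ccont, cC1_minus; [apply cC1_const|apply wpR_cC1; auto; now apply off_gz_0]|].
      apply ccont_plus; [now apply inv_zeta_ccont; auto; lia|].
      apply ccont_reflect. replace (0 - 0)%C with (RtoC 0) by ring. apply inv_zeta_ccont; auto; lia.
    - assert (A := near'_off_0 0). assert (B := near'_off 0 mu). assert (D := near'_off 0 (- mu)).
      eapply near'_impl; [|apply (near'_and _ _ _ A (near'_and _ _ _ B D))].
      intros z [Hz [H2 H1]]. change (off L gall (z - mu)%C) in H1.
      replace (0 - z)%C with (- z)%C by ring.
      assert (K := wp_addition mu z Hmu H2mu Hz H1 H2). rewrite wzeta3_square in K by auto.
      assert (K2 := inv_zeta_difference mu z Hmu H1 H2). rewrite <- K in K2. rewrite wp_wpR in K2.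
      assert (z <> RtoC 0) by now apply off_gall_ne0 in Hz.
      set (S := (inv_zeta L mu 2 z + inv_zeta L mu 2 (- z))%C) in *.
      set (V := (inv_zeta L mu 4 z + inv_zeta L mu 4 (- z))%C) in *.
      replace V with ((z * z * V) / (z * z))%C by (field; auto). rewrite <- K2. field. auto. }
  cbv beta in E. replace (0 - 0)%C with (RtoC 0) in E by ring.
  rewrite (inv_zeta_0 L HL mu 4 Hmu ltac:(lia)), (inv_zeta_0 L HL mu 2 Hmu (le_n 2)), wpR_0 in E.
  replace (Epow L gall 5 mu) with (- (1 / 2) * (- Epow L gall 5 mu + - Epow L gall 5 mu))%C by field.
  rewrite E. field.
Qed.

(** Half-periods are excluded from the generic case and recovered by continuity. *)
Lemma Epow_5 mu : off L gall mu -> Epow L gall 5 mu = (wp L mu * Epow L gall 3 mu)%C.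
Proof.
  intros Hmu. apply (ccont_eq_near' (Epow L gall 5) (fun z => wp L z * Epow L gall 3 z)%C).
  - apply (cderiv_ccont _ _ _ (Epow_cderiv L HL 5 mu ltac:(lia) Hmu)).
  - apply ccont_mult; [apply cC1_ccont, wp_cC1; auto|].
    apply (cderiv_ccont _ _ _ (Epow_cderiv L HL 3 mu ltac:(lia) Hmu)).
  - assert (A := near_near' _ _ (off_near L gall mu HL Hmu)).
    assert (B : near' mu (fun z => off L gall (z + z)%C)).
    { destruct (near'_off (mu + mu)%C 0) as [d [Hd H]]. exists (d / 2). split; [lra|]. intros h Hh H0.
      replace (mu + h + (mu + h))%C with (mu + mu + (2 * h) + 0)%C by ring. apply H.
      - rewrite Cmod_mult, Cmod_R, Rabs_pos_eq; lra.
      - apply Cmult_neq_0; auto. intro E. apply RtoC_inj in E. lra. }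
    eapply near'_impl; [|apply (near'_and _ _ _ A B)].
    intros z [H1 H2]. now apply Epow_5_generic.
Qed.

Definition wpdd (z : C) : C := (6 * Epow L gall 4 z)%C.

Lemma wpd_cderiv z : off L gall z -> cderiv (wpd L) z (wpdd z).
Proof.
  intros Hz. unfold wpd, wpdd.
  apply (cderiv_eq _ _ (0 * Epow L gall 3 z + - (2) * (- RtoC (INR 3) * Epow L gall 4 z))%C).
  - replace (INR 3) with 3 by (simpl; ring). ring.
  - apply (cderiv_mult (fun _ => - (2))%C (Epow L gall 3)); [apply cderiv_const|].
    apply Epow_cderiv; auto.
Qed.

Lemma wpdd_cderiv z : off L gall z -> cderiv wpdd z (12 * wp L z * wpd L z)%C.
Proof.
  intros Hz. unfold wpd, wpdd.
  apply (cderiv_eq _ _ (0 * Epow L gall 4 z + 6 * (- RtoC (INR 4) * Epow L gall 5 z))%C).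
  - rewrite Epow_5 by auto. replace (INR 4) with 4 by (simpl; ring). ring.
  - apply (cderiv_mult (fun _ => RtoC 6)%C (Epow L gall 4)); [apply cderiv_const|].
    apply Epow_cderiv; auto.
Qed.

Lemma wpd_periodic m n z : off L gall z -> wpd L (z + lattice_pt L m n)%C = wpd L z.
Proof.
  intros Hz. apply (cderiv_unique (wp L) z).
  - apply (cderiv_near (fun z => wp L (z + lattice_pt L m n)%C)).
    + eapply near_impl; [|apply (off_near L gall z HL Hz)]. intros y Hy. now apply wp_periodic.
    + apply cderiv_shift, wp_cderiv; auto. now apply off_gall_shift.
  - now apply wp_cderiv.
Qed.

Lemma wpd_odd z : off L gall z -> wpd L (- z) = (- wpd L z)%C.
Proof.
  intros Hz. assert (H := cderiv_reflect (wp L) z 0 (wpd L (- z))).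
  assert (K : cderiv (wp L) z (- wpd L (- z))%C).
  { apply (cderiv_ext (fun z => wp L (0 - z)%C)).
    - intros y. replace (0 - y)%C with (- y)%C by ring. apply wp_even.
    - apply H. replace (0 - z)%C with (- z)%C by ring. apply wp_cderiv; auto. now apply off_gall_opp. }
  rewrite (cderiv_unique _ _ _ _ (wp_cderiv L HL z Hz) K). ring.
Qed.
End Elliptic.

Lemma cderiv_C_derive f z l : cderiv f z l -> C_derive f z = l.
Proof.
  intros H. apply is_C_derive_unique. split.
  - apply is_linear_scal_l.
  - intros x Hx. rewrite <- (is_filter_lim_locally_unique _ _ Hx). clear x Hx.
    intros e. destruct (H e (cond_pos e)) as [d [Hd H']].
    exists (mkposreal d Hd). intros y' Hy. set (y := y' : C).
    change (Cmod (y - z)%C < d) in Hy.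
    change (Cmod (f y - f z - (y - z) * l)%C <= e * Cmod (y - z)%C).
    specialize (H' _ Hy). now replace (z + (y - z))%C with y in H' by ring.
Qed.

Lemma wp'_wpd L z : nondegenerate L -> off L gall z -> wp' L z = wpd L z.
Proof. intros HL Hz. apply cderiv_C_derive. now apply wp_cderiv. Qed.

(** * Rhombic lattices *)

(** The two lattices of the statement are scaled copies of each other: [l = 1] gives [Ltilde], and
    [l = lambda] gives [Lat] by conversion. *)
Definition rhombic (l t : R) : lattice :=
  Lattice (2 * (l * (1 - Ci * t)))%C (2 * (l * (1 + Ci * t)))%C.

Lemma Ltilde_rhombic t : Ltilde t = rhombic 1 t.
Proof. unfold Ltilde, rhombic. f_equal; ring. Qed.

Lemma rhombic_pt l t m n :
  lattice_pt (rhombic l t) m n = (2 * l * (IZR m + IZR n), 2 * l * t * (IZR n - IZR m))%R.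
Proof.
  unfold lattice_pt, rhombic, Ci, RtoC, Cplus, Cmult, Cminus, Copp; simpl. f_equal; ring.
Qed.

Lemma rhombic_pt_scale l t m n : lattice_pt (rhombic l t) m n = (l * lattice_pt (rhombic 1 t) m n)%C.
Proof.
  rewrite !rhombic_pt. unfold RtoC, Cmult; simpl. f_equal; ring.
Qed.

Lemma rhombic_nondegenerate l t : 0 < l -> 0 < t -> nondegenerate (rhombic l t).
Proof.
  intros Hl Ht. unfold nondegenerate, rhombic, Ci, RtoC, Re, Im; simpl.
  match goal with |- ?x <> 0 => replace x with (8 * (l * l * t)) by ring end.
  assert (0 < l * l * t) by (repeat apply Rmult_lt_0_compat; auto). lra.
Qed.

(** The real lattice points are those with [m = n], that is, the multiples of [4 l]. *)
Lemma rhombic_off_real l t x : 0 < l -> 0 < t -> 0 < x < 4 * l -> off (rhombic l t) gall (RtoC x).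
Proof.
  intros Hl Ht Hx m n _ E. rewrite rhombic_pt in E. unfold RtoC in E. injection E. intros E2 E1.
  assert (Hlt : 0 < 2 * l * t) by (repeat apply Rmult_lt_0_compat; lra).
  assert (Hmn : IZR n - IZR m = 0) by nra.
  rewrite <- minus_IZR in Hmn. apply eq_IZR in Hmn.
  replace n with m in E1 by lia.
  assert (0 < IZR m) by nra. assert (IZR m < 1) by nra.
  apply lt_IZR in H, H0. lia.
Qed.

(** The lattice lies on the vertical lines with abscissa in [2 l Z] and, as used below, on the
    horizontal lines with ordinate in [2 l t Z]. The strips between them serve as domains without
    poles. *)
Lemma rhombic_off_Re l t z : 0 < l -> 0 < Re z < 2 * l -> off (rhombic l t) gall z.
Proof.
  intros Hl Hz m n _ E. rewrite rhombic_pt in E. rewrite E in Hz. unfold Re in Hz; simpl in Hz.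
  rewrite <- plus_IZR in Hz.
  assert (H : 0 < IZR (m + n)) by nra. assert (H0 : IZR (m + n) < 1) by nra.
  apply lt_IZR in H, H0. lia.
Qed.

Lemma rhombic_off_Im l t z : 0 < l -> 0 < t -> 0 < Im z < 2 * l * t -> off (rhombic l t) gall z.
Proof.
  intros Hl Ht Hz m n _ E. rewrite rhombic_pt in E. rewrite E in Hz. unfold Im in Hz; simpl in Hz.
  rewrite <- minus_IZR in Hz. assert (P : 0 < 2 * l * t) by (repeat apply Rmult_lt_0_compat; lra).
  assert (H : 0 < IZR (n - m)) by nra. assert (H0 : IZR (n - m) < 1) by nra.
  apply lt_IZR in H, H0. lia.
Qed.

Lemma Cconj_inv_total (x : C) : Cconj (/ x) = (/ Cconj x)%C.
Proof.
  destruct x as [a b]. unfold Cconj, Cinv; simpl.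
  replace (- b * (- b * 1)) with (b * (b * 1)) by ring. f_equal. unfold Rdiv; ring.
Qed.

Lemma rhombic_pt_conj l t m n : Cconj (lattice_pt (rhombic l t) m n) = lattice_pt (rhombic l t) n m.
Proof. rewrite !rhombic_pt. unfold Cconj; simpl. f_equal; ring. Qed.

Lemma origin_sym m n : origin m n = origin n m.
Proof. unfold origin. apply Bool.andb_comm. Qed.

Section Rhombic.
Variables l t : R.
Hypothesis Hl : 0 < l.
Hypothesis Ht : 0 < t.
Let L := rhombic l t.
Let HL : nondegenerate L := rhombic_nondegenerate l t Hl Ht.

(** Conjugation exchanges the two generators, hence the exchange of indices in the sum. *)
Lemma wp_conj z : off L gz z -> wp L (Cconj z) = Cconj (wp L z).
Proof.
  intros Hz. rewrite !wp_wpR, Cplus_conj. f_equal.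
  - now rewrite Cconj_inv_total, Cmult_conj.
  - unfold wpR. rewrite <- Lsum_conj by now apply wpR_dom.
    rewrite <- (Lsum_swap (fun m n => wpR_term L m n (Cconj z))). apply Lsum_ext. intros m n.
    unfold wpR_term. rewrite (origin_sym n m). destruct (origin m n).
    + unfold Cconj; simpl. unfold RtoC. f_equal; ring.
    + unfold L. rewrite <- rhombic_pt_conj. fold L.
      now rewrite Cminus_conj, !Cconj_inv_total, !Cmult_conj, !Cminus_conj.
Qed.

Lemma wzeta_conj z : off L gz z -> wzeta L (Cconj z) = Cconj (wzeta L z).
Proof.
  intros Hz. rewrite !wzeta_zetaR, Cplus_conj. f_equal.
  - now rewrite Cconj_inv_total.
  - unfold zetaR. rewrite <- Lsum_conj by now apply zetaR_dom.
    rewrite <- (Lsum_swap (fun m n => zetaR_term L m n (Cconj z))). apply Lsum_ext. intros m n.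
    unfold zetaR_term. rewrite (origin_sym n m). destruct (origin m n).
    + unfold Cconj; simpl. unfold RtoC. f_equal; ring.
    + unfold L. rewrite <- rhombic_pt_conj. fold L. unfold Cdiv.
      now rewrite !Cplus_conj, !Cmult_conj, !Cconj_inv_total, !Cmult_conj, !Cminus_conj.
Qed.

Lemma Cconj_pow (x : C) k : Cconj (x ^ k) = (Cconj x ^ k)%C.
Proof. apply Cpow_conj. Qed.

Lemma Epow_conj k z : (3 <= k)%nat -> off L gall z ->
  Epow L gall k (Cconj z) = Cconj (Epow L gall k z).
Proof.
  intros Hk Hz. unfold Epow, PSum, gall.
  rewrite <- Lsum_conj by (apply (PSum_dom L (fun _ _ => RtoC 1) gall 0 k z HL (cdom_1 _)); auto).
  rewrite <- (Lsum_swap (fun m n => (1 * / (Cconj z - lattice_pt L m n) ^ k)%C)).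
  apply Lsum_ext. intros m n. unfold L. rewrite <- rhombic_pt_conj. fold L.
  rewrite Cmult_conj, Cconj_inv_total, Cconj_pow, Cminus_conj. f_equal.
  unfold Cconj, RtoC; simpl. f_equal; ring.
Qed.

Lemma Cconj_RtoC (x : R) : Cconj x = RtoC x.
Proof. unfold Cconj, RtoC; simpl. f_equal; ring. Qed.

Lemma real_of_conj (z : C) : Cconj z = z -> z = RtoC (Re z).
Proof. destruct z as [a b]. unfold Cconj, RtoC, Re; simpl. intros H. injection H. intros. f_equal. lra. Qed.

Lemma wp_real (x : R) : off L gall x -> wp L x = RtoC (Re (wp L x)).
Proof.
  intros Hx. apply real_of_conj. rewrite <- wp_conj by now apply off_gall_gz. now rewrite Cconj_RtoC.
Qed.

Lemma wzeta_real (x : R) : off L gall x -> wzeta L x = RtoC (Re (wzeta L x)).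
Proof.
  intros Hx. apply real_of_conj. rewrite <- wzeta_conj by now apply off_gall_gz. now rewrite Cconj_RtoC.
Qed.

Lemma Epow_real k (x : R) : (3 <= k)%nat -> off L gall x -> Epow L gall k x = RtoC (Re (Epow L gall k x)).
Proof.
  intros Hk Hx. apply real_of_conj. rewrite <- Epow_conj by auto. now rewrite Cconj_RtoC.
Qed.

Lemma wpd_real (x : R) : off L gall x -> wpd L x = RtoC (Re (wpd L x)).
Proof.
  intros Hx. unfold wpd. rewrite Epow_real by auto.
  generalize (Re (Epow L gall 3 x)). intros y. unfold RtoC, Re, Cmult, Copp; simpl. f_equal; ring.
Qed.

Lemma wpdd_real (x : R) : off L gall x -> wpdd L x = RtoC (Re (wpdd L x)).
Proof.
  intros Hx. unfold wpdd. rewrite Epow_real by auto.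
  generalize (Re (Epow L gall 4 x)). intros y. unfold RtoC, Re, Cmult, Copp; simpl. f_equal; ring.
Qed.

Let L1 := rhombic 1 t.
Let HL1 : nondegenerate L1 := rhombic_nondegenerate 1 t Rlt_0_1 Ht.

Lemma RtoC_l_ne : RtoC l <> RtoC 0.
Proof. intro E. apply RtoC_inj in E. lra. Qed.

Lemma Cinv_scale (x : C) : (/ (l * x) = / l * / x)%C.
Proof.
  (* At [x = 0] both sides are 0, because the inverse of 0 is 0; the scaling lemmas then need no
     side condition on each term. *)
  destruct (Ceq_dec x 0) as [->|Hx].
  - replace (RtoC l * 0)%C with (RtoC 0) by ring.
    assert (E : (/ RtoC 0)%C = RtoC 0) by (unfold Cinv, RtoC; simpl; f_equal; unfold Rdiv; ring).
    rewrite E. ring.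
  - field. split; auto. apply RtoC_l_ne.
Qed.

Lemma wzeta_scale z : off L1 gz z -> wzeta L (l * z)%C = (/ l * wzeta L1 z)%C.
Proof.
  intros Hz. rewrite !wzeta_zetaR.
  replace (/ l * (/ z + zetaR L1 z))%C with (/ l * / z + / l * zetaR L1 z)%C by ring.
  f_equal.
  - now rewrite Cinv_scale.
  - unfold zetaR. rewrite <- Lsum_scal by now apply zetaR_dom. apply Lsum_ext. intros m n.
    unfold zetaR_term. destruct (origin m n); [ring|].
    unfold L. rewrite rhombic_pt_scale. fold L1. set (w := lattice_pt L1 m n).
    replace (l * z - l * w)%C with (l * (z - w))%C by ring.
    replace (l * w * (l * w))%C with (l * (l * (w * w)))%C by ring.
    unfold Cdiv. rewrite !Cinv_scale.
    replace (l * z * (/ l * (/ l * / (w * w))))%C with ((l * / l) * (/ l * (z * / (w * w))))%C by ring.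
    rewrite Cinv_r by apply RtoC_l_ne. ring.
Qed.

Lemma wpd_scale z : off L1 gall z -> wpd L (l * z)%C = (/ l * / l * / l * wpd L1 z)%C.
Proof.
  intros Hz. unfold wpd, Epow, PSum, gall.
  replace (/ l * / l * / l * (- (2) * Lsum (fun m n : Z => 1 * / (z - lattice_pt L1 m n) ^ 3)))%C
    with (- (2) * ((/ l * / l * / l) * Lsum (fun m n : Z => 1 * / (z - lattice_pt L1 m n) ^ 3)))%C by ring.
  f_equal. rewrite <- Lsum_scal.
  - apply Lsum_ext. intros m n. unfold L. rewrite rhombic_pt_scale. fold L1.
    set (w := lattice_pt L1 m n).
    replace ((l * z - l * w) ^ 3)%C with (l * (l * (l * (z - w) ^ 3)))%C by ring.
    rewrite !Cinv_scale. ring.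
  - apply (PSum_dom L1 (fun _ _ => RtoC 1) gall 0 3 z HL1 (cdom_1 _)); auto.
Qed.
End Rhombic.

(** * The differential equation *)

(** [wp'' - 6 wp^2] has derivative 0 by [wp''' = 12 wp wp']. Its value, classically [- g2 / 2], is
    never computed: only its constancy along segments free of poles is used. *)
Lemma wpdd_transport L z0 z : nondegenerate L ->
  (forall r, 0 <= r <= 1 -> off L gall (z0 + r * (z - z0))%C) ->
  (wpdd L z - 6 * (wp L z * wp L z))%C = (wpdd L z0 - 6 * (wp L z0 * wp L z0))%C.
Proof.
  intros HL H. symmetry.
  apply (cderiv_zero_segment (fun z => wpdd L z - 6 * (wp L z * wp L z))%C).
  intros r Hr. specialize (H r Hr). set (y := (z0 + r * (z - z0))%C) in *.
  apply (cderiv_eq _ _ (12 * wp L y * wpd L y - (0 * (wp L y * wp L y) + 6 * (wpd L y * wp L y + wp L y * wpd L y)))%C);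
    [ring|].
  apply cderiv_minus; [now apply wpdd_cderiv|].
  apply (cderiv_mult (fun _ => RtoC 6) (fun z => wp L z * wp L z)%C); [apply cderiv_const|].
  apply cderiv_mult; now apply wp_cderiv.
Qed.

(** The first integral of [wp'' = 6 wp^2 + g]; its constant, classically [- g3], is expressed by the
    values at a base point. *)
Lemma wpd_transport L z0 z (g : C) : nondegenerate L ->
  (forall r, 0 <= r <= 1 -> off L gall (z0 + r * (z - z0))%C) ->
  (wpdd L z0 - 6 * (wp L z0 * wp L z0))%C = g ->
  (wpd L z * wpd L z - 4 * (wp L z * wp L z * wp L z) - 2 * g * wp L z)%C =
  (wpd L z0 * wpd L z0 - 4 * (wp L z0 * wp L z0 * wp L z0) - 2 * g * wp L z0)%C.
Proof.
  intros HL H Hg. symmetry.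
  apply (cderiv_zero_segment (fun z => wpd L z * wpd L z - 4 * (wp L z * wp L z * wp L z) - 2 * g * wp L z)%C).
  intros r Hr. set (y := (z0 + r * (z - z0))%C) in *.
  assert (Hy : off L gall y) by now apply H.
  assert (E : wpdd L y = (6 * (wp L y * wp L y) + g)%C).
  { rewrite <- Hg, <- (wpdd_transport L z0 y HL); [ring|].
    intros q Hq. unfold y. replace (z0 + q * (z0 + r * (z - z0) - z0))%C with (z0 + (q * r)%R * (z - z0))%C
      by (rewrite RtoC_mult; ring). apply H. nra. }
  apply (cderiv_eq _ _ (wpdd L y * wpd L y + wpd L y * wpdd L y
    - (0 * (wp L y * wp L y * wp L y) + 4 * ((wpd L y * wp L y + wp L y * wpd L y) * wp L y + wp L y * wp L y * wpd L y))
    - (0 * wp L y + 2 * g * wpd L y))%C); [rewrite E; ring|].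
  apply cderiv_minus; [apply cderiv_minus|].
  - apply cderiv_mult; now apply wpd_cderiv.
  - apply (cderiv_mult (fun _ => RtoC 4) (fun z => wp L z * wp L z * wp L z)%C); [apply cderiv_const|].
    apply (cderiv_mult (fun z => wp L z * wp L z)%C (wp L)); [apply cderiv_mult|]; now apply wp_cderiv.
  - apply (cderiv_mult (fun _ => 2 * g)%C (wp L)); [apply cderiv_const|now apply wp_cderiv].
Qed.

Lemma wp_blowup L M : nondegenerate L -> near' 0 (fun z => M < Cmod (wp L z)).
Proof.
  intros HL. assert (Hc := cC1_ccont _ _ (wpR_cC1 L HL 0 (off_gz_0 L HL))).
  destruct (Hc 1 Rlt_0_1) as [d [Hd H]].
  set (K := 1 + Rabs M + 1 + Cmod (wpR L 0)).
  assert (HK : 1 < K) by (unfold K; generalize (Rabs_pos M) (Cmod_ge_0 (wpR L 0)); lra).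
  exists (Rmin d (/ K)). split; [apply Rmin_pos; auto; apply Rinv_0_lt_compat; lra|].
  intros h Hh H0. replace (0 + h)%C with h in * by ring.
  assert (P : 0 < Cmod h) by now apply Cmod_gt_0.
  assert (H1 := H h (Rlt_le_trans _ _ _ Hh (Rmin_l _ _))).
  assert (H2 := Rlt_le_trans _ _ _ Hh (Rmin_r _ _)).
  replace (0 + h)%C with h in H1 by ring.
  rewrite wp_wpR. eapply Rlt_le_trans; [|apply Cmod_sub_ge].
  rewrite Cmod_inv by now apply Cmult_neq_0. rewrite Cmod_mult.
  assert (B : Cmod (wpR L h) <= 1 + Cmod (wpR L 0)).
  { replace (wpR L h) with ((wpR L h - wpR L 0) + wpR L 0)%C by ring.
    eapply Rle_trans; [apply Cmod_triangle|]. lra. }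
  assert (Q : K < / (Cmod h * Cmod h)).
  { rewrite <- (Rinv_inv K). apply Rinv_lt_contravar.
    - apply Rmult_lt_0_compat; [nra|apply Rinv_0_lt_compat; lra].
    - assert (/ K < 1) by (rewrite <- Rinv_1; apply Rinv_lt_contravar; lra).
      assert (0 < / K) by (apply Rinv_0_lt_compat; lra). nra. }
  unfold K in Q. generalize (Rle_abs M). lra.
Qed.

(** [E(t) e^(- K t)] is nonincreasing, nonnegative and starts at 0. *)
Lemma gronwall_zero (E E' : R -> R) (K T : R) : 0 <= T ->
  (forall t, 0 <= t <= T -> is_derive E t (E' t)) ->
  (forall t, 0 <= t <= T -> E' t <= K * E t) ->
  (forall t, 0 <= E t) -> E 0 = 0 -> E T = 0.
Proof.
  intros HT Hd Hle Hp H0.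
  destruct (Req_dec T 0) as [->|HT0]; auto.
  assert (D : forall t, 0 <= t <= T ->
    is_derive (fun t => E t * exp (- K * t)) t ((E' t - K * E t) * exp (- K * t))).
  { intros t Ht. evar_last.
    - apply (is_derive_mult E (fun t => exp (- K * t)) t (E' t) (- K * exp (- K * t)) (Hd t Ht)).
      + auto_derive; auto. ring.
      + intros; apply Rmult_comm.
    - unfold plus, mult; simpl. ring. }
  destruct (MVT_gen (fun t => E t * exp (- K * t)) 0 T (fun t => (E' t - K * E t) * exp (- K * t)))
    as [c [Hc Heq]].
  - intros t Ht. apply D. rewrite Rmin_left, Rmax_right in Ht by auto. lra.
  - intros t Ht. rewrite Rmin_left, Rmax_right in Ht by auto.
    apply derivable_continuous_pt. exists ((E' t - K * E t) * exp (- K * t)).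
    apply is_derive_Reals. now apply D.
  - rewrite Rmin_left, Rmax_right in Hc by auto. rewrite H0 in Heq.
    assert (X := exp_pos (- K * c)). assert (Y := exp_pos (- K * T)).
    assert (Z := Hle c Hc). assert (P := Hp T).
    assert (N1 : (E' c - K * E c) * exp (- K * c) <= 0) by nra.
    assert (N2 : (E' c - K * E c) * exp (- K * c) * (T - 0) <= 0) by nra.
    rewrite <- Heq in N2.
    assert (N3 : E T * exp (- K * T) <= 0) by lra.
    apply Rle_antisym; auto. nra.
Qed.

Lemma bounded_curve (c : R -> C) (T : R) :
  (forall t, 0 <= t <= T -> exists l, vderiv c t l) ->
  exists M, 0 <= M /\ forall t, 0 <= t <= T -> Cmod (c t) <= M.
Proof.
  intros H. destruct (Rle_dec 0 T) as [HT|HT].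
  2:{ exists 0. split; [lra|]. intros; lra. }
  destruct (interval_induction (fun u v => exists M, 0 <= M /\
    forall t, Rmax 0 u <= t <= Rmin T v -> Cmod (c t) <= M) 0 T HT) as [M [HM HM']].
  - intros t Ht. destruct (H t Ht) as [l Hc].
    destruct (vderiv_cont _ _ _ Hc 1 Rlt_0_1) as [d [Hd Hd']].
    exists d. split; auto. intros u v Hu Huv Hv. exists (1 + Cmod (c t)).
    split; [generalize (Cmod_ge_0 (c t)); lra|]. intros x Hx.
    assert (u <= x) by (eapply Rle_trans; [apply Rmax_r|apply Hx]).
    assert (x <= v) by (eapply Rle_trans; [apply Hx|apply Rmin_r]).
    assert (B : Rabs (x - t) < d) by (apply Rabs_def1; lra).
    specialize (Hd' _ B). replace (t + (x - t)) with x in Hd' by ring.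
    replace (c x) with ((c x - c t) + c t)%C by ring.
    eapply Rle_trans; [apply Cmod_triangle|]. lra.
  - intros u v w Huv Hvw [M1 [P1 H1]] [M2 [P2 H2]]. exists (Rmax M1 M2).
    split; [eapply Rle_trans; [apply P1|apply Rmax_l]|]. intros t [Ha Hb].
    destruct (Rle_dec t v).
    + eapply Rle_trans; [apply H1|apply Rmax_l]. split; auto. apply Rmin_glb; auto.
      eapply Rle_trans; [apply Hb|apply Rmin_l].
    + eapply Rle_trans; [apply H2|apply Rmax_r]. split; [|auto]. apply Rmax_lub; [|lra].
      eapply Rle_trans; [apply Rmax_l|apply Ha].
  - exists M. split; auto. intros t Ht. apply HM'. rewrite Rmax_left, Rmin_left; lra.
Qed.

(** Uniqueness for [wp'' = 6 wp^2 + g] along a line of direction [d], written as a first-order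
    system. The energy [|u - u'|^2 + |v - v'|^2] obeys Gronwall's inequality because the quadratic
    term is Lipschitz along bounded curves. *)
Lemma ode_unique (u v u' v' : R -> C) (d g : C) (T : R) : 0 <= T ->
  (forall t, 0 <= t <= T -> vderiv u t (d * v t)) ->
  (forall t, 0 <= t <= T -> vderiv v t (d * (6 * (u t * u t) + g))) ->
  (forall t, 0 <= t <= T -> vderiv u' t (d * v' t)) ->
  (forall t, 0 <= t <= T -> vderiv v' t (d * (6 * (u' t * u' t) + g))) ->
  u 0 = u' 0 -> v 0 = v' 0 -> u T = u' T.
Proof.
  intros HT Hu Hv Hu' Hv' H0 H1.
  destruct (bounded_curve u T) as [M [HM HuM]]; [intros t Ht; eexists; now apply Hu|].
  destruct (bounded_curve u' T) as [M' [HM' HuM']]; [intros t Ht; eexists; now apply Hu'|].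
  set (p := fun t => Re (u t) - Re (u' t)). set (q := fun t => Im (u t) - Im (u' t)).
  set (a := fun t => Re (v t) - Re (v' t)). set (b := fun t => Im (v t) - Im (v' t)).
  set (U := fun t => (u t - u' t)%C). set (V := fun t => (v t - v' t)%C).
  (* The divided difference of [6 u^2]: the derivative of [V] is [d W U]. *)
  set (W := fun t => (6 * (u t + u' t))%C).
  set (p' := fun t => Re (d * V t)%C). set (q' := fun t => Im (d * V t)%C).
  set (a' := fun t => Re (d * (W t * U t))%C). set (b' := fun t => Im (d * (W t * U t))%C).
  assert (Dp : forall t, 0 <= t <= T -> is_derive p t (p' t)).
  { intros t Ht. evar_last; [apply (is_derive_minus (V := R_NormedModule));
      [apply (vderiv_Re _ _ _ (Hu t Ht))|apply (vderiv_Re _ _ _ (Hu' t Ht))]|].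
    unfold p', V, minus, plus, opp, Re; simpl. ring. }
  assert (Dq : forall t, 0 <= t <= T -> is_derive q t (q' t)).
  { intros t Ht. evar_last; [apply (is_derive_minus (V := R_NormedModule));
      [apply (vderiv_Im _ _ _ (Hu t Ht))|apply (vderiv_Im _ _ _ (Hu' t Ht))]|].
    unfold q', V, minus, plus, opp, Im; simpl. ring. }
  assert (Da : forall t, 0 <= t <= T -> is_derive a t (a' t)).
  { intros t Ht. evar_last; [apply (is_derive_minus (V := R_NormedModule));
      [apply (vderiv_Re _ _ _ (Hv t Ht))|apply (vderiv_Re _ _ _ (Hv' t Ht))]|].
    unfold a', W, U, minus, plus, opp, Re; simpl. ring. }
  assert (Db : forall t, 0 <= t <= T -> is_derive b t (b' t)).
  { intros t Ht. evar_last; [apply (is_derive_minus (V := R_NormedModule));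
      [apply (vderiv_Im _ _ _ (Hv t Ht))|apply (vderiv_Im _ _ _ (Hv' t Ht))]|].
    unfold b', W, U, minus, plus, opp, Im; simpl. ring. }
  assert (Z : p T ^ 2 + q T ^ 2 + a T ^ 2 + b T ^ 2 = 0).
  { apply (gronwall_zero (fun t => p t ^ 2 + q t ^ 2 + a t ^ 2 + b t ^ 2)
      (fun t => 2 * (p t * p' t + q t * q' t + a t * a' t + b t * b' t))
      (2 * (Cmod d * (1 + 6 * (M + M')))) T HT).
    - intros t Ht. specialize (Dp t Ht). specialize (Dq t Ht). specialize (Da t Ht). specialize (Db t Ht).
      auto_derive.
      + repeat split; auto; eexists; eauto.
      + replace (Derive (fun x => p x) t) with (p' t) by (symmetry; apply is_derive_unique, Dp).
        replace (Derive (fun x => q x) t) with (q' t) by (symmetry; apply is_derive_unique, Dq).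
        replace (Derive (fun x => a x) t) with (a' t) by (symmetry; apply is_derive_unique, Da).
        replace (Derive (fun x => b x) t) with (b' t) by (symmetry; apply is_derive_unique, Db). ring.
    - intros t Ht.
      assert (CS : forall x y : C, Re x * Re y + Im x * Im y <= Cmod x * Cmod y).
      { intros x y. replace (Re x * Re y + Im x * Im y) with (Re (Cconj x * y)%C).
        - eapply Rle_trans; [apply Rle_abs|]. eapply Rle_trans; [apply re_le_Cmod|].
          rewrite Cmod_mult, Cmod_conj. lra.
        - destruct x, y; unfold Re, Im; simpl. ring. }
      assert (EU : p t ^ 2 + q t ^ 2 = Cmod (U t) ^ 2) by (rewrite Cmod2_alt; reflexivity).
      assert (EV : a t ^ 2 + b t ^ 2 = Cmod (V t) ^ 2) by (rewrite Cmod2_alt; reflexivity).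
      assert (A1 : p t * p' t + q t * q' t <= Cmod (U t) * (Cmod d * Cmod (V t))).
      { rewrite <- Cmod_mult. apply (CS (U t) (d * V t)%C). }
      assert (A2 : a t * a' t + b t * b' t <= Cmod (V t) * (Cmod d * (Cmod (W t) * Cmod (U t)))).
      { rewrite <- !Cmod_mult. rewrite Cmod_mult. apply (CS (V t) (d * (W t * U t))%C). }
      assert (BW : Cmod (W t) <= 6 * (M + M')).
      { unfold W. rewrite Cmod_mult, Cmod_R, Rabs_pos_eq by lra. apply Rmult_le_compat_l; [lra|].
        eapply Rle_trans; [apply Cmod_triangle|]. specialize (HuM t Ht). specialize (HuM' t Ht). lra. }
      assert (PU := Cmod_ge_0 (U t)). assert (PV := Cmod_ge_0 (V t)). assert (Pd := Cmod_ge_0 d).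
      assert (PW := Cmod_ge_0 (W t)).
      assert (UV : 0 <= Cmod (U t) * Cmod (V t)) by now apply Rmult_le_pos.
      assert (UV2 : 2 * (Cmod (U t) * Cmod (V t)) <= Cmod (U t) ^ 2 + Cmod (V t) ^ 2)
        by (generalize (pow2_ge_0 (Cmod (U t) - Cmod (V t))); lra).
      replace (p t ^ 2 + q t ^ 2 + a t ^ 2 + b t ^ 2) with (Cmod (U t) ^ 2 + Cmod (V t) ^ 2) by lra.
      apply Rle_trans with (2 * (Cmod (U t) * Cmod (V t) * (Cmod d * (1 + 6 * (M + M'))))).
      + assert (Cmod (V t) * (Cmod d * (Cmod (W t) * Cmod (U t))) <=
          Cmod (U t) * Cmod (V t) * (Cmod d * (6 * (M + M')))).
        { replace (Cmod (V t) * (Cmod d * (Cmod (W t) * Cmod (U t))))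
            with (Cmod (U t) * Cmod (V t) * (Cmod d * Cmod (W t))) by ring.
          apply Rmult_le_compat_l; auto. apply Rmult_le_compat_l; auto. }
        lra.
      + set (X := Cmod d * (1 + 6 * (M + M'))). assert (0 <= X) by (apply Rmult_le_pos; lra).
        assert (0 <= Cmod (U t) ^ 2 + Cmod (V t) ^ 2)
          by (generalize (pow2_ge_0 (Cmod (U t))) (pow2_ge_0 (Cmod (V t))); lra).
        nra.
    - intros t. generalize (pow2_ge_0 (p t)) (pow2_ge_0 (q t)) (pow2_ge_0 (a t)) (pow2_ge_0 (b t)). lra.
    - unfold p, q, a, b. rewrite H0, H1. ring. }
  assert (Zp : p T = 0) by (generalize (pow2_ge_0 (q T)) (pow2_ge_0 (a T)) (pow2_ge_0 (b T)); nra).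
  assert (Zq : q T = 0) by (generalize (pow2_ge_0 (p T)) (pow2_ge_0 (a T)) (pow2_ge_0 (b T)); nra).
  unfold p, q in Zp, Zq. destruct (u T), (u' T). unfold Re, Im in *; simpl in *. f_equal; lra.
Qed.

Lemma vderiv_line a d t : vderiv (fun t : R => a + t * d)%C t d.
Proof.
  generalize (vderiv_segment a (a + d)%C t). replace (a + d - a)%C with d by ring. auto.
Qed.

(** As [x] tends to 0 the left side runs into the pole, while the right side tends to the finite
    value [wp L p]. *)
Lemma wp_no_finite_limit L p e f : nondegenerate L -> off L gall p -> e <> RtoC 0 ->
  ~ (forall x : R, 0 < x < 1 -> wp L (x * e)%C = wp L (p + x * f)%C).
Proof.
  intros HL Hp He H.
  destruct (cC1_ccont _ _ (wp_cC1 L HL p Hp) 1 Rlt_0_1) as [d [Hd Hc]].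
  destruct (wp_blowup L (1 + Cmod (wp L p)) HL) as [d' [Hd' Hb]].
  assert (Pe : 0 < Cmod e) by now apply Cmod_gt_0. assert (Pf := Cmod_ge_0 f).
  set (x := Rmin (1 / 2) (Rmin (d / (1 + Cmod f)) (d' / (2 * Cmod e)))).
  assert (X1 : x <= 1 / 2) by apply Rmin_l.
  assert (X2 : x <= d / (1 + Cmod f)) by (eapply Rle_trans; [apply Rmin_r|apply Rmin_l]).
  assert (X3 : x <= d' / (2 * Cmod e)) by (eapply Rle_trans; [apply Rmin_r|apply Rmin_r]).
  assert (X0 : 0 < x) by (repeat apply Rmin_pos; try apply Rdiv_lt_0_compat; lra).
  assert (A : Cmod (x * f)%C < d).
  { rewrite Cmod_mult, Cmod_R, Rabs_pos_eq by lra.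
    apply (Rmult_le_compat_r (1 + Cmod f)) in X2; [|lra].
    replace (d / (1 + Cmod f) * (1 + Cmod f)) with d in X2 by (field; lra). nra. }
  assert (B : Cmod (x * e)%C < d').
  { rewrite Cmod_mult, Cmod_R, Rabs_pos_eq by lra.
    apply (Rmult_le_compat_r (2 * Cmod e)) in X3; [|lra].
    replace (d' / (2 * Cmod e) * (2 * Cmod e)) with d' in X3 by (field; lra). nra. }
  assert (N : (x * e)%C <> RtoC 0).
  { apply Cmult_neq_0; auto. intro K. apply RtoC_inj in K. lra. }
  specialize (Hc _ A). specialize (Hb _ B N). cbv beta in Hb.
  replace (0 + x * e)%C with (x * e)%C in Hb by ring. rewrite (H x ltac:(lra)) in Hb.
  assert (T := Cmod_triangle (wp L (p + x * f) - wp L p)%C (wp L p)).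
  replace (wp L (p + x * f) - wp L p + wp L p)%C with (wp L (p + x * f)) in T by ring. lra.
Qed.

Lemma wpd_half_period L z m n : nondegenerate L -> off L gall z -> (z + z)%C = lattice_pt L m n ->
  wpd L z = RtoC 0.
Proof.
  intros HL Hz E.
  assert (A : wpd L z = (- wpd L z)%C).
  { rewrite <- wpd_odd by auto. rewrite <- (wpd_periodic L HL m n (- z)%C) by now apply off_gall_opp.
    f_equal. rewrite <- E. ring. }
  replace (wpd L z) with (/ 2 * (wpd L z + wpd L z))%C by field. rewrite A at 1. ring.
Qed.

Section RhombicReal.
Variables l t : R.
Hypothesis Hl : 0 < l.
Hypothesis Ht : 0 < t.
Let L := rhombic l t.
Let HL : nondegenerate L := rhombic_nondegenerate l t Hl Ht.

Lemma real_segment_off (a b r : R) : 0 < a < 4 * l -> 0 < b < 4 * l -> 0 <= r <= 1 ->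
  off L gall (a + r * (b - a))%C.
Proof.
  intros Ha Hb Hr. replace (a + r * (b - a))%C with (RtoC (a + r * (b - a))).
  - apply rhombic_off_real; auto. destruct (Rle_dec a b); split; nra.
  - now rewrite RtoC_plus, RtoC_mult, RtoC_minus.
Qed.

(** If [wp'(x) = 0], then [wp (x + r)] and [wp (x - r)] have the same Cauchy data at [r = 0], hence
    agree for [r < x]. As [r] tends to [x], one argument tends to the regular point [2 x] and the
    other to the pole 0. *)
Lemma wpd_nonzero (x : R) : 0 < x < 2 * l -> wpd L x <> RtoC 0.
Proof.
  intros Hx E.
  assert (O : forall y : R, 0 < y < 4 * l -> off L gall y) by (intros; now apply rhombic_off_real).
  set (g := (wpdd L x - 6 * (wp L x * wp L x))%C).
  assert (ODE : forall y : R, 0 < y < 4 * l -> wpdd L y = (6 * (wp L y * wp L y) + g)%C).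
  { intros y Hy. unfold g. rewrite <- (wpdd_transport L x y HL); [ring|].
    intros r Hr. apply real_segment_off; auto. lra. }
  assert (Lp : forall r : R, (x + r * 1)%C = RtoC (x + r)) by (intros; rewrite RtoC_plus; ring).
  assert (Lm : forall r : R, (x + r * - (1))%C = RtoC (x - r)) by (intros; rewrite RtoC_minus; ring).
  apply (wp_no_finite_limit L (RtoC (2 * x)) (RtoC x) (- RtoC x)%C HL).
  - apply O. lra.
  - intro K. apply RtoC_inj in K. lra.
  (* At parameter [T] the backward curve is at [y x], close to the pole for small [y], and the
     forward one at [2 x - y x]. *)
  - intros y Hy. set (T := x * (1 - y)).
    assert (HT : 0 <= T < x) by (unfold T; split; nra).
    assert (U := ode_unique (fun r : R => wp L (x + r * 1)%C) (fun r : R => wpd L (x + r * 1)%C)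
       (fun r : R => wp L (x + r * - (1))%C) (fun r : R => (- (1) * wpd L (x + r * - (1)))%C) 1 g T).
    cbv beta in U. rewrite (Lp T), (Lm T) in U.
    replace (RtoC (x + T)) with (RtoC (2 * x) + y * - RtoC x)%C in U.
    2:{ unfold T. rewrite !RtoC_plus, !RtoC_mult, RtoC_minus. ring. }
    replace (RtoC (x - T)) with (y * RtoC x)%C in U.
    2:{ unfold T. rewrite !RtoC_minus, !RtoC_mult, RtoC_minus. ring. }
    symmetry. apply U.
    + lra.
    + intros r Hr. apply (cderiv_vderiv (wp L)); [|apply vderiv_line].
      apply wp_cderiv; auto. rewrite Lp. apply O. lra.
    + intros r Hr. rewrite Lp, <- ODE, <- Lp by lra.
      apply (cderiv_vderiv (wpd L)); [|apply vderiv_line].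
      apply wpd_cderiv; auto. rewrite Lp. apply O. lra.
    + intros r Hr. rewrite Cmult_1_l. apply (cderiv_vderiv (wp L)); [|apply vderiv_line].
      apply wp_cderiv; auto. rewrite Lm. apply O. lra.
    + intros r Hr. rewrite Lm, <- ODE, <- Lm by lra.
      replace (1 * wpdd L (x + r * - (1)))%C with (- (1) * (- (1) * wpdd L (x + r * - (1))))%C by ring.
      apply (cderiv_vderiv (fun z => - (1) * wpd L z)%C (fun r : R => x + r * - (1))%C r); [|apply vderiv_line].
      apply (cderiv_eq _ _ (0 * wpd L (x + r * - (1)) + - (1) * wpdd L (x + r * - (1)))%C); [ring|].
      apply (cderiv_mult (fun _ => - (1))%C (wpd L)); [apply cderiv_const|].
      apply wpd_cderiv; auto. rewrite Lm. apply O. lra.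
    + f_equal. ring.
    + replace (x + 0 * 1)%C with (RtoC x) by ring. replace (x + 0 * - (1))%C with (RtoC x) by ring.
      rewrite E. ring.
Qed.

Lemma wp_real_derive (x : R) : off L gall x -> is_derive (fun x : R => Re (wp L x)) x (Re (wpd L x)).
Proof.
  intros Hx. assert (V := cderiv_vderiv (wp L) (fun x : R => 0 + x * 1)%C x (wpd L x) 1).
  replace (1 * wpd L x)%C with (wpd L x) in V by ring.
  assert (W : cderiv (wp L) (0 + x * 1)%C (wpd L x)).
  { replace (0 + x * 1)%C with (RtoC x) by ring. now apply wp_cderiv. }
  eapply is_derive_ext; [|apply (vderiv_Re _ _ _ (V W (vderiv_line 0 1 x)))].
  intros r. cbv beta. now replace (0 + r * 1)%C with (RtoC r) by ring.
Qed.

Lemma wpd_real_derive (x : R) : off L gall x -> is_derive (fun x : R => Re (wpd L x)) x (Re (wpdd L x)).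
Proof.
  intros Hx. assert (V := cderiv_vderiv (wpd L) (fun x : R => 0 + x * 1)%C x (wpdd L x) 1).
  replace (1 * wpdd L x)%C with (wpdd L x) in V by ring.
  assert (W : cderiv (wpd L) (0 + x * 1)%C (wpdd L x)).
  { replace (0 + x * 1)%C with (RtoC x) by ring. now apply wpd_cderiv. }
  eapply is_derive_ext; [|apply (vderiv_Re _ _ _ (V W (vderiv_line 0 1 x)))].
  intros r. cbv beta. now replace (0 + r * 1)%C with (RtoC r) by ring.
Qed.

Lemma wp_real_asymptotics : exists d B, 0 < d /\ forall y, 0 < y < d ->
  Rabs (Re (wp L y) - / (y * y)) <= B.
Proof.
  destruct (cC1_ccont _ _ (wpR_cC1 L HL 0 (off_gz_0 L HL)) 1 Rlt_0_1) as [d [Hd H]].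
  exists d, (1 + Cmod (wpR L 0)). split; auto. intros y Hy.
  specialize (H (RtoC y)). rewrite Cmod_R, Rabs_pos_eq in H by lra. specialize (H ltac:(lra)).
  replace (0 + y)%C with (RtoC y) in H by ring.
  replace (Re (wp L y) - / (y * y)) with (Re (wpR L y)).
  - eapply Rle_trans; [apply re_le_Cmod|].
    replace (wpR L y) with ((wpR L y - wpR L 0) + wpR L 0)%C by ring.
    eapply Rle_trans; [apply Cmod_triangle|]. lra.
  - rewrite wp_wpR. rewrite <- RtoC_mult, <- RtoC_inv by nra. unfold Re, RtoC; simpl. ring.
Qed.

(** [wp'] keeps one sign on the interval, having no zero there. If it were positive, [wp] would
    increase on [(0, x]], against its growth like [1 / y^2] at 0. *)
Lemma wpd_negative (x : R) : 0 < x < 2 * l -> Re (wpd L x) < 0.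
Proof.
  intros Hx.
  assert (O : forall y : R, 0 < y < 4 * l -> off L gall y) by (intros; now apply rhombic_off_real).
  assert (NZ : forall y : R, 0 < y < 2 * l -> Re (wpd L y) <> 0).
  { intros y Hy E. apply (wpd_nonzero y Hy). rewrite (wpd_real l t Hl Ht); [|apply O; lra].
    fold L. now rewrite E. }
  destruct (Rlt_le_dec (Re (wpd L x)) 0) as [H|H]; auto. exfalso.
  assert (Pos : forall y, 0 < y <= x -> 0 < Re (wpd L y)).
  { intros y Hy. destruct (Rlt_le_dec 0 (Re (wpd L y))) as [K|K]; auto. exfalso.
    assert (K1 : Re (wpd L y) < 0) by (destruct K; auto; exfalso; apply (NZ y); lra).
    assert (H1 : 0 < Re (wpd L x)) by (destruct H; auto; exfalso; apply (NZ x); lra).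
    assert (Hyx : y < x) by (destruct (Req_dec y x); [subst; lra|lra]).
    destruct (IVT_interv (fun x : R => Re (wpd L x)) y x) as [c [Hc Ec]]; auto.
    - intros c Hc. apply derivable_continuous_pt. eexists. apply is_derive_Reals, wpd_real_derive. apply O. lra.
    - apply (NZ c); auto. lra. }
  destruct wp_real_asymptotics as [d [B [Hd HB]]].
  (* A level above [wp x + B], and below [1 / y^2] as soon as [y <= 1 / M]. *)
  set (M := 2 + Rabs (Re (wp L x)) + Rabs B).
  assert (HM : 1 < M) by (unfold M; generalize (Rabs_pos (Re (wp L x))) (Rabs_pos B); lra).
  assert (IM : 0 < / M < 1).
  { split; [apply Rinv_0_lt_compat; lra|]. rewrite <- Rinv_1. apply Rinv_lt_contravar; lra. }
  set (y := Rmin (/ M) (Rmin (d / 2) (x / 2))).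
  assert (Y0 : 0 < y) by (repeat apply Rmin_pos; lra).
  assert (Y1 : y <= / M) by apply Rmin_l.
  assert (Y2 : y <= d / 2) by (eapply Rle_trans; [apply Rmin_r|apply Rmin_l]).
  assert (Y3 : y <= x / 2) by (eapply Rle_trans; [apply Rmin_r|apply Rmin_r]).
  assert (A : Re (wp L y) <= Re (wp L x)).
  { destruct (MVT_gen (fun x : R => Re (wp L x)) y x (fun x : R => Re (wpd L x))) as [c [Hc Ec]].
    - intros c Hc. rewrite Rmin_left, Rmax_right in Hc by lra. apply wp_real_derive, O. lra.
    - intros c Hc. rewrite Rmin_left, Rmax_right in Hc by lra.
      apply derivable_continuous_pt. eexists. apply is_derive_Reals, wp_real_derive. apply O. lra.
    - rewrite Rmin_left, Rmax_right in Hc by lra. assert (P := Pos c ltac:(lra)). nra. }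
  specialize (HB y ltac:(lra)). apply Rabs_le_between in HB.
  assert (Q : M <= / (y * y)).
  { rewrite <- (Rinv_inv M). apply Rinv_le_contravar; [nra|]. nra. }
  unfold M in Q. generalize (Rle_abs (Re (wp L x))) (Rle_abs B). lra.
Qed.

(** Both half-periods are critical points of [wp], so equal values would mean equal Cauchy data, and
    [wp] would agree at [omega1 - r omega1] and [omega2 - r omega1]. As [r] tends to 1, the first
    argument tends to the pole 0 and the second to [omega2 - omega1], which is not a lattice
    point. *)
Lemma omega1_ne_omega2 : wp L (l * (1 - Ci * t))%C <> wp L (l * (1 + Ci * t))%C.
Proof.
  intros E. set (o1 := (l * (1 - Ci * t))%C) in *. set (o2 := (l * (1 + Ci * t))%C) in *.
  set (g := (wpdd L l - 6 * (wp L l * wp L l))%C).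
  assert (R1 : Re o1 = l) by (unfold o1, Ci, RtoC, Re; simpl; ring).
  assert (R2 : Re o2 = l) by (unfold o2, Ci, RtoC, Re; simpl; ring).
  assert (S : forall (a b : C) (r : R), Re (a + r * b)%C = Re a + r * Re b)
    by (intros; unfold RtoC, Re; simpl; ring).
  assert (Sm : forall (a b : C), Re (a - b)%C = Re a - Re b)
    by (intros; unfold RtoC, Re; simpl; ring).
  assert (Sn : forall (a : C), Re (- a)%C = - Re a)
    by (intros; unfold RtoC, Re; simpl; ring).
  assert (O : forall z, 0 < Re z < 2 * l -> off L gall z) by (intros; now apply rhombic_off_Re).
  assert (ODE : forall z, 0 < Re z < 2 * l -> wpdd L z = (6 * (wp L z * wp L z) + g)%C).
  { intros z Hz. unfold g. rewrite <- (wpdd_transport L l z HL); [ring|].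
    intros r Hr. apply O. rewrite S, Sm. change (Re (RtoC l)) with l. split; nra. }
  assert (P0 : forall z m n, off L gall z -> (z + z)%C = lattice_pt L m n -> wpd L z = RtoC 0)
    by (intros; eapply wpd_half_period; eauto).
  assert (Z1 : wpd L o1 = RtoC 0).
  { apply (P0 o1 1%Z 0%Z); [apply O; lra|]. unfold lattice_pt, L, rhombic, o1; simpl. ring. }
  assert (Z2 : wpd L o2 = RtoC 0).
  { apply (P0 o2 0%Z 1%Z); [apply O; lra|]. unfold lattice_pt, L, rhombic, o2; simpl. ring. }
  apply (wp_no_finite_limit L (o2 - o1)%C o1 o1 HL).
  - intros m n _ K. unfold L in K. rewrite rhombic_pt in K.
    unfold o1, o2, Ci, RtoC, Cplus, Cmult, Cminus, Copp in K; simpl in K. injection K. intros K2 K1.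
    rewrite <- plus_IZR in K1. rewrite <- minus_IZR in K2.
    assert (A1 : IZR (m + n) = 0) by nra. apply eq_IZR in A1.
    assert (P : 0 < l * t) by nra.
    assert (A2 : l * t * (IZR (n - m) - 1) = 0) by lra.
    apply Rmult_integral in A2. destruct A2 as [A2|A2]; [lra|].
    assert (A3 : IZR (n - m) = IZR 1) by lra. apply eq_IZR in A3. lia.
  - intro K. rewrite K in R1. unfold RtoC, Re in R1; simpl in R1. lra.
  - intros x Hx.
    assert (U := ode_unique (fun r : R => wp L (o1 + r * - o1)%C) (fun r : R => wpd L (o1 + r * - o1)%C)
       (fun r : R => wp L (o2 + r * - o1)%C) (fun r : R => wpd L (o2 + r * - o1)%C) (- o1)%C g (1 - x)).
    cbv beta in U.
    replace (o1 + (1 - x)%R * - o1)%C with (x * o1)%C in U by (rewrite RtoC_minus; ring).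
    replace (o2 + (1 - x)%R * - o1)%C with (o2 - o1 + x * o1)%C in U by (rewrite RtoC_minus; ring).
    assert (B1 : forall r : R, 0 <= r <= 1 - x -> 0 < Re (o1 + r * - o1)%C < 2 * l).
    { intros r Hr. rewrite S, Sn, R1. split; nra. }
    assert (B2 : forall r : R, 0 <= r <= 1 - x -> 0 < Re (o2 + r * - o1)%C < 2 * l).
    { intros r Hr. rewrite S, Sn, R1, R2. split; nra. }
    apply U.
    + lra.
    + intros r Hr. apply (cderiv_vderiv (wp L)); [|apply vderiv_line]. apply wp_cderiv; auto.
    + intros r Hr. rewrite <- ODE by auto.
      apply (cderiv_vderiv (wpd L)); [|apply vderiv_line]. apply wpd_cderiv; auto.
    + intros r Hr. apply (cderiv_vderiv (wp L)); [|apply vderiv_line]. apply wp_cderiv; auto.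
    + intros r Hr. rewrite <- ODE by auto.
      apply (cderiv_vderiv (wpd L)); [|apply vderiv_line]. apply wpd_cderiv; auto.
    + replace (o1 + 0 * - o1)%C with o1 by ring. replace (o2 + 0 * - o1)%C with o2 by ring. auto.
    + replace (o1 + 0 * - o1)%C with o1 by ring. replace (o2 + 0 * - o1)%C with o2 by ring.
      rewrite Z1, Z2. auto.
Qed.
End RhombicReal.

(** Vieta's relations by successive divided differences, which only ask that the three roots be
    distinct. *)
Lemma cubic_vieta (c1 c2 r1 r2 r3 : C) :
  r1 <> r2 -> r1 <> r3 -> r2 <> r3 ->
  (forall r, r = r1 \/ r = r2 \/ r = r3 -> (- (r * r * r) + c2 * (r * r) - c1 * r + 1)%C = RtoC 0) ->
  c1 = (r1 * r2 + r1 * r3 + r2 * r3)%C /\ (r1 * r2 * r3)%C = RtoC 1.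
Proof.
  intros N12 N13 N23 H.
  assert (E1 := H r1 ltac:(auto)). assert (E2 := H r2 ltac:(auto)). assert (E3 := H r3 ltac:(auto)).
  assert (D : forall a b : C, a <> b -> (a - b)%C <> RtoC 0).
  { intros a b N K. apply N. replace a with ((a - b) + b)%C by ring. rewrite K. ring. }
  assert (Cancel : forall a b : C, a <> RtoC 0 -> (a * b)%C = RtoC 0 -> b = RtoC 0).
  { intros a b Ha K. replace b with (/ a * (a * b))%C by (field; auto). rewrite K. ring. }
  assert (F12 : (- (r1 * r1 + r1 * r2 + r2 * r2) + c2 * (r1 + r2) - c1)%C = RtoC 0).
  { apply (Cancel (r1 - r2)%C); auto. transitivity (RtoC 0 - RtoC 0)%C; [|ring].
    rewrite <- E1 at 1. rewrite <- E2. ring. }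
  assert (F13 : (- (r1 * r1 + r1 * r3 + r3 * r3) + c2 * (r1 + r3) - c1)%C = RtoC 0).
  { apply (Cancel (r1 - r3)%C); auto. transitivity (RtoC 0 - RtoC 0)%C; [|ring].
    rewrite <- E1 at 1. rewrite <- E3. ring. }
  assert (G : (c2 - (r1 + r2 + r3))%C = RtoC 0).
  { apply (Cancel (r2 - r3)%C); auto. transitivity (RtoC 0 - RtoC 0)%C; [|ring].
    rewrite <- F12 at 1. rewrite <- F13. ring. }
  assert (Ec2 : c2 = (r1 + r2 + r3)%C).
  { replace c2 with ((c2 - (r1 + r2 + r3)) + (r1 + r2 + r3))%C by ring. rewrite G. ring. }
  assert (Ec1 : c1 = (r1 * r2 + r1 * r3 + r2 * r3)%C).
  { transitivity (c1 + RtoC 0)%C; [ring|]. rewrite <- F12, Ec2. ring. }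
  split; auto.
  transitivity (r1 * r2 * r3 + RtoC 0)%C; [ring|]. rewrite <- E3 at 1. rewrite Ec1, Ec2. ring.
Qed.

(** * The function phi on the real axis *)

Section Phi.
Variables l t mu : R.
Hypothesis Hl : 0 < l.
Hypothesis Ht : 0 < t.
Hypothesis Hmu : 0 < mu < 2 * l.
Let L := rhombic l t.
Let HL : nondegenerate L := rhombic_nondegenerate l t Hl Ht.
Hypothesis Hwpd : wpd L mu = RtoC (- (1 / 4)).

Definition phr (x : R) : R := 4 * Re (wp (rhombic l t) mu) - 4 * Re (wp (rhombic l t) x).
Definition dphr (x : R) : R := - 4 * Re (wpd (rhombic l t) x).
(** With [coef1], the coefficients of the cubic satisfied by phi: [phi'^2 = - phi^3 + coef2 phi^2 -
    coef1 phi + 1]. The last factor of [coef1] is the constant [wp'' - 6 wp^2], evaluated at the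
    base point [l]. *)
Definition coef2 : R := 12 * Re (wp (rhombic l t) mu).
Definition coef1 : R :=
  48 * Re (wp (rhombic l t) mu) ^ 2 +
  8 * (Re (wpdd (rhombic l t) l) - 6 * Re (wp (rhombic l t) l) ^ 2).
Definition cubic (y : R) : R := - y ^ 3 + coef2 * y ^ 2 - coef1 * y + 1.
Definition cubic' (y : R) : R := - 3 * y ^ 2 + 2 * coef2 * y - coef1.

Lemma off_real (x : R) : 0 < x < 4 * l -> off L gall x.
Proof. intros. now apply rhombic_off_real. Qed.

(** The first integral of the differential equation, compared between [z] and [mu]; the constant
    term 1 is [16 wp'(mu)^2]. *)
Lemma phi_cubic_complex z :
  (forall r, 0 <= r <= 1 -> off L gall (RtoC l + r * (z - RtoC l))%C) ->
  let F := (4 * wp L mu - 4 * wp L z)%C in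
  (16 * (wpd L z * wpd L z))%C = (- (F * F * F) + coef2 * (F * F) - coef1 * F + 1)%C.
Proof.
  intros Hz F.
  set (g := (wpdd L l - 6 * (wp L l * wp L l))%C).
  assert (Eg : g = RtoC (Re (wpdd L l) - 6 * Re (wp L l) ^ 2)).
  { unfold g. rewrite (wpdd_real l t Hl Ht), (wp_real l t Hl Ht) by (apply off_real; lra).
    fold L. set (x := Re (wpdd L l)). set (y := Re (wp L l)).
    rewrite RtoC_minus, RtoC_mult, RtoC_pow. simpl. ring. }
  assert (Em : wp L mu = RtoC (Re (wp L mu))) by (apply (wp_real l t Hl Ht), off_real; lra).
  assert (T1 := wpd_transport L l z g HL Hz eq_refl).
  assert (T2 := wpd_transport L l mu g HL (fun r Hr => real_segment_off l t Hl Ht l mu r ltac:(lra) ltac:(lra) Hr) eq_refl).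
  rewrite <- T2 in T1. clear T2. rewrite Hwpd in T1.
  assert (E1 : RtoC coef1 = (3 * (4 * wp L mu) * (4 * wp L mu) + 8 * g)%C).
  { unfold coef1. fold L. rewrite RtoC_plus, RtoC_mult, RtoC_mult, RtoC_pow, Eg, Em. simpl. ring. }
  assert (E2 : RtoC coef2 = (3 * (4 * wp L mu))%C).
  { unfold coef2. fold L. rewrite RtoC_mult, Em. simpl. ring. }
  rewrite E1, E2. unfold F. set (p := wp L z) in *. set (m := wp L mu) in *.
  replace (wpd L z * wpd L z)%C with
    ((wpd L z * wpd L z - 4 * (p * p * p) - 2 * g * p) + 4 * (p * p * p) + 2 * g * p)%C by ring.
  rewrite T1. rewrite RtoC_opp, RtoC_div by lra. field.
Qed.

Lemma phr_complex (x : R) : 0 < x < 4 * l -> (4 * wp L mu - 4 * wp L x)%C = RtoC (phr x).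
Proof.
  intros Hx. unfold phr. fold L.
  rewrite RtoC_minus, !RtoC_mult. rewrite <- !(wp_real l t Hl Ht) by (apply off_real; lra). reflexivity.
Qed.

Lemma phr_square x : 0 < x < 4 * l -> dphr x ^ 2 = cubic (phr x).
Proof.
  intros Hx.
  assert (E := phi_cubic_complex x (fun r Hr => real_segment_off l t Hl Ht l x r ltac:(lra) Hx Hr)).
  cbv zeta in E. rewrite phr_complex in E by auto.
  apply RtoC_inj. unfold dphr, cubic. fold L.
  rewrite (wpd_real l t Hl Ht) in E by now apply off_real. fold L in E.
  rewrite !RtoC_plus, !RtoC_minus, !RtoC_plus, !RtoC_opp, !RtoC_mult, !RtoC_pow.
  transitivity (16 * (Re (wpd L x) * Re (wpd L x)))%C; [|rewrite E; simpl; ring].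
  rewrite RtoC_mult. simpl. replace (RtoC (-4)) with (- RtoC 4)%C by (rewrite <- RtoC_opp; reflexivity). ring.
Qed.

Lemma phr_derive x : 0 < x < 4 * l -> is_derive phr x (dphr x).
Proof.
  intros Hx. unfold phr, dphr. fold L.
  assert (D := wp_real_derive l t Hl Ht x (off_real x Hx)). fold L in D.
  evar_last.
  - apply (is_derive_minus (V := R_NormedModule)); [apply is_derive_const|].
    apply (is_derive_scal (fun x : R => Re (wp L x)) x 4 _ D).
  - change (0 - 4 * Re (wpd L x) = - 4 * Re (wpd L x)). ring.
Qed.

Lemma dphr_derive x : 0 < x < 4 * l -> is_derive dphr x (cubic' (phr x) / 2).
Proof.
  intros Hx.
  assert (D := wpd_real_derive l t Hl Ht x (off_real x Hx)). fold L in D.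
  assert (E := wpdd_transport L l x HL (fun r Hr => real_segment_off l t Hl Ht l x r ltac:(lra) Hx Hr)).
  unfold L in E. rewrite (wpdd_real l t Hl Ht x), (wp_real l t Hl Ht x), (wpdd_real l t Hl Ht l), (wp_real l t Hl Ht l) in E
    by (apply off_real; lra). fold L in E.
  rewrite <- !RtoC_mult, <- !RtoC_minus in E. apply RtoC_inj in E.
  unfold dphr. fold L. evar_last.
  - apply (is_derive_scal (fun x : R => Re (wpd L x)) x (-4) _ D).
  - unfold cubic', phr, coef1, coef2. fold L.
    replace (Re (wpdd L x)) with (Re (wpdd L l) - 6 * (Re (wp L l) * Re (wp L l)) + 6 * (Re (wp L x) * Re (wp L x))) by lra.
    field.
Qed.

Lemma dphr_pos x : 0 < x < 2 * l -> 0 < dphr x.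
Proof. intros Hx. unfold dphr. generalize (wpd_negative l t Hl Ht x Hx). fold L. lra. Qed.

Lemma dphr_mu : dphr mu = 1.
Proof. unfold dphr. fold L. rewrite Hwpd. unfold Re, RtoC; simpl. field. Qed.

Lemma phr_mu : phr mu = 0.
Proof. unfold phr. ring. Qed.

Lemma dphr_half : dphr (2 * l) = 0.
Proof.
  unfold dphr. fold L. rewrite (wpd_half_period L (RtoC (2 * l)) 1 1 HL).
  - unfold Re, RtoC; simpl; ring.
  - apply off_real; lra.
  - unfold L. rewrite rhombic_pt. unfold RtoC, Cplus; simpl. f_equal; ring.
Qed.

Lemma phr_increasing x y : 0 < x -> x < y -> y <= 2 * l -> phr x < phr y.
Proof.
  intros Hx Hxy Hy. destruct (MVT_cor2 phr dphr x y Hxy) as [c [E Hc]].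
  - intros c Hc. apply is_derive_Reals, phr_derive. lra.
  - assert (P := dphr_pos c ltac:(lra)). nra.
Qed.

Lemma phr_sign x : 0 < x <= 2 * l -> (x < mu -> phr x < 0) /\ (mu < x -> 0 < phr x).
Proof.
  intros Hx. split; intros H; rewrite <- phr_mu; apply phr_increasing; lra.
Qed.

Lemma phr_half_pos : 0 < phr (2 * l).
Proof. apply phr_sign; lra. Qed.

(** [phi'] vanishes at the three half-periods, so the values of phi there are the roots of the
    cubic. They are distinct: the third is real, while the first two are conjugate and different. *)
Lemma coef1_sum :
  let R1 := (4 * wp L mu - 4 * wp L (l * (1 - Ci * t)))%C in
  let R2 := (4 * wp L mu - 4 * wp L (l * (1 + Ci * t)))%C in
  let R3 := (4 * wp L mu - 4 * wp L (RtoC (2 * l)))%C in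
  coef1 = Re (R1 * R2 + R1 * R3 + R2 * R3)%C.
Proof.
  intros R1 R2 R3.
  assert (E3 : R3 = RtoC (phr (2 * l))) by (apply phr_complex; lra).
  assert (Or : forall z, Re z = l -> forall r, 0 <= r <= 1 -> off L gall (RtoC l + r * (z - RtoC l))%C).
  { intros z Hz r Hr. apply rhombic_off_Re; auto.
    replace (Re _) with (l + r * (Re z - l)) by (unfold Re, RtoC; simpl; ring). rewrite Hz. lra. }
  assert (Re1 : Re (l * (1 - Ci * t))%C = l) by (unfold Ci, RtoC, Re; simpl; ring).
  assert (Re2 : Re (l * (1 + Ci * t))%C = l) by (unfold Ci, RtoC, Re; simpl; ring).
  assert (O1 : off L gall (l * (1 - Ci * t))%C) by (apply rhombic_off_Re; auto; rewrite Re1; lra).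
  assert (O2 : off L gall (l * (1 + Ci * t))%C) by (apply rhombic_off_Re; auto; rewrite Re2; lra).
  assert (Ec : R2 = Cconj R1).
  { unfold R1, R2. rewrite Cminus_conj, !Cmult_conj, !Cconj_RtoC. f_equal.
    - f_equal. rewrite (wp_real l t Hl Ht) by (apply off_real; lra). now rewrite Cconj_RtoC.
    - f_equal. unfold L. rewrite <- wp_conj by (auto; now apply off_gall_gz).
      f_equal. unfold Ci, RtoC, Cconj, Cmult, Cplus, Cminus, Copp; simpl. f_equal; ring. }
  assert (N12 : R1 <> R2).
  { intros E. apply (omega1_ne_omega2 l t Hl Ht). fold L. unfold R1, R2 in E.
    set (a := wp L (l * (1 - Ci * t))) in *. set (b := wp L (l * (1 + Ci * t))) in *.
    transitivity (wp L mu - / 4 * (4 * wp L mu - 4 * a))%C; [field|]. rewrite E. field. }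
  assert (N13 : R1 <> R3).
  { intros E. apply N12. rewrite Ec, E, E3. now rewrite Cconj_RtoC. }
  assert (N23 : R2 <> R3).
  { intros E. apply N12. rewrite Ec in E. rewrite Ec, E.
    replace R1 with (Cconj (Cconj R1)) by apply Cconj_conj. now rewrite E, E3, Cconj_RtoC. }
  destruct (cubic_vieta coef1 coef2 R1 R2 R3 N12 N13 N23) as [Ec1 _].
  - intros r [-> | [-> | ->]].
    + unfold R1. rewrite <- phi_cubic_complex by now apply Or.
      rewrite (wpd_half_period L _ 1 0 HL O1); [ring|]. unfold lattice_pt, L, rhombic; simpl. ring.
    + unfold R2. rewrite <- phi_cubic_complex by now apply Or.
      rewrite (wpd_half_period L _ 0 1 HL O2); [ring|]. unfold lattice_pt, L, rhombic; simpl. ring.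
    + unfold R3. rewrite <- phi_cubic_complex.
      * rewrite (wpd_half_period L _ 1 1 HL); [ring|apply off_real; lra|].
        unfold L. rewrite rhombic_pt. unfold RtoC, Cplus; simpl. f_equal; ring.
      * intros r Hr. apply real_segment_off; auto; lra.
  - rewrite <- Ec1. reflexivity.
Qed.
End Phi.

(** * The logarithm of the modulus of the sigma function *)

Lemma ln_Cmod_derive (c : R -> C) t d : vderiv c t d -> c t <> RtoC 0 ->
  is_derive (fun t => ln (Cmod (c t))) t (Re (d / c t)%C).
Proof.
  intros Hc H0. assert (D1 := vderiv_Re _ _ _ Hc). assert (D2 := vderiv_Im _ _ _ Hc).
  assert (P : 0 < Re (c t) ^ 2 + Im (c t) ^ 2).
  { rewrite <- Cmod2_alt. apply pow_lt. now apply Cmod_gt_0. }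
  assert (D : is_derive (fun t => Re (c t) ^ 2 + Im (c t) ^ 2) t (2 * (Re (c t) * Re d + Im (c t) * Im d))).
  { evar_last; [apply (is_derive_plus (V := R_NormedModule)); apply is_derive_pow; eassumption|].
    unfold plus; simpl. ring. }
  apply (is_derive_ext_loc (fun t => / 2 * ln (Re (c t) ^ 2 + Im (c t) ^ 2))).
  - assert (Hloc : locally t (fun t => 0 < Re (c t) ^ 2 + Im (c t) ^ 2)).
    { assert (Hct : continuous (fun t => Re (c t) ^ 2 + Im (c t) ^ 2) t).
      { apply (ex_derive_continuous (K := R_AbsRing) (V := R_NormedModule)). eexists; apply D. }
      apply (Hct (fun y => 0 < y)). apply (open_gt 0). auto. }
    eapply filter_imp; [|apply Hloc]. intros s Hs. cbv beta in Hs.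
    unfold Cmod. rewrite <- Rpower_sqrt by auto. unfold Rpower. rewrite ln_exp. reflexivity.
  - evar_last.
    + apply is_derive_scal. apply (is_derive_comp ln); [apply is_derive_Reals, derivable_pt_lim_ln; apply P|apply D].
    + unfold scal; simpl. unfold mult; simpl.
      unfold Cdiv, Cmult, Cinv, Re, Im in *; simpl in *. field. lra.
Qed.

(** The mean value theorem along [1 + r e]: the remainder has derivative [Re (r^2 e^3 / (1 + r e))],
    and the denominator stays at least [1 / 2]. *)
Lemma ln_Cmod_taylor e : Cmod e <= 1 / 2 ->
  Rabs (ln (Cmod (1 + e)%C) - Re e + Re (e * e)%C / 2) <= 2 * Cmod e ^ 3.
Proof.
  intros He. assert (Pe := Cmod_ge_0 e).
  assert (NZ : forall r, 0 <= r <= 1 -> 1 / 2 <= Cmod (1 + r * e)%C).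
  { intros r Hr. eapply Rle_trans; [|apply Cmod_sub_ge]. rewrite Cmod_1, Cmod_mult, Cmod_R, Rabs_pos_eq by lra.
    nra. }
  set (G := fun r : R => ln (Cmod (1 + r * e)%C) - r * Re e + r ^ 2 * (Re (e * e)%C / 2)).
  set (G' := fun r : R => Re (e / (1 + r * e))%C - Re e + r * Re (e * e)%C).
  destruct (MVT_cor2 G G' 0 1 Rlt_0_1) as [r [E Hr]].
  - intros r Hr. apply is_derive_Reals. unfold G, G'.
    assert (N := NZ r Hr).
    assert (D := ln_Cmod_derive (fun r : R => 1 + r * e)%C r e (vderiv_line 1 e r)
       ltac:(apply Cmod_gt_0; lra)).
    evar_last.
    + apply (is_derive_plus (V := R_NormedModule)).
      * apply (is_derive_minus (V := R_NormedModule)); [apply D|].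
        apply (is_derive_scal_l (V := R_NormedModule) (fun r => r)). apply is_derive_id.
      * apply (is_derive_scal_l (V := R_NormedModule) (fun r => r ^ 2)). apply is_derive_pow, is_derive_id.
    + unfold minus, plus, opp, scal, one; simpl. unfold mult; simpl. lra.
  - replace (ln (Cmod (1 + e)%C) - Re e + Re (e * e)%C / 2) with (G 1 - G 0).
    2:{ unfold G. replace (1 + 1 * e)%C with (1 + e)%C by ring. replace (1 + 0 * e)%C with (RtoC 1) by ring.
        rewrite Cmod_1, ln_1. ring. }
    rewrite E, Rminus_0_r, Rmult_1_r. unfold G'.
    assert (N := NZ r ltac:(lra)).
    assert (N0 : (1 + r * e)%C <> RtoC 0) by (apply Cmod_gt_0; lra).
    replace (Re (e / (1 + r * e))%C - Re e + r * Re (e * e)%C)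
      with (Re (e / (1 + r * e) - e + r * (e * e))%C) by (unfold Re, RtoC; simpl; ring).
    replace (e / (1 + r * e) - e + r * (e * e))%C with (r * r * (e ^ 3) * / (1 + r * e))%C by (simpl; field; auto).
    eapply Rle_trans; [apply re_le_Cmod|].
    rewrite !Cmod_mult, Cmod_pow, Cmod_R, Rabs_pos_eq, Cmod_inv by (auto; lra).
    assert (P3 : 0 <= Cmod e ^ 3) by now apply pow_le.
    assert (I : / Cmod (1 + r * e)%C <= 2).
    { replace 2 with (/ (1 / 2)) by field. apply Rinv_le_contravar; lra. }
    assert (I0 : 0 < / Cmod (1 + r * e)%C) by (apply Rinv_0_lt_compat; lra).
    assert (r * r <= 1) by nra. assert (0 <= r * r) by nra.
    rewrite (Rmult_comm 2). apply Rmult_le_compat; try lra; [now apply Rmult_le_pos|]. nra.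
Qed.

(** The logarithm of the modulus of the Weierstrass factor [(1 - z/w) exp (z/w + (z/w)^2 / 2)], so
    that [lnsigma] is [log |sigma|]. Only moduli of [g] matter for the metric, and sums of real
    logarithms avoid both infinite products and branches. *)
Definition sigma_term (L : lattice) (m n : Z) (z : C) : R :=
  if origin m n then 0
  else ln (Cmod (1 - z / lattice_pt L m n)%C) + Re (z / lattice_pt L m n)%C
       + Re (z / lattice_pt L m n * (z / lattice_pt L m n))%C / 2.

Definition lnsigmaR (L : lattice) (z : C) : R := Re (Lsum (fun m n => RtoC (sigma_term L m n z))).

Definition lnsigma (L : lattice) (z : C) : R := ln (Cmod z) + lnsigmaR L z.

Section Sigma.
Variable L : lattice.
Hypothesis HL : nondegenerate L.

Lemma ln_bound a b x : 0 < a -> a <= x -> x <= b -> Rabs (ln x) <= Rabs (ln a) + Rabs (ln b).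
Proof.
  intros Ha Hx Hb.
  assert (H1 : ln a <= ln x) by (destruct Hx as [Hx| ->]; [left; apply ln_increasing; lra|lra]).
  assert (H2 : ln x <= ln b) by (destruct Hb as [Hb| ->]; [left; apply ln_increasing; lra|lra]).
  generalize (Rle_abs (ln b)) (Rle_abs (- ln a)) (Rabs_pos (ln a)) (Rabs_pos (ln b)). rewrite Rabs_Ropp.
  intros. apply Rabs_le. lra.
Qed.

(** The constant [q] is such that [|z / w| <= q / size]. For [size > 2 q] this is at most [1 / 2]
    and the Taylor bound gives order 3. For the other terms a crude bound [C0] suffices, weighted by
    [((1 + 2 q) / size)^3 >= 1]. *)
Lemma sigma_dom z : off L gz z -> dom (fun m n => RtoC (sigma_term L m n z)).
Proof.
  intros Hz. destruct (lattice_separated_0 L HL) as [e [He H0]].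
  destruct (off_separated L gz z HL Hz) as [d [Hd H]].
  assert (G1 := Cmod_ge_0 (gen1 L)). assert (G2 := Cmod_ge_0 (gen2 L)).
  set (G := 1 + (Cmod (gen1 L) + Cmod (gen2 L))). assert (HG : 1 <= G) by (unfold G; lra).
  assert (Pz := Cmod_ge_0 z).
  set (q := Cmod z / e). assert (Hq : 0 <= q) by (apply Rmult_le_pos; auto; left; now apply Rinv_0_lt_compat).
  set (C0 := Rabs (ln (d / G)) + Rabs (ln (1 + q)) + q + q * q / 2).
  assert (HC0 : 0 <= C0).
  { unfold C0. generalize (Rabs_pos (ln (d / G))) (Rabs_pos (ln (1 + q))). nra. }
  exists (C0 * (1 + 2 * q) ^ 3 + 2 * q ^ 3). intros m n. assert (S1 := size_ge_1 m n).
  assert (Q0 : 0 < / size m n ^ 3) by (apply Rinv_0_lt_compat, pow_lt; lra).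
  assert (Pq3 : 0 <= q ^ 3) by now apply pow_le.
  assert (Pq4 : 0 <= C0 * (1 + 2 * q) ^ 3) by (apply Rmult_le_pos; auto; apply pow_le; lra).
  rewrite Cmod_R. unfold sigma_term. destruct (origin m n) eqn:E.
  - rewrite Rabs_R0. apply Rmult_le_pos; lra.
  - assert (Hg : gz m n = true) by (unfold gz; now rewrite E).
    specialize (H m n Hg). specialize (H0 m n Hg).
    assert (U := lattice_pt_upper L m n).
    set (w := lattice_pt L m n) in *.
    replace (0 - w)%C with (- w)%C in H0 by ring. rewrite Cmod_opp in H0.
    assert (Pw : 0 < Cmod w) by nra.
    assert (Hw : w <> RtoC 0) by (now apply Cmod_gt_0).
    set (x := (z / w)%C).
    assert (Bx : Cmod x <= q / size m n).
    { unfold x. rewrite Cmod_div by auto. unfold q.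
      replace (Cmod z / e / size m n) with (Cmod z * / (e * size m n)) by (field; lra).
      apply Rmult_le_compat_l; auto. apply Rinv_le_contravar; [nra|auto]. }
    assert (Bq : q / size m n <= q).
    { rewrite <- (Rmult_1_r q) at 2. apply Rmult_le_compat_l; auto. rewrite <- Rinv_1. apply Rinv_le_contravar; lra. }
    assert (Px := Cmod_ge_0 x).
    destruct (Rle_dec (size m n) (2 * q)) as [Hs|Hs].
    + apply Rle_trans with C0.
      * assert (A1 : Rabs (ln (Cmod (1 - x)%C)) <= Rabs (ln (d / G)) + Rabs (ln (1 + q))).
        { apply ln_bound.
          - apply Rdiv_lt_0_compat; lra.
          - replace (1 - x)%C with (- (z - w) / w)%C by (unfold x; field; auto).
            rewrite Cmod_div, Cmod_opp by auto.
            apply (Rmult_le_reg_r (G * Cmod w)); [nra|].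
            replace (d / G * (G * Cmod w)) with (d * Cmod w) by (field; lra).
            replace (Cmod (z - w)%C / Cmod w * (G * Cmod w)) with (Cmod (z - w)%C * G) by (field; lra).
            assert (Cmod w <= G * size m n) by (unfold G; nra). nra.
          - eapply Rle_trans; [apply Cmod_triangle|]. rewrite Cmod_1, Cmod_opp. lra. }
        assert (A2 : Rabs (Re x) <= q) by (eapply Rle_trans; [apply re_le_Cmod|lra]).
        assert (A3 : Rabs (Re (x * x)%C) <= q * q).
        { eapply Rle_trans; [apply re_le_Cmod|]. rewrite Cmod_mult. apply Rmult_le_compat; lra. }
        eapply Rle_trans; [apply Rabs_triang|]. 
        eapply Rle_trans; [apply Rplus_le_compat_r, Rabs_triang|].
        unfold Rdiv at 1. rewrite Rabs_mult, (Rabs_pos_eq (/ 2)) by lra. unfold C0. lra.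
      * apply Rle_trans with (C0 * ((1 + 2 * q) ^ 3 * / size m n ^ 3)).
        -- replace C0 with (C0 * (size m n ^ 3 * / size m n ^ 3)) at 1 by (field; lra).
           apply Rmult_le_compat_l; auto.
           apply Rmult_le_compat_r; [lra|]. apply pow_incr. lra.
        -- unfold Rdiv. rewrite Rmult_plus_distr_r.
           assert (0 <= 2 * q ^ 3 * / size m n ^ 3) by (apply Rmult_le_pos; lra). lra.
    + assert (Hx : Cmod x <= 1 / 2).
      { eapply Rle_trans; [apply Bx|]. apply (Rmult_le_reg_r (size m n)); [lra|].
        replace (q / size m n * size m n) with q by (field; lra). lra. }
      assert (T := ln_Cmod_taylor (- x)%C ltac:(rewrite Cmod_opp; auto)). rewrite Cmod_opp in T.
      replace (1 + - x)%C with (1 - x)%C in T by ring. replace (- x * - x)%C with (x * x)%C in T by ring.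
      replace (Re (- x)%C) with (- Re x) in T by reflexivity.
      replace (ln (Cmod (1 - x)%C) - - Re x) with (ln (Cmod (1 - x)%C) + Re x) in T by ring.
      eapply Rle_trans; [apply T|].
      apply Rle_trans with (2 * (q ^ 3 * / size m n ^ 3)).
      * apply Rmult_le_compat_l; [lra|]. replace (q ^ 3 * / size m n ^ 3) with ((q / size m n) ^ 3) by (field; lra).
        apply pow_incr. lra.
      * unfold Rdiv. rewrite Rmult_plus_distr_r.
        assert (0 <= C0 * (1 + 2 * q) ^ 3 * / size m n ^ 3) by (apply Rmult_le_pos; lra). lra.
Qed.

Lemma Lsum_Re_RtoC a : dom a -> Lsum (fun m n => RtoC (Re (a m n))) = RtoC (Re (Lsum a)).
Proof.
  intros H. apply clim_CLim. assert (K := dom_clim _ H). apply clim_intro.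
  - eapply is_lim_seq_ext; [|apply (clim_Re _ _ K)]. intros. now rewrite !sq_Re.
  - eapply is_lim_seq_ext; [|apply is_lim_seq_const]. intros N. rewrite sq_Im. simpl.
    assert (E := sq_R_scal 0 (fun _ _ => 0) N). cbv beta in E.
    replace (0 * 0) with 0 in E by ring. rewrite Rmult_0_l in E. symmetry. exact E.
Qed.

(** Termwise, [1 - (z + h) / w = (1 - z / w) (1 + e)] with [e = h / (z - w)]. The expansion of
    [log |1 + e|] and the quadratic correction combine into the term of [Re (h zeta)] and an error
    of order [|h|^2], with summable coefficients. *)
Lemma lnsigmaR_quad z : off L gz z -> exists d M, 0 < d /\ 0 <= M /\ forall h, Cmod h < d ->
  Rabs (lnsigmaR L (z + h)%C - lnsigmaR L z - Re (h * zetaR L z)%C) <= M * (Cmod h * Cmod h).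
Proof.
  intros Hz. destruct (off_separated L gz z HL Hz) as [d [Hd H]].
  destruct (off_near L gz z HL Hz) as [d' [Hd' Hnear]].
  destruct (wpR_dom L HL z Hz) as [W HW].
  assert (HW0 : 0 <= W).
  { specialize (HW 0%Z 0%Z). rewrite (size_origin 0 0 eq_refl) in HW.
    replace (W / 1 ^ 3) with W in HW by (simpl; field). eapply Rle_trans; [apply Cmod_ge_0|apply HW]. }
  assert (Pd : 0 < / d ^ 3) by (apply Rinv_0_lt_compat, pow_lt; auto).
  set (M := 2 * / d ^ 3 * d + W / 2).
  assert (HM : 0 <= M) by (unfold M; nra).
  exists (Rmin d' (d / 2)), (25 * M). split; [apply Rmin_pos; lra|]. split; [lra|].
  intros h Hh. assert (Hh1 := Rlt_le_trans _ _ _ Hh (Rmin_l _ _)).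
  assert (Hh2 := Rlt_le_trans _ _ _ Hh (Rmin_r _ _)). assert (Ph := Cmod_ge_0 h).
  assert (D0 := sigma_dom z Hz). assert (D1 := sigma_dom (z + h)%C (Hnear h Hh1)).
  assert (D2 : dom (fun m n => h * zetaR_term L m n z)%C) by now apply dom_scal, zetaR_dom.
  assert (E2 : Re (h * zetaR L z)%C = Re (Lsum (fun m n => RtoC (Re (h * zetaR_term L m n z)%C)))).
  { rewrite Lsum_Re_RtoC by auto. unfold zetaR. rewrite Lsum_scal by now apply zetaR_dom. reflexivity. }
  assert (D3 : dom (fun m n => RtoC (Re (h * zetaR_term L m n z)%C))).
  { destruct D2 as [K HK]. exists K. intros m n. rewrite Cmod_R. eapply Rle_trans; [apply re_le_Cmod|apply HK]. }
  rewrite E2. unfold lnsigmaR.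
  replace (Re _ - Re _ - Re _) with
    (Re (Lsum (fun m n => RtoC (sigma_term L m n (z + h)%C)) - Lsum (fun m n => RtoC (sigma_term L m n z))
      - Lsum (fun m n => RtoC (Re (h * zetaR_term L m n z)%C)))%C) by reflexivity.
  rewrite <- Lsum_minus by auto.
  rewrite <- Lsum_minus; auto.
  2:{ apply (dom_ext (fun m n => RtoC (sigma_term L m n (z + h)%C) + - (1) * RtoC (sigma_term L m n z))%C);
        [intros; ring|]. apply dom_plus; auto. now apply dom_scal. }
  eapply Rle_trans; [apply re_le_Cmod|].
  rewrite Rmult_assoc. apply Lsum_bound; [nra|]. intros m n. assert (S1 := size_ge_1 m n).
  assert (Q0 : 0 < / size m n ^ 3) by (apply Rinv_0_lt_compat, pow_lt; lra).
  rewrite <- !RtoC_minus, Cmod_R. unfold sigma_term, zetaR_term.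
  specialize (HW m n). unfold wpR_term in HW. destruct (origin m n) eqn:E.
  - replace (0 - 0 - Re (h * 0)%C) with 0 by (unfold Re; simpl; ring). rewrite Rabs_R0.
    apply Rmult_le_pos; [nra|lra].
  - assert (Hg : gz m n = true) by (unfold gz; now rewrite E).
    assert (Hw := lattice_pt_nonzero L m n HL Hg).
    specialize (H m n Hg). set (w := lattice_pt L m n) in *. set (x := (z - w)%C) in *.
    assert (Px : 0 < Cmod x) by nra.
    assert (Hx : x <> RtoC 0) by now apply Cmod_gt_0.
    set (e := (h / x)%C).
    assert (Be : Cmod e <= Cmod h / (d * size m n)).
    { unfold e. rewrite Cmod_div by auto. apply Rmult_le_compat_l; auto. apply Rinv_le_contravar; nra. }
    assert (Be2 : Cmod h / (d * size m n) <= 1 / 2).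
    { apply (Rmult_le_reg_r (d * size m n)); [nra|].
      replace (Cmod h / (d * size m n) * (d * size m n)) with (Cmod h) by (field; lra). nra. }
    assert (T := ln_Cmod_taylor e ltac:(lra)).
    assert (N1 : (1 + e)%C <> RtoC 0).
    { apply Cmod_gt_0. generalize (Cmod_sub_ge 1 e). rewrite Cmod_1. lra. }
    assert (N2 : (1 - z / w)%C <> RtoC 0).
    { replace (1 - z / w)%C with (- x / w)%C by (unfold x; field; auto).
      intro K. apply Hx. replace x with (- ((- x / w) * w))%C by (field; auto). rewrite K. ring. }
    assert (El : ln (Cmod (1 - (z + h) / w)%C) = ln (Cmod (1 - z / w)%C) + ln (Cmod (1 + e)%C)).
    { rewrite <- ln_mult by now apply Cmod_gt_0. rewrite <- Cmod_mult. f_equal. f_equal.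
      unfold e, x in *. field. auto. }
    rewrite El.
    assert (Er : ln (Cmod (1 - z / w)%C) + ln (Cmod (1 + e)%C) + Re ((z + h) / w)%C
         + Re ((z + h) / w * ((z + h) / w))%C / 2
         - (ln (Cmod (1 - z / w)%C) + Re (z / w)%C + Re (z / w * (z / w))%C / 2)
         - Re (h * (/ x + / w + z / (w * w)))%C
       = (ln (Cmod (1 + e)%C) - Re e + Re (e * e)%C / 2) - Re (h * h * (/ (x * x) - / (w * w)))%C / 2).
    (* The complex identity whose real part collects all the terms without logarithm. *)
    { assert (Ec : ((z + h) / w + (z + h) / w * ((z + h) / w) / 2 - (z / w + z / w * (z / w) / 2)
          - h * (/ x + / w + z / (w * w)) = - e + e * e / 2 - h * h * (/ (x * x) - / (w * w)) / 2)%C).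
      { unfold e. field. auto. }
      apply (f_equal Re) in Ec.
      assert (Hh2' : forall a : C, Re (a / 2)%C = Re a / 2) by (intros; unfold Re, RtoC; simpl; field).
      assert (Pm : forall a b : C, Re (a - b)%C = Re a - Re b) by reflexivity.
      assert (Pp : forall a b : C, Re (a + b)%C = Re a + Re b) by reflexivity.
      assert (Pn : forall a : C, Re (- a)%C = - Re a) by reflexivity.
      rewrite !Pm, !Pp, !Hh2', Pn in Ec.
      set (a1 := Re ((z + h) / w)%C) in *. set (a2 := Re ((z + h) / w * ((z + h) / w))%C) in *.
      set (a3 := Re (z / w)%C) in *. set (a4 := Re (z / w * (z / w))%C) in *.
      set (a5 := Re (h * (/ x + / w + z / (w * w)))%C) in *. set (a6 := Re e) in *.
      set (a7 := Re (e * e)%C) in *. set (a8 := Re (h * h * (/ (x * x) - / (w * w)))%C) in *. lra. }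
    fold x. rewrite Er. eapply Rle_trans; [apply Rabs_triang|]. rewrite Rabs_Ropp.
    unfold M. replace ((2 * / d ^ 3 * d + W / 2) * (Cmod h * Cmod h) / size m n ^ 3)
      with (2 * / d ^ 3 * d * (Cmod h * Cmod h) * / size m n ^ 3 + (Cmod h * Cmod h) * (W / size m n ^ 3) / 2)
      by (field; lra).
    apply Rplus_le_compat.
    + eapply Rle_trans; [apply T|].
      apply Rle_trans with (2 * (Cmod h / (d * size m n)) ^ 3).
      * apply Rmult_le_compat_l; [lra|]. apply pow_incr. split; [apply Cmod_ge_0|auto].
      * replace ((Cmod h / (d * size m n)) ^ 3) with (/ d ^ 3 * (Cmod h * (Cmod h * Cmod h)) * / size m n ^ 3)
          by (field; lra).
        replace (2 * / d ^ 3 * d * (Cmod h * Cmod h) * / size m n ^ 3)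
          with (2 * (/ d ^ 3 * (d * (Cmod h * Cmod h)) * / size m n ^ 3)) by ring.
        apply Rmult_le_compat_l; [lra|]. apply Rmult_le_compat_r; [lra|]. apply Rmult_le_compat_l; [lra|].
        apply Rmult_le_compat_r; nra.
    + unfold Rdiv at 1. rewrite Rabs_mult, (Rabs_pos_eq (/ 2)) by lra.
      apply Rmult_le_compat_r; [lra|]. eapply Rle_trans; [apply re_le_Cmod|]. rewrite !Cmod_mult.
      apply Rmult_le_compat_l; [nra|]. apply HW.
Qed.

Lemma lnsigmaR_curve (c : R -> C) t k : off L gz (c t) -> vderiv c t k ->
  is_derive (fun t => lnsigmaR L (c t)) t (Re (k * zetaR L (c t))%C).
Proof.
  intros Hz Hc. destruct (lnsigmaR_quad _ Hz) as [d [M [Hd [HM H]]]].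
  set (l := zetaR L (c t)) in *. assert (Pk := Cmod_ge_0 k). assert (Pl := Cmod_ge_0 l).
  apply is_derive_eps. intros e He.
  set (e1 := Rmin 1 (e / (2 * (1 + Cmod l)))).
  assert (He1 : 0 < e1) by (apply Rmin_pos; [lra|]; apply Rdiv_lt_0_compat; lra).
  set (Q := (1 + M) * ((1 + Cmod k) * (1 + Cmod k))).
  assert (HQ : 0 < Q) by (unfold Q; apply Rmult_lt_0_compat; nra).
  destruct (Hc e1 He1) as [d1 [Hd1 H1]]. destruct (vderiv_cont _ _ _ Hc d Hd) as [d2 [Hd2 H2]].
  exists (Rmin (e / (2 * Q)) (Rmin d1 d2)). split.
  { repeat apply Rmin_pos; auto. apply Rdiv_lt_0_compat; lra. }
  intros h Hh. assert (Hh0 := Rlt_le_trans _ _ _ Hh (Rmin_l _ _)).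
  assert (Hh' := Rlt_le_trans _ _ _ Hh (Rmin_r _ _)).
  assert (A := H1 h (Rlt_le_trans _ _ _ Hh' (Rmin_l _ _))).
  assert (B := H2 h (Rlt_le_trans _ _ _ Hh' (Rmin_r _ _))).
  set (q := (c (t + h)%R - c t)%C) in *. assert (Ph := Rabs_pos h).
  assert (D := H q B). replace (c t + q)%C with (c (t + h)%R) in D by (unfold q; ring).
  assert (Bq : Cmod q <= (1 + Cmod k) * Rabs h).
  { replace q with ((q - h * k) + h * k)%C by ring.
    eapply Rle_trans; [apply Cmod_triangle|]. rewrite Cmod_mult, Cmod_R.
    assert (e1 <= 1) by apply Rmin_l. nra. }
  replace (lnsigmaR L (c (t + h)) - lnsigmaR L (c t) - h * Re (k * l)%C)
    with ((lnsigmaR L (c (t + h)) - lnsigmaR L (c t) - Re (q * l)%C) + Re ((q - h * k) * l)%C)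
    by (unfold Re, RtoC; simpl; ring).
  eapply Rle_trans; [apply Rabs_triang|].
  apply Rle_trans with (M * (Cmod q * Cmod q) + Cmod ((q - h * k) * l)%C).
  { apply Rplus_le_compat; [apply D|apply re_le_Cmod]. }
  rewrite Cmod_mult.
  assert (Pq := Cmod_ge_0 q).
  assert (X1 : M * (Cmod q * Cmod q) <= e / 2 * Rabs h).
  { apply Rle_trans with (Q * Rabs h * Rabs h).
    - unfold Q. assert (Cmod q * Cmod q <= ((1 + Cmod k) * Rabs h) * ((1 + Cmod k) * Rabs h))
        by (apply Rmult_le_compat; lra).
      assert (M * (Cmod q * Cmod q) <= (1 + M) * (((1 + Cmod k) * Rabs h) * ((1 + Cmod k) * Rabs h)))
        by (apply Rmult_le_compat; nra).
      lra.
    - apply Rmult_le_compat_r; auto. apply (Rmult_lt_compat_l Q) in Hh0; auto.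
      replace (Q * (e / (2 * Q))) with (e / 2) in Hh0 by (field; lra). lra. }
  assert (X2 : Cmod (q - h * k)%C * Cmod l <= e / 2 * Rabs h).
  { apply Rle_trans with (e / (2 * (1 + Cmod l)) * Rabs h * (1 + Cmod l)); [|right; field; lra].
    apply Rmult_le_compat; try lra; [apply Cmod_ge_0|].
    eapply Rle_trans; [apply A|]. apply Rmult_le_compat_r; auto. apply Rmin_r. }
  lra.
Qed.

Lemma lnsigma_curve (c : R -> C) t k : off L gall (c t) -> vderiv c t k ->
  is_derive (fun t => lnsigma L (c t)) t (Re (k * wzeta L (c t))%C).
Proof.
  intros Hz Hc. unfold lnsigma.
  replace (Re (k * wzeta L (c t))%C) with (Re (k / c t)%C + Re (k * zetaR L (c t))%C).
  - apply (is_derive_plus (V := R_NormedModule)).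
    + apply ln_Cmod_derive; auto. now apply off_gall_ne0 in Hz.
    + apply lnsigmaR_curve; auto. now apply off_gall_gz.
  - rewrite wzeta_zetaR. set (a := (/ c t)%C). unfold Cdiv. fold a. set (b := zetaR L (c t)).
    unfold Re; simpl. ring.
Qed.

Lemma lnsigmaR_even z : lnsigmaR L (- z)%C = lnsigmaR L z.
Proof.
  unfold lnsigmaR. f_equal. rewrite <- (Lsum_opp (fun m n => RtoC (sigma_term L m n (- z)))).
  apply Lsum_ext. intros m n. unfold sigma_term. rewrite origin_opp, lattice_pt_opp.
  destruct (origin m n); auto.
  replace (- z / - lattice_pt L m n)%C with (z / lattice_pt L m n)%C; auto.
  unfold Cdiv. rewrite Cinv_opp. ring.
Qed.

Lemma lnsigma_even z : lnsigma L (- z)%C = lnsigma L z.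
Proof. unfold lnsigma. now rewrite Cmod_opp, lnsigmaR_even. Qed.
End Sigma.

Lemma lnsigma_conj l t z : lnsigma (rhombic l t) (Cconj z) = lnsigma (rhombic l t) z.
Proof.
  unfold lnsigma. rewrite Cmod_conj. f_equal. unfold lnsigmaR. f_equal.
  rewrite <- (Lsum_swap (fun m n => RtoC (sigma_term _ m n (Cconj z)))).
  apply Lsum_ext. intros m n. unfold sigma_term. rewrite (origin_sym n m).
  destruct (origin m n); auto. rewrite <- rhombic_pt_conj. set (w := lattice_pt _ m n).
  replace (Cconj z / Cconj w)%C with (Cconj (z / w)) by (unfold Cdiv; now rewrite Cmult_conj, Cconj_inv_total).
  set (x := (z / w)%C).
  replace (1 - Cconj x)%C with (Cconj (1 - x)).
  2:{ rewrite Cminus_conj. f_equal. apply Cconj_RtoC. }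
  rewrite Cmod_conj, <- Cmult_conj. reflexivity.
Qed.

(** * The modulus of the Gauss map *)

Lemma Cmod_Cexp z : Cmod (Cexp z) = exp (Re z).
Proof.
  unfold Cexp, Cmod; simpl.
  replace (exp (Re z) * cos (Im z) * (exp (Re z) * cos (Im z) * 1) +
    exp (Re z) * sin (Im z) * (exp (Re z) * sin (Im z) * 1)) with (Rsqr (exp (Re z))).
  - apply sqrt_Rsqr. left; apply exp_pos.
  - generalize (sin2_cos2 (Im z)). unfold Rsqr. intros E.
    transitivity (exp (Re z) * exp (Re z) * (sin (Im z) * sin (Im z) + cos (Im z) * cos (Im z)));
      [rewrite E; ring|ring].
Qed.

(** By the mean value theorem, difference quotients at [x] are values of [d] nearby. Applied at
    [mu], where the formula for the derivative is first known only on a punctured neighbourhood. *)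
Lemma is_derive_extend (f d : R -> R) (x e : R) : 0 < e ->
  continuous f x -> continuous d x ->
  (forall y, Rabs (y - x) < e -> y <> x -> is_derive f y (d y)) -> is_derive f x (d x).
Proof.
  intros He Hf Hd H. apply is_derive_Reals. intros eps Heps.
  apply continuity_pt_filterlim in Hd. destruct (Hd eps Heps) as [a [Ha Hd']].
  exists (mkposreal (Rmin e a) (Rmin_pos _ _ He Ha)). simpl. intros h H0 Hh.
  assert (Hh1 := Rlt_le_trans _ _ _ Hh (Rmin_l _ _)). assert (Hh2 := Rlt_le_trans _ _ _ Hh (Rmin_r _ _)).
  destruct (MVT_gen f x (x + h) d) as [c [Hc E]].
  - intros y Hy. apply H.
    + apply Rabs_def2 in Hh1. unfold Rmin, Rmax in Hy. destruct (Rle_dec x (x + h)); apply Rabs_def1; lra.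
    + unfold Rmin, Rmax in Hy. destruct (Rle_dec x (x + h)); lra.
  - intros y Hy. destruct (Req_dec y x) as [->|N]; [now apply continuity_pt_filterlim|].
    apply derivable_continuous_pt. eexists. apply is_derive_Reals, H; auto.
    apply Rabs_def2 in Hh1. unfold Rmin, Rmax in Hy. destruct (Rle_dec x (x + h)); apply Rabs_def1; lra.
  - rewrite E. replace (d c * (x + h - x) / h) with (d c) by (field; auto).
    destruct (Req_dec c x) as [->|N]; [now rewrite Rminus_diag, Rabs_R0|].
    apply Hd'. split; [split; [exact I|auto]|]. simpl. unfold R_dist.
    apply Rabs_def2 in Hh2. unfold Rmin, Rmax in Hc. destruct (Rle_dec x (x + h)); apply Rabs_def1; lra.
Qed.

Section Gauss.
Variables l t mu : R.
Hypothesis Hl : 0 < l.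
Hypothesis Ht : 0 < t.
Hypothesis Hmu : 0 < mu < 2 * l.
Let L := rhombic l t.
Let HL : nondegenerate L := rhombic_nondegenerate l t Hl Ht.
Hypothesis Hwpd : wpd L mu = RtoC (- (1 / 4)).
Hypothesis Hzeta : 2 * l * Re (wzeta L mu) = Re (wzeta L (RtoC (2 * l))) * mu.

Definition phiC (z : C) : C := (4 * wp (rhombic l t) mu - 4 * wp (rhombic l t) z)%C.

(** This is [log |g|] for [g0 = 1]: by the zeta formula, [1 / phi] has the primitive [log sigma(z -
    mu) - log sigma(z + mu) + 2 zeta(mu) z], with [zeta(mu)] real, and the real part vanishes at
    0. *)
Definition lng (z : C) : R :=
  lnsigma (rhombic l t) (z - mu)%C - lnsigma (rhombic l t) (z + mu)%C
  + 2 * Re (wzeta (rhombic l t) mu) * Re z.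

Definition ordinary (z : C) : Prop := off L gall (z - mu)%C /\ off L gall (z + mu)%C.

Lemma mu_off : off L gall mu.
Proof. apply rhombic_off_real; auto; lra. Qed.

Lemma phiC_inv z : off L gall z -> ordinary z -> (phiC z * wzeta3 L mu z)%C = RtoC 1.
Proof.
  intros Hz [H1 H2]. unfold phiC. fold L.
  assert (E := wp_addition L HL mu z mu_off).
  rewrite Hwpd in E. rewrite <- RtoC_plus in E.
  assert (E' : ((wp L z - wp L mu) * wzeta3 L mu z)%C = RtoC (- (1 / 4))).
  { apply E; auto. apply rhombic_off_real; auto; lra. }
  transitivity (- (4) * ((wp L z - wp L mu) * wzeta3 L mu z))%C; [ring|].
  rewrite E', <- RtoC_opp, <- RtoC_mult. f_equal. field.
Qed.

Lemma phiC_nonzero_inv z : off L gall z -> ordinary z -> (/ phiC z)%C = wzeta3 L mu z.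
Proof.
  intros Hz Ho. assert (E := phiC_inv z Hz Ho).
  assert (N : phiC z <> RtoC 0).
  { intro K. rewrite K in E. replace (0 * wzeta3 L mu z)%C with (RtoC 0) in E by ring.
    apply RtoC_inj in E. lra. }
  transitivity (/ phiC z * (phiC z * wzeta3 L mu z))%C; [rewrite E; ring|field; auto].
Qed.

Lemma phiC_nonzero z : off L gall z -> ordinary z -> phiC z <> RtoC 0.
Proof.
  intros Hz Ho K. assert (E := phiC_inv z Hz Ho). rewrite K in E.
  replace (0 * wzeta3 L mu z)%C with (RtoC 0) in E by ring. apply RtoC_inj in E. lra.
Qed.

Lemma ordinary_of_nonzero z : off L gall z -> phiC z <> RtoC 0 -> ordinary z.
Proof.
  intros Hz N. split; intros m n _ E; apply N; unfold phiC; fold L.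
  - replace z with (mu + lattice_pt L m n)%C by (rewrite <- E; ring).
    rewrite wp_periodic by (auto; apply mu_off). ring.
  - replace z with (- mu + lattice_pt L m n)%C by (rewrite <- E; ring).
    rewrite wp_periodic by (auto; apply off_gall_opp, mu_off). rewrite wp_even. ring.
Qed.

(** [mu] is real, so translation by [mu] or [- mu] keeps a point inside the strip free of lattice
    points. *)
Lemma strip_ordinary z : 0 < Im z < 2 * l * t -> off L gall z /\ ordinary z.
Proof.
  intros Hz. split; [|split]; apply rhombic_off_Im; auto.
  - replace (Im (z - mu)%C) with (Im z) by (unfold Im, RtoC; simpl; ring). auto.
  - replace (Im (z + mu)%C) with (Im z) by (unfold Im, RtoC; simpl; ring). auto.
Qed.

Lemma lng_curve (c : R -> C) r k : ordinary (c r) -> vderiv c r k ->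
  is_derive (fun r => lng (c r)) r (Re (k * wzeta3 L mu (c r))%C).
Proof.
  intros [H1 H2] Hc. unfold lng. fold L.
  assert (Cm : forall w, vderiv (fun r => c r + w)%C r k).
  { intros w e He. destruct (Hc e He) as [d [Hd H]]. exists d; split; auto. intros h Hh.
    replace (c (r + h)%R + w - (c r + w) - h * k)%C with (c (r + h)%R - c r - h * k)%C by ring. auto. }
  assert (D1 := lnsigma_curve L HL (fun r => c r + - mu)%C r k H1 (Cm (- mu)%C)).
  assert (D2 := lnsigma_curve L HL (fun r => c r + mu)%C r k H2 (Cm (RtoC mu))).
  assert (D3 := vderiv_Re _ _ _ Hc).
  evar_last.
  - apply (is_derive_plus (V := R_NormedModule)).
    + apply (is_derive_minus (V := R_NormedModule)); [apply D1|apply D2].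
    + apply (is_derive_scal (fun r => Re (c r)) r (2 * Re (wzeta L mu)) _ D3).
  - assert (Ez : wzeta L mu = RtoC (Re (wzeta L mu))) by (apply (wzeta_real l t Hl Ht), mu_off).
    unfold wzeta3. rewrite Ez.
    change (c r - mu)%C with (c r + - mu)%C.
    set (a := wzeta L (c r + - mu)%C). set (b := wzeta L (c r + mu)%C). set (z0 := Re (wzeta L mu)).
    unfold minus, plus, opp, Re, RtoC; simpl. ring.
Qed.

Lemma wzeta3_cC1 z : ordinary z -> cC1 (wzeta3 L mu) z.
Proof.
  intros [H1 H2]. apply cC1_plus; [|apply cC1_const]. apply cC1_minus.
  - apply (cC1_shift (wzeta L) z (- mu)), wzeta_cC1; auto.
  - apply cC1_shift, wzeta_cC1; auto.
Qed.

(** Lattice points are tolerated at the two ends only: the coded value of [1 / phi] need not be its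
    limit there, but the integral ignores end points. *)
Lemma segment_int_lng a b :
  (forall r, 0 <= r <= 1 -> ordinary (a + r * (b - a))%C) ->
  (forall r, 0 < r < 1 -> off L gall (a + r * (b - a))%C) ->
  Re (segment_int (fun nu => / phiC nu)%C a b) = lng b - lng a.
Proof.
  intros Ho Hoff. set (c := fun r : R => (a + r * (b - a))%C).
  assert (V : forall r, vderiv c r (b - a)%C) by (intros; apply vderiv_segment).
  set (p := fun r => Re (wzeta3 L mu (c r))). set (q := fun r => Im (wzeta3 L mu (c r))).
  assert (Cp : forall r, 0 <= r <= 1 -> continuous p r).
  { intros r Hr. eapply continuous_Re_curve; [|apply V]. apply cC1_ccont, wzeta3_cC1, Ho; auto. }
  assert (Cq : forall r, 0 <= r <= 1 -> continuous q r).
  { intros r Hr. eapply continuous_Im_curve; [|apply V]. apply cC1_ccont, wzeta3_cC1, Ho; auto. }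
  assert (Ip : is_RInt p 0 1 (RInt p 0 1)).
  { apply (RInt_correct (V := R_CompleteNormedModule)), (ex_RInt_continuous (V := R_CompleteNormedModule)).
    intros r. rewrite Rmin_left, Rmax_right by lra. apply Cp. }
  assert (Iq : is_RInt q 0 1 (RInt q 0 1)).
  { apply (RInt_correct (V := R_CompleteNormedModule)), (ex_RInt_continuous (V := R_CompleteNormedModule)).
    intros r. rewrite Rmin_left, Rmax_right by lra. apply Cq. }
  assert (IC : is_RInt (V := C_R_NormedModule) (fun r : R => (/ phiC (a + r * (b - a)))%C) 0 1 (RInt p 0 1, RInt q 0 1)).
  { apply (is_RInt_ext (V := C_R_NormedModule) (fun r => wzeta3 L mu (c r))).
    - intros r. rewrite Rmin_left, Rmax_right by lra. intros Hr. symmetry.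
      apply phiC_nonzero_inv; [apply Hoff|apply Ho]; lra.
    - apply (is_RInt_fct_extend_pair (U := R_NormedModule) (V := R_NormedModule) (fun r => wzeta3 L mu (c r))); [apply Ip|apply Iq]. }
  unfold segment_int. rewrite (is_RInt_unique (V := C_R_CompleteNormedModule) _ _ _ _ IC).
  assert (I1 : is_RInt (fun r => Re (b - a)%C * p r - Im (b - a)%C * q r) 0 1
     (Re (b - a)%C * RInt p 0 1 - Im (b - a)%C * RInt q 0 1)).
  { apply (is_RInt_minus (V := R_NormedModule)); apply (is_RInt_scal (V := R_NormedModule)); auto. }
  assert (I2 : is_RInt (fun r => Re (b - a)%C * p r - Im (b - a)%C * q r) 0 1 (lng (c 1) - lng (c 0))).
  { apply (is_RInt_derive (fun r => lng (c r))).
    - intros r. rewrite Rmin_left, Rmax_right by lra. intros Hr.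
      apply (lng_curve c r (b - a)%C); [apply Ho; auto|apply V].
    - intros r. rewrite Rmin_left, Rmax_right by lra. intros Hr.
      apply (continuous_minus (V := R_NormedModule)); apply (continuous_scal_r (V := R_NormedModule)); auto. }
  apply (is_RInt_unique (V := R_CompleteNormedModule)) in I1, I2. rewrite I1 in I2.
  unfold c in I2. replace (a + 1 * (b - a))%C with b in I2 by ring.
  replace (a + 0 * (b - a))%C with a in I2 by ring. rewrite <- I2. reflexivity.
Qed.

Lemma lng_0 : lng 0 = 0.
Proof.
  unfold lng. replace (0 - mu)%C with (- mu)%C by ring. replace (0 + mu)%C with (RtoC mu) by ring.
  rewrite lnsigma_even. unfold Re, RtoC; simpl. ring.
Qed.

Let special (z : C) : Prop := in_lattice L z \/ (~ in_lattice L z /\ phiC z = RtoC 0).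

(** The open strip [0 < Im z < 2 l t] contains neither poles nor zeros of phi, so a path along its
    middle line links 0 to any admissible point of the closed strip, and each segment contributes an
    increment of [lng]. *)
Lemma gauss_modulus (g : C -> C) :
  (forall z p, ~ (~ in_lattice L z /\ phiC z = RtoC 0) -> path_avoiding special 0 z p ->
     g z = (1 * Cexp (path_int (fun nu => / phiC nu) 0 p))%C) ->
  forall z, off L gall z -> phiC z <> RtoC 0 -> Rabs (Im z - l * t) <= l * t ->
  Cmod (g z) = exp (lng z).
Proof.
  intros Hg z Hz Hphi Him.
  assert (Hlt : 0 < l * t) by now apply Rmult_lt_0_compat.
  assert (Oz := ordinary_of_nonzero z Hz Hphi).
  assert (Hs : forall p, 0 < Im p < 2 * l * t -> ~ special p).
  { intros p Hp [K|[_ K]]; destruct (strip_ordinary p Hp) as [A B].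
    - now apply off_gall in A.
    - now apply (phiC_nonzero p). }
  (* Up the imaginary axis to half the height of the strip, then across, then vertically to [z]. *)
  set (z1 := (0, l * t)%R : C). set (z2 := (Re z, l * t)%R : C).
  apply Rabs_le_between in Him.
  assert (I1 : forall r : R, Im (0 + r * (z1 - 0))%C = r * (l * t)) by (intros; unfold Im, z1, RtoC; simpl; ring).
  assert (I2 : forall r : R, Im (z1 + r * (z2 - z1))%C = l * t) by (intros; unfold Im, z1, z2, RtoC; simpl; ring).
  assert (I3 : forall r : R, Im (z2 + r * (z - z2))%C = l * t + r * (Im z - l * t))
    by (intros; unfold Im, z1, z2, RtoC; simpl; ring).
  assert (B3 : forall r, 0 <= r < 1 -> 0 < l * t + r * (Im z - l * t) < 2 * l * t) by (intros; split; nra).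
  rewrite (Hg z [z1; z2; z]).
  - rewrite Cmod_mult, Cmod_1, Rmult_1_l, Cmod_Cexp. f_equal. simpl path_int.
    replace (Re _) with (Re (segment_int (fun nu => / phiC nu)%C 0 z1) + (Re (segment_int (fun nu => / phiC nu)%C z1 z2)
       + Re (segment_int (fun nu => / phiC nu)%C z2 z))) by (unfold Re, RtoC; simpl; ring).
    rewrite !segment_int_lng.
    + rewrite lng_0. ring.
    + intros r Hr. destruct (Req_dec r 1) as [->|N].
      * now replace (z2 + 1 * (z - z2))%C with z by ring.
      * apply strip_ordinary. rewrite I3. apply B3. lra.
    + intros r Hr. apply strip_ordinary. rewrite I3. apply B3. lra.
    + intros r Hr. apply strip_ordinary. rewrite I2. lra.
    + intros r Hr. apply strip_ordinary. rewrite I2. lra.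
    + intros r Hr. destruct (Req_dec r 0) as [->|N].
      * replace (0 + 0 * (z1 - 0))%C with (RtoC 0) by ring. split.
        -- replace (0 - mu)%C with (- mu)%C by ring. apply off_gall_opp, mu_off.
        -- replace (0 + mu)%C with (RtoC mu) by ring. apply mu_off.
      * apply strip_ordinary. rewrite I1. split; nra.
    + intros r Hr. apply strip_ordinary. rewrite I1. split; nra.
  - tauto.
  - split; [reflexivity|]. intros p Hp. simpl in Hp.
    destruct Hp as [[r [Hr ->]]|[[r [Hr ->]]|[[r [Hr ->]]| ->]]]; auto.
    + destruct (Req_dec r 0) as [->|N]; [left; ring|]. right; right. apply Hs. rewrite I1. split; nra.
    + right; right. apply Hs. rewrite I2. lra.
    + destruct (Req_dec r 1) as [->|N]; [right; left; ring|]. right; right. apply Hs. rewrite I3. apply B3. lra.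
Qed.

(** [4 l - mu] is the next zero of phi after [mu] on the real axis. *)
Lemma real_ordinary x : 0 < x < 4 * l - mu -> x <> mu -> ordinary (RtoC x).
Proof.
  intros Hx N. split.
  - rewrite <- RtoC_minus. destruct (Rlt_dec mu x); [apply rhombic_off_real; auto; lra|].
    replace (RtoC (x - mu)) with (- RtoC (mu - x))%C by (rewrite <- RtoC_opp; f_equal; ring).
    apply off_gall_opp, rhombic_off_real; auto; lra.
  - rewrite <- RtoC_plus. apply rhombic_off_real; auto; lra.
Qed.

Lemma lng_real_derive x : 0 < x < 4 * l - mu -> x <> mu ->
  is_derive (fun x => lng (RtoC x)) x (/ phr l t mu x).
Proof.
  intros Hx N. assert (O := real_ordinary x Hx N).
  assert (V := vderiv_line 0 1 x).
  assert (D := lng_curve (fun r : R => 0 + r * 1)%C x 1).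
  cbv beta in D. replace (0 + x * 1)%C with (RtoC x) in D by ring. specialize (D O V).
  evar_last.
  - eapply is_derive_ext; [|apply D]. intros r. cbv beta. f_equal. ring.
  - assert (Hoff : off L gall x) by (apply rhombic_off_real; auto; lra).
    rewrite Cmult_1_l, <- phiC_nonzero_inv by auto.
    assert (E : phiC x = RtoC (phr l t mu x)) by (apply (phr_complex l t mu); auto; lra).
    rewrite E, <- RtoC_inv; [reflexivity|].
    intro K. apply (phiC_nonzero x Hoff O). now rewrite E, K.
Qed.

(** The sum has derivative [- wp (2 l + x) + wp (2 l - x)], which is 0 because the two arguments are
    opposite modulo the period [4 l]. *)
Lemma wzeta_half_period (x : R) : 0 <= x < 2 * l ->
  Re (wzeta L (RtoC (2 * l + x))) + Re (wzeta L (RtoC (2 * l - x))) = 2 * Re (wzeta L (RtoC (2 * l))).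
Proof.
  intros Hx.
  assert (E := cderiv_zero_segment (fun z => wzeta L (RtoC (2 * l) + z) + wzeta L (RtoC (2 * l) - z))%C 0 x).
  cbv beta in E. lapply E; clear E; [intros E|].
  2:{ intros r Hr.
    replace (0 + r * (x - 0))%C with (RtoC (r * x)) by (rewrite RtoC_mult; ring).
    assert (Hrx : 0 <= r * x < 2 * l) by (split; nra).
    assert (O1 : off L gall (RtoC (2 * l + r * x))) by (apply rhombic_off_real; auto; lra).
    assert (O2 : off L gall (RtoC (2 * l - r * x))) by (apply rhombic_off_real; auto; lra).
    rewrite RtoC_plus in O1. rewrite RtoC_minus in O2.
    apply (cderiv_eq _ _ (- wp L (RtoC (r * x) + RtoC (2 * l)) + - - wp L (RtoC (2 * l) - RtoC (r * x)))%C).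
    - replace (RtoC (2 * l) - RtoC (r * x))%C with (- (RtoC (r * x) - RtoC (2 * l)))%C by ring. rewrite wp_even.
      rewrite <- (wp_periodic L HL 1 1 (RtoC (r * x) - RtoC (2 * l))%C).
      + replace (RtoC (r * x) - RtoC (2 * l) + lattice_pt L 1 1)%C with (RtoC (r * x) + RtoC (2 * l))%C; [ring|].
        unfold lattice_pt, L, rhombic; simpl. rewrite !RtoC_mult. ring.
      + replace (RtoC (r * x) - RtoC (2 * l))%C with (- (RtoC (2 * l) - RtoC (r * x)))%C by ring.
        now apply off_gall_opp.
    - apply cderiv_plus.
      + apply (cderiv_ext (fun z => wzeta L (z + RtoC (2 * l)))%C); [intros; f_equal; ring|].
        apply cderiv_shift. apply wzeta_cderiv; auto.
        now replace (RtoC (r * x) + RtoC (2 * l))%C with (RtoC (2 * l) + RtoC (r * x))%C by ring.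
      + apply cderiv_reflect. now apply wzeta_cderiv. }
  rewrite <- RtoC_plus, <- !RtoC_minus, <- RtoC_plus, Rplus_0_r, Rminus_0_r in E.
  transitivity (Re (wzeta L (RtoC (2 * l + x)) + wzeta L (RtoC (2 * l - x)))%C); [reflexivity|].
  rewrite <- E. unfold Re; simpl. ring.
Qed.

(** [log |sigma(2 l + x)| - log |sigma(2 l - x)|] is linear in [x] with slope [2 zeta(2 l)]. Hence
    the value sought is [4 l zeta(mu) - 2 mu zeta(2 l)], which the equation defining [C_s] sets to
    0. *)
Lemma lng_half : lng (RtoC (2 * l)) = 0.
Proof.
  set (V := fun x => lnsigma L (RtoC (2 * l + x)) - lnsigma L (RtoC (2 * l - x))).
  assert (D : forall x, 0 <= x <= mu -> is_derive V x (2 * Re (wzeta L (RtoC (2 * l))))).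
  { intros x Hx. rewrite <- (wzeta_half_period x) by lra.
    assert (O1 : off L gall (RtoC (2 * l) + x * 1)%C).
    { replace (RtoC (2 * l) + x * 1)%C with (RtoC (2 * l + x)) by (rewrite RtoC_plus; ring).
      apply rhombic_off_real; auto; lra. }
    assert (O2 : off L gall (RtoC (2 * l) + x * - (1))%C).
    { replace (RtoC (2 * l) + x * - (1))%C with (RtoC (2 * l - x)) by (rewrite RtoC_minus; ring).
      apply rhombic_off_real; auto; lra. }
    assert (D1 := lnsigma_curve L HL (fun r : R => RtoC (2 * l) + r * 1)%C x 1 O1 (vderiv_line _ _ _)).
    assert (D2 := lnsigma_curve L HL (fun r : R => RtoC (2 * l) + r * - (1))%C x (- (1)) O2 (vderiv_line _ _ _)).
    unfold V. evar_last.
    - apply (is_derive_minus (V := R_NormedModule)).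
      + eapply is_derive_ext; [|apply D1]. intros r. cbv beta. f_equal. rewrite RtoC_plus. ring.
      + eapply is_derive_ext; [|apply D2]. intros r. cbv beta. f_equal. rewrite RtoC_minus. ring.
    - replace (RtoC (2 * l) + x * 1)%C with (RtoC (2 * l + x)) by (rewrite RtoC_plus; ring).
      replace (RtoC (2 * l) + x * - (1))%C with (RtoC (2 * l - x)) by (rewrite RtoC_minus; ring).
      set (a := wzeta L (RtoC (2 * l + x))). set (b := wzeta L (RtoC (2 * l - x))).
      unfold minus, plus, opp, Re, RtoC; simpl. ring. }
  destruct (MVT_cor2 V (fun _ => 2 * Re (wzeta L (RtoC (2 * l)))) 0 mu) as [c [E _]]; [lra| |].
  { intros c Hc. apply is_derive_Reals, D; auto. }
  unfold V in E. rewrite Rplus_0_r, Rminus_0_r in E.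
  unfold lng. fold L. rewrite <- RtoC_minus, <- RtoC_plus.
  change (Re (RtoC (2 * l))) with (2 * l).
  set (a := Re (wzeta L mu)) in *. set (b := Re (wzeta L (RtoC (2 * l)))) in *. lra.
Qed.

(** The reflection in the imaginary axis preserves [|sigma|]; for [z] on that axis it sends [z - mu]
    to [z + mu], and the linear term vanishes. *)
Lemma lng_imaginary y : lng (0, y) = 0.
Proof.
  unfold lng. rewrite <- (lnsigma_conj l t ((0, y) - mu)%C), <- (lnsigma_even _ (Cconj _)).
  replace (- Cconj ((0, y) - mu))%C with ((0, y) + mu)%C.
  - unfold Re; simpl. ring.
  - unfold Cconj, RtoC, Cplus, Cminus, Copp; simpl. f_equal; ring.
Qed.

Lemma ordinary_reflect z : ordinary z -> ordinary (lattice_pt L 0 1 - z)%C.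
Proof.
  intros [H1 H2]. split.
  - replace (lattice_pt L 0 1 - z - mu)%C with (- (z + mu) + lattice_pt L 0 1)%C by ring.
    now apply off_gall_shift, off_gall_opp.
  - replace (lattice_pt L 0 1 - z + mu)%C with (- (z - mu) + lattice_pt L 0 1)%C by ring.
    now apply off_gall_shift, off_gall_opp.
Qed.

(** [wzeta3] is even and periodic, so [lng z + lng (2 omega2 - z)] has derivative 0. *)
Lemma lng_reflect_segment a b : (forall r, 0 <= r <= 1 -> ordinary (a + r * (b - a))%C) ->
  lng (lattice_pt L 0 1 - a)%C + lng a = lng (lattice_pt L 0 1 - b)%C + lng b.
Proof.
  intros Ho. set (w := lattice_pt L 0 1).
  set (E := fun r : R => lng ((w - a) + r * - (b - a))%C + lng (a + r * (b - a))%C).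
  assert (Er : forall r : R, ((w - a) + r * - (b - a))%C = (w - (a + r * (b - a)))%C) by (intros; ring).
  assert (D : forall r, 0 <= r <= 1 -> is_derive E r 0).
  { intros r Hr. assert (O := Ho r Hr). assert (O' := ordinary_reflect _ O). fold w in O'. rewrite <- Er in O'.
    evar_last; [apply (is_derive_plus (V := R_NormedModule));
      [apply (lng_curve _ _ _ O' (vderiv_line _ _ _))|apply (lng_curve _ _ _ O (vderiv_line _ _ _))]|].
    assert (P : wzeta3 L mu (w - a + r * - (b - a))%C = wzeta3 L mu (a + r * (b - a))%C).
    { rewrite Er. set (z := (a + r * (b - a))%C) in *. destruct O as [O1 O2].
      replace (w - z)%C with (- z + lattice_pt L 0 1)%C by (unfold w; ring).
      rewrite wzeta3_periodic.
      - now apply wzeta3_even.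
      - auto.
      - replace (- z - mu)%C with (- (z + mu))%C by ring. now apply off_gall_opp.
      - replace (- z + mu)%C with (- (z - mu))%C by ring. now apply off_gall_opp. }
    rewrite P. set (q := wzeta3 L mu _). unfold plus, Re; simpl. ring. }
  assert (F := eq_is_derive E 0 1 D Rlt_0_1). unfold E in F.
  replace (w - a + 0 * - (b - a))%C with (w - a)%C in F by ring.
  replace (w - a + 1 * - (b - a))%C with (w - b)%C in F by ring.
  replace (a + 0 * (b - a))%C with a in F by ring.
  now replace (a + 1 * (b - a))%C with b in F by ring.
Qed.

(** The constant [lng z + lng (2 omega2 - z)] is evaluated at [z = 2 l], whose image
    [2 omega2 - 2 l] is purely imaginary: both terms are 0. The path from [2 l] to [x] leaves the
    real axis because the zero [mu] of phi may lie between them. *)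
Lemma lng_reflect x : 0 < x <= 2 * l -> x <> mu -> lng (2 * l - x, 2 * l * t)%R = - lng (RtoC x).
Proof.
  intros Hx N. assert (Hlt : 0 < l * t) by now apply Rmult_lt_0_compat.
  assert (Ew : forall y, (lattice_pt L 0 1 - RtoC y)%C = (2 * l - y, 2 * l * t)%R).
  { intros y. unfold L. rewrite rhombic_pt. unfold RtoC, Cminus, Cplus, Copp; simpl. f_equal; ring. }
  assert (O1 : ordinary (RtoC (2 * l))) by (apply real_ordinary; lra).
  assert (O2 : ordinary (RtoC x)) by (apply real_ordinary; auto; lra).
  assert (S1 := lng_reflect_segment (RtoC (2 * l)) (2 * l, l * t)%R).
  assert (S2 := lng_reflect_segment (2 * l, l * t)%R (x, l * t)%R).
  assert (S3 := lng_reflect_segment (x, l * t)%R (RtoC x)).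
  assert (T : lng (lattice_pt L 0 1 - RtoC (2 * l))%C + lng (RtoC (2 * l)) = lng (lattice_pt L 0 1 - RtoC x)%C + lng (RtoC x)).
  { rewrite S1, S2, S3; auto; intros r Hr.
    - destruct (Req_dec r 1) as [->|N1].
      + now replace ((x, l * t)%R + 1 * (RtoC x - (x, l * t)%R))%C with (RtoC x) by ring.
      + apply strip_ordinary. replace (Im _) with (l * t * (1 - r)) by (unfold Im, RtoC; simpl; ring). split; nra.
    - apply strip_ordinary. replace (Im _) with (l * t) by (unfold Im, RtoC; simpl; ring). lra.
    - destruct (Req_dec r 0) as [->|N1].
      + now replace (RtoC (2 * l) + 0 * ((2 * l, l * t)%R - RtoC (2 * l)))%C with (RtoC (2 * l)) by ring.
      + apply strip_ordinary. replace (Im _) with (l * t * r) by (unfold Im, RtoC; simpl; ring). split; nra. }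
  rewrite !Ew, lng_half in T. replace (2 * l - 2 * l) with 0 in T by ring. rewrite lng_imaginary in T. lra.
Qed.
End Gauss.

(** * Algebras of functions closed under differentiation *)

(** A function in an algebra generated by functions whose derivatives stay in it has derivatives of
    all orders. Smoothness of the solution of Wente's system is obtained this way, without formulas
    for higher derivatives. *)
Inductive alg (B : (R -> R) -> Prop) : (R -> R) -> Prop :=
| alg_base f : B f -> alg B f
| alg_const c : alg B (fun _ => c)
| alg_plus f g : alg B f -> alg B g -> alg B (fun x => f x + g x)
| alg_mult f g : alg B f -> alg B g -> alg B (fun x => f x * g x).

Definition diff_closed (a b : R) (B : (R -> R) -> Prop) : Prop :=
  forall f, B f -> exists f', alg B f' /\ forall x, a < x < b -> is_derive f x (f' x).

Definition adjoin (B : (R -> R) -> Prop) (h : R -> R) : (R -> R) -> Prop := fun f => B f \/ f = h.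

Lemma alg_mono (B B' : (R -> R) -> Prop) f : (forall h, B h -> alg B' h) -> alg B f -> alg B' f.
Proof.
  intros H K. induction K.
  - auto.
  - apply alg_const.
  - now apply alg_plus.
  - now apply alg_mult.
Qed.

Lemma alg_adjoin B h f : alg B f -> alg (adjoin B h) f.
Proof. apply alg_mono. intros. apply alg_base. now left. Qed.

Lemma alg_adjoined B h : alg (adjoin B h) h.
Proof. apply alg_base. now right. Qed.

Lemma alg_derive a b B f : diff_closed a b B -> alg B f ->
  exists f', alg B f' /\ forall x, a < x < b -> is_derive f x (f' x).
Proof.
  intros HB H. induction H as [f Hf|c|f g _ [f' [Hf1 Hf2]] _ [g' [Hg1 Hg2]]|f g Hf [f' [Hf1 Hf2]] Hg [g' [Hg1 Hg2]]].
  - auto.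
  - exists (fun _ => 0). split; [apply alg_const|]. intros. apply (is_derive_const (V := R_NormedModule)).
  - exists (fun x => f' x + g' x). split; [now apply alg_plus|]. intros x Hx.
    apply (is_derive_plus (V := R_NormedModule)); auto.
  - exists (fun x => f' x * g x + f x * g' x). split; [apply alg_plus; apply alg_mult; auto|]. intros x Hx.
    apply (is_derive_mult f g x (f' x) (g' x)); auto. intros; apply Rmult_comm.
Qed.

Lemma diff_closed_adjoin a b B h h' : diff_closed a b B -> alg (adjoin B h) h' ->
  (forall x, a < x < b -> is_derive h x (h' x)) -> diff_closed a b (adjoin B h).
Proof.
  intros HB Hh' Hd f [Hf| ->].
  - destruct (HB f Hf) as [f' [H1 H2]]. exists f'. split; auto. now apply alg_adjoin.
  - now exists h'.
Qed.

Lemma diff_closed_inv a b B h : diff_closed a b B -> alg B h -> (forall x, a < x < b -> h x <> 0) ->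
  diff_closed a b (adjoin B (fun x => / h x)).
Proof.
  intros HB Hh H0. destruct (alg_derive a b B h HB Hh) as [h' [H1 H2]].
  apply (diff_closed_adjoin a b B _ (fun x => (-1) * h' x * (/ h x * / h x))); auto.
  - apply alg_mult; [apply alg_mult; [apply alg_const|now apply alg_adjoin]|].
    apply alg_mult; apply alg_adjoined.
  - intros x Hx. evar_last; [apply is_derive_inv; [apply H2, Hx|now apply H0]|]. field. now apply H0.
Qed.

(** On the interval every iterated derivative coincides with an element of the algebra. *)
Lemma alg_smooth a b B f : diff_closed a b B -> alg B f -> forall u, a < u < b -> smooth_at f u.
Proof.
  intros HB Hf.
  assert (Hloc : forall x, a < x < b -> locally x (fun y => a < y < b)).
  { intros x Hx. apply (locally_interval _ x a b); simpl; try lra. intros; lra. }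
  assert (K : forall n, exists fn, alg B fn /\ forall x, a < x < b -> Derive_n f n x = fn x).
  { induction n as [|n [fn [H1 H2]]]; [now exists f|].
    destruct (alg_derive a b B fn HB H1) as [g [G1 G2]]. exists g. split; auto. intros x Hx.
    simpl. rewrite (Derive_ext_loc _ fn).
    - now apply is_derive_unique, G2.
    - eapply filter_imp; [|apply Hloc, Hx]. auto. }
  intros u Hu. unfold smooth_at.
  apply (filter_imp (F := locally u) (fun y => a < y < b)); [|now apply Hloc]. intros x Hx n.
  destruct n as [|n]; simpl; auto. destruct (K n) as [fn [H1 H2]].
  destruct (alg_derive a b B fn HB H1) as [g [G1 G2]]. exists (g x).
  apply (is_derive_ext_loc fn); [|now apply G2].
  eapply filter_imp; [|apply Hloc, Hx]. intros y Hy. symmetry. auto.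
Qed.

Lemma alg_reflect (B B' : (R -> R) -> Prop) b f :
  (forall h, B h -> B' (fun x => h (b - x))) -> alg B f -> alg B' (fun x => f (b - x)).
Proof.
  intros H K. induction K.
  - apply alg_base; auto.
  - apply alg_const.
  - now apply (alg_plus B' (fun x => f (b - x)) (fun x => g (b - x))).
  - now apply (alg_mult B' (fun x => f (b - x)) (fun x => g (b - x))).
Qed.

Lemma is_derive_reflect (f : R -> R) b x d : is_derive f (b - x) d -> is_derive (fun x => f (b - x)) x (- d).
Proof.
  intros H. evar_last.
  - apply (is_derive_comp f (fun x => b - x) x d (-1) H). auto_derive; auto; ring.
  - unfold scal; simpl. unfold mult; simpl. ring.
Qed.

Lemma diff_closed_reflect b B : diff_closed 0 b B ->
  diff_closed 0 b (fun f => B f \/ exists h, B h /\ f = (fun x => h (b - x))).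
Proof.
  intros HB f [Hf|[h [Hh ->]]].
  - destruct (HB f Hf) as [f' [H1 H2]]. exists f'. split; auto.
    eapply alg_mono; [|apply H1]. intros k Hk. apply alg_base. auto.
  - destruct (HB h Hh) as [h' [H1 H2]]. exists (fun x => (-1) * h' (b - x)). split.
    + apply alg_mult; [apply alg_const|]. apply (alg_reflect B); auto. intros k Hk. right. now exists k.
    + intros x Hx. evar_last; [apply is_derive_reflect, H2; lra|]. ring.
Qed.

(** * Second-order behaviour at the ends of the interval *)

(** The mean value theorem for [y (b - u) - k u^2], whose derivative is nonnegative for small [u]
    because [y1] is close to its linear part of slope [m > 2 k]. *)
Lemma second_order_lower (y y1 : R -> R) (b e m k : R) : 0 < e ->
  (forall x, b - e < x <= b -> is_derive y x (y1 x)) -> y1 b = 0 -> is_derive y1 b m -> 2 * k < m ->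
  exists d, 0 < d /\ forall u, 0 < u < d -> y b + k * u ^ 2 <= y (b - u).
Proof.
  intros He Hy H0 H1 Hk. apply is_derive_eps with (e := m - 2 * k) in H1; [|lra].
  destruct H1 as [d [Hd H]]. exists (Rmin d e). split; [now apply Rmin_pos|]. intros u Hu.
  assert (U1 := Rlt_le_trans _ _ _ (proj2 Hu) (Rmin_l _ _)).
  assert (U2 := Rlt_le_trans _ _ _ (proj2 Hu) (Rmin_r _ _)).
  destruct (MVT_cor2 (fun u => y (b - u) - k * u ^ 2) (fun u => - y1 (b - u) - 2 * k * u) 0 u) as [c [E Hc]]; [lra| |].
  - intros c Hc. apply is_derive_Reals. evar_last.
    + apply (is_derive_minus (V := R_NormedModule)).
      * apply is_derive_reflect, Hy. lra.
      * apply is_derive_scal, is_derive_pow, is_derive_id.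
    + unfold minus, plus, opp, one; simpl. ring.
  - specialize (H (- c)). rewrite Rabs_Ropp, Rabs_pos_eq in H by lra. specialize (H ltac:(lra)).
    rewrite H0 in H. apply Rabs_le_between in H. replace (b + - c) with (b - c) in H by ring.
    rewrite Rminus_0_r in E.
    assert (0 <= (- y1 (b - c) - 2 * k * c) * (u - 0)) by (apply Rmult_le_pos; lra). lra.
Qed.

Lemma interior_critical_point (D D' : R -> R) (a b u0 : R) :
  a < u0 < b -> (forall x, a <= x <= b -> is_derive D x (D' x)) -> D u0 < D a -> D u0 < D b ->
  exists u, a < u < b /\ D u <= D u0 /\ D' u = 0.
Proof.
  intros Hu HD Ha Hb.
  assert (HR : forall x, a <= x <= b -> derivable_pt D x).
  { intros x Hx. exists (D' x). now apply is_derive_Reals, HD. }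
  destruct (continuity_ab_min D a b) as [u [Hmin Hu1]]; [lra| |].
  - intros c Hc. now apply derivable_continuous_pt, HR.
  - exists u. assert (Hle := Hmin u0 ltac:(lra)).
    assert (u <> a) by (intros ->; lra). assert (u <> b) by (intros ->; lra).
    split; [lra|]. split; auto.
    assert (E := deriv_minimum D a b u (HR u Hu1) ltac:(lra) ltac:(lra)
      (fun x H1 H2 => Hmin x ltac:(lra))).
    rewrite <- E. symmetry. rewrite derive_pt_eq. now apply is_derive_Reals, HD.
Qed.

(* If D = y(x) - y(b-x) has limit -y(b) at 0 but second-order coefficient
   1/4 - k < 0 there, then D takes values below both D(0+) and D(b/2) = 0. *)
Lemma critical_point_exists (y y' : R -> R) (b yb k Bd e : R) :
  0 < b -> 0 < yb -> 1 / 4 < k -> 0 < e ->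
  (forall x, 0 < x < b -> 0 < y x /\ is_derive y x (y' x)) ->
  (forall x, 0 < x < e -> y x * (4 / x ^ 2 - Bd) <= 1) ->
  (forall x, 0 < x < e -> yb + k * x ^ 2 <= y (b - x)) ->
  (forall eta, 0 < eta -> exists d, 0 < d /\ forall x, 0 < x < d -> y (b - x) < yb + eta) ->
  exists u, 0 < u < b / 2 /\ y u < y (b - u) /\ y' u + y' (b - u) = 0.
Proof.
  intros Hb Hyb Hk He Hy Hu Hl Hc.
  set (D := fun x => y x - y (b - x)). set (D' := fun x => y' x + y' (b - x)).
  assert (HD : forall x, 0 < x < b -> is_derive D x (D' x)).
  { intros x Hx. evar_last.
    - apply (is_derive_minus (V := R_NormedModule)); [apply Hy, Hx|].
      apply is_derive_reflect, Hy. lra.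
    - unfold D', minus, plus, opp; simpl. ring. }
  (* The margin left by [1 / 4 < k]: for small [x] with [Bd * x ^ 2 < c], the upper bound at 0 gives
     [y x < k * x ^ 2], hence [D x < - yb]. *)
  set (c := 4 - 1 / k).
  assert (Hc0 : 0 < c).
  { unfold c. apply (Rmult_lt_reg_r k); [lra|]. replace ((4 - 1 / k) * k) with (4 * k - 1) by (field; lra). lra. }
  set (u0 := Rmin (Rmin (e / 2) (b / 4)) (Rmin 1 (c / (2 * (1 + Rabs Bd))))).
  assert (PB := Rabs_pos Bd).
  assert (A1 : u0 <= e / 2) by (eapply Rle_trans; [apply Rmin_l|apply Rmin_l]).
  assert (A2 : u0 <= b / 4) by (eapply Rle_trans; [apply Rmin_l|apply Rmin_r]).
  assert (A3 : u0 <= 1) by (eapply Rle_trans; [apply Rmin_r|apply Rmin_l]).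
  assert (A4 : u0 <= c / (2 * (1 + Rabs Bd))) by (eapply Rle_trans; [apply Rmin_r|apply Rmin_r]).
  assert (A0 : 0 < u0) by (repeat apply Rmin_pos; try apply Rdiv_lt_0_compat; lra).
  assert (Bu : Bd * u0 ^ 2 < c).
  { apply (Rmult_le_compat_r (2 * (1 + Rabs Bd))) in A4; [|lra].
    replace (c / (2 * (1 + Rabs Bd)) * (2 * (1 + Rabs Bd))) with c in A4 by (field; lra).
    assert (Bd * u0 ^ 2 <= Rabs Bd * u0 ^ 2) by (apply Rmult_le_compat_r; [apply pow2_ge_0|apply Rle_abs]).
    assert (Rabs Bd * u0 ^ 2 <= Rabs Bd * u0) by (apply Rmult_le_compat_l; auto; nra). nra. }
  assert (Du0 : D u0 < - yb).
  { assert (H1 := Hu u0 ltac:(lra)). assert (H2 := Hl u0 ltac:(lra)). destruct (Hy u0 ltac:(lra)) as [H3 _].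
    assert (P2 : 0 < u0 ^ 2) by (apply pow_lt; auto).
    assert (H4 : y u0 * (4 - Bd * u0 ^ 2) <= u0 ^ 2).
    { replace (4 - Bd * u0 ^ 2) with ((4 / u0 ^ 2 - Bd) * u0 ^ 2) by (field; lra).
      assert (y u0 * (4 / u0 ^ 2 - Bd) * u0 ^ 2 <= 1 * u0 ^ 2) by (apply Rmult_le_compat_r; lra). lra. }
    assert (H5 : 1 / k < 4 - Bd * u0 ^ 2) by (unfold c in Bu; lra).
    assert (H6 : y u0 * (1 / k) < u0 ^ 2) by nra.
    apply (Rmult_lt_compat_r k) in H6; [|lra].
    replace (y u0 * (1 / k) * k) with (y u0) in H6 by (field; lra). unfold D. lra. }
  destruct (Hc (- D u0 - yb) ltac:(lra)) as [d [Hd Hlim]].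
  (* No value of [D] at 0 is used; near 0 it approaches [- yb], and [a] is small enough for
     [D a > D u0]. *)
  set (a := Rmin (d / 2) (u0 / 2)).
  assert (B0 : 0 < a) by (apply Rmin_pos; lra).
  assert (B1 : a <= d / 2) by apply Rmin_l. assert (B2 : a <= u0 / 2) by apply Rmin_r.
  destruct (interior_critical_point D D' a (b / 2) u0) as [u [Hu1 [Hu2 Hu3]]].
  - lra.
  - intros x Hx. apply HD. lra.
  - specialize (Hlim a ltac:(lra)). destruct (Hy a ltac:(lra)) as [H1 _]. unfold D in *. lra.
  - unfold D at 2. replace (b - b / 2) with (b / 2) by field. lra.
  - exists u. split; [lra|]. split; [|exact Hu3]. unfold D in *. lra.
Qed.

Lemma continuous_eq_locally' (f g : R -> R) (p : R) :
  continuous f p -> continuous g p -> locally' p (fun x => f x = g x) -> f p = g p.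
Proof.
  intros Hf Hg H.
  apply (filterlim_locally_unique (F := Rbar_locally' p) f); simpl.
  - intros P HP. destruct (Hf P HP) as [e He]. exists e. intros x Hx _. apply He, Hx.
  - apply (filterlim_ext_loc g).
    + destruct H as [e He]. exists e. intros x Hx N. symmetry. now apply He.
    + intros P HP. destruct (Hg P HP) as [e He]. exists e. intros x Hx _. apply He, Hx.
Qed.

Lemma diff_closed_restrict a b a' b' B : a <= a' -> b' <= b -> diff_closed a b B -> diff_closed a' b' B.
Proof.
  intros Ha Hb HB f Hf. destruct (HB f Hf) as [f' [H1 H2]]. exists f'. split; auto.
  intros x Hx. apply H2. lra.
Qed.

(* Two equations 2 omega_u = alpha e^omega + beta e^(-omega) on the same vertical
   line determine alpha and beta, smoothly, wherever the two values of e^omega differ. *)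
Lemma wente_solution (b p : R) (B : (R -> R) -> Prop) (H dH alpha beta : R -> R) (sing : R -> Prop) :
  diff_closed 0 b B -> alg B H -> alg B dH -> (forall x, 0 < x < b -> 0 < H x) ->
  0 < p < b -> H p <> H (b - p) ->
  (forall u, ~ sing u -> smooth_at alpha u /\ smooth_at beta u) ->
  (sing p -> ~ exists f g : R -> R, smooth_at f p /\ smooth_at g p /\
     locally' p (fun x => f x = alpha x /\ g x = beta x)) ->
  locally' p (fun x => 2 * dH x = alpha x * H x ^ 2 + beta x /\
     - 2 * dH (b - x) = alpha x * H (b - x) ^ 2 + beta x) ->
  ~ sing p /\ beta p = 2 * (dH p * H (b - p) ^ 2 + dH (b - p) * H p ^ 2) * / (H (b - p) ^ 2 - H p ^ 2).
Proof.
  intros HB HH HdH Hpos Hp Hne Hsm Hsing Heq.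
  set (B4 := fun f => B f \/ exists h, B h /\ f = (fun x => h (b - x))).
  assert (HB4 : diff_closed 0 b B4) by now apply diff_closed_reflect.
  assert (M : forall f, alg B f -> alg B4 f).
  { intros f. apply alg_mono. intros h Hh. apply alg_base. now left. }
  assert (Mr : forall f, alg B f -> alg B4 (fun x => f (b - x))).
  { intros f. apply alg_reflect. intros h Hh. right. now exists h. }
  (* Up to sign, the determinant of the two equations, which are linear in [alpha x] and
     [beta x]. *)
  set (E := fun x => H (b - x) * H (b - x) + (-1) * (H x * H x)).
  assert (HE : alg B4 E).
  { apply alg_plus; [apply (alg_mult B4 (fun x => H (b - x)) (fun x => H (b - x))); auto|].
    apply alg_mult; [apply alg_const|]. apply alg_mult; auto. }
  assert (Ep : E p <> 0).
  { unfold E. assert (P1 := Hpos p Hp). assert (P2 := Hpos (b - p) ltac:(lra)).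
    replace (H (b - p) * H (b - p) + -1 * (H p * H p)) with ((H (b - p) - H p) * (H (b - p) + H p)) by ring.
    apply Rmult_integral_contrapositive_currified; lra. }
  destruct (alg_derive 0 b B4 E HB4 HE) as [E' [_ HE']].
  assert (CE : continuous E p).
  { apply (ex_derive_continuous (K := R_AbsRing) (V := R_NormedModule)). eexists. apply HE'; auto. }
  assert (Hnear : exists e, 0 < e /\ 0 <= p - e /\ p + e <= b /\ forall x, p - e < x < p + e -> E x <> 0).
  { apply continuity_pt_filterlim in CE. destruct (CE (Rabs (E p)) (Rabs_pos_lt _ Ep)) as [d [Hd Hc]].
    exists (Rmin d (Rmin p (b - p))).
    assert (A1 := Rmin_l d (Rmin p (b - p))). assert (A2 := Rmin_r d (Rmin p (b - p))).
    assert (A3 := Rmin_l p (b - p)). assert (A4 := Rmin_r p (b - p)).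
    split; [repeat apply Rmin_pos; lra|]. split; [lra|]. split; [lra|]. intros x Hx K.
    destruct (Req_dec x p) as [->|N]; [auto|].
    specialize (Hc x). simpl in Hc. unfold R_dist in Hc.
    assert (Rabs (E x - E p) < Rabs (E p)).
    { apply Hc. split; [split; [exact I|auto]|]. apply Rabs_def1; lra. }
    rewrite K, Rminus_0_l, Rabs_Ropp in H0. lra. }
  destruct Hnear as [e [He [He1 [He2 HE0]]]].
  set (B5 := adjoin B4 (fun x => / E x)).
  assert (HB5 : diff_closed (p - e) (p + e) B5).
  { apply diff_closed_inv; auto. now apply (diff_closed_restrict 0 b). }
  (* Cramer's rule; the second equation carries [- dH (b - x)], which turns the expected differences
     into sums. *)
  set (a0 := fun x => (-2) * (dH (b - x) + dH x) * / E x).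
  set (b0 := fun x => 2 * (dH x * (H (b - x) * H (b - x)) + dH (b - x) * (H x * H x)) * / E x).
  assert (IE : alg B5 (fun x => / E x)) by apply alg_adjoined.
  assert (M5 : forall f, alg B f -> alg B5 f) by (intros; now apply alg_adjoin, M).
  assert (M5r : forall f, alg B f -> alg B5 (fun x => f (b - x))) by (intros; now apply alg_adjoin, Mr).
  assert (Ha0 : alg B5 a0).
  { apply alg_mult; auto. apply alg_mult; [apply alg_const|]. apply (alg_plus B5 (fun x => dH (b - x)) dH); auto. }
  assert (Hb0 : alg B5 b0).
  { apply alg_mult; auto. apply alg_mult; [apply alg_const|]. apply alg_plus.
    - apply (alg_mult B5 dH); auto. apply (alg_mult B5 (fun x => H (b - x)) (fun x => H (b - x))); auto.
    - apply (alg_mult B5 (fun x => dH (b - x))); auto. apply alg_mult; auto. }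
  assert (Sa := alg_smooth _ _ _ _ HB5 Ha0 p ltac:(lra)).
  assert (Sb := alg_smooth _ _ _ _ HB5 Hb0 p ltac:(lra)).
  assert (Hab : locally' p (fun x => a0 x = alpha x /\ b0 x = beta x)).
  { destruct Heq as [d Hd]. exists (mkposreal _ (Rmin_pos _ _ (cond_pos d) He)). intros x Hx N.
    assert (Hx1 : Rabs (x - p) < Rmin d e) by exact Hx.
    destruct (Hd x (Rlt_le_trans _ _ _ Hx1 (Rmin_l _ _)) N) as [E1 E2].
    assert (Hx2 := Rlt_le_trans _ _ _ Hx1 (Rmin_r _ _)). apply Rabs_def2 in Hx2.
    assert (N0 := HE0 x ltac:(lra)).
    unfold a0, b0. split.
    - apply (Rmult_eq_reg_r (E x)); auto. rewrite Rmult_assoc, Rinv_l, Rmult_1_r by auto.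
      unfold E. simpl in E1, E2. lra.
    - apply (Rmult_eq_reg_r (E x)); auto. rewrite Rmult_assoc, Rinv_l, Rmult_1_r by auto.
      replace (dH x) with ((alpha x * H x ^ 2 + beta x) / 2) by lra.
      replace (dH (b - x)) with (- (alpha x * H (b - x) ^ 2 + beta x) / 2) by lra. unfold E. field. }
  (* The smooth pair [a0], [b0] agrees with [alpha], [beta] around [p], so a singularity at [p]
     would be removable. *)
  assert (NS : ~ sing p).
  { intros K. apply (Hsing K). exists a0, b0. auto. }
  split; auto.
  destruct (Hsm p NS) as [_ Sbeta].
  assert (Cont : forall f, smooth_at f p -> continuous f p).
  { intros f Hf. apply locally_singleton in Hf.
    apply (ex_derive_continuous (K := R_AbsRing) (V := R_NormedModule)), (Hf 1%nat). }
  rewrite <- (continuous_eq_locally' b0 beta p); auto.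
  - unfold b0, E. simpl. f_equal; [ring|f_equal; ring].
  - destruct Hab as [d Hd]. exists d. intros x Hx N. apply (Hd x Hx N).
Qed.

(** * The metric factor on the real axis *)

Section Metric.
Variables l t mu : R.
Hypothesis Hl : 0 < l.
Hypothesis Ht : 0 < t.
Hypothesis Hmu : 0 < mu < 2 * l.
Let L := rhombic l t.
Let HL : nondegenerate L := rhombic_nondegenerate l t Hl Ht.
Hypothesis Hwpd : wpd L mu = RtoC (- (1 / 4)).
Hypothesis Hzeta : 2 * l * Re (wzeta L mu) = Re (wzeta L (RtoC (2 * l))) * mu.
Let f := phr l t mu.
Let f1 := dphr l t.
Let c1 := coef1 l t mu.
Let c2 := coef2 l t mu.

(* K extends |phi| / |g| smoothly across the zero mu of phi and g. *)
Definition quotK (x : R) : R :=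
  4 * Re (wp_quot (rhombic l t) mu x) *
  exp (- lnsigmaR (rhombic l t) (RtoC (x - mu)) + lnsigma (rhombic l t) (RtoC (x + mu))
       - 2 * Re (wzeta (rhombic l t) mu) * x).

(** The logarithmic derivative [(phi' - 1) / phi] of [quotK], freed of its removable singularity at
    [mu]: by the cubic, [(phi' - 1) (phi' + 1) = phi (- phi^2 + coef2 phi - coef1)], and
    [phi' + 1 > 0] on [(0, 2 l)]. *)
Definition kappa (x : R) : R :=
  - (coef1 l t mu - coef2 l t mu * phr l t mu x + phr l t mu x ^ 2) * / (dphr l t x + 1).

Lemma phr_quot x : 0 < x < 4 * l -> f x = 4 * (x - mu) * Re (wp_quot L mu x).
Proof.
  intros Hx.
  assert (E := wp_quot_spec L HL mu x (mu_off l t mu Hl Ht Hmu) ltac:(apply rhombic_off_real; auto)).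
  apply (f_equal Re) in E. unfold f, phr. fold L.
  replace (Re (wp L x - wp L mu)%C) with (Re (wp L x) - Re (wp L mu)) in E by reflexivity.
  replace (Re (- (x - mu) * wp_quot L mu x)%C) with (- (x - mu) * Re (wp_quot L mu x)) in E
    by (set (q := wp_quot L mu x); unfold Re, RtoC; simpl; ring).
  lra.
Qed.

Lemma wp_quot_derivable x : 0 < x < 4 * l -> exists d, is_derive (fun x : R => Re (wp_quot L mu x)) x d.
Proof.
  intros Hx. destruct (wp_quot_cC1 L HL mu x (mu_off l t mu Hl Ht Hmu) ltac:(apply rhombic_off_real; auto)) as [dq Hq].
  apply near_self in Hq. destruct Hq as [Hq _].
  assert (V := cderiv_vderiv (wp_quot L mu) (fun r : R => 0 + r * 1)%C x (dq x) 1).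
  cbv beta in V. replace (0 + x * 1)%C with (RtoC x) in V by ring.
  exists (Re (1 * dq x)%C). eapply is_derive_ext; [|apply (vderiv_Re _ _ _ (V Hq (vderiv_line 0 1 x)))].
  intros r. cbv beta. now replace (0 + r * 1)%C with (RtoC r) by ring.
Qed.

(** [4 * wp_quot] is [phi / (x - mu)], so its value at [mu] is [phi'(mu) = 1]. *)
Lemma wp_quot_mu : 4 * Re (wp_quot L mu mu) = 1.
Proof.
  destruct (wp_quot_derivable mu ltac:(lra)) as [d Hd].
  rewrite <- (dphr_mu l t mu Hwpd).
  assert (D := phr_derive l t mu Hl Ht mu ltac:(lra)).
  rewrite <- (is_derive_unique _ _ _ D). symmetry. apply is_derive_unique.
  apply (is_derive_ext_loc (fun x => 4 * (x - mu) * Re (wp_quot L mu x))).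
  - assert (Hloc : locally mu (fun y => 0 < y < 4 * l)).
    { apply (locally_interval _ mu 0 (4 * l)); simpl; try lra. intros; lra. }
    eapply filter_imp; [|apply Hloc]. intros y Hy. symmetry. now apply phr_quot.
  - evar_last.
    + apply (is_derive_mult (fun x => 4 * (x - mu)) (fun x : R => Re (wp_quot L mu x)) mu 4 d); auto.
      * auto_derive; auto. ring.
      * intros; apply Rmult_comm.
    + unfold plus, mult; simpl. ring.
Qed.

Lemma phr_nonzero x : 0 < x <= 2 * l -> x <> mu -> f x <> 0.
Proof.
  intros Hx N. destruct (phr_sign l t mu Hl Ht Hmu x Hx) as [H1 H2]. fold f in H1, H2.
  destruct (Rlt_dec x mu) as [A|A]; [specialize (H1 A); lra|]. specialize (H2 ltac:(lra)). lra.
Qed.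

Lemma wp_quot_pos x : 0 < x <= 2 * l -> 0 < Re (wp_quot L mu x).
Proof.
  intros Hx. destruct (Req_dec x mu) as [->|N].
  - generalize wp_quot_mu. lra.
  - assert (E := phr_quot x ltac:(lra)). destruct (phr_sign l t mu Hl Ht Hmu x Hx) as [H1 H2].
    fold f in H1, H2. destruct (Rlt_dec x mu) as [A|A]; [specialize (H1 A); nra|].
    specialize (H2 ltac:(lra)). nra.
Qed.

Lemma quotK_pos x : 0 < x <= 2 * l -> 0 < quotK x.
Proof.
  intros Hx. unfold quotK. fold L. apply Rmult_lt_0_compat; [|apply exp_pos].
  generalize (wp_quot_pos x Hx). lra.
Qed.

Lemma quotK_spec x : 0 < x <= 2 * l -> x <> mu -> quotK x = Rabs (f x) * exp (- lng l t mu x).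
Proof.
  intros Hx N. unfold quotK, lng. fold L. rewrite (phr_quot x) by lra.
  rewrite <- RtoC_minus, <- RtoC_plus. unfold lnsigma at 2. rewrite Cmod_R.
  assert (P := wp_quot_pos x Hx). assert (Pa : 0 < Rabs (x - mu)) by (apply Rabs_pos_lt; lra).
  rewrite !Rabs_mult, (Rabs_pos_eq 4), (Rabs_pos_eq (Re _)) by lra.
  change (Re (RtoC x)) with x.
  set (A := lnsigmaR L (RtoC (x - mu))). set (D := lnsigma L (RtoC (x + mu))). set (z := Re (wzeta L mu)).
  replace (- (ln (Rabs (x - mu)) + A - D + 2 * z * x)) with (- ln (Rabs (x - mu)) + (- A + D - 2 * z * x)) by ring.
  rewrite exp_plus, exp_Ropp, exp_ln by auto. field. lra.
Qed.

Lemma quotK_continuous x : 0 < x <= 2 * l -> continuous quotK x.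
Proof.
  intros Hx. apply (ex_derive_continuous (K := R_AbsRing) (V := R_NormedModule)).
  destruct (wp_quot_derivable x ltac:(lra)) as [d1 D1].
  assert (V : forall y : R, vderiv (fun r : R => y + r * 1)%C x 1) by (intros; apply vderiv_line).
  assert (O2 : off L gz (- mu + x * 1)%C).
  { replace (- mu + x * 1)%C with (RtoC (x - mu)) by (rewrite RtoC_minus; ring).
    destruct (Req_dec x mu) as [->|N]; [rewrite Rminus_diag; now apply off_gz_0|].
    rewrite RtoC_minus. apply off_gall_gz, (real_ordinary l t mu Hl Ht Hmu); lra. }
  assert (O3 : off L gall (mu + x * 1)%C).
  { replace (mu + x * 1)%C with (RtoC (x + mu)) by (rewrite RtoC_plus; ring).
    apply rhombic_off_real; auto; lra. }
  assert (D2 := lnsigmaR_curve L HL (fun r : R => - mu + r * 1)%C x 1 O2 (vderiv_line _ _ _)).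
  assert (D3 := lnsigma_curve L HL (fun r : R => mu + r * 1)%C x 1 O3 (vderiv_line _ _ _)).
  apply (is_derive_ext _ (fun x => lnsigmaR L (RtoC (x - mu)))) in D2.
  2:{ intros r. f_equal. rewrite RtoC_minus. ring. }
  apply (is_derive_ext _ (fun x => lnsigma L (RtoC (x + mu)))) in D3.
  2:{ intros r. f_equal. rewrite RtoC_plus. ring. }
  unfold quotK. fold L. apply ex_derive_mult.
  - apply ex_derive_scal. eexists; apply D1.
  - apply (ex_derive_comp exp); [eexists; apply is_derive_exp|].
    apply (ex_derive_minus (V := R_NormedModule)).
    + apply (ex_derive_plus (V := R_NormedModule)); [apply (ex_derive_opp (V := R_NormedModule))|]; eexists; eauto.
    + auto_derive. auto.
Qed.

Lemma kappa_phr x : 0 < x < 2 * l -> kappa x * f x = f1 x - 1.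
Proof.
  intros Hx. assert (P := dphr_pos l t Hl Ht x Hx).
  assert (E := phr_square l t mu Hl Ht Hmu Hwpd x ltac:(lra)).
  unfold kappa. fold f f1 c1 c2. fold f f1 in E. unfold cubic in E. fold c1 c2 in E. fold f1 in P.
  apply (Rmult_eq_reg_r (f1 x + 1)); [|lra].
  replace (- (c1 - c2 * f x + f x ^ 2) * / (f1 x + 1) * f x * (f1 x + 1))
    with (- f x ^ 3 + c2 * f x ^ 2 - c1 * f x) by (field; lra).
  simpl in *. lra.
Qed.

Lemma quotK_derive_off x : 0 < x < 2 * l -> x <> mu -> is_derive quotK x (quotK x * kappa x).
Proof.
  intros Hx N. assert (Nf : f x <> 0) by (apply phr_nonzero; auto; lra).
  (* [s] is the constant sign of phi on the side of [mu] where [x] lies. *)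
  assert (S : exists s, s * s = 1 /\ s * f x = Rabs (f x) /\
     locally x (fun y => 0 < y < 2 * l /\ y <> mu /\ s * f y = Rabs (f y))).
  { destruct (Rlt_dec x mu) as [A|A].
    - exists (-1). assert (K : forall y, 0 < y < mu -> -1 * f y = Rabs (f y)).
      { intros y Hy. destruct (phr_sign l t mu Hl Ht Hmu y ltac:(lra)) as [H1 _]. fold f in H1.
        rewrite Rabs_left; [ring|apply H1; lra]. }
      split; [ring|]. split; [apply K; lra|].
      apply (locally_interval _ x 0 mu); simpl; try lra. intros y H1 H2. split; [lra|]. split; [lra|].
      apply K; auto.
    - exists 1. assert (K : forall y, mu < y < 2 * l -> 1 * f y = Rabs (f y)).
      { intros y Hy. destruct (phr_sign l t mu Hl Ht Hmu y ltac:(lra)) as [_ H1]. fold f in H1.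
        rewrite Rabs_pos_eq; [ring|]. left. apply H1; lra. }
      split; [ring|]. split; [apply K; lra|].
      apply (locally_interval _ x mu (2 * l)); simpl; try lra. intros y H1 H2. split; [lra|]. split; [lra|].
      apply K; auto. }
  destruct S as [s [Hs [Hsx Hloc]]].
  apply (is_derive_ext_loc (fun y => s * f y * exp (- lng l t mu y))).
  { eapply filter_imp; [|apply Hloc]. intros y [Hy [Ny Ey]]. rewrite Ey. symmetry. apply quotK_spec; auto; lra. }
  rewrite quotK_spec by (auto; lra). rewrite <- Hsx.
  assert (D1 := phr_derive l t mu Hl Ht x ltac:(lra)). fold f f1 in D1.
  assert (D2 := lng_real_derive l t mu Hl Ht Hmu Hwpd x ltac:(lra) N). fold f in D2.
  evar_last.
  - apply (is_derive_mult (fun y => s * f y) (fun y : R => exp (- lng l t mu y)) x).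
    + apply is_derive_scal, D1.
    + apply (is_derive_comp exp); [apply is_derive_exp|]. apply (is_derive_opp (V := R_NormedModule)), D2.
    + intros; apply Rmult_comm.
  - unfold plus, mult, scal, opp; simpl. unfold mult; simpl.
    apply (Rmult_eq_reg_r (f x)); auto.
    replace (s * f x * exp (- lng l t mu x) * kappa x * f x)
      with (s * f x * exp (- lng l t mu x) * (kappa x * f x)) by ring.
    rewrite kappa_phr by auto. field. auto.
Qed.

Lemma quotK_derive x : 0 < x < 2 * l -> is_derive quotK x (quotK x * kappa x).
Proof.
  intros Hx. destruct (Req_dec x mu) as [->|N]; [|now apply quotK_derive_off].
  apply (is_derive_extend quotK (fun x => quotK x * kappa x) mu (Rmin mu (2 * l - mu))).
  - apply Rmin_pos; lra.
  - apply quotK_continuous; lra.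
  - apply (continuous_mult (K := R_AbsRing)); [apply quotK_continuous; lra|].
    apply (ex_derive_continuous (K := R_AbsRing) (V := R_NormedModule)).
    assert (D1 := phr_derive l t mu Hl Ht mu ltac:(lra)).
    assert (D2 := dphr_derive l t mu Hl Ht mu ltac:(lra)).
    unfold kappa. auto_derive. repeat split; try (eexists; eassumption).
    rewrite (dphr_mu l t mu Hwpd). lra.
  - intros y Hy N. apply Rabs_def2 in Hy. apply quotK_derive_off; auto.
    generalize (Rmin_l mu (2 * l - mu)) (Rmin_r mu (2 * l - mu)). lra.
Qed.

(** The factor [|phi| (|g| + 1 / |g|) / 2], rewritten with [quotK = |phi| / |g|] in a form that
    stays smooth and positive at [mu]. *)
Definition metricH (x : R) : R := (phr l t mu x * phr l t mu x * / quotK x + quotK x) * (1 / 2).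

(** The generators are phi, [phi'], [1 / (phi' + 1)], [quotK] and [1 / quotK]; [phi''] is a
    polynomial in phi by the cubic, and the derivative of [quotK] is [quotK * kappa]. *)
Lemma metricH_alg : exists B, diff_closed 0 (2 * l) B /\ alg B metricH.
Proof.
  set (B0 := fun h => h = f \/ h = f1).
  assert (A0 : alg B0 f) by (apply alg_base; now left).
  assert (A1 : alg B0 f1) by (apply alg_base; now right).
  assert (C0 : diff_closed 0 (2 * l) B0).
  { intros h [-> | ->].
    - exists f1. split; auto. intros x Hx. apply phr_derive; auto; lra.
    - exists (fun x => ((-3) * (f x * f x) + (2 * c2 * f x + - c1)) * (1 / 2)). split.
      + apply alg_mult; [|apply alg_const]. apply alg_plus.
        * apply alg_mult; [apply alg_const|now apply alg_mult].
        * apply alg_plus; [|apply alg_const]. apply alg_mult; auto. apply alg_const.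
      + intros x Hx. evar_last; [apply (dphr_derive l t mu); auto; lra|].
        unfold cubic'. fold f c1 c2. simpl. field. }
  set (w := fun x => / (f1 x + 1)).
  set (B1 := adjoin B0 w).
  assert (C1' : diff_closed 0 (2 * l) B1).
  { apply (diff_closed_inv 0 (2 * l) B0 (fun x => f1 x + 1)); auto.
    - apply alg_plus; auto. apply alg_const.
    - intros x Hx. generalize (dphr_pos l t Hl Ht x Hx). fold f1. lra. }
  set (B2 := adjoin B1 quotK).
  assert (C2' : diff_closed 0 (2 * l) B2).
  { apply (diff_closed_adjoin _ _ _ _ (fun x => quotK x * (((-1) * (c1 + ((- c2) * f x + f x * f x))) * w x))); auto.
    - assert (F : alg B2 f) by now apply alg_adjoin, alg_adjoin.
      apply alg_mult; [apply alg_adjoined|]. apply alg_mult; [|apply alg_adjoin, alg_adjoined].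
      apply alg_mult; [apply alg_const|]. apply alg_plus; [apply alg_const|].
      apply alg_plus; [apply alg_mult; auto; apply alg_const|now apply alg_mult].
    - intros x Hx. evar_last; [now apply quotK_derive|]. unfold kappa, w. fold f f1 c1 c2. ring. }
  exists (adjoin B2 (fun x => / quotK x)). split.
  - apply diff_closed_inv; auto; [apply alg_adjoined|]. intros x Hx. generalize (quotK_pos x ltac:(lra)). lra.
  - unfold metricH. fold f. apply alg_mult; [|apply alg_const]. apply alg_plus.
    + apply alg_mult; [|apply alg_adjoined].
      apply alg_mult; now apply alg_adjoin, alg_adjoin, alg_adjoin.
    + apply alg_adjoin, alg_adjoined.
Qed.

Lemma metricH_pos x : 0 < x <= 2 * l -> 0 < metricH x.
Proof.
  intros Hx. assert (P := quotK_pos x Hx). unfold metricH. fold f.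
  assert (0 <= f x * f x * / quotK x).
  { apply Rmult_le_pos; [nra|]. left. now apply Rinv_0_lt_compat. }
  lra.
Qed.

(** The inequality of arithmetic and geometric means, in the form [(phi + quotK)^2 >= 0]. *)
Lemma metricH_ge x : 0 < x <= 2 * l -> - f x <= metricH x.
Proof.
  intros Hx. assert (P := quotK_pos x Hx). unfold metricH. fold f.
  apply (Rmult_le_reg_r (2 * quotK x)); [lra|].
  replace ((f x * f x * / quotK x + quotK x) * (1 / 2) * (2 * quotK x)) with (f x * f x + quotK x * quotK x)
    by (field; lra).
  generalize (Rle_0_sqr (f x + quotK x)). unfold Rsqr. lra.
Qed.

Lemma metricH_spec x : 0 < x <= 2 * l -> x <> mu ->
  metricH x = Rabs (f x) / 2 * (exp (lng l t mu x) + / exp (lng l t mu x)).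
Proof.
  intros Hx N. unfold metricH. fold f. rewrite (quotK_spec x Hx N).
  assert (Nf := Rabs_pos_lt _ (phr_nonzero x Hx N)). rewrite exp_Ropp.
  assert (Pe := exp_pos (lng l t mu x)).
  replace (f x * f x) with (Rabs (f x) * Rabs (f x)) by (rewrite <- Rabs_mult; apply Rabs_pos_eq; nra).
  field. lra.
Qed.
End Metric.

(** Put [N = F cosh (log E)]. Since [E' = E / F], [E b = 1] and [F'(b) = 0], one finds [N'(b) = 0]
    and [N''(b) = c + 1 / F b], so the second derivative of [1 / N] at [b] is the bound required of
    [2 k]. *)
Lemma inverse_metric_second_order (F F1 E : R -> R) (b e c k : R) : 0 < e ->
  (forall x, Rabs (x - b) < e -> 0 < F x /\ is_derive F x (F1 x) /\ 0 < E x /\ is_derive E x (E x * / F x)) ->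
  F1 b = 0 -> E b = 1 -> is_derive F1 b c -> 2 * k < - (c + / F b) / F b ^ 2 ->
  exists d, 0 < d /\ forall u, 0 < u < d -> / F b + k * u ^ 2 <= / (F (b - u) / 2 * (E (b - u) + / E (b - u))).
Proof.
  intros He HF H0 HE HD Hk.
  set (N := fun x => F x / 2 * (E x + / E x)).
  set (N1 := fun x => F1 x / 2 * (E x + / E x) + (E x - / E x) / 2).
  assert (DN : forall x, Rabs (x - b) < e -> 0 < N x /\ is_derive N x (N1 x)).
  { intros x Hx. destruct (HF x Hx) as [PF [DF [PE DE]]]. split.
    - unfold N. assert (0 < / E x) by now apply Rinv_0_lt_compat. apply Rmult_lt_0_compat; lra.
    - unfold N. auto_derive.
      + repeat split; try (eexists; eassumption). lra.
      + replace (Derive (fun x => F x) x) with (F1 x) by (symmetry; apply is_derive_unique, DF).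
        replace (Derive (fun x => E x) x) with (E x * / F x) by (symmetry; apply is_derive_unique, DE).
        unfold N1. field. lra. }
  assert (Hb : Rabs (b - b) < e) by (rewrite Rminus_diag, Rabs_R0; auto).
  destruct (HF b Hb) as [PFb [DFb [PEb DEb]]].
  assert (Nb : N b = F b) by (unfold N; rewrite HE; field).
  assert (N1b : N1 b = 0) by (unfold N1; rewrite HE, H0; field).
  assert (DN1 : is_derive N1 b (c + / F b)).
  { unfold N1. auto_derive.
    - repeat split; try (eexists; eassumption); lra.
    - replace (Derive (fun x => F1 x) b) with c by (symmetry; apply is_derive_unique, HD).
      replace (Derive (fun x => E x) b) with (E b * / F b) by (symmetry; apply is_derive_unique, DEb).
      rewrite HE, H0. field. lra. }
  destruct (second_order_lower (fun x => / N x) (fun x => - N1 x / N x ^ 2) b e (- (c + / F b) / F b ^ 2) k) as [d [Hd H]]; auto.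
  - intros x Hx. destruct (DN x) as [P D]; [apply Rabs_def1; lra|].
    apply is_derive_inv; auto. lra.
  - rewrite N1b. unfold Rdiv. ring.
  - destruct (DN b Hb) as [P D]. auto_derive.
    + repeat split; try (eexists; eassumption). rewrite Rmult_1_r. nra.
    + replace (Derive (fun x => N1 x) b) with (c + / F b) by (symmetry; apply is_derive_unique, DN1).
      replace (Derive (fun x => N x) b) with (N1 b) by (symmetry; apply is_derive_unique, D).
      rewrite N1b, Nb. field. lra.
  - exists d. split; auto. intros u Hu. rewrite <- Nb. now apply H.
Qed.

(** * A critical point of the difference of inverse metric factors *)

Section CriticalPoint.
Variables l t mu : R.
Hypothesis Hl : 0 < l.
Hypothesis Ht : 0 < t.
Hypothesis Hmu : 0 < mu < 2 * l.
Hypothesis Hwpd : wpd (rhombic l t) mu = RtoC (- (1 / 4)).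
Hypothesis Hzeta : 2 * l * Re (wzeta (rhombic l t) mu) = Re (wzeta (rhombic l t) (RtoC (2 * l))) * mu.
Hypothesis Hneg : coef1 l t mu < 0.
Let H := metricH l t mu.

Lemma metricH_end : exists d k, 0 < d /\ 1 / 4 < k /\
  (forall u, 0 < u < d -> / phr l t mu (2 * l) + k * u ^ 2 <= / H (2 * l - u)) /\
  (forall eta, 0 < eta -> exists d', 0 < d' /\ forall u, 0 < u < d' -> / H (2 * l - u) < / phr l t mu (2 * l) + eta).
Proof.
  set (F := phr l t mu). set (E := fun x : R => exp (lng l t mu x)). set (b := 2 * l).
  assert (PF : forall x, mu < x <= b -> 0 < F x) by (intros x Hx; apply (phr_sign l t mu Hl Ht Hmu); unfold b in *; lra).
  assert (DF : forall x, 0 < x < 4 * l -> is_derive F x (dphr l t x)) by (intros; apply phr_derive; auto).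
  assert (Eb : E b = 1) by (unfold E, b; rewrite (lng_half l t mu Hl Ht Hmu Hzeta); apply exp_0).
  assert (Hb : 0 < F b) by (apply PF; unfold b; lra).
  assert (Hnear : exists e, 0 < e /\ forall x, Rabs (x - b) < e -> mu < x < 4 * l - mu /\ 0 < F x).
  { assert (CF : continuous F b).
    { apply (ex_derive_continuous (K := R_AbsRing) (V := R_NormedModule)). eexists. apply DF. unfold b; lra. }
    apply continuity_pt_filterlim in CF. destruct (CF (F b) Hb) as [d [Hd Hc]].
    exists (Rmin d (b - mu)). split; [apply Rmin_pos; unfold b in *; lra|]. intros x Hx.
    assert (X1 := Rlt_le_trans _ _ _ Hx (Rmin_l _ _)). assert (X2 := Rlt_le_trans _ _ _ Hx (Rmin_r _ _)).
    apply Rabs_def2 in X2. split; [unfold b in *; lra|].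
    destruct (Req_dec x b) as [->|N]; auto.
    specialize (Hc x). simpl in Hc. unfold R_dist in Hc.
    specialize (Hc (conj (conj I (not_eq_sym N)) X1)). apply Rabs_def2 in Hc. lra. }
  destruct Hnear as [e [He Hnear]].
  assert (DE : forall x, Rabs (x - b) < e -> is_derive E x (E x * / F x)).
  { intros x Hx. destruct (Hnear x Hx) as [Hx1 Hx2]. unfold E. evar_last.
    - apply (is_derive_comp exp (fun x : R => lng l t mu x)); [apply is_derive_exp|].
      apply (lng_real_derive l t mu Hl Ht Hmu Hwpd); lra.
    - unfold scal; simpl. unfold mult; simpl. unfold F. ring. }
  assert (Hspec : forall u, 0 < u < Rmin e (b - mu) -> H (b - u) = F (b - u) / 2 * (E (b - u) + / E (b - u))).
  { intros u Hu. assert (U1 := Rmin_l e (b - mu)). assert (U2 := Rmin_r e (b - mu)).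
    unfold H. rewrite (metricH_spec l t mu Hl Ht Hmu Hwpd); [|unfold b in *; lra..].
    rewrite Rabs_pos_eq; [reflexivity|]. left. apply PF. lra. }
  set (rho := F b) in *.
  set (m := - (cubic' l t mu rho / 2 + / rho) / rho ^ 2).
  (* [m] is the second derivative of [1 / H] at [2 l]. As [rho = r3] is a root of the cubic,
     eliminating [coef2] gives [m = 1 / 2 - coef1 / (2 rho^2)]: here the sign of the sum of the
     [r_i r_j] enters. *)
  assert (Hm : 1 / 2 < m).
  { assert (C : cubic l t mu rho = 0).
    { unfold rho, F, b. rewrite <- (phr_square l t mu Hl Ht Hmu Hwpd) by lra. rewrite dphr_half by auto. ring. }
    unfold cubic in C.
    assert (P2 : 0 < rho ^ 2) by now apply pow_lt.
    assert (Q : m - 1 / 2 = - coef1 l t mu / (2 * rho ^ 2)).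
    { assert (P3 : 0 < rho ^ 3) by (now apply pow_lt).
      unfold m, cubic'. apply (Rmult_eq_reg_r (2 * rho ^ 3)); [|lra].
      transitivity (2 * rho ^ 3 - 2 * coef2 l t mu * rho ^ 2 + coef1 l t mu * rho - 2); [field; lra|].
      transitivity (- coef1 l t mu * rho); [lra|field; lra]. }
    assert (0 < - coef1 l t mu / (2 * rho ^ 2)) by (apply Rdiv_lt_0_compat; lra). lra. }
  (* Any coefficient strictly between [1 / 4] and [m / 2] will do; the midpoint is taken. *)
  destruct (inverse_metric_second_order F (dphr l t) E b e (cubic' l t mu rho / 2) ((1 / 4 + m / 2) / 2)) as [d [Hd Hlow]]; auto.
  - intros x Hx. destruct (Hnear x Hx) as [X1 X2]. split; auto. split; [apply DF; lra|]. split; [apply exp_pos|auto].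
  - unfold b. now apply dphr_half.
  - unfold rho. apply dphr_derive; auto. unfold b; lra.
  - fold rho. unfold m in Hm |- *. lra.
  - exists (Rmin d (Rmin e (b - mu))), ((1 / 4 + m / 2) / 2).
    split; [repeat apply Rmin_pos; unfold b in *; lra|]. split; [lra|]. split.
    + intros u Hu. rewrite Hspec; [apply Hlow|].
      * assert (A := Rmin_l d (Rmin e (b - mu))). lra.
      * assert (A := Rmin_r d (Rmin e (b - mu))). lra.
    + intros eta Heta.
      assert (Cy : continuous (fun x => / (F x / 2 * (E x + / E x))) b).
      { apply (ex_derive_continuous (K := R_AbsRing) (V := R_NormedModule)).
        assert (Hbb : Rabs (b - b) < e) by (rewrite Rminus_diag, Rabs_R0; auto).
        assert (D1 := DE b Hbb). assert (D2 := DF b ltac:(unfold b; lra)).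
        auto_derive. rewrite Eb. repeat split; try (eexists; eassumption); try lra.
        fold rho. replace (rho * / 2 * (1 + / 1)) with rho by field. lra. }
      apply continuity_pt_filterlim in Cy. destruct (Cy eta Heta) as [d' [Hd' Hc]].
      exists (Rmin d' (Rmin e (b - mu))). split; [repeat apply Rmin_pos; unfold b in *; lra|].
      intros u Hu. assert (A1 := Rmin_l d' (Rmin e (b - mu))). assert (A2 := Rmin_r d' (Rmin e (b - mu))).
      rewrite Hspec by lra. specialize (Hc (b - u)). simpl in Hc. unfold R_dist in Hc.
      rewrite Eb in Hc. fold rho in Hc. replace (rho / 2 * (1 + / 1)) with rho in Hc by field.
      assert (K : Rabs (/ (F (b - u) / 2 * (E (b - u) + / E (b - u))) - / rho) < eta).
      { apply Hc. split; [split; [exact I|lra]|]. apply Rabs_def1; lra. }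
      apply Rabs_def2 in K. lra.
Qed.

(** At 0, [H >= - phi] and [- phi = 4 / x^2 + O(1)] bound [1 / H] by about [x^2 / 4], while the
    coefficient at [2 l] exceeds [1 / 4]. The final relation is the vanishing derivative of the
    difference, cleared of denominators. *)
Lemma metricH_critical (dH : R -> R) :
  (forall x, 0 < x < 2 * l -> is_derive H x (dH x)) ->
  exists u, 0 < u < l /\ H u <> H (2 * l - u) /\
    dH u * H (2 * l - u) ^ 2 + dH (2 * l - u) * H u ^ 2 = 0.
Proof.
  intros HdH.
  assert (HP : forall x, 0 < x < 2 * l -> 0 < H x) by (intros x Hx; apply (metricH_pos l t mu Hl Ht Hmu Hwpd); lra).
  destruct (wp_real_asymptotics l t Hl Ht) as [d1 [B [Hd1 HB]]].
  destruct metricH_end as [d2 [k [Hd2 [Hk [Hlow Hlim]]]]].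
  destruct (critical_point_exists (fun x => / H x) (fun x => - dH x / H x ^ 2) (2 * l)
    (/ phr l t mu (2 * l)) k (4 * B + 4 * Re (wp (rhombic l t) mu)) (Rmin (Rmin d1 d2) (2 * l))) as [u [Hu1 [Hu2 Hu3]]].
  - lra.
  - apply Rinv_0_lt_compat, phr_half_pos; auto.
  - auto.
  - repeat apply Rmin_pos; lra.
  - intros x Hx. assert (P := HP x Hx). split; [now apply Rinv_0_lt_compat|]. apply is_derive_inv; auto. lra.
  - intros x Hx. assert (A1 := Rmin_l (Rmin d1 d2) (2 * l)). assert (A2 := Rmin_r (Rmin d1 d2) (2 * l)).
    assert (A3 := Rmin_l d1 d2). specialize (HB x ltac:(lra)). apply Rabs_le_between in HB.
    assert (G := metricH_ge l t mu Hl Ht Hmu Hwpd x ltac:(lra)). fold H in G. unfold phr in G.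
    assert (P := HP x ltac:(lra)).
    apply (Rmult_le_reg_l (H x)); auto. rewrite <- Rmult_assoc, Rinv_r, Rmult_1_l, Rmult_1_r by lra.
    replace (4 / x ^ 2) with (4 * / (x * x)) by (field; lra). lra.
  - intros x Hx. assert (A1 := Rmin_l (Rmin d1 d2) (2 * l)). assert (A3 := Rmin_r d1 d2). apply Hlow. lra.
  - intros eta Heta. destruct (Hlim eta Heta) as [d' [Hd' HH]]. now exists d'.
  - assert (P1 := HP u ltac:(lra)). assert (P2 := HP (2 * l - u) ltac:(lra)).
    exists u. split; [lra|]. split; [intro K; rewrite K in Hu2; lra|].
    apply (Rmult_eq_reg_r (- (/ (H u ^ 2 * H (2 * l - u) ^ 2)))).
    + rewrite Rmult_0_l, <- Hu3. field. lra.
    + apply Ropp_neq_0_compat, Rinv_neq_0_compat. apply Rmult_integral_contrapositive_currified; apply pow_nonzero; lra.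
Qed.
End CriticalPoint.

(** * Normalization of the lattice and conclusion *)

Lemma lambda_facts (tau s : R) : 0 < tau -> 0 < s < 2 ->
  0 < lambda tau s /\
  wpd (rhombic (lambda tau s) tau) (RtoC (lambda tau s * s)) = RtoC (- (1 / 4)).
Proof.
  intros Ht Hs. set (l := lambda tau s).
  assert (Hl : 0 < l) by apply exp_pos.
  assert (Hoff : off (rhombic 1 tau) gall (RtoC s)) by (apply rhombic_off_real; lra).
  assert (HN := rhombic_nondegenerate 1 tau Rlt_0_1 Ht).
  assert (Hneg := wpd_negative 1 tau Rlt_0_1 Ht s ltac:(lra)).
  set (X := - 4 * Re (wpd (rhombic 1 tau) s)).
  assert (El : l = Rpower X (1 / 3)).
  { unfold l, lambda, X. now rewrite Ltilde_rhombic, wp'_wpd. }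
  assert (HX : 0 < X) by (unfold X; lra).
  (* [wp'] is homogeneous of degree -3, so the cube root in [lambda] normalizes its value at [mu] to
     [- 1 / 4]. *)
  assert (L3 : l ^ 3 = X).
  { rewrite <- Rpower_pow by auto. rewrite El, Rpower_mult.
    replace (1 / 3 * INR 3) with 1 by (simpl; field). now apply Rpower_1. }
  split; auto.
  rewrite RtoC_mult, (wpd_scale l tau Hl Ht) by auto.
  rewrite (wpd_real 1 tau Rlt_0_1 Ht) by auto.
  assert (Nl : RtoC l <> RtoC 0) by (intro K; apply RtoC_inj in K; lra).
  replace (Re (wpd (rhombic 1 tau) s)) with (- (1 / 4) * l ^ 3) by (rewrite L3; unfold X; field).
  rewrite RtoC_mult, RtoC_pow. field. auto.
Qed.

(** Zeta is homogeneous of degree -1, so the equation defining [s] carries over to the scaled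
    lattice; all its terms are real. *)
Lemma zeta_condition (l tau s : R) : 0 < l -> 0 < tau -> 0 < s < 2 ->
  (2 * wzeta (Ltilde tau) s - wzeta (Ltilde tau) 2 * s)%C = RtoC 0 ->
  2 * l * Re (wzeta (rhombic l tau) (RtoC (l * s))) = Re (wzeta (rhombic l tau) (RtoC (2 * l))) * (l * s).
Proof.
  intros Hl Ht Hs E. rewrite Ltilde_rhombic in E.
  assert (O1 : off (rhombic 1 tau) gall (RtoC s)) by (apply rhombic_off_real; lra).
  assert (O2 : off (rhombic 1 tau) gall (RtoC 2)) by (apply rhombic_off_real; lra).
  rewrite RtoC_mult, (Rmult_comm 2 l), RtoC_mult.
  rewrite !(wzeta_scale l tau Hl Ht) by now apply off_gall_gz.
  rewrite (wzeta_real 1 tau Rlt_0_1 Ht s), (wzeta_real 1 tau Rlt_0_1 Ht 2) in E by auto.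
  rewrite (wzeta_real 1 tau Rlt_0_1 Ht s), (wzeta_real 1 tau Rlt_0_1 Ht 2) by auto.
  set (a := Re (wzeta (rhombic 1 tau) s)) in *. set (b := Re (wzeta (rhombic 1 tau) 2)) in *.
  rewrite <- !RtoC_mult, <- RtoC_minus in E. apply RtoC_inj in E.
  rewrite <- RtoC_inv, <- !RtoC_mult by lra. change (l * 2 * (/ l * a) = / l * b * (l * s)).
  field_simplify; lra.
Qed.

Theorem theorem8p4 :
  forall (tau s : R) (g : C -> C) (Psi : C -> R3) (omega : R -> R -> R)
         (sing : R -> Prop) (alpha beta : R -> R),
  Cs tau s ->
  is_gauss_map tau s 1 g ->
  is_immersion tau s g Psi ->
  is_conformal_factor tau s g Psi omega ->
  associated tau s omega sing alpha beta ->
  sum_rr tau s < 0 ->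
  exists ustar : R,
    0 < ustar < omega3 tau s / 2 /\
    ~ sing ustar /\ beta ustar = 0 /\
    ~ sing (omega3 tau s - ustar) /\ beta (omega3 tau s - ustar) = 0.
Proof.
  intros tau s g Psi omega sing alpha beta [tau0 [_ [[Ht _] [[Hs Hz] _]]]] Hg _ Hconf Hassoc Hsum.
  destruct (lambda_facts tau s Ht Hs) as [Hl Hwpd].
  assert (Hzeta := zeta_condition (lambda tau s) tau s Hl Ht Hs Hz).
  set (l := lambda tau s) in *. set (mu0 := l * s) in *.
  assert (Hmu : 0 < mu0 < 2 * l) by (unfold mu0; split; nra).
  assert (Hlt : 0 < l * tau) by now apply Rmult_lt_0_compat.
  assert (Hneg : coef1 l tau mu0 < 0).
  { rewrite (coef1_sum l tau mu0 Hl Ht Hmu Hwpd). exact Hsum. }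
  assert (Hmod := gauss_modulus l tau mu0 Hl Ht Hmu Hwpd g).
  assert (Hmod' : forall z, off (rhombic l tau) gall z -> phiC l tau mu0 z <> RtoC 0 ->
     Rabs (Im z - l * tau) <= l * tau -> Cmod (g z) = exp (lng l tau mu0 z)).
  { apply Hmod. intros z p H1 H2. exact (Hg z p H1 H2). }
  clear Hmod. set (H := metricH l tau mu0).
  assert (W0 : forall x, 0 < x < 2 * l -> x <> mu0 ->
     ~ in_lattice (Lat tau s) (x, 0) /\ exp (omega x 0) = H x).
  { intros x Hx N.
    assert (O : off (rhombic l tau) gall (RtoC x)) by (apply rhombic_off_real; auto; lra).
    assert (NL : ~ in_lattice (Lat tau s) (x, 0)) by (apply off_gall in O; exact O).
    assert (Ep : phiC l tau mu0 x = RtoC (phr l tau mu0 x)) by (apply (phr_complex l tau mu0); auto; lra).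
    assert (Np : phr l tau mu0 x <> 0) by (apply (phr_nonzero l tau mu0 Hl Ht Hmu); auto; lra).
    assert (NP : phiC l tau mu0 x <> RtoC 0) by (rewrite Ep; intro K; apply RtoC_inj in K; auto).
    split; auto. destruct (Hconf x 0 NL) as [_ [_ [_ Hexp]]]. rewrite (Hexp NP).
    change (phi tau s (x, 0)) with (phiC l tau mu0 x). change (x, 0) with (RtoC x).
    rewrite Hmod', Ep, Cmod_R by (auto; simpl; rewrite Rminus_0_l, Rabs_Ropp, Rabs_pos_eq; lra).
    symmetry. apply (metricH_spec l tau mu0 Hl Ht Hmu Hwpd); auto; lra. }
  (* At height [2 l tau = Im (2 omega2)] the point over [x] is [2 omega2 - (2 l - x)]. There phi
     takes its value at [2 l - x] and [|g|] is the inverse of its value at [2 l - x], which leaves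
     [|g| + 1 / |g|] unchanged. *)
  assert (W1 : forall x, 0 < x < 2 * l -> 2 * l - x <> mu0 ->
     ~ in_lattice (Lat tau s) (x, 2 * l * tau) /\ exp (omega x (2 * l * tau)) = H (2 * l - x)).
  { intros x Hx N. set (z := (x, 2 * l * tau) : C).
    assert (Ez : z = (- RtoC (2 * l - x) + lattice_pt (rhombic l tau) 0 1)%C).
    { rewrite rhombic_pt. unfold z, RtoC, Cplus, Copp; simpl. f_equal; ring. }
    assert (O' : off (rhombic l tau) gall (RtoC (2 * l - x))) by (apply rhombic_off_real; auto; lra).
    assert (O : off (rhombic l tau) gall z) by (rewrite Ez; now apply off_gall_shift, off_gall_opp).
    assert (NL : ~ in_lattice (Lat tau s) z) by (apply off_gall in O; exact O).
    assert (Ep : phiC l tau mu0 z = RtoC (phr l tau mu0 (2 * l - x))).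
    { rewrite <- (phr_complex l tau mu0) by (auto; lra). unfold phiC. rewrite Ez.
      rewrite wp_periodic, wp_even; auto; [now apply rhombic_nondegenerate|now apply off_gall_opp]. }
    assert (Np : phr l tau mu0 (2 * l - x) <> 0) by (apply (phr_nonzero l tau mu0 Hl Ht Hmu); auto; lra).
    assert (NP : phiC l tau mu0 z <> RtoC 0) by (rewrite Ep; intro K; apply RtoC_inj in K; auto).
    split; auto. destruct (Hconf x (2 * l * tau) NL) as [_ [_ [_ Hexp]]]. rewrite (Hexp NP).
    change (phi tau s (x, 2 * l * tau)) with (phiC l tau mu0 z). change (x, 2 * l * tau) with z.
    rewrite Hmod', Ep, Cmod_R by (auto; simpl; rewrite Rabs_pos_eq; lra).
    assert (R := lng_reflect l tau mu0 Hl Ht Hmu Hzeta (2 * l - x) ltac:(lra) N).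
    replace (2 * l - (2 * l - x)) with x in R by ring. fold z in R. rewrite R, exp_Ropp, Rinv_inv.
    unfold H. rewrite (metricH_spec l tau mu0 Hl Ht Hmu Hwpd) by (auto; lra). ring. }
  destruct (metricH_alg l tau mu0 Hl Ht Hmu Hwpd) as [B [HB HHB]].
  destruct (alg_derive _ _ _ _ HB HHB) as [dH [HdHB HdH]]. fold H in HHB, HdH.
  assert (HP : forall x, 0 < x < 2 * l -> 0 < H x)
    by (intros x Hx; apply (metricH_pos l tau mu0 Hl Ht Hmu Hwpd); lra).
  destruct Hassoc as [Hiso [Hsm [Heq Hrem]]].
  assert (Hloc : forall x, 0 < x < 2 * l -> locally x (fun y => 0 < y < 2 * l)).
  { intros x Hx. apply (locally_interval _ x 0 (2 * l)); simpl; try lra. intros; lra. }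
  assert (Hne : forall x c : R, x <> c -> locally x (fun y => y <> c)).
  { intros x c N. exists (mkposreal _ (Rabs_pos_lt (x - c) ltac:(lra))). intros y Hy ->.
    change (Rabs (c - x) < Rabs (x - c)) in Hy. rewrite Rabs_minus_sym in Hy. lra. }
  (* The points [(x, 0)] and [(x, 2 l tau)] lie over the same abscissa and share [alpha x] and
     [beta x]; Wente's equation at each is multiplied by [e^omega]. *)
  assert (Sys : forall x, 0 < x < 2 * l -> x <> mu0 -> x <> 2 * l - mu0 -> ~ sing x ->
    2 * dH x = alpha x * H x ^ 2 + beta x /\
    - 2 * dH (2 * l - x) = alpha x * H (2 * l - x) ^ 2 + beta x).
  { intros x Hx N1 N2 NS. split.
    - destruct (W0 x Hx N1) as [NL Ex]. assert (K := Heq x 0 NS NL). assert (P := HP x Hx).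
      assert (D : Derive (fun x => omega x 0) x = dH x * / H x).
      { apply is_derive_unique. apply (is_derive_ext_loc (fun y => ln (H y))).
        - eapply filter_imp; [|apply (filter_and _ _ (Hloc x Hx) (Hne x mu0 N1))].
          intros y [Hy Ny]. destruct (W0 y Hy Ny) as [_ Ey]. rewrite <- Ey. apply ln_exp.
        - apply (is_derive_comp ln H x (/ H x) (dH x)); [|auto]. apply is_derive_Reals, derivable_pt_lim_ln; auto. }
      rewrite D, exp_Ropp, Ex in K. apply (Rmult_eq_reg_r (/ H x)); [|apply Rinv_neq_0_compat; lra].
      rewrite Rmult_assoc, K. field. lra.
    - assert (N2' : 2 * l - x <> mu0) by lra.
      destruct (W1 x Hx N2') as [NL Ex]. assert (K := Heq x (2 * l * tau) NS NL).
      assert (P := HP (2 * l - x) ltac:(lra)).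
      assert (D : Derive (fun x => omega x (2 * l * tau)) x = - dH (2 * l - x) * / H (2 * l - x)).
      { apply is_derive_unique. apply (is_derive_ext_loc (fun y => ln (H (2 * l - y)))).
        - eapply filter_imp; [|apply (filter_and _ _ (Hloc x Hx) (Hne x (2 * l - mu0) N2))].
          intros y [Hy Ny]. destruct (W1 y Hy ltac:(lra)) as [_ Ey]. rewrite <- Ey. apply ln_exp.
        - apply (is_derive_comp ln (fun y => H (2 * l - y)) x (/ H (2 * l - x)) (- dH (2 * l - x))).
          + apply is_derive_Reals, derivable_pt_lim_ln; auto.
          + apply is_derive_reflect, HdH. lra. }
      rewrite D, exp_Ropp, Ex in K. apply (Rmult_eq_reg_r (/ H (2 * l - x))); [|apply Rinv_neq_0_compat; lra].
      transitivity (2 * (- dH (2 * l - x) * / H (2 * l - x))); [ring|]. rewrite K. field. lra. }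
  assert (Hsol : forall p, 0 < p < 2 * l -> H p <> H (2 * l - p) ->
    ~ sing p /\ beta p = 2 * (dH p * H (2 * l - p) ^ 2 + dH (2 * l - p) * H p ^ 2) * / (H (2 * l - p) ^ 2 - H p ^ 2)).
  { intros p Hp Np. apply (wente_solution (2 * l) p B H dH alpha beta sing); auto.
    destruct (Hiso p) as [d0 Hd0]. destruct (Hloc p Hp) as [d1 Hd1].
    (* A radius that keeps [x] away from [c]; when [p = c] the value 1 is arbitrary, since only
       points [x <> p] are considered. *)
    set (d2 := fun c => if Req_EM_T p c then 1 else Rabs (p - c)).
    assert (Pd2 : forall c, 0 < d2 c) by (intros c; unfold d2; destruct (Req_EM_T p c); [lra|apply Rabs_pos_lt; lra]).
    assert (Hd2 : forall c x : R, Rabs (x - p) < d2 c -> x <> p -> x <> c).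
    { intros c x Hx Nx ->. unfold d2 in Hx. destruct (Req_EM_T p c); [congruence|].
      rewrite Rabs_minus_sym in Hx. lra. }
    exists (mkposreal _ (Rmin_pos _ _ (Rmin_pos _ _ (cond_pos d0) (cond_pos d1)) (Rmin_pos _ _ (Pd2 mu0) (Pd2 (2 * l - mu0))))).
    intros x Hx Nx. assert (Hx' : Rabs (x - p) < Rmin (Rmin d0 d1) (Rmin (d2 mu0) (d2 (2 * l - mu0)))) by exact Hx.
    assert (X1 := Rlt_le_trans _ _ _ Hx' (Rmin_l _ _)). assert (X2 := Rlt_le_trans _ _ _ Hx' (Rmin_r _ _)).
    apply Sys.
    - apply Hd1. apply (Rlt_le_trans _ _ _ X1 (Rmin_r _ _)).
    - apply Hd2; auto. apply (Rlt_le_trans _ _ _ X2 (Rmin_l _ _)).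
    - apply Hd2; auto. apply (Rlt_le_trans _ _ _ X2 (Rmin_r _ _)).
    - apply Hd0; auto. apply (Rlt_le_trans _ _ _ X1 (Rmin_l _ _)). }
  destruct (metricH_critical l tau mu0 Hl Ht Hmu Hwpd Hzeta Hneg dH HdH) as [u [Hu [Nu Eu]]].
  fold H in Nu, Eu.
  change (omega3 tau s) with (2 * l).
  destruct (Hsol u ltac:(lra) Nu) as [S1 B1].
  assert (Eb : 2 * l - (2 * l - u) = u) by ring.
  destruct (Hsol (2 * l - u) ltac:(lra) ltac:(rewrite Eb; auto)) as [S2 B2].
  exists u. split; [lra|]. split; auto. split; [rewrite B1, Eu; ring|]. split; auto.
  (* The numerator is symmetric under [u |-> 2 l - u], so the same relation makes [beta] vanish at
     both points. *)
  rewrite B2, Eb. replace (dH (2 * l - u) * H u ^ 2 + dH u * H (2 * l - u) ^ 2) with 0 by lra. ring.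
Qed.
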